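(* Let $\alpha>0$, let $d\ge 1$ be an integer with $d>2(\alpha\wedge 2)$, and let $h$ be as in the context. There is $L_0$ (depending on $d,\alpha,h$) such that for all $L\ge L_0$ the following holds for self-avoiding walk with step distribution $D(x)=h(x/L)/\sum_{y\in\mathbb{Z}^d}h(y/L)$. For every $k\in\mathbb{R}^d$, with $k_n:=f_\alpha(n)\,k$, $$\frac{\hat c_n(k_n)}{\hat c_n(0)}\longrightarrow \exp\{-K_\alpha\,|k|^{\alpha\wedge 2}\}\qquad\text{as } n\to\infty,$$ where $$K_\alpha=\Big(1+\sum_{x\in\mathbb{Z}^d}\sum_{n=2}^\infty n\,\pi_n(x)\,z_c^{\,n-1}\Big)^{-1}\times\begin{cases}1,&\text{if }\alpha\le 2,\\[2pt] 1+(2d z_c v_\alpha)^{-1}\displaystyle\sum_{x\in\mathbb{Z}^d}\sum_{n=2}^\infty |x|^2\,\pi_n(x)\,z_c^{\,n},&\text{if }\alpha>2.\end{cases}$$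
   Context: Notation: $a\wedge b=\min\{a,b\}$; $|\cdot|$ is the Euclidean norm on $\mathbb{R}^d$; $*$ is convolution on $\mathbb{Z}^d$; for $f:\mathbb{Z}^d\to\mathbb{C}$, $\hat f(k)=\sum_{x\in\mathbb{Z}^d}f(x)e^{ik\cdot x}$. Step distribution. $h$ is a non-negative bounded function on $\mathbb{R}^d$, almost everywhere continuous, symmetric under reflections in coordinate hyperplanes and rotations by ninety degrees, with $h(x)\sim c_h|x|^{-d-\alpha}$ as $|x|\to\infty$ for some constant $c_h>0$ (ratio tends to 1). If $\alpha\le 2$, $h$ is moreover assumed to be completely rotation invariant on $\mathbb{R}^d$. For a spread-out parameter $L\ge1$, $D(x)=h(x/L)/\sum_{y\in\mathbb{Z}^d}h(y/L)$, $x\in\mathbb{Z}^d$. It is assumed that $D(0)=0$. The constant $v_\alpha>0$ is defined by: as $|k|\to0$, $1-\hat D(k)\sim v_\alpha|k|^{\alpha\wedge2}$ if $\alpha\ne2$, and $1-\hat D(k)\sim v_2|k|^2\log(1/|k|)$ if $\alpha=2$. Self-avoiding walk. $\mathcal W_n(x)$ is the set of $(w_0,\dots,w_n)$ with $w_i\in\mathbb{Z}^d$, $w_0=0$, $w_n=x$; $w$ is self-avoiding if $w_i\ne w_j$ for $i\ne j$. $c_0(x)=\delta_{0,x}$ and, for $n\ge1$, $c_n(x)=\sum_{w\in\mathcal W_n(x)}\prod_{i=1}^nD(w_i-w_{i-1})\mathbf 1\{w\text{ is self-avoiding}\}$. $c_n=\sum_xc_n(x)=\hat c_n(0)$, and $z_c\in(0,\infty)$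 is the radius of convergence of $\chi(z)=\sum_{n\ge0}c_nz^n$. Lace expansion coefficients. The functions $\pi_m:\mathbb{Z}^d\to\mathbb{R}$, $m\ge2$, are those determined by the recursion $c_{n+1}(x)=(D*c_n)(x)+\sum_{m=2}^{n+1}(\pi_m*c_{n+1-m})(x)$ for all $n\ge0$, $x\in\mathbb{Z}^d$. Under the conditions of the claim ($L$ large) the double sums defining $K_\alpha$ converge absolutely and $K_\alpha\in(0,\infty)$. Scaling: for $n\ge2$, $f_\alpha(n)=(v_\alpha n)^{-1/(\alpha\wedge2)}$ if $\alpha\neq2$ and $f_2(n)=(v_2\,n\log\sqrt n)^{-1/2}$ if $\alpha=2$. *)

(* Defs.v *)
From mathcomp Require Import all_boot all_order all_algebra.
From mathcomp Require Import all_classical all_reals all_analysis.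
From mathcomp Require Import complex.

Set Implicit Arguments.
Unset Strict Implicit.
Unset Printing Implicit Defensive.

Import Order.TTheory GRing.Theory Num.Theory.
Import numFieldNormedType.Exports.

Local Open Scope classical_set_scope.
Local Open Scope ring_scope.

(* Points of R^d and Z^d are the row vectors 'rV[R]_d and 'rV[int]_d.  The
   library norm `|x| on 'rV[R]_d is the sup norm (its topology is the usual
   one), so the Euclidean norm is introduced separately. *)
Definition dotr (R : realType) (d : nat) (x y : 'rV[R]_d) : R :=
  \sum_(i < d) x 0 i * y 0 i.

Definition enorm (R : realType) (d : nat) (x : 'rV[R]_d) : R :=
  Num.sqrt (dotr x x).

Definition ztor (R : realType) (d : nat) (x : 'rV[int]_d) : 'rV[R]_d :=
  map_mx intr x.

(* Unconditional sum of a real family; meaningful when f is summable on D. *)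
Definition usum (R : realType) (T : choiceType) (D : set T) (f : T -> R) : R :=
  fine (\esum_(x in D) (Num.max (f x) 0)%:E) -
  fine (\esum_(x in D) (Num.max (- f x) 0)%:E).

Definition zsum (R : realType) (d : nat) (f : 'rV[int]_d -> R) : R :=
  usum [set: 'rV[int]_d] f.

Definition csum (R : realType) (d : nat) (f : 'rV[int]_d -> R[i]) : R[i] :=
  Complex (zsum (fun x => complex.Re (f x))) (zsum (fun x => complex.Im (f x))).

Definition expi (R : realType) (t : R) : R[i] := Complex (cos t) (sin t).

Definition fourier (R : realType) (d : nat) (f : 'rV[int]_d -> R[i])
    (k : 'rV[R]_d) : R[i] :=
  csum (fun x => f x * expi (dotr k (ztor R x))).

Definition rfourier (R : realType) (d : nat) (f : 'rV[int]_d -> R)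
    (k : 'rV[R]_d) : R[i] :=
  fourier (fun x => (f x)%:C%C) k.

Definition zconv (R : realType) (d : nat) (f g : 'rV[int]_d -> R)
    (x : 'rV[int]_d) : R :=
  zsum (fun y => f y * g (x - y)).

(* The library has no Lebesgue measure on 'rV[R]_d; Lebesgue-null sets are
   those covered by countably many closed boxes of arbitrarily small total
   volume. *)
Definition lebesgue_null (R : realType) (d : nat) (A : set 'rV[R]_d) : Prop :=
  forall e : R, 0 < e ->
  exists a b : nat -> 'rV[R]_d,
    [/\ forall n i, a n 0 i <= b n 0 i,
        A `<=` \bigcup_n [set x | forall i, a n 0 i <= x 0 i <= b n 0 i]
      & (\sum_(0 <= n <oo) (\prod_(i < d) (b n 0 i - a n 0 i))%:E < e%:E)%E].

Definition ae_continuous (R : realType) (d : nat) (h : 'rV[R]_d -> R) : Prop :=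
  lebesgue_null [set x | ~ {for x, continuous h}].

Definition reflect_coord (R : realType) (d : nat) (i : 'I_d) (x : 'rV[R]_d) :
  'rV[R]_d := \row_l (if l == i then - x 0 l else x 0 l).

(* Rotation by ninety degrees in the plane spanned by the axes i and j. *)
Definition rot90 (R : realType) (d : nat) (i j : 'I_d) (x : 'rV[R]_d) :
  'rV[R]_d :=
  \row_l (if l == i then - x 0 j else if l == j then x 0 i else x 0 l).

Definition rotation_invariant (R : realType) (d : nat) (h : 'rV[R]_d -> R) :
  Prop :=
  forall Q : 'M[R]_d, Q *m Q^T = 1%:M -> \det Q = 1 ->
  forall x, h (x *m Q) = h x.

Definition stepD (R : realType) (d : nat) (h : 'rV[R]_d -> R) (L : R)
    (x : 'rV[int]_d) : R :=
  h (L^-1 *: ztor R x) / zsum (fun y : 'rV[int]_d => h (L^-1 *: ztor R y)).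

Record step_profile (R : realType) (d : nat) (alpha : R) (h : 'rV[R]_d -> R) :
  Prop := StepProfile {
  profile_ge0 : forall x, 0 <= h x;
  profile_bounded : exists M, forall x, h x <= M;
  profile_ae_continuous : ae_continuous h;
  profile_reflect : forall i x, h (reflect_coord i x) = h x;
  profile_rot90 : forall i j x, i != j -> h (rot90 i j x) = h x;
  profile_tail : exists2 c, 0 < c & forall e, 0 < e ->
    exists M, forall x, M < enorm x ->
      `| h x / (c * enorm x `^ (- d%:R - alpha)) - 1 | < e;
  profile_rotation : alpha <= 2 -> rotation_invariant h;
  profile_step0 : forall L, 1 <= L -> stepD h L 0 = 0
}.

Definition v_scale (R : realType) (d : nat) (alpha : R) (k : 'rV[R]_d) : R :=
  if alpha == 2 then enorm k ^+ 2 * ln (1 / enorm k)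
  else enorm k `^ Num.min alpha 2.

Definition is_v_alpha (R : realType) (d : nat) (alpha : R)
    (D : 'rV[int]_d -> R) (v : R) : Prop :=
  0 < v /\
  ((1 - rfourier D k) / (v * v_scale alpha k)%:C%C : R[i]^o)
    @[k --> (0 : 'rV[R]_d)^'] --> (1 : R[i]^o).

Definition v_alpha (R : realType) (d : nat) (alpha : R)
    (D : 'rV[int]_d -> R) : R :=
  xget 0 [set v | is_v_alpha alpha D v].

Definition walks (d n : nat) (x : 'rV[int]_d) :
  set {ffun 'I_n.+1 -> 'rV[int]_d} :=
  [set w | w ord0 = 0 /\ w ord_max = x].

Definition saw (R : realType) (d : nat) (D : 'rV[int]_d -> R) (n : nat)
    (x : 'rV[int]_d) : R :=
  if n is 0%N then (x == 0)%:R
  else usum (@walks d n x) (fun w : {ffun 'I_n.+1 -> 'rV[int]_d} =>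
    (\prod_(1 <= i < n.+1) D (w (inord i) - w (inord i.-1))) *
    (injectiveb w)%:R).

Definition saw_total (R : realType) (d : nat) (D : 'rV[int]_d -> R) (n : nat) :
  R := zsum (saw D n).

Definition conv_radius (R : realType) (a : nat -> R) : \bar R :=
  ereal_sup [set r%:E | r in [set r : R | 0 <= r /\ cvgn (pseries a r)]].

Definition z_crit (R : realType) (d : nat) (D : 'rV[int]_d -> R) : R :=
  fine (conv_radius (saw_total D)).

(* Since c_0 = delta_0, this recursion determines pi_m for every m >= 2;
   the values of pi at 0 and 1 are irrelevant. *)
Definition lace_recursion (R : realType) (d : nat) (D : 'rV[int]_d -> R)
    (pi_ : nat -> 'rV[int]_d -> R) : Prop :=
  forall (n : nat) (x : 'rV[int]_d),
    saw D n.+1 x = zconv D (saw D n) x +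
      \sum_(2 <= m < n.+2) zconv (pi_ m) (saw D (n.+1 - m)) x.

Definition lace_term1 (R : realType) (d : nat) (pi_ : nat -> 'rV[int]_d -> R)
    (z : R) (x : 'rV[int]_d) (n : nat) : R :=
  n%:R * pi_ n x * z ^+ n.-1.

Definition lace_term2 (R : realType) (d : nat) (pi_ : nat -> 'rV[int]_d -> R)
    (z : R) (x : 'rV[int]_d) (n : nat) : R :=
  enorm (ztor R x) ^+ 2 * pi_ n x * z ^+ n.

Definition lace_sum (R : realType) (d : nat) (a : 'rV[int]_d -> nat -> R) : R :=
  zsum (fun x => usum [set n : nat | (2 <= n)%N] (a x)).

Definition lace_summable (R : realType) (d : nat)
    (a : 'rV[int]_d -> nat -> R) : Prop :=
  summable [set p : 'rV[int]_d * nat | (2 <= p.2)%N]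
    (fun p => (a p.1 p.2)%:E).

Definition K_alpha (R : realType) (d : nat) (alpha v z : R)
    (pi_ : nat -> 'rV[int]_d -> R) : R :=
  (1 + lace_sum (lace_term1 pi_ z))^-1 *
  (if alpha <= 2 then 1
   else 1 + (2 * d%:R * z * v)^-1 * lace_sum (lace_term2 pi_ z)).

Definition f_alpha (R : realType) (alpha v : R) (n : nat) : R :=
  if alpha == 2 then (v * n%:R * ln (Num.sqrt n%:R)) `^ (- (2%:R)^-1)
  else (v * n%:R) `^ (- (Num.min alpha 2)^-1).

(* Main.v *)
(* The lace expansion (repeated inclusion-exclusion on the first return of the
   walk to its past) gives the renewal equation
   c_(n+1)(k) = D(k) c_n(k) + sum_m pi_m(k) c_(n+1-m)(k), with pi an alternating
   series of ladder diagrams.  The diagrams are controlled by the bubble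
   sum_x H_z(x)^2 of the two-point function H_z = sum_(n >= 1) c_n z^n and by a
   bound (1 - cos k.x) H_z(x) <= W (1 - D(k)).  These two bounds are continuous
   in z and improve themselves, because the transform 1 / (1 - z D - Pi_z) of
   the two-point function is at most a multiple of 1 / (1 - D), and the square
   of the latter is small on average when d > 2 min(alpha, 2) and L is large;
   hence they hold up to z_c.  Integrals over the torus are avoided: a summable
   even function with a non-negative cosine transform is non-negative at 0.

   At z_c the renewal weights z_c D and z_c^m pi_m have total mass 1 and a mean
   H close to 1.  At the frequency k_n their mass is 1 - t / n + o(1 / n), and
   dividing the equation by the tail sums of the weights gives
   z_c^n c_n(k_n) -> exp(- t / H) / H.  Here t comes from 1 - D(k_n) and, if
   alpha > 2, from the second moment of Pi, by dominated convergence.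

   For alpha > 2 the asymptotics of 1 - D follow from second moments.  For
   alpha <= 2 they only depend on the tail of D, so that D may be compared with
   sum_n n^(-1-alpha/2) p_n, where p_n is a product of centred binomial laws:
   the tail and the transform of this mixture are both Riemann sums. *)

From HB Require Import structures.
Require Import Defs.
From mathcomp Require Import all_boot all_order all_algebra.
From mathcomp Require Import all_classical all_reals all_analysis.
From mathcomp Require Import complex ring lra zify.

Set Implicit Arguments.
Unset Strict Implicit.
Unset Printing Implicit Defensive.

Import Order.TTheory GRing.Theory Num.Theory.
Import numFieldNormedType.Exports.

Local Open Scope classical_set_scope.
Local Open Scope ring_scope.

(** * Extended non-negative reals *)

(** Diagram sums take values in [0, +oo], made into a commutative semiring, so that sums may be
    interchanged freely and finiteness is checked only once a bound is known. Signs enter late, in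
    [pir]. Torus integrals are replaced by [ct_dom]: if the transform of an even g is bounded in
    absolute value by that of M, then g(x) <= M(0). Smallness of the mean of D^2 / (1 - D)^2 thus
    becomes an existence statement: for each e > 0 some summable M has a transform above D^2 / (e +
    1 - D)^2 and M(0) <= B / L^d, with B independent of e. This M is a weighted dyadic sum of
    autocorrelations of averages of D; M(0) is a geometric series of ratio 4^min(alpha,2) / 2^d.
    Constants: the resolvent estimate has the factor 285, the improved bound is 8 * 285, and W = 16
    * 285 is twice that; b = 1 / (1600 W); large L gives B / L^d <= b^2 / 2048, which improves the
    bubble from b^2 to b^2 / 2. Dominated convergence as k -> 0 needs uniformity in k: the bound on
    (1 - cos k.x) Pi is 1 - D(k) times one summable function that does not depend on k. *)

Lemma eq_ler (R : realDomainType) (x y : R) : x = y -> x <= y.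
Proof. by move->. Qed.

(** As a commutative semiring, with 0 * +oo = 0, it makes [ring] and the big-operator lemmas
    available for sums whose convergence is not yet known. *)
Definition enn (R : realType) := {x : \bar R | (0 <= x)%E}.

Section EnnSemiring.
Variable R : realType.
Local Notation E := (enn R).

HB.instance Definition _ := Choice.on E.

Definition enn_mk (x : \bar R) (h : (0 <= x)%E) : E := exist _ x h.

Definition enn_zero : E := enn_mk (lexx 0%E).
Definition enn_one : E := @enn_mk 1%E (@lee01 R).
Definition enn_add (x y : E) : E := enn_mk (adde_ge0 (valP x) (valP y)).
Definition enn_mul (x y : E) : E := enn_mk (mule_ge0 (valP x) (valP y)).

Lemma enn_addA : associative enn_add.
Proof. by move=> x y z; apply: val_inj => /=; rewrite addeA. Qed.
Lemma enn_addC : commutative enn_add.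
Proof. by move=> x y; apply: val_inj => /=; rewrite addeC. Qed.
Lemma enn_add0 : left_id enn_zero enn_add.
Proof. by move=> x; apply: val_inj => /=; rewrite add0e. Qed.
Lemma enn_mulA : associative enn_mul.
Proof. by move=> x y z; apply: val_inj => /=; rewrite muleA. Qed.
Lemma enn_mulC : commutative enn_mul.
Proof. by move=> x y; apply: val_inj => /=; rewrite muleC. Qed.
Lemma enn_mul1 : left_id enn_one enn_mul.
Proof. by move=> x; apply: val_inj => /=; rewrite mul1e. Qed.
Lemma enn_mulD : left_distributive enn_mul enn_add.
Proof. by move=> x y z; apply: val_inj => /=; rewrite ge0_muleDl ?(valP x) ?(valP y). Qed.
Lemma enn_mul0 : left_zero enn_zero enn_mul.
Proof. by move=> x; apply: val_inj => /=; rewrite mul0e. Qed.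
Lemma enn_1neq0 : enn_one != enn_zero.
Proof. by rewrite -(inj_eq val_inj) /= onee_neq0. Qed.

HB.instance Definition _ := GRing.isNmodule.Build E enn_addA enn_addC enn_add0.
HB.instance Definition _ := GRing.Nmodule_isComNzSemiRing.Build E
  enn_mulA enn_mulC enn_mul1 enn_mulD enn_mul0 enn_1neq0.

Definition enn_le (x y : E) : bool := (val x <= val y)%E.

End EnnSemiring.

Notation "x <<= y" := (enn_le x y) (at level 70, no associativity).

Section EnnTheory.
Variable R : realType.
Local Notation E := (enn R).
Implicit Types x y z : E.

Lemma val_ennD x y : val (x + y) = (val x + val y)%E. Proof. by []. Qed.
Lemma val_ennM x y : val (x * y) = (val x * val y)%E. Proof. by []. Qed.
Lemma val_enn_sum (I : Type) (r : seq I) (P : pred I) (f : I -> E) :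
  val (\sum_(i <- r | P i) f i) = (\sum_(i <- r | P i) val (f i))%E.
Proof. by elim/big_rec2 : _ => // i x y _ <-. Qed.

Lemma elexx x : x <<= x. Proof. exact: lexx. Qed.
Lemma ele_trans y x z : x <<= y -> y <<= z -> x <<= z.
Proof. exact: le_trans. Qed.
Lemma ele_anti x y : x <<= y -> y <<= x -> x = y.
Proof. by move=> h1 h2; apply: val_inj; apply/le_anti/andP; split. Qed.
Lemma ele0 x : 0 <<= x. Proof. exact: (valP x). Qed.
Lemma eleD x y x' y' : x <<= x' -> y <<= y' -> x + y <<= x' + y'.
Proof. exact: leeD. Qed.
Lemma eleM x y x' y' : x <<= x' -> y <<= y' -> x * y <<= x' * y'.
Proof. by move=> h1 h2; apply: lee_pmul => //; exact: (valP _). Qed.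
Lemma eleMl x y z : y <<= z -> x * y <<= x * z.
Proof. by apply: eleM; exact: elexx. Qed.
Lemma eleMr x y z : y <<= z -> y * x <<= z * x.
Proof. by move=> h; apply: eleM => //; exact: elexx. Qed.
Lemma eleDl x y : x <<= x + y.
Proof. by rewrite -{1}[x]addr0; apply: eleD; rewrite ?elexx ?ele0. Qed.
Lemma eleDr x y : x <<= y + x.
Proof. by rewrite addrC; exact: eleDl. Qed.
Lemma ele_eq x y : x = y -> x <<= y. Proof. by move->; exact: elexx. Qed.
Lemma ele_bool (b : bool) x : b%:R * x <<= x.
Proof. by case: b; rewrite ?mul1r ?mul0r ?elexx ?ele0. Qed.
Lemma ele_sum (I : Type) (r : seq I) (P : pred I) (f g : I -> E) :
  (forall i, P i -> f i <<= g i) ->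
  \sum_(i <- r | P i) f i <<= \sum_(i <- r | P i) g i.
Proof. by move=> h; elim/big_rec2: _ => [|i y1 y2 Pi]; [exact: elexx|apply: eleD; exact: h]. Qed.
Lemma eleX x y n : x <<= y -> x ^+ n <<= y ^+ n.
Proof. by move=> h; elim: n => [|n IH]; rewrite ?expr0 ?elexx// !exprS eleM. Qed.
Lemma ele_total x y : x <<= y \/ y <<= x.
Proof. by case/orP: (le_total (val x) (val y)); [left|right]. Qed.

Lemma ofR_subproof (r : R) : (0 <= (Num.max r 0)%:E)%E.
Proof. by rewrite lee_fin le_max lexx orbT. Qed.
(** Negative numbers are clipped to 0, and [toR] sends +oo to 0; hence the sign and finiteness
    conditions of [ofRK] and [toRK]. *)
Definition ofR (r : R) : E := enn_mk (ofR_subproof r).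
Definition toR x : R := fine (val x).
Definition efin x : bool := (val x < +oo)%E.

Lemma val_ofR r : 0 <= r -> val (ofR r) = r%:E.
Proof. by move=> r0 /=; rewrite max_l. Qed.
Lemma toR_ge0 x : 0 <= toR x. Proof. by apply: fine_ge0; exact: (valP x). Qed.
Lemma ofRK r : 0 <= r -> toR (ofR r) = r.
Proof. by move=> r0; rewrite /toR val_ofR. Qed.
Lemma ofR_fin r : efin (ofR r). Proof. by rewrite /efin /= ltry. Qed.
Lemma toRK x : efin x -> ofR (toR x) = x.
Proof.
move=> h; apply: val_inj; rewrite val_ofR ?toR_ge0// /toR fineK//.
by rewrite ge0_fin_numE//; exact: (valP x).
Qed.
Lemma ofR0 : ofR 0 = 0. Proof. by apply: val_inj; rewrite val_ofR. Qed.
Lemma toR0 : toR 0 = 0. Proof. by []. Qed.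
Lemma ofR1 : ofR 1 = 1. Proof. by apply: val_inj; rewrite val_ofR. Qed.
Lemma ofRD r s : 0 <= r -> 0 <= s -> ofR (r + s) = ofR r + ofR s.
Proof. by move=> r0 s0; apply: val_inj; rewrite val_ennD !val_ofR ?addr_ge0. Qed.
Lemma ofRM r s : 0 <= r -> 0 <= s -> ofR (r * s) = ofR r * ofR s.
Proof. by move=> r0 s0; apply: val_inj; rewrite val_ennM !val_ofR ?mulr_ge0. Qed.
Lemma ofR_nat n : ofR n%:R = n%:R.
Proof. by elim: n => [|n IH]; rewrite ?ofR0// -addn1 !natrD ofRD// IH ofR1. Qed.
Lemma ofRX r n : 0 <= r -> ofR (r ^+ n) = ofR r ^+ n.
Proof. by move=> r0; elim: n => [|n IH]; rewrite ?ofR1// !exprS ofRM ?exprn_ge0// IH. Qed.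
Lemma ofR_sum (I : Type) (s : seq I) (P : pred I) (f : I -> R) :
  (forall i, P i -> 0 <= f i) ->
  ofR (\sum_(i <- s | P i) f i) = \sum_(i <- s | P i) ofR (f i).
Proof.
move=> h; elim: s => [|i s IH]; rewrite ?big_nil ?ofR0// !big_cons.
by case: ifP => // Pi; rewrite ofRD ?h ?sumr_ge0// IH.
Qed.
Lemma ele_ofR r s : r <= s -> ofR r <<= ofR s.
Proof. by move=> rs; rewrite /enn_le /= lee_fin ge_max !le_max rs lexx orbT. Qed.
Lemma ofR_le r s : 0 <= s -> ofR r <<= ofR s -> r <= s.
Proof. by move=> s0; rewrite /enn_le [val (ofR s)]val_ofR//= lee_fin ge_max => /andP[]. Qed.
Lemma efin_le x y : x <<= y -> efin y -> efin x.
Proof. exact: le_lt_trans. Qed.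
Lemma efinD x y : efin x -> efin y -> efin (x + y).
Proof. by move=> hx hy; rewrite /efin val_ennD lte_add_pinfty. Qed.
Lemma efinM x y : efin x -> efin y -> efin (x * y).
Proof. by move=> hx hy; rewrite -(toRK hx) -(toRK hy) -ofRM ?toR_ge0// ofR_fin. Qed.
Lemma efin_sum (I : Type) (s : seq I) (P : pred I) (f : I -> E) :
  (forall i, P i -> efin (f i)) -> efin (\sum_(i <- s | P i) f i).
Proof. by move=> h; elim/big_ind: _ => //; [rewrite -ofR0 ofR_fin|exact: efinD]. Qed.
Lemma efin_nat n : efin (n%:R : E). Proof. by rewrite -ofR_nat ofR_fin. Qed.
Lemma efin0 : efin (0 : E). Proof. by rewrite -ofR0 ofR_fin. Qed.
Lemma efin1 : efin (1 : E). Proof. by rewrite -ofR1 ofR_fin. Qed.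
Lemma efin_ofR_le x r : x <<= ofR r -> efin x.
Proof. by move/efin_le; apply; exact: ofR_fin. Qed.
Lemma toR_le x r : 0 <= r -> x <<= ofR r -> toR x <= r.
Proof. by move=> r0 h; apply: ofR_le => //; rewrite toRK// (efin_ofR_le h). Qed.
Lemma toRD x y : efin x -> efin y -> toR (x + y) = toR x + toR y.
Proof. by move=> hx hy; rewrite -{1}(toRK hx) -{1}(toRK hy) -ofRD ?toR_ge0// ofRK// addr_ge0 ?toR_ge0. Qed.
Lemma toRM x y : efin x -> efin y -> toR (x * y) = toR x * toR y.
Proof. by move=> hx hy; rewrite -{1}(toRK hx) -{1}(toRK hy) -ofRM ?toR_ge0// ofRK// mulr_ge0 ?toR_ge0. Qed.
Lemma toR_sum (I : Type) (s : seq I) (P : pred I) (f : I -> E) :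
  (forall i, P i -> efin (f i)) ->
  toR (\sum_(i <- s | P i) f i) = \sum_(i <- s | P i) toR (f i).
Proof.
move=> h; elim: s => [|i s IH]; rewrite ?big_nil// !big_cons.
by case: ifP => // Pi; rewrite toRD ?h ?efin_sum// IH.
Qed.
Lemma toR_mono x y : efin y -> x <<= y -> toR x <= toR y.
Proof. by move=> hy h; apply: toR_le; rewrite ?toR_ge0// toRK. Qed.
Lemma ele_addI x y z : efin x -> x + y <<= x + z -> y <<= z.
Proof. by move=> hx; rewrite /enn_le !val_ennD leeD2lE// ge0_fin_numE ?(valP x). Qed.
Lemma ele_natI n x y : n.+1%:R * x <<= n.+1%:R * y -> x <<= y.
Proof.
have e : ofR n.+1%:R^-1 * n.+1%:R = 1.
  by rewrite -ofR_nat -ofRM ?invr_ge0// mulVf ?ofR1// pnatr_eq0.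
by move=> h; rewrite -[x]mul1r -[y]mul1r -e -!mulrA; exact: eleMl.
Qed.
(** Infinite arguments make the right side infinite and are removed beforehand; for finite ones this
    is (a - b)^2 >= 0, which has no direct form in a semiring. *)
Lemma ele_amgm x y : x * y + x * y <<= x * x + y * y.
Proof.
have [hx|nx] := boolP (efin x); last first.
  apply: (ele_trans (y := x)); last first.
    apply: ele_trans (eleDl _ _); move: nx; rewrite /efin /enn_le val_ennM -leNgt leye_eq => /eqP ->.
    by rewrite mulyy.
  by move: nx; rewrite /efin /enn_le -leNgt leye_eq => /eqP ->; rewrite leey.
have [hy|ny] := boolP (efin y); last first.
  apply: (ele_trans (y := y)); last first.
    apply: ele_trans (eleDr _ _); move: ny; rewrite /efin /enn_le val_ennM -leNgt leye_eq => /eqP ->.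
    by rewrite mulyy.
  by move: ny; rewrite /efin /enn_le -leNgt leye_eq => /eqP ->; rewrite leey.
rewrite -(toRK hx) -(toRK hy); have := toR_ge0 x; have := toR_ge0 y.
move: (toR x) (toR y) => a b b0 a0; rewrite -!ofRM// -!ofRD ?mulr_ge0//.
by apply: ele_ofR; have := sqr_ge0 (a - b); rewrite sqrrB => ?; nra.
Qed.
End EnnTheory.
Arguments ele_trans {R} y {x z}.
#[global] Hint Resolve elexx ele0 toR_ge0 ofR_fin efin_nat efin0 efin1 : core.

Section Tsum.
Variable R : realType.
Local Notation E := (enn R).
Implicit Types T : choiceType.

Lemma tsum_subproof T (f : T -> E) : (0 <= \esum_(x in setT) val (f x))%E.
Proof. by apply: esum_ge0 => x _; exact: (valP (f x)). Qed.
Definition tsum T (f : T -> E) : E := enn_mk (tsum_subproof f).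

Lemma eq_tsum T (f g : T -> E) : f =1 g -> tsum f = tsum g.
Proof. by move=> h; congr tsum; apply/funext. Qed.

Lemma le_tsum T (f g : T -> E) : (forall x, f x <<= g x) -> tsum f <<= tsum g.
Proof. by move=> h; apply: le_esum => x _; exact: h. Qed.

Lemma tsum0 T : tsum (fun _ : T => 0) = 0.
Proof. by apply: val_inj; rewrite /= esum1. Qed.

Lemma tsum_eq0 T (f : T -> E) : (forall x, f x = 0) -> tsum f = 0.
Proof. by move=> h; rewrite -[RHS](tsum0 T); apply: eq_tsum. Qed.

Lemma tsumD T (f g : T -> E) : tsum (fun x => f x + g x) = tsum f + tsum g.
Proof.
by apply: val_inj; rewrite /= -esumD// => x _; [exact: (valP (f x))|exact: (valP (g x))].
Qed.

Lemma tsum_big T (I : Type) (r : seq I) (P : pred I) (f : T -> I -> E) :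
  tsum (fun x => \sum_(i <- r | P i) f x i) = \sum_(i <- r | P i) tsum (f^~ i).
Proof.
elim: r => [|i r IH].
  by rewrite big_nil; apply: tsum_eq0 => x; rewrite big_nil.
rewrite big_cons -IH; case: ifP => Pi.
  by rewrite -tsumD; apply: eq_tsum => x; rewrite big_cons Pi.
by apply: eq_tsum => x; rewrite big_cons Pi.
Qed.

Lemma tsum_ub T (f : T -> E) c :
  (forall s : seq T, uniq s -> \sum_(x <- s) f x <<= c) -> tsum f <<= c.
Proof.
move=> h; apply: ge_ereal_sup => _ /= [A [finA _] <-].
rewrite fsbig_finite//=; have := h (finmap.enum_fset (fset_set A)) (finmap.fset_uniq _).
by rewrite /enn_le val_enn_sum.
Qed.

Lemma tsum_ge_seq T (f : T -> E) (s : seq T) : uniq s -> \sum_(x <- s) f x <<= tsum f.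
Proof.
move=> us; rewrite /enn_le /= val_enn_sum; apply: esum_ge.
by exists [set` s]; [split => //; exact: finite_seq|rewrite -fsbig_seq].
Qed.

Lemma tsum_ge1 T (f : T -> E) a : f a <<= tsum f.
Proof. by have := @tsum_ge_seq _ f [:: a] isT; rewrite big_seq1. Qed.

Lemma tsum_mull_le T (c : E) (f : T -> E) : tsum (fun x => c * f x) <<= c * tsum f.
Proof. by apply: tsum_ub => s us; rewrite -mulr_sumr eleMl// tsum_ge_seq. Qed.

(** A finite non-zero c can be inverted, which reverses [tsum_mull_le]. An infinite c has no
    inverse, but then a single non-zero term makes the left side infinite. *)
Lemma tsumZl T (c : E) (f : T -> E) : tsum (fun x => c * f x) = c * tsum f.
Proof.
apply: ele_anti; first exact: tsum_mull_le.
have [->|c0] := eqVneq c 0; first by rewrite mul0r ele0.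
have [hc|nc] := boolP (efin c).
  have tc0 : 0 < toR c.
    rewrite lt_neqAle toR_ge0 andbT eq_sym; apply: contra c0 => /eqP e.
    by rewrite -(toRK hc) e ofR0.
  have ic : ofR (toR c)^-1 * c = 1.
    by rewrite -{2}(toRK hc) -ofRM ?invr_ge0 ?toR_ge0// mulVf ?ofR1// gt_eqF.
  have -> : tsum f = tsum (fun x => ofR (toR c)^-1 * (c * f x)).
    by apply: eq_tsum => x; rewrite mulrA ic mul1r.
  apply: (ele_trans _ (eleMl _ (tsum_mull_le _ _))).
  by rewrite mulrA [c * _]mulrC ic mul1r.
have [[a fa]|H] := pselect (exists a, f a != 0); last first.
  by rewrite [X in c * X]tsum_eq0 ?mulr0// => x; apply/eqP/negPn/negP => h; apply: H; exists x.
apply: (ele_trans (c * f a)); last exact: (tsum_ge1 (fun x => c * f x) a).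
have -> : c * f a = c.
  apply: val_inj; move: nc; rewrite val_ennM /efin -leNgt leye_eq => /eqP ->.
  by rewrite gt0_mulye// lt_neqAle (valP (f a)) andbT eq_sym; apply: contra fa => /eqP e; apply/eqP/val_inj.
by move: nc; rewrite /enn_le /efin -leNgt leye_eq => /eqP ->; rewrite leey.
Qed.

Lemma tsumZr T (c : E) (f : T -> E) : tsum (fun x => f x * c) = tsum f * c.
Proof. by rewrite mulrC -tsumZl; apply: eq_tsum => x; rewrite mulrC. Qed.

Lemma tsum_pair T1 T2 (f : T1 -> T2 -> E) :
  tsum (fun x => tsum (f x)) = tsum (fun p : T1 * T2 => f p.1 p.2).
Proof.
apply: val_inj => /=; rewrite esum_esum; last by move=> i j _ _; exact: (valP (f i j)).
by congr esum; apply/seteqP; split.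
Qed.

Lemma tsum_bij T1 T2 (e : T1 -> T2) (f : T2 -> E) :
  bijective e -> tsum f = tsum (fun x => f (e x)).
Proof.
move=> [g eg ge]; apply: val_inj => /=; apply: reindex_esum.
by split=> // [x y _ _ /(can_inj eg)//|y _]; exists (g y).
Qed.

Lemma tsum_swap T1 T2 (f : T1 -> T2 -> E) :
  tsum (fun x => tsum (f x)) = tsum (fun y => tsum (f^~ y)).
Proof.
rewrite !tsum_pair (tsum_bij (e := fun p : T2 * T1 => (p.2, p.1)))//.
by exists (fun p => (p.2, p.1)) => -[].
Qed.

Lemma tsum_delta T (a : T) (f : T -> E) : tsum (fun x => (x == a)%:R * f x) = f a.
Proof.
apply: ele_anti; last by apply: ele_trans (tsum_ge1 _ a); rewrite eqxx mul1r.
apply: tsum_ub => s us; have [sa|sa] := boolP (a \in s).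
  rewrite (bigD1_seq a)//= eqxx mul1r big1 ?addr0// => x /negbTE ->.
  by rewrite mul0r.
rewrite big_seq big1// => x xs.
by have [xa|] := eqVneq x a; [rewrite -xa xs in sa|rewrite mul0r].
Qed.

Lemma tsum_inj_le T1 T2 (e : T1 -> T2) (f : T2 -> E) :
  injective e -> tsum (fun x => f (e x)) <<= tsum f.
Proof.
move=> ie; apply: tsum_ub => s us.
rewrite -(big_map e predT f); apply: tsum_ge_seq.
by rewrite map_inj_uniq.
Qed.

Lemma tsum_delta_r T (a : T) (f : T -> E) : tsum (fun x => (a == x)%:R * f x) = f a.
Proof. by rewrite -[RHS](tsum_delta a); apply: eq_tsum => x; rewrite eq_sym. Qed.

Lemma tsum_natS (f : nat -> E) : tsum f = f 0%N + tsum (fun n => f n.+1).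
Proof.
rewrite -{1}(tsum_delta 0%N f) -{1}[f]/(fun n => f n).
have -> : tsum f = tsum (fun n => (n == 0%N)%:R * f n + (n != 0%N)%:R * f n).
  by apply: eq_tsum => n; case: eqP; rewrite mul0r mul1r ?addr0 ?add0r.
rewrite tsumD; congr (_ + _).
have -> : tsum (fun n => (n != 0%N)%:R * f n) =
   tsum (fun n => tsum (fun m : nat => (m.+1 == n)%:R * f n)).
  apply: eq_tsum => -[|n] /=; first by rewrite mul0r tsum_eq0// => x; rewrite mul0r.
  rewrite mul1r -[LHS](tsum_delta n (fun=> f n.+1)); apply: eq_tsum => m.
  by rewrite eqSS.
rewrite tsum_swap; apply: eq_tsum => m; exact: tsum_delta_r.
Qed.

Lemma ele_sum_sub T (f : T -> E) (s t : seq T) :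
  uniq s -> {subset s <= t} -> \sum_(x <- s) f x <<= \sum_(x <- t) f x.
Proof.
elim: s t => [|a s IH] t us st; first by rewrite big_nil ele0.
move: us => /= /andP[as_ us].
have at_ : a \in t by apply: st; rewrite mem_head.
rewrite big_cons (perm_big _ (perm_to_rem at_)) big_cons eleD// IH// => x xs.
have := st x; rewrite inE xs orbT => /(_ isT); rewrite (perm_mem (perm_to_rem at_)) inE.
by case/orP => // /eqP xa; rewrite xa (negbTE as_) in xs.
Qed.

Lemma tsum_nat_ub (f : nat -> E) c :
  (forall n, \sum_(i < n) f i <<= c) -> tsum f <<= c.
Proof.
move=> h; apply: tsum_ub => s us; apply: ele_trans (h (\max_(i <- s) i).+1).
rewrite -(big_mkord xpredT) ; apply: ele_sum_sub => // x xs.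
by rewrite mem_index_iota /= ltnS; exact: (@leq_bigmax_seq _ s xpredT id x xs isT).
Qed.

Lemma tsum_nat_ge (f : nat -> E) n : \sum_(i < n) f i <<= tsum f.
Proof. by rewrite -(big_mkord xpredT); apply: tsum_ge_seq; exact: iota_uniq. Qed.

Lemma tsum_nat_fin (f : nat -> E) n :
  tsum (fun i => (i < n)%N%:R * f i) = \sum_(i < n) f i.
Proof.
elim: n f => [|n IH] f; first by rewrite big_ord0 tsum_eq0// => i; rewrite mul0r.
by rewrite tsum_natS big_ord_recl mul1r; congr (_ + _); exact: (IH (fun i => f i.+1)).
Qed.

Lemma tsum_finType (T : finType) (f : T -> E) : tsum f = \sum_x f x.
Proof.
apply: ele_anti; last by apply: tsum_ge_seq; exact: index_enum_uniq.
by apply: tsum_ub => s us; apply: ele_sum_sub => // x _; exact: mem_index_enum.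
Qed.

Lemma tsum_mem T (f : T -> E) (s : seq T) : uniq s ->
  tsum (fun x => (x \in s)%:R * f x) = \sum_(x <- s) f x.
Proof.
elim: s => [|a s IH] /= => [_|/andP[as_ us]].
  by rewrite big_nil tsum_eq0// => x; rewrite mul0r.
rewrite big_cons -IH// -(tsum_delta a f) -tsumD; apply: eq_tsum => x.
rewrite inE; have [->|_] := eqVneq x a; last by rewrite /= mul0r add0r.
by rewrite (negbTE as_) mul0r addr0.
Qed.

(** If every finite set left a remainder above e, all finite partial sums would be at most the total
    minus e, and so would their supremum. *)
Lemma tsum_tail T (f : T -> E) (e : R) : 0 < e -> efin (tsum f) ->
  exists2 s : seq T, uniq s & tsum (fun x => (x \notin s)%:R * f x) <<= ofR e.
Proof.
move=> e0 hf; apply: contrapT => H.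
suff : tsum f <<= ofR (toR (tsum f) - e).
  rewrite -{1}(toRK hf) => h; have := toR_ge0 (tsum f); rewrite le_eqVlt => /orP[/eqP z|p].
    apply: H; exists [::] => //; apply: (ele_trans (tsum f)).
      by apply: le_tsum => x; exact: ele_bool.
    by rewrite -(toRK hf) -z ele_ofR// ltW.
  have [q|q] := leP 0 (toR (tsum f) - e); first by have := ofR_le q h; lra.
  move: h; rewrite (_ : ofR (_ - e) = 0) -?ofR0; last first.
    by apply: val_inj => /=; rewrite max_r ?ltW// maxxx.
  by move=> /(ofR_le (lexx 0)); rewrite leNgt p.
apply: tsum_ub => s us; have [//|h] := ele_total (\sum_(x <- s) f x) (ofR (toR (tsum f) - e)).
exfalso; apply: H; exists s => //.
have E0 : tsum f = \sum_(x <- s) f x + tsum (fun x => (x \notin s)%:R * f x).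
  rewrite -tsum_mem// -tsumD; apply: eq_tsum => x.
  by case: (x \in s); rewrite /= mul0r mul1r ?addr0 ?add0r.
have fs : efin (\sum_(x <- s) f x) by apply: efin_le hf; exact: tsum_ge_seq.
apply: (ele_addI (x := \sum_(x <- s) f x)) => //; rewrite -E0 -{1}(toRK hf) -(toRK fs).
rewrite -ofRD ?toR_ge0// ?ltW//; apply: ele_ofR.
have := toR_mono fs h; have [q|q] := leP 0 (toR (tsum f) - e); first by rewrite ofRK//; lra.
by move=> _; have := toR_ge0 (\sum_(x <- s) f x); lra.
Qed.

Lemma efin_tsum T (f : T -> E) a : efin (tsum f) -> efin (f a).
Proof. by apply: efin_le; exact: tsum_ge1. Qed.

Lemma tsum_prod2 T1 T2 (f : T1 -> E) (g : T2 -> E) :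
  tsum f * tsum g = tsum (fun x => tsum (fun y => f x * g y)).
Proof. by rewrite -tsumZr; apply: eq_tsum => x; rewrite tsumZl. Qed.

Lemma tsum_subr (V : zmodType) (a : V) (f : V -> E) : tsum f = tsum (fun x => f (x - a)).
Proof. by apply: tsum_bij; exists (fun x => x + a) => x; rewrite ?subrK ?addrK. Qed.
Lemma tsum_addr (V : zmodType) (a : V) (f : V -> E) : tsum f = tsum (fun x => f (x + a)).
Proof. by apply: tsum_bij; exists (fun x => x - a) => x; rewrite ?subrK ?addrK. Qed.
Lemma tsum_opp (V : zmodType) (f : V -> E) : tsum f = tsum (fun x => f (- x)).
Proof. by apply: tsum_bij; exists (fun x => - x) => x; rewrite opprK. Qed.
End Tsum.

(** * Self-avoiding walks and the lace expansion *)

Section Walks.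
Variables (R : realType) (V : zmodType) (D : V -> enn R).
Local Notation E := (enn R).
Implicit Types (A T : seq V) (u v w x y : V).

(* Weight of the n-step self-avoiding walks from u to x that avoid T; T records the past of the walk. *)
Fixpoint Fw n T u x : E :=
  if n is n'.+1 then
    tsum (fun y => D (y - u) * (y \notin u :: T)%:R * Fw n' (u :: T) y x)
  else (u == x)%:R.

(* Walks from u are followed until their first hit of A; phi receives the
   remaining time, the walked piece and the hitting point. *)
Fixpoint Hit n A T u (phi : nat -> seq V -> V -> E) : E :=
  if n is n'.+1 then
    tsum (fun y => D (y - u) * (y \notin u :: T)%:R *
      (if y \in A then phi n' (u :: T) y else Hit n' A (u :: T) y phi))
  else 0.

(** The walk is classified by its first visit to A at a positive time. The continuation receives the
    vertices already used, since it must still avoid them. *)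
Lemma Fw_split n A T u x :
  Fw n T u x = Fw n (T ++ A) u x + Hit n A T u (fun m T' u' => Fw m T' u' x).
Proof.
elim: n T u => [|n IH] T u /=; first by rewrite addr0.
rewrite -tsumD; apply: eq_tsum => y.
have -> : (y \notin u :: T ++ A) = (y \notin u :: T) && (y \notin A).
  by rewrite -cat_cons mem_cat negb_or.
case: (y \notin u :: T); last by rewrite !mulr0 !mul0r addr0.
case: (y \in A) => /=; first by rewrite mulr0 mul0r add0r.
by rewrite !mulr1 {1}IH mulrDr.
Qed.

Lemma Hit_le n A T u phi psi :
  (forall m T' u', phi m T' u' <<= psi m T' u') ->
  Hit n A T u phi <<= Hit n A T u psi.
Proof.
move=> h; elim: n T u => [|n IH] T u //=; apply: le_tsum => y; apply: eleMl.
by case: ifP.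
Qed.

Lemma Hit_eq n A T u phi psi :
  (forall m T' u', phi m T' u' = psi m T' u') ->
  Hit n A T u phi = Hit n A T u psi.
Proof. by move=> h; apply: ele_anti; apply: Hit_le => m T' u'; rewrite h. Qed.

Lemma HitD n A T u phi psi :
  Hit n A T u (fun m T' u' => phi m T' u' + psi m T' u') =
  Hit n A T u phi + Hit n A T u psi.
Proof.
elim: n T u => [|n IH] T u //=; first by rewrite addr0.
by rewrite -tsumD; apply: eq_tsum => y; rewrite -mulrDr IH; case: ifP.
Qed.

Lemma Hit0 n A T u phi : (forall m T' u', (m < n)%N -> phi m T' u' = 0) ->
  Hit n A T u phi = 0.
Proof.
elim: n T u => [|n IH] T u //= h; apply: tsum_eq0 => y.
rewrite IH ?h ?if_same ?mulr0// => m T' u' mn; apply: h.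
by rewrite (leq_trans mn).
Qed.

(** Cutting at the first hit leaves all remaining time to the continuation, so that a convolution on
    the right of [Hit] passes to the continuation. *)
Lemma Hit_conv n A T u (phi : nat -> seq V -> V -> V -> E) (psi : nat -> V -> E) :
  \sum_(m < n.+1) tsum (fun v => Hit m A T u (fun m' T' u' => phi m' T' u' v) * psi (n - m)%N v) =
  Hit n A T u (fun m' T' u' => \sum_(m < m'.+1) tsum (fun v => phi m T' u' v * psi (m' - m)%N v)).
Proof.
elim: n T u => [|n IH] T u; rewrite big_ord_recl /=.
  by rewrite big_ord0 addr0 tsum_eq0// => v; rewrite mul0r.
rewrite tsum_eq0 ?add0r; last by move=> v; rewrite mul0r.
under eq_bigr => m _.
  under eq_tsum => v do rewrite -tsumZr.
  rewrite tsum_swap; over.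
rewrite -tsum_big; apply: eq_tsum => y.
under [LHS]eq_bigr => m _.
  under eq_tsum => v do rewrite -mulrA.
  rewrite tsumZl; over.
rewrite -mulr_sumr; congr (_ * _); case: (y \in A).
  by apply: eq_bigr => m _; apply: eq_tsum => v; rewrite subSS.
rewrite -IH; apply: eq_bigr => m _; apply: eq_tsum => v; by rewrite subSS.
Qed.

Definition cw n x : E := Fw n [::] 0 x.

Lemma Fw_map (g : V -> V) (a : V) n T u x :
  injective g -> bijective (fun x => g x + a) -> (forall x y, g (x - y) = g x - g y) ->
  (forall x, D (g x) = D x) ->
  Fw n (map (fun x => g x + a) T) (g u + a) (g x + a) = Fw n T u x.
Proof.
move=> ig bg gB Dg; elim: n T u => [|n IH] T u /=.
  by rewrite (inj_eq (addIr a)) (inj_eq ig).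
have iga : injective (fun x => g x + a) by exact: bij_inj.
rewrite (tsum_bij _ bg); apply: eq_tsum => y.
rewrite opprD addrACA subrr addr0 -gB Dg; congr (_ * _ * _).
  by rewrite -[_ :: map _ _]/(map (fun x => g x + a) (u :: T)) (mem_map iga).
exact: (IH (u :: T)).
Qed.

Lemma FwE n u x : Fw n [::] u x = cw n (x - u).
Proof.
rewrite /cw -(@Fw_map id u n [::] 0 (x - u)) ?add0r ?subrK//=.
by exists (fun x => x - u) => y; rewrite ?addrK ?subrK.
Qed.

Lemma cw_map (g : V -> V) n x : bijective g -> g 0 = 0 ->
  (forall x y, g (x - y) = g x - g y) -> (forall x, D (g x) = D x) -> cw n (g x) = cw n x.
Proof.
move=> bg g0 gB Dg; have := @Fw_map g 0 n [::] 0 x (bij_inj bg) _ gB Dg.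
rewrite /= !addr0 g0; apply; case: bg => f fg gf.
by exists f => y /=; rewrite addr0.
Qed.

Lemma Fw_anti n T T' u x : {subset T <= T'} -> Fw n T' u x <<= Fw n T u x.
Proof.
elim: n T T' u => [|n IH] T T' u h //=; apply: le_tsum => y.
have h' : {subset u :: T <= u :: T'}.
  by move=> z; rewrite !inE => /orP[->//|/h ->]; rewrite orbT.
apply: eleM; last exact: IH.
apply: eleMl; have [|ny] := boolP (y \in u :: T); last by case: (_ \in _); rewrite ?ele0 ?elexx.
by move/h' => ->; exact: ele0.
Qed.

Lemma Fw_le_cw n T u x : Fw n T u x <<= cw n (x - u).
Proof. by rewrite -FwE; apply: Fw_anti. Qed.

(** N walks in succession, of total length m: the first ends at its first hit of A, each later one
    at its first hit of the walk just before it. Only that most recent walk is remembered. In [Rem]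
    one more walk follows, which has to avoid its predecessor. *)
Fixpoint Qw N m A u x : E :=
  if N is N'.+1 then Hit m A [::] u (fun m' T' u' => Qw N' m' T' u' x)
  else ((m == 0%N) && (u == x))%:R.

Fixpoint Rem N n A u x : E :=
  if N is N'.+1 then Hit n A [::] u (fun m' T' u' => Rem N' m' T' u' x)
  else Fw n A u x.

(** A free walk after the last piece either avoids that piece or hits it, by [Fw_split]: two
    consecutive remainders appear, so that an alternating sum over N telescopes. *)
Lemma Qw_conv N n A u x :
  \sum_(m < n.+1) tsum (fun v => Qw N m A u v * cw (n - m) (x - v)) =
  Rem N n A u x + Rem N.+1 n A u x.
Proof.
elim: N n A u => [|N IH] n A u.
  rewrite big_ord_recl /= big1 ?addr0; last first.
    by move=> i _; apply: tsum_eq0 => v; rewrite mul0r.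
  rewrite subn0 -(@Fw_split n A [::]) FwE; under eq_tsum => v do rewrite eq_sym.
  exact: (tsum_delta u (fun v => cw n (x - v))).
rewrite [LHS](@Hit_conv n A [::] u (fun m' T' u' v => Qw N m' T' u' v) (fun m v => cw m (x - v))).
by rewrite [RHS]/= -HitD; apply: Hit_eq => m T' u'; exact: IH.
Qed.

Lemma Rem_eq0 N n A u x : (n < N)%N -> Rem N n A u x = 0.
Proof.
elim: N n A u => [//|N IH] n A u nN; rewrite /=; apply: Hit0 => m T' u' mn; apply: IH.
by rewrite (leq_trans mn).
Qed.

Lemma Qw_eq0 N m A u x : (m < N)%N -> Qw N m A u x = 0.
Proof.
elim: N m A u => [//|N IH] n A u nN; rewrite /=; apply: Hit0 => m T' u' mn; apply: IH.
by rewrite (leq_trans mn).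
Qed.

(** The first step y is split off, whence [m.-1]; for N > 0 the first piece has to return to the
    origin. *)
Definition Pw N m x : E := tsum (fun y => D y * Qw N m.-1 [:: 0] y x).
Definition PR N n x : E := tsum (fun y => D y * Rem N n [:: 0] y x).

Lemma Pw_conv N n x :
  \sum_(m < n.+1) tsum (fun v => Pw N m.+1 v * cw (n - m) (x - v)) =
  PR N n x + PR N.+1 n x.
Proof.
rewrite /PR -tsumD.
under [RHS]eq_tsum => y do rewrite -mulrDr -Qw_conv mulr_sumr.
rewrite tsum_big; apply: eq_bigr => m _.
under [RHS]eq_tsum => y do rewrite -tsumZl.
rewrite tsum_swap; apply: eq_tsum => v.
by rewrite /Pw -tsumZr; apply: eq_tsum => y; rewrite mulrA.
Qed.

Lemma PR0 n x : D 0 = 0 -> PR 0 n x = cw n.+1 x.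
Proof.
move=> D0; rewrite /PR /cw /=; apply: eq_tsum => y; rewrite subr0 inE.
by have [->|_] := eqVneq y 0; rewrite ?D0 ?mul0r// mulr1.
Qed.

Lemma PR_eq0 N n x : (n < N)%N -> PR N n x = 0.
Proof. by move=> h; apply: tsum_eq0 => y; rewrite Rem_eq0 ?mulr0. Qed.

Lemma Pw_eq0 N m x : (m.-1 < N)%N -> Pw N m x = 0.
Proof. by move=> h; apply: tsum_eq0 => y; rewrite Qw_eq0 ?mulr0. Qed.

Lemma Pw0 m x : Pw 0 m.+1 x = (m == 0%N)%:R * D x.
Proof.
rewrite /Pw /=; case: m => [|m] /=; last by rewrite mul0r tsum_eq0// => y; rewrite mulr0.
under eq_tsum => y do rewrite mulrC.
by rewrite (tsum_delta x D) mul1r.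
Qed.

(** Dropping the condition that v is the first visit to A leaves a walk from u to v; s is the time
    that remains at v. *)
Lemma Hit_bound n A T u (g : nat -> V -> E) :
  Hit n A T u (fun m _ v => g m v) <<=
  \sum_(v <- A) \sum_(s < n) Fw (n - s) T u v * g s v.
Proof.
elim: n T u => [|n IH] T u /=; first exact: ele0.
apply: (ele_trans (tsum (fun y => D (y - u) * (y \notin u :: T)%:R *
   (\sum_(v <- A) \sum_(s < n.+1) Fw (n - s) (u :: T) y v * g s v)))).
  apply: le_tsum => y; apply: eleMl; case: ifPn => yA.
    rewrite (perm_big _ (perm_to_rem yA)) big_cons; apply: ele_trans (eleDl _ _).
    by rewrite big_ord_recr /= subnn /= eqxx mul1r eleDr.
  apply: ele_trans (IH _ _) _; apply: ele_sum => v _.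
  by rewrite big_ord_recr eleDl.
under eq_tsum => y do rewrite mulr_sumr.
rewrite tsum_big; apply: ele_sum => v _.
under eq_tsum => y do rewrite mulr_sumr.
rewrite tsum_big; apply: ele_sum => s _.
rewrite subSn ?leq_ord//= -tsumZr; apply: le_tsum => y; by rewrite mulrA.
Qed.

(** Walks from u to v cut at a marked vertex v', with i steps before it and at least one step after
    it; s is the time that remains at v. *)
Definition Lad n T u v (f : nat -> V -> V -> E) : E :=
  \sum_(s < n) \sum_(i < n - s) tsum (fun v' => Fw i T u v' * cw (n - s - i) (v - v') * f s v' v).

(** A continuation that sums over the vertices of the walked piece marks one of them. The piece is
    cut there and its second part is freed from the past. Marked vertices in the initial list T are
    counted apart. *)
Lemma Hit_ladder n A T u (f : nat -> V -> V -> E) :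
  Hit n A T u (fun m T' v => \sum_(v' <- T') f m v' v) <<=
  \sum_(v <- A) (\sum_(v' <- T) \sum_(s < n) Fw (n - s) T u v * f s v' v + Lad n T u v f).
Proof.
elim: n T u => [|n IH] T u; first exact: ele0.
apply: (ele_trans (tsum (fun y => D (y - u) * (y \notin u :: T)%:R *
   (\sum_(v <- A) (\sum_(v' <- u :: T) \sum_(s < n.+1) Fw (n - s) (u :: T) y v * f s v' v
      + Lad n (u :: T) y v f))))).
  rewrite [Hit _ _ _ _ _]/=; apply: le_tsum => y; apply: eleMl; case: ifPn => yA.
    rewrite [X in _ <<= X](perm_big _ (perm_to_rem yA)) [X in _ <<= X]big_cons.
    apply: ele_trans (eleDl _ _).
    apply: ele_trans (eleDl _ _); apply: ele_sum => v' _.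
    by rewrite big_ord_recr /= subnn /= eqxx mul1r eleDr.
  apply: ele_trans (IH _ _) _; apply: ele_sum => v _; apply: eleD => //.
  by apply: ele_sum => v' _; rewrite big_ord_recr eleDl.
have FS i x' : tsum (fun y => D (y - u) * (y \notin u :: T)%:R * Fw i (u :: T) y x') = Fw i.+1 T u x'.
  by [].
under eq_tsum => y do rewrite mulr_sumr.
rewrite tsum_big; apply: ele_sum => v _.
under eq_tsum => y do rewrite mulrDr.
rewrite tsumD.
set X := tsum _; set Y := tsum _.
have -> : X = \sum_(v' <- u :: T) \sum_(s < n.+1) Fw (n.+1 - s) T u v * f s v' v.
  rewrite /X; under eq_tsum => y do rewrite mulr_sumr.
  rewrite tsum_big; apply: eq_bigr => v' _.
  under eq_tsum => y do rewrite mulr_sumr.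
  rewrite tsum_big; apply: eq_bigr => s _; rewrite subSn ?leq_ord// -FS -tsumZr.
  by apply: eq_tsum => y; rewrite mulrA.
have -> : Y = \sum_(s < n.+1) \sum_(i < n - s)
    tsum (fun v' => Fw i.+1 T u v' * cw (n - s - i) (v - v') * f s v' v).
  rewrite big_ord_recr /= subnn big_ord0 addr0 /Y.
  under eq_tsum => y do rewrite mulr_sumr.
  rewrite tsum_big; apply: eq_bigr => s _.
  under eq_tsum => y do rewrite mulr_sumr.
  rewrite tsum_big; apply: eq_bigr => i _.
  under eq_tsum => y do rewrite -tsumZl.
  rewrite tsum_swap; apply: eq_tsum => v'; rewrite -!tsumZr.
  by apply: eq_tsum => y; rewrite !mulrA.
rewrite big_cons addrAC addrC; apply: eleD => //.
rewrite /Lad -big_split; apply: ele_sum => s _ /=.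
rewrite subSn ?leq_ord// big_ord_recl /= subn0; apply: eleD => //.
under [X in _ <<= X]eq_tsum => v' do rewrite -mulrA.
rewrite (tsum_delta_r u (fun v' => cw (n - s).+1 (v - v') * f s v' v)).
exact: eleMr (Fw_le_cw (n - s).+1 _ _ _).
Qed.

(* The N-loop ladder with total length m; w and xi are the displacements of the
   two rails, r is the next rung. *)
Fixpoint yl N m (w xi : V) : E :=
  if N is N'.+1 then
    \sum_(s < m) \sum_(i < m - s)
      tsum (fun r => cw i (w + r) * cw (m - s - i) r * yl N' s r (xi - r))
  else ((0 < m)%N && (xi == 0))%:R * cw m w.

(** Each walk ends on its predecessor, and the vertex hit there cuts the predecessor in two; the two
    parts are the sides of a loop. Symmetry of D allows the second part to be read backwards. *)
Lemma Qw_ladder N m A u x : (forall r, D (- r) = D r) ->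
  Qw N.+1 m A u x <<= \sum_(v <- A) yl N m (v - u) (x - v).
Proof.
move=> Dsym.
have csym n r : cw n (- r) = cw n r.
  have bo : bijective (fun z : V => - z) by exists (fun z : V => - z) => z; rewrite opprK.
  by apply: (cw_map n r bo); [rewrite oppr0|move=> y z; rewrite opprD|].
elim: N m A u => [|N IH] m A u.
  apply: ele_trans (Hit_bound m A [::] u (fun m v => ((m == 0%N) && (v == x))%:R)) _.
  apply: ele_sum => v _ /=; case: m => [|m]; first by rewrite big_ord0 ele0.
  rewrite big_ord_recl /= big1 ?addr0; last by move=> i _; rewrite mulr0.
  rewrite mulrC subr_eq0 eq_sym; apply: eleMl.
  exact: (Fw_le_cw m.+1 [::] u v).
change (Qw N.+2 m A u x) with (Hit m A [::] u (fun m' T' u' => Qw N.+1 m' T' u' x)).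
apply: ele_trans (Hit_le _ _ _ _ (fun m' T' u' => IH m' T' u')) _.
apply: ele_trans (Hit_ladder m A [::] u (fun s v' v => yl N s (v' - v) (x - v'))) _.
apply: ele_sum => v _; rewrite big_nil add0r /Lad /=.
apply: ele_sum => s _; apply: ele_sum => i _.
rewrite (tsum_addr v); apply: le_tsum => r.
have -> : r + v - v = r by rewrite addrK.
have -> : v - (r + v) = - r by rewrite opprD addrCA subrr addr0.
have -> : x - (r + v) = x - v - r by rewrite opprD addrA addrAC.
rewrite FwE csym; have -> : r + v - u = v - u + r by rewrite -addrA addrC.
exact: elexx.
Qed.

Lemma Pw_ladder N m x : (forall r, D (- r) = D r) ->
  Pw N.+1 m x <<= tsum (fun y => D y * yl N m.-1 y x).
Proof.
move=> Dsym; rewrite /Pw [X in _ <<= X]tsum_opp; apply: le_tsum => y; rewrite Dsym.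
by apply: eleMl; apply: ele_trans (Qw_ladder _ _ _ _ _ Dsym) _; rewrite big_seq1 sub0r subr0.
Qed.

Lemma Fw_add n m T u x : Fw (n + m) T u x <<= tsum (fun v => Fw n T u v * cw m (x - v)).
Proof.
elim: n T u => [|n IH] T u.
  by rewrite add0n /= (tsum_delta_r u (fun v => cw m (x - v))) Fw_le_cw.
rewrite addSn [Fw n.+1]/= [Fw (n + m).+1 _ _ _]/=.
under [X in _ <<= X]eq_tsum => v do rewrite -tsumZr.
rewrite [X in _ <<= X]tsum_swap; apply: le_tsum => y.
apply: ele_trans (eleMl _ (IH _ _)) _; rewrite -tsumZl.
by apply: ele_eq; apply: eq_tsum => v; rewrite mulrA.
Qed.

Lemma cw_add n m x : cw (n + m) x <<= tsum (fun v => cw n v * cw m (x - v)).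
Proof. exact: Fw_add. Qed.

Lemma cw0 x : cw 0 x = (x == 0)%:R. Proof. by rewrite /cw /= eq_sym. Qed.

Lemma cwS n x : cw n.+1 x <<= tsum (fun y => D y * cw n (x - y)).
Proof.
apply: le_tsum => y; rewrite subr0; apply: eleM; last exact: Fw_le_cw.
by rewrite mulrC ele_bool.
Qed.

(** Walks with one distinguished step, weighted by [wt] of that step; used to transfer a weight of
    the end point to the single steps. *)
Fixpoint Fmark (wt : V -> E) n T u x : E :=
  if n is n'.+1 then
    tsum (fun y => D (y - u) * (y \notin u :: T)%:R *
       (wt (y - u) * Fw n' (u :: T) y x + Fmark wt n' (u :: T) y x))
  else 0.

Lemma Fmark_le wt n T u x :
  Fmark wt n T u x <<= \sum_(i < n) tsum (fun v => Fw i T u v *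
     tsum (fun y => wt (y - v) * D (y - v) * cw (n - i.+1) (x - y))).
Proof.
elim: n T u => [|n IH] T u; first by rewrite big_ord0.
rewrite big_ord_recl [Fmark _ _ _ _ _]/=.
under eq_tsum => y do rewrite mulrDr.
rewrite tsumD; apply: eleD.
  rewrite [X in _ <<= X](tsum_delta_r u (fun v => tsum (fun y => wt (y - v) * D (y - v) * cw (n.+1 - 1) (x - y)))).
  apply: le_tsum => y; rewrite mulrA subn1 /=; apply: eleM; last exact: Fw_le_cw.
  by rewrite mulrC; apply: eleMl; rewrite mulrC ele_bool.
apply: (ele_trans (tsum (fun y => D (y - u) * (y \notin u :: T)%:R *
  (\sum_(i < n) tsum (fun v => Fw i (u :: T) y v *
     tsum (fun y => wt (y - v) * D (y - v) * cw (n - i.+1) (x - y))))))).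
  by apply: le_tsum => y; apply: eleMl; exact: IH.
under eq_tsum => y do rewrite mulr_sumr.
rewrite tsum_big; apply: ele_sum => i _ /=.
under eq_tsum => y do rewrite -tsumZl.
rewrite tsum_swap; apply: le_tsum => v; rewrite -tsumZr.
by apply: ele_eq; apply: eq_tsum => y; rewrite mulrA.
Qed.

(** With N = n + 1 the hypothesis reads wt(x + y) <= (1 + 1/N) wt x + (1 + N) wt y. The first
    coefficient turns the factor N of the induction hypothesis into N + 1, so the weight of the end
    point is at most the number of steps times the sum of the step weights. *)
Lemma Fw_mark (wt : V -> E) n T u x : wt 0 = 0 ->
  (forall n x y, n.+1%:R * wt (x + y) <<= n.+2%:R * (wt x + n.+1%:R * wt y)) ->
  wt (x - u) * Fw n T u x <<= n%:R * Fmark wt n T u x.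
Proof.
move=> wt0 wtD; elim: n T u => [|n IH] T u.
  by rewrite /= mul0r; have [->|_] := eqVneq u x; rewrite ?subrr ?wt0 ?mul0r ?mulr0.
rewrite /= -!tsumZl; apply: le_tsum => y.
rewrite [wt _ * _]mulrCA [n.+1%:R * _]mulrCA; apply: eleMl.
case: n IH => [|n] IH.
  rewrite mul1r /= addr0; have [->|_] := eqVneq y x; rewrite ?mulr1 ?elexx//.
  by rewrite !mulr0.
apply: (@ele_natI _ n); rewrite mulrA.
apply: (ele_trans (n.+2%:R * (wt (x - y) + n.+1%:R * wt (y - u)) * Fw n.+1 (u :: T) y x)).
  by apply: eleMr; have := wtD n (x - y) (y - u); rewrite addrA subrK.
rewrite -mulrA [n.+1%:R * (_ * _)]mulrCA; apply: eleMl; rewrite mulrDl mulrDr addrC -mulrA.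
by apply: eleD.
Qed.
End Walks.

(** * Summing the ladder diagrams *)

Section NatSums.
Variable R : realType.
Local Notation E := (enn R).

Lemma tsum_nat_shift (f : nat -> E) i :
  tsum (fun n => (i <= n)%N%:R * f (n - i)%N) = tsum f.
Proof.
elim: i f => [|i IH] f; first by apply: eq_tsum => n; rewrite mul1r subn0.
by rewrite tsum_natS mul0r add0r -[RHS]IH.
Qed.

Lemma tsum_tri (g : nat -> nat -> E) :
  tsum (fun n => \sum_(i < n.+1) g i (n - i)%N) = tsum (fun i => tsum (g i)).
Proof.
under eq_tsum => n do rewrite -(tsum_nat_fin (fun i => g i (n - i)%N)).
by rewrite tsum_swap; apply: eq_tsum => i; exact: tsum_nat_shift.
Qed.

Lemma tsum_tri1 (g : nat -> nat -> E) :
  tsum (fun n => \sum_(i < n) g i (n - i)%N) = tsum (fun i => tsum (fun j => g i j.+1)).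
Proof.
rewrite tsum_natS big_ord0 add0r -tsum_tri; apply: eq_tsum => n.
by apply: eq_bigr => i _; rewrite subSn// leq_ord.
Qed.

Lemma tsum_tri2 (g : nat -> nat -> nat -> E) :
  tsum (fun m => \sum_(s < m) \sum_(i < m - s) g s i (m - s - i)%N) =
  tsum (fun s => tsum (fun i => tsum (fun j => g s i j.+1))).
Proof.
rewrite (tsum_tri1 (fun s k => \sum_(i < k) g s i (k - i)%N)); apply: eq_tsum => s.
rewrite -tsum_tri; apply: eq_tsum => n; apply: eq_bigr => i _.
by rewrite subSn// leq_ord.
Qed.
End NatSums.

(** * Generating functions of the ladders *)

Section Ladder.
Variables (R : realType) (V : zmodType) (D : V -> enn R) (z : enn R).
Local Notation E := (enn R).
Local Notation cw := (cw D).
Local Notation yl := (yl D).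
Hypothesis Dsym : forall x, D (- x) = D x.
Implicit Types (x y w r xi : V).

Lemma cw_sym n x : cw n (- x) = cw n x.
Proof.
have bo : bijective (fun z : V => - z) by exists (fun z : V => - z) => t; rewrite opprK.
by apply: (cw_map n x bo); [rewrite oppr0|move=> a b; rewrite opprD|].
Qed.

(** The two-point function; [Hf] omits the walk of length 0, and [Hd] is the image under z d/dz. *)
Definition Gf x : E := tsum (fun n => z ^+ n * cw n x).
Definition Hf x : E := tsum (fun n => z ^+ n.+1 * cw n.+1 x).
Definition Hd x : E := tsum (fun n => n%:R * z ^+ n * cw n x).

Lemma GfE x : Gf x = (x == 0)%:R + Hf x.
Proof. by rewrite /Gf tsum_natS mul1r cw0. Qed.
Lemma Hf_sym x : Hf (- x) = Hf x.
Proof. by apply: eq_tsum => n; rewrite cw_sym. Qed.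
Lemma Gf_sym x : Gf (- x) = Gf x.
Proof. by apply: eq_tsum => n; rewrite cw_sym. Qed.

(** The factor n counts the cuts of an n-step walk before one of its steps; forgetting that the two
    parts avoid each other gives the convolution, and the second part is never empty. *)
Lemma Hd_le x : Hd x <<= tsum (fun v => Gf v * Hf (x - v)).
Proof.
apply: (ele_trans (tsum (fun n => \sum_(i < n)
   tsum (fun v => (z ^+ i * cw i v) * (z ^+ (n - i) * cw (n - i) (x - v)))))).
  apply: le_tsum => n; rewrite -mulrA mulr_natl -[n in _ *+ n]card_ord -sumr_const.
  apply: ele_sum => i _; apply: (ele_trans (z ^+ n * tsum (fun v => cw i v * cw (n - i) (x - v)))).
    by apply: eleMl; have := cw_add D i (n - i) x; rewrite subnKC// ltnW.
  rewrite -tsumZl; apply: ele_eq; apply: eq_tsum => v.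
  by rewrite -{1}(subnKC (ltnW (ltn_ord i))) exprD mulrACA.
rewrite (tsum_tri1 (fun i j => tsum (fun v => (z ^+ i * cw i v) * (z ^+ j * cw j (x - v))))).
apply: ele_eq; under eq_tsum => i do rewrite tsum_swap.
rewrite tsum_swap; apply: eq_tsum => v; rewrite /Gf -tsumZr.
by apply: eq_tsum => i; rewrite tsumZl.
Qed.

(** The weight [om] of the total length is kept general so as to cover both z^m and m z^m. *)
Lemma yl_gen (om : nat -> E) N w xi :
  tsum (fun m => om m * yl N.+1 m w xi) =
  tsum (fun r => tsum (fun s => tsum (fun i => tsum (fun j =>
    om (s + (i + j.+1))%N * (cw i (w + r) * cw j.+1 r * yl N s r (xi - r)))))).
Proof.
transitivity (tsum (fun m => \sum_(s < m) \sum_(i < m - s)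
   om (s + (i + (m - s - i)))%N * tsum (fun r => cw i (w + r) * cw (m - s - i) r * yl N s r (xi - r)))).
  apply: eq_tsum => m /=; rewrite mulr_sumr; apply: eq_bigr => s _; rewrite mulr_sumr.
  by apply: eq_bigr => i _; rewrite !subnKC// ltnW.
rewrite (tsum_tri2 (fun s i j => om (s + (i + j))%N *
  tsum (fun r => cw i (w + r) * cw j r * yl N s r (xi - r)))).
under eq_tsum => s.
  under eq_tsum => i.
    under eq_tsum => j do rewrite -tsumZl.
    rewrite tsum_swap; over.
  rewrite tsum_swap; over.
by rewrite tsum_swap.
Qed.

Definition Yf N w xi : E := tsum (fun m => z ^+ m * yl N m w xi).
Definition Yb N w : E := tsum (fun xi => Yf N w xi).
Definition Yd N w : E := tsum (fun xi => tsum (fun m => m%:R * z ^+ m * yl N m w xi)).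

Lemma Yf0 w xi : Yf 0 w xi = (xi == 0)%:R * Hf w.
Proof.
rewrite /Yf tsum_natS /= mul0r mulr0 add0r -tsumZl; apply: eq_tsum => n.
by rewrite mulrCA.
Qed.

Lemma YfS N w xi : Yf N.+1 w xi = tsum (fun r => Gf (w + r) * Hf r * Yf N r (xi - r)).
Proof.
rewrite /Yf yl_gen; apply: eq_tsum => r.
rewrite -[RHS]tsumZl; apply: eq_tsum => s.
rewrite /Gf mulrAC -!tsumZr; apply: eq_tsum => i.
rewrite -tsumZl; apply: eq_tsum => j.
by rewrite !exprD; ring.
Qed.

Lemma Yb0 w : Yb 0 w = Hf w.
Proof. by rewrite /Yb; under eq_tsum => xi do rewrite Yf0; exact: (tsum_delta 0 (fun=> Hf w)). Qed.

Lemma YbS N w : Yb N.+1 w = tsum (fun r => Gf (w + r) * (Hf r * Yb N r)).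
Proof.
rewrite /Yb; under eq_tsum => xi do rewrite YfS.
rewrite tsum_swap; apply: eq_tsum => r; rewrite tsumZl mulrA; congr (_ * _).
by rewrite [RHS](tsum_subr r).
Qed.

Lemma Yd0 w : Yd 0 w <<= Hd w.
Proof.
rewrite /Yd tsum_swap; apply: le_tsum => m /=.
apply: (ele_trans (tsum (fun xi : V => (xi == 0)%:R * (m%:R * z ^+ m * cw m w)))).
  apply: le_tsum => xi; rewrite mulrCA; apply: eleMr.
  by case: (0 < m)%N; rewrite ?elexx ?ele0.
by rewrite (tsum_delta 0 (fun=> m%:R * z ^+ m * cw m w)).
Qed.

(** Leibniz rule: the total length is the sum of the lengths of the two walks of the first loop and
    of the remaining ladder. *)
Lemma YdS N w : Yd N.+1 w = tsum (fun r => Hd (w + r) * (Hf r * Yb N r)) +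
   tsum (fun r => Gf (w + r) * (Hd r * Yb N r)) +
   tsum (fun r => Gf (w + r) * (Hf r * Yd N r)).
Proof.
have HdE r : Hd r = tsum (fun j => j.+1%:R * z ^+ j.+1 * cw j.+1 r).
  by rewrite /Hd tsum_natS !mul0r add0r.
have prod4 (a c : nat -> E) (e : V -> nat -> E) :
    tsum a * (tsum c * tsum (fun xi => tsum (e xi))) =
    tsum (fun xi => tsum (fun s => tsum (fun i => tsum (fun j => a i * (c j * e xi s))))).
  rewrite mulrA -tsumZl; apply: eq_tsum => xi; rewrite -tsumZl; apply: eq_tsum => s.
  rewrite -mulrA -tsumZr; apply: eq_tsum => i; rewrite -tsumZr -tsumZl.
  by apply: eq_tsum => j.
rewrite -!tsumD /Yd; under eq_tsum => xi do rewrite yl_gen.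
rewrite tsum_swap; apply: eq_tsum => r.
have Ysub (f : V -> E) : tsum f = tsum (fun xi => f (xi - r)) by exact: tsum_subr.
rewrite /Yb (Ysub (Yf N r)) (Ysub (fun xi => tsum _)) (HdE r) /Hd /Gf /Hf /Yf.
rewrite !prod4 -!tsumD; apply: eq_tsum => xi; rewrite -!tsumD; apply: eq_tsum => s.
rewrite -!tsumD; apply: eq_tsum => i; rewrite -!tsumD; apply: eq_tsum => j.
by rewrite !natrD !exprD; ring.
Qed.

Section Bounds.
Variable b : R.
Hypotheses (b0 : 0 <= b) (b16 : 16 * b <= 1).
Hypothesis HB : tsum (fun x => Hf x * Hf x) <<= ofR (b ^+ 2).

Lemma sqr_ele (x : E) : x * x <<= ofR (b ^+ 2) -> x <<= ofR b.
Proof.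
move=> h; have fx : efin x.
  rewrite /efin ltNge leye_eq; apply/negP => /eqP e.
  by have := efin_ofR_le h; rewrite /efin val_ennM e mulyy.
move: h; rewrite -(toRK fx) -ofRM ?toR_ge0// => /(ofR_le (exprn_ge0 2 b0)) h.
by apply: ele_ofR; have := toR_ge0 x; move: b0 b16; nra.
Qed.

Lemma Hf_sup x : Hf x <<= ofR b.
Proof. by apply: sqr_ele; apply: ele_trans HB; exact: (tsum_ge1 (fun x => Hf x * Hf x)). Qed.

(** By 2ab <= a^2 + b^2 and translation, which here replaces the Cauchy-Schwarz inequality. *)
Lemma HH_sup w : tsum (fun r => Hf (w + r) * Hf r) <<= ofR (b ^+ 2).
Proof.
apply: (@ele_natI _ 1); rewrite !mulr2n !mulrDl !mul1r -tsumD.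
apply: (ele_trans (tsum (fun r => Hf (w + r) * Hf (w + r) + Hf r * Hf r))).
  by apply: le_tsum => r; exact: ele_amgm.
rewrite tsumD; apply: eleD; last exact: HB.
apply: ele_trans HB; rewrite [X in _ <<= X](tsum_addr w).
by apply: ele_eq; apply: eq_tsum => r; rewrite addrC.
Qed.

(** Bounds sup_w sum_r G(w + r) H(r), the cost of one more loop; the two terms come from G = delta +
    H. *)
Definition sg : R := b + b ^+ 2.

Lemma GH_sup w : tsum (fun r => Gf (w + r) * Hf r) <<= ofR sg.
Proof.
under eq_tsum => r do rewrite GfE mulrDl.
rewrite tsumD /sg ofRD ?exprn_ge0//; apply: eleD; last exact: HH_sup.
have -> : tsum (fun r => (w + r == 0)%:R * Hf r) = Hf (- w).
  rewrite -[RHS](tsum_delta (- w)); apply: eq_tsum => r.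
  by rewrite addrC addr_eq0.
exact: Hf_sup.
Qed.

Lemma GG_sup w : tsum (fun r => Gf (w + r) * Gf r) <<= ofR 4.
Proof.
apply: (ele_trans (tsum (fun r => Gf (w + r) * Hf r + (r == 0)%:R * Gf (w + r)))).
  by apply: ele_eq; apply: eq_tsum => r; rewrite [Gf r]GfE mulrDr addrC [_ * _%:R]mulrC.
rewrite tsumD (tsum_delta 0 (fun r => Gf (w + r))) addr0 GfE.
apply: (ele_trans (ofR sg + (ofR 1 + ofR b))).
  apply: eleD; first exact: GH_sup; apply: eleD; last exact: Hf_sup.
  by rewrite ofR1; case: (w == 0); rewrite ?ele0.
rewrite -!ofRD// /sg ?addr_ge0 ?exprn_ge0//; apply: ele_ofR; move: b0 b16; nra.
Qed.

Lemma Gf_sup w : Gf w <<= ofR 2.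
Proof.
rewrite GfE; apply: (ele_trans (ofR 1 + ofR b)); last by rewrite -ofRD//; apply: ele_ofR; move: b0 b16; nra.
by apply: eleD; last exact: Hf_sup; rewrite ofR1; case: (w == 0); rewrite ?ele0.
Qed.

Lemma Hd_sup x : Hd x <<= ofR sg.
Proof.
apply: ele_trans (Hd_le x) _; apply: ele_trans _ (GH_sup x).
rewrite (tsum_addr x); apply: le_tsum => r.
by rewrite opprD addrCA subrr addr0 Hf_sym addrC.
Qed.

Lemma sg_le : 0 <= sg <= 2 * b.
Proof. by rewrite /sg; apply/andP; split; move: b0 b16; nra. Qed.

(** Partial sums over the number of loops obey the recursion [SYS] in K, so that bounds uniform in K
    follow by induction and pass to the full series. *)
Definition SY K w : E := \sum_(N < K) Yb N w.

Lemma SYS K w : SY K.+1 w = Hf w + tsum (fun r => Gf (w + r) * (Hf r * SY K r)).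
Proof.
rewrite /SY big_ord_recl Yb0; congr (_ + _).
under [RHS]eq_tsum => r do rewrite !mulr_sumr.
by rewrite tsum_big; apply: eq_bigr => N _; rewrite YbS.
Qed.

Lemma tsum_sup (f g : V -> E) c : (forall x, f x <<= c) -> tsum (fun x => f x * g x) <<= c * tsum g.
Proof. by move=> h; rewrite -tsumZl; apply: le_tsum => x; exact: eleMr. Qed.

Lemma HSY_bound K : tsum (fun r => Hf r * SY K r) <<= ofR (2 * b ^+ 2).
Proof.
have b2 : 0 <= b ^+ 2 by rewrite exprn_ge0.
have /andP[s0 s2] := sg_le.
elim: K => [|K IH].
  by rewrite tsum_eq0 ?ele0// => r; rewrite /SY big_ord0 mulr0.
under eq_tsum => w do rewrite SYS mulrDr -tsumZl.
rewrite tsumD tsum_swap.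
apply: (ele_trans (ofR (b ^+ 2) + tsum (fun r => ofR sg * (Hf r * SY K r)))).
  apply: eleD; first exact: HB.
  apply: le_tsum => r; under eq_tsum => w do rewrite mulrA [Hf w * _]mulrC.
  rewrite tsumZr; apply: eleMr; under eq_tsum => w do rewrite addrC.
  exact: GH_sup.
rewrite tsumZl; apply: (ele_trans (ofR (b ^+ 2) + ofR sg * ofR (2 * b ^+ 2))).
  by apply: eleD; [exact: elexx|exact: eleMl].
rewrite -ofRM ?mulr_ge0// -ofRD ?mulr_ge0//; apply: ele_ofR; move: b0 b16; nra.
Qed.

Lemma SY_bound K w : SY K w <<= ofR (2 * b).
Proof.
case: K => [|K]; first by rewrite /SY big_ord0 ele0.
rewrite SYS; apply: (ele_trans (ofR b + ofR 2 * ofR (2 * b ^+ 2))).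
  apply: eleD; first exact: Hf_sup.
  apply: ele_trans (tsum_sup _ (fun r => Gf_sup (w + r))) _.
  by apply: eleMl; exact: HSY_bound.
rewrite -ofRM ?mulr_ge0 ?exprn_ge0// -ofRD ?mulr_ge0 ?exprn_ge0//; apply: ele_ofR; move: b0 b16; nra.
Qed.

Lemma GSY_bound K w : tsum (fun r => Gf (w + r) * SY K r) <<= ofR (4 * b).
Proof.
have /andP[s0 s2] := sg_le.
case: K => [|K]; first by rewrite tsum_eq0 ?ele0// => r; rewrite /SY big_ord0 mulr0.
under eq_tsum => r do rewrite SYS mulrDr -tsumZl.
rewrite tsumD tsum_swap; apply: (ele_trans (ofR sg + ofR 4 * ofR (2 * b ^+ 2))).
  apply: eleD; first exact: GH_sup.
  apply: (ele_trans (tsum (fun t => ofR 4 * (Hf t * SY K t)))).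
    apply: le_tsum => t; under eq_tsum => r do rewrite mulrA.
    rewrite tsumZr; apply: eleMr; apply: ele_trans _ (GG_sup (w - t)).
    rewrite (tsum_subr t); apply: ele_eq; apply: eq_tsum => r.
    by rewrite subrK addrCA addrC addrAC.
  by rewrite tsumZl; apply: eleMl; exact: HSY_bound.
rewrite -ofRM ?mulr_ge0 ?exprn_ge0// -ofRD ?mulr_ge0 ?exprn_ge0//; apply: ele_ofR; rewrite /sg; move: b0 b16; nra.
Qed.

Definition SYd K w : E := \sum_(N < K) Yd N w.

Lemma SYdS K w : SYd K.+1 w <<= Hd w + (tsum (fun r => Hd (w + r) * (Hf r * SY K r)) +
   tsum (fun r => Gf (w + r) * (Hd r * SY K r)) +
   tsum (fun r => Gf (w + r) * (Hf r * SYd K r))).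
Proof.
rewrite /SYd big_ord_recl; apply: eleD; first exact: Yd0.
under eq_bigr => N _ do rewrite YdS.
rewrite !big_split /= -!tsum_big; apply: eleD; [apply: eleD|];
  by apply: le_tsum => r; rewrite -!mulr_sumr.
Qed.

Lemma SYd_bound K w : SYd K w <<= ofR (8 * b).
Proof.
have /andP[s0 s2] := sg_le; have b2 : 0 <= b ^+ 2 by rewrite exprn_ge0.
elim: K w => [|K IH] w; first by rewrite /SYd big_ord0 ele0.
apply: ele_trans (SYdS K w) _.
apply: (ele_trans (ofR sg + (ofR sg * ofR (2 * b ^+ 2) + ofR sg * ofR (4 * b) + ofR (8 * b) * ofR sg))).
  apply: eleD; first exact: Hd_sup; apply: eleD; first apply: eleD.
  - apply: ele_trans (tsum_sup _ (fun r => Hd_sup (w + r))) _; apply: eleMl; exact: HSY_bound.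
  - apply: (ele_trans (tsum (fun r => ofR sg * (Gf (w + r) * SY K r)))).
      by apply: le_tsum => r; rewrite mulrCA; apply: eleMr; exact: Hd_sup.
    by rewrite tsumZl; apply: eleMl; exact: GSY_bound.
  - apply: (ele_trans (tsum (fun r => ofR (8 * b) * (Gf (w + r) * Hf r)))).
      by apply: le_tsum => r; rewrite mulrA mulrC; apply: eleMr; exact: IH.
    by rewrite tsumZl; apply: eleMl; exact: GH_sup.
rewrite -!ofRM ?mulr_ge0 ?exprn_ge0// -!ofRD ?addr_ge0 ?mulr_ge0 ?exprn_ge0//.
by apply: ele_ofR; rewrite /sg; move: b0 b16; nra.
Qed.

Section Weights.
Variables (wt : V -> E) (kap W : E).
Hypotheses (wt0 : wt 0 = 0) (wtD : forall x y, wt (x + y) <<= 2%:R * (wt x + wt y)).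
Hypothesis wtH : forall x, wt x * Hf x <<= kap * W.

(** The weight is distributed over the displacements r along a rail, with a factor 2 for each
    splitting, and at one of them wt H is replaced by kap W. The result contains neither [wt] nor
    [kap]: with wt = 1 - cos k.x and kap = 1 - D(k), one majorant serves all frequencies. *)
Fixpoint eW N w xi : E :=
  if N is N'.+1 then
    2%:R * tsum (fun r => Gf (w + r) * (W * Yf N' r (xi - r) + Hf r * eW N' r (xi - r)))
  else 0.

Lemma eW_bound N w xi : wt xi * Yf N w xi <<= kap * eW N w xi.
Proof.
elim: N w xi => [|N IH] w xi.
  by rewrite Yf0; have [->|_] := eqVneq xi 0; rewrite ?wt0 !(mul0r, mulr0).
rewrite YfS /= -tsumZl mulrCA -!tsumZl; apply: le_tsum => r.
apply: (ele_trans (2%:R * (wt r + wt (xi - r)) * (Gf (w + r) * Hf r * Yf N r (xi - r)))).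
  by apply: eleMr; have := wtD r (xi - r); rewrite [r + _]addrC subrK.
rewrite -mulrA; apply: eleMl.
rewrite (_ : _ * _ = Gf (w + r) * ((wt r * Hf r) * Yf N r (xi - r) +
   Hf r * (wt (xi - r) * Yf N r (xi - r)))); last by ring.
rewrite (_ : kap * _ = Gf (w + r) * ((kap * W) * Yf N r (xi - r) +
   Hf r * (kap * eW N r (xi - r)))); last by ring.
apply: eleMl; apply: eleD; [exact: eleMr|exact: eleMl].
Qed.

Definition eb N w : E := tsum (eW N w).
Lemma eb0 w : eb 0 w = 0. Proof. exact: tsum0. Qed.
Lemma ebS N w : eb N.+1 w = 2%:R * tsum (fun r => Gf (w + r) * (W * Yb N r + Hf r * eb N r)).
Proof.
rewrite /eb /= tsumZl tsum_swap; congr (_ * _); apply: eq_tsum => r.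
by rewrite tsumZl tsumD !tsumZl /Yb [in RHS](tsum_subr r) [X in _ + _ * X](tsum_subr r).
Qed.

Definition SE K w : E := \sum_(N < K) eb N w.

Lemma SE_bound K w : SE K w <<= ofR (16 * b) * W.
Proof.
have /andP[s0 s2] := sg_le.
elim: K w => [|K IH] w; first by rewrite /SE big_ord0 ele0.
rewrite /SE big_ord_recl eb0 add0r.
under eq_bigr => N _ do rewrite ebS.
rewrite -mulr_sumr -tsum_big.
apply: (ele_trans (2%:R * (ofR (4 * b) * W + ofR sg * (ofR (16 * b) * W)))).
  apply: eleMl; apply: (ele_trans (tsum (fun r => Gf (w + r) * SY K r * W +
     Gf (w + r) * Hf r * (ofR (16 * b) * W)))).
    apply: le_tsum => r; rewrite -mulr_sumr big_split /= -!mulr_sumr mulrDr.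
    apply: eleD; first by apply: ele_eq; rewrite /SY; ring.
    by rewrite -mulrA; apply: eleMl; apply: eleMl; exact: IH.
  rewrite tsumD !tsumZr; apply: eleD; apply: eleMr; [exact: GSY_bound|exact: GH_sup].
rewrite (_ : _ * _ = (ofR 2 * (ofR (4 * b) + ofR sg * ofR (16 * b))) * W); last first.
  by rewrite (ofR_nat _ 2); ring.
apply: eleMr; rewrite -!ofRM ?mulr_ge0// -!ofRD ?addr_ge0 ?mulr_ge0//.
rewrite -ofRM ?addr_ge0 ?mulr_ge0//; apply: ele_ofR; rewrite /sg; move: b0 b16; nra.
Qed.
End Weights.

Hypothesis D1 : tsum D = 1.
Local Notation Pw := (Pw D).

Definition Pt m x : E := tsum (fun N => Pw N.+1 m x).

Lemma Pt_small m x : (m <= 1)%N -> Pt m x = 0.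
Proof. by move=> m1; apply: tsum_eq0 => N; rewrite Pw_eq0//; case: m m1 => [|[]]. Qed.

Lemma Pt_le m x : Pt m x <<= tsum (fun N => tsum (fun y => D y * yl N m.-1 y x)).
Proof. by apply: le_tsum => N; exact: Pw_ladder. Qed.

Lemma Pt_gen (om : nat -> E) :
  tsum (fun x => tsum (fun m => om m * Pt m x)) <<=
  tsum (fun N => tsum (fun y => D y * tsum (fun xi => tsum (fun m => om m.+1 * yl N m y xi)))).
Proof.
apply: (ele_trans (tsum (fun x => tsum (fun m => tsum (fun N => tsum (fun y =>
   D y * (om m.+1 * yl N m y x))))))).
  apply: le_tsum => x; rewrite tsum_natS (Pt_small x (leq0n 1)) mulr0 add0r.
  apply: le_tsum => m; apply: ele_trans (eleMl _ (Pt_le _ _)) _.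
  rewrite -tsumZl; apply: le_tsum => N; rewrite -tsumZl; apply: le_tsum => y.
  by rewrite mulrCA.
under eq_tsum => x do rewrite tsum_swap.
rewrite [X in X <<= _]tsum_swap; apply: le_tsum => N.
under eq_tsum => x do rewrite tsum_swap.
rewrite [X in X <<= _]tsum_swap; apply: le_tsum => y.
by rewrite -tsumZl; apply: le_tsum => x; rewrite -tsumZl.
Qed.

Lemma tsumN_le (f : nat -> V -> E) c : (forall K y, \sum_(N < K) f N y <<= c) ->
  tsum (fun N => tsum (fun y => D y * f N y)) <<= c.
Proof.
move=> h; rewrite tsum_swap; apply: (ele_trans (tsum (fun y => D y * c))).
  by apply: le_tsum => y; rewrite tsumZl; apply: eleMl; apply: tsum_nat_ub => K; exact: h.
by rewrite tsumZr D1 mul1r.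
Qed.

Lemma Pt_sum0 : tsum (fun x => tsum (fun m => z ^+ m * Pt m x)) <<= z * ofR (2 * b).
Proof.
apply: ele_trans (Pt_gen _) _.
apply: (ele_trans (z * tsum (fun N => tsum (fun y => D y * Yb N y)))).
  rewrite -tsumZl; apply: le_tsum => N; rewrite -tsumZl; apply: le_tsum => y.
  rewrite mulrCA; apply: eleMl; rewrite -tsumZl; apply: le_tsum => xi.
  by rewrite -tsumZl; apply: le_tsum => m; rewrite exprS mulrA.
by apply: eleMl; apply: tsumN_le => K y; exact: SY_bound.
Qed.

Lemma Pt_sum1 : tsum (fun x => tsum (fun m => m%:R * z ^+ m * Pt m x)) <<= z * ofR (10 * b).
Proof.
apply: ele_trans (Pt_gen _) _.
apply: (ele_trans (z * tsum (fun N => tsum (fun y => D y * (Yd N y + Yb N y))))).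
  rewrite -tsumZl; apply: le_tsum => N; rewrite -tsumZl; apply: le_tsum => y.
  rewrite mulrCA; apply: eleMl; rewrite /Yd /Yb -tsumD -tsumZl; apply: le_tsum => xi.
  rewrite /Yf -tsumD -tsumZl; apply: le_tsum => m; rewrite exprS -[in X in X <<= _]addn1 natrD.
  by apply: ele_eq; ring.
apply: eleMl; apply: tsumN_le => K y; rewrite big_split.
apply: (ele_trans (ofR (8 * b) + ofR (2 * b))).
  by apply: eleD; [exact: SYd_bound|exact: SY_bound].
by rewrite -ofRD ?mulr_ge0//; apply: ele_ofR; move: b0; lra.
Qed.

Definition gW W x : E := z * tsum (fun N => tsum (fun y => D y * eW W N y x)).

Lemma gW_sum W : tsum (gW W) <<= z * (ofR (16 * b) * W).
Proof.
rewrite tsumZl tsum_swap; apply: eleMl.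
apply: (ele_trans (tsum (fun N => tsum (fun y => D y * eb W N y)))).
  by apply: le_tsum => N; rewrite tsum_swap; apply: le_tsum => y; rewrite tsumZl.
by apply: tsumN_le => K y; exact: SE_bound.
Qed.

Lemma gW_bound (wt : V -> E) (kap W : E) x : wt 0 = 0 ->
  (forall x y, wt (x + y) <<= 2%:R * (wt x + wt y)) ->
  (forall x, wt x * Hf x <<= kap * W) ->
  wt x * tsum (fun m => z ^+ m * Pt m x) <<= kap * gW W x.
Proof.
move=> wt0 wtD wtH.
apply: (ele_trans (wt x * (z * tsum (fun N => tsum (fun y => D y * Yf N y x))))).
  apply: eleMl; rewrite tsum_natS (Pt_small x (leq0n 1)) mulr0 add0r.
  apply: (ele_trans (tsum (fun m => tsum (fun N => tsum (fun y => z * (D y * (z ^+ m * yl N m y x))))))).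
    apply: le_tsum => m; apply: ele_trans (eleMl _ (Pt_le _ _)) _.
    rewrite -tsumZl; apply: le_tsum => N; rewrite -tsumZl; apply: le_tsum => y.
    by apply: ele_eq; rewrite exprS /=; ring.
  rewrite tsum_swap -tsumZl; apply: le_tsum => N; rewrite tsum_swap -tsumZl; apply: le_tsum => y.
  by rewrite tsumZl tsumZl.
rewrite /gW mulrCA [kap * _]mulrCA; apply: eleMl; rewrite -!tsumZl; apply: le_tsum => N.
rewrite -!tsumZl; apply: le_tsum => y; rewrite mulrCA [kap * _]mulrCA; apply: eleMl.
exact: eW_bound.
Qed.
End Bounds.
End Ladder.

(** * Absolutely convergent sums *)

Section Rsum.
Variable R : realType.
Local Notation E := (enn R).
Implicit Types T : choiceType.

Definition rsum T (f : T -> R) : R := usum [set: T] f.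
Definition asum T (f : T -> R) : E := tsum (fun x => ofR `|f x|).
Definition summ T (f : T -> R) : bool := efin (asum f).

(** True by conversion, so that identities for [tsum] carry over to both parts of a signed sum. *)
Lemma rsumE T (f : T -> R) :
  rsum f = toR (tsum (fun x => ofR (f x))) - toR (tsum (fun x => ofR (- f x))).
Proof. by []. Qed.

Lemma ofR_le0 (r : R) : r <= 0 -> ofR r = 0.
Proof. by move=> r0; apply: val_inj => /=; rewrite max_r. Qed.

Lemma toR_pm (r : R) : toR (ofR r) - toR (ofR (- r)) = r.
Proof.
have [r0|r0] := leP 0 r; first by rewrite ofRK// ofR_le0 ?oppr_le0// -ofR0 ofRK// subr0.
by rewrite ofR_le0 ?(ltW r0)// ofRK ?oppr_ge0 ?(ltW r0)// -ofR0 ofRK// sub0r opprK.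
Qed.

Lemma ofR_absl (r : R) : ofR r <<= ofR `|r|.
Proof. by apply: ele_ofR; exact: ler_norm. Qed.
Lemma ofR_absr (r : R) : ofR (- r) <<= ofR `|r|.
Proof. by apply: ele_ofR; rewrite -normrN ler_norm. Qed.

Lemma summ_pos T (f : T -> R) : summ f -> efin (tsum (fun x => ofR (f x))).
Proof. by apply: efin_le; apply: le_tsum => x; exact: ofR_absl. Qed.
Lemma summ_neg T (f : T -> R) : summ f -> efin (tsum (fun x => ofR (- f x))).
Proof. by apply: efin_le; apply: le_tsum => x; exact: ofR_absr. Qed.

Lemma eq_rsum T (f g : T -> R) : f =1 g -> rsum f = rsum g.
Proof. by move=> h; congr rsum; apply/funext. Qed.
Lemma eq_summ T (f g : T -> R) : f =1 g -> summ f = summ g.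
Proof. by move=> h; congr summ; apply/funext. Qed.

(** Any difference of two summable non-negative families may replace the positive and negative
    parts, because f^+ + q = f^- + p termwise. Additivity and Fubini are instances. *)
Lemma rsum_pm T (f : T -> R) (p q : T -> E) :
  (forall x, f x = toR (p x) - toR (q x)) -> efin (tsum p) -> efin (tsum q) ->
  summ f /\ rsum f = toR (tsum p) - toR (tsum q).
Proof.
move=> h fp fq.
have hp x : efin (p x) by exact: efin_tsum fp.
have hq x : efin (q x) by exact: efin_tsum fq.
have sf : summ f.
  apply: efin_le (efinD fp fq); rewrite -tsumD; apply: le_tsum => x.
  rewrite -(toRK (hp x)) -(toRK (hq x)) -ofRD ?toR_ge0//; apply: ele_ofR.
  by rewrite h (le_trans (ler_normB _ _))// !ger0_norm ?toR_ge0.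
split => //; rewrite rsumE.
have e : tsum (fun x => ofR (f x)) + tsum q = tsum (fun x => ofR (- f x)) + tsum p.
  rewrite -!tsumD; apply: eq_tsum => x.
  rewrite -(toRK (hp x)) -(toRK (hq x)) h; have := toR_ge0 (p x); have := toR_ge0 (q x).
  move: (toR _) (toR _) => b a a0 b0; have [ab|ba] := leP a b.
    by rewrite opprB [ofR (a - b)]ofR_le0 ?subr_le0// add0r -ofRD ?subr_ge0// subrK.
  by rewrite opprB [ofR (b - a)]ofR_le0 ?subr_le0 ?(ltW ba)// add0r -ofRD ?subr_ge0 ?(ltW ba)// subrK.
move: (congr1 (@toR R) e); rewrite !toRD ?(summ_pos sf) ?(summ_neg sf)// => {}e.
by lra.
Qed.

Lemma rsum_ge0E T (f : T -> R) : (forall x, 0 <= f x) -> rsum f = toR (tsum (fun x => ofR (f x))).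
Proof.
move=> f0; rewrite rsumE [X in _ - toR X]tsum_eq0; first by rewrite -ofR0 ofRK// subr0.
by move=> x; rewrite ofR_le0// oppr_le0.
Qed.

Lemma rsum_toR T (p : T -> E) : efin (tsum p) -> rsum (fun x => toR (p x)) = toR (tsum p).
Proof.
move=> h; rewrite rsum_ge0E; last by move=> x; exact: toR_ge0.
by congr toR; apply: eq_tsum => x; rewrite toRK// (efin_tsum x h).
Qed.

Lemma summ_toR T (p : T -> E) : efin (tsum p) -> summ (fun x => toR (p x)).
Proof.
apply: efin_le; apply: le_tsum => x; rewrite ger0_norm ?toR_ge0//.
have [h|h] := boolP (efin (p x)); first by rewrite toRK.
by move: h; rewrite /efin /enn_le -leNgt leye_eq => /eqP ->; rewrite leey.
Qed.

Lemma summ_ge0E T (f : T -> R) : (forall x, 0 <= f x) -> summ f = efin (tsum (fun x => ofR (f x))).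
Proof. by move=> f0; congr efin; apply: eq_tsum => x; rewrite ger0_norm. Qed.

Lemma summ_le T (f g : T -> R) : (forall x, `|f x| <= g x) -> summ g -> summ f.
Proof.
move=> h; apply: efin_le; apply: le_tsum => x; apply: ele_ofR.
by rewrite (le_trans (h x))// ler_norm.
Qed.
Lemma summ_abs T (f : T -> R) : summ (fun x => `|f x|) = summ f.
Proof. by congr efin; apply: eq_tsum => x; rewrite normr_id. Qed.
Lemma summD T (f g : T -> R) : summ f -> summ g -> summ (fun x => f x + g x).
Proof.
move=> sf sg; apply: efin_le (efinD sf sg); rewrite -tsumD; apply: le_tsum => x.
by rewrite -ofRD//; apply: ele_ofR; exact: ler_normD.
Qed.
Lemma summN T (f : T -> R) : summ (fun x => - f x) = summ f.
Proof. by congr efin; apply: eq_tsum => x; rewrite normrN. Qed.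
Lemma summB T (f g : T -> R) : summ f -> summ g -> summ (fun x => f x - g x).
Proof. by move=> sf sg; apply: (summD (g := fun x => - g x)); rewrite ?summN. Qed.
Lemma asumZ T (c : R) (f : T -> R) : asum (fun x => c * f x) = ofR `|c| * asum f.
Proof. by rewrite -tsumZl; apply: eq_tsum => x; rewrite normrM ofRM. Qed.
Lemma summZ T (c : R) (f : T -> R) : summ f -> summ (fun x => c * f x).
Proof. by rewrite /summ asumZ => h; rewrite efinM. Qed.
Lemma summ0 T : summ (fun _ : T => 0 : R).
Proof. by rewrite /summ /asum tsum_eq0// => x; rewrite normr0 ofR0. Qed.
Lemma summ_big T (I : Type) (r : seq I) (P : pred I) (f : I -> T -> R) :
  (forall i, P i -> summ (f i)) -> summ (fun x => \sum_(i <- r | P i) f i x).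
Proof.
move=> h; elim: r => [|i r IH].
  by rewrite (eq_summ (g := fun=> 0)) ?summ0// => x; rewrite big_nil.
rewrite (eq_summ (g := fun x => (if P i then f i x else 0) + \sum_(i <- r | P i) f i x)).
  apply: summD => //; have [Pi|_] := boolP (P i); [exact: h|exact: summ0].
by move=> x; rewrite big_cons; case: ifP => _ //; rewrite add0r.
Qed.

Lemma rsumD T (f g : T -> R) : summ f -> summ g -> rsum (fun x => f x + g x) = rsum f + rsum g.
Proof.
move=> sf sg.
have fp : efin (tsum (fun x => ofR (f x) + ofR (g x))) by rewrite tsumD efinD ?summ_pos.
have fq : efin (tsum (fun x => ofR (- f x) + ofR (- g x))) by rewrite tsumD efinD ?summ_neg.
have [|_ ->] := @rsum_pm T (fun x => f x + g x) _ _ _ fp fq.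
  by move=> x; rewrite !toRD// -{1}(toR_pm (f x)) -{1}(toR_pm (g x)); ring.
rewrite !rsumE !tsumD !toRD ?(summ_pos sf) ?(summ_neg sf) ?(summ_pos sg) ?(summ_neg sg)//.
ring.
Qed.

Lemma rsumN T (f : T -> R) : rsum (fun x => - f x) = - rsum f.
Proof.
rewrite !rsumE opprB; congr (_ - toR _); apply: eq_tsum => x; by rewrite opprK.
Qed.

Lemma rsumB T (f g : T -> R) : summ f -> summ g -> rsum (fun x => f x - g x) = rsum f - rsum g.
Proof. by move=> sf sg; rewrite -rsumN -rsumD// summN. Qed.

Lemma rsum0 T : rsum (fun _ : T => 0 : R) = 0.
Proof. by rewrite rsumE !tsum_eq0 ?subrr// => x; rewrite ?oppr0 ofR0. Qed.

(** No summability is assumed: a positive factor keeps an infinite part infinite, and such a part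
    counts as 0 on both sides. *)
Lemma rsumZ T (c : R) (f : T -> R) : rsum (fun x => c * f x) = c * rsum f.
Proof.
wlog c0 : c / 0 <= c.
  move=> H; have [|c0] := leP 0 c; first exact: H.
  rewrite -[c]opprK mulNr -H ?oppr_ge0 ?(ltW c0)// -rsumN.
  by apply: eq_rsum => x; rewrite mulNr.
have [->|cn] := eqVneq c 0; first by rewrite mul0r (eq_rsum (g := fun=> 0)) ?rsum0// => x; rewrite mul0r.
have ofRMl (r : R) : ofR (c * r) = ofR c * ofR r.
  have [r0|r0] := leP 0 r; first by rewrite ofRM.
  by rewrite (ofR_le0 (ltW r0)) mulr0 ofR_le0// mulr_ge0_le0// ltW.
rewrite !rsumE; under eq_tsum => x do rewrite ofRMl.
under [X in _ - toR X]eq_tsum => x do rewrite -mulrN ofRMl.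
rewrite !tsumZl.
have toRMl (y : E) : toR (ofR c * y) = c * toR y.
  have [h|h] := boolP (efin y); first by rewrite toRM// ofRK.
  have yy : val y = +oo%E by apply/eqP; rewrite -leye_eq leNgt.
  rewrite /toR val_ennM yy /= gt0_muley ?mulr0//; rewrite lte_fin lt_max.
  by rewrite lt_def cn c0.
by rewrite !toRMl; ring.
Qed.

Lemma le_rsum T (f g : T -> R) : summ f -> summ g -> (forall x, f x <= g x) -> rsum f <= rsum g.
Proof.
move=> sf sg h; rewrite -subr_ge0 -rsumB// rsum_ge0E ?toR_ge0// => x.
by rewrite subr_ge0.
Qed.

Lemma rsum_ge0 T (f : T -> R) : (forall x, 0 <= f x) -> 0 <= rsum f.
Proof. by move=> f0; rewrite rsum_ge0E// toR_ge0. Qed.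

Lemma rsum_abs T (f : T -> R) : rsum (fun x => `|f x|) = toR (asum f).
Proof. by rewrite rsum_ge0E. Qed.

Lemma ler_norm_rsum T (f : T -> R) : summ f -> `|rsum f| <= rsum (fun x => `|f x|).
Proof.
move=> sf; rewrite ler_norml -rsumN !le_rsum ?summN ?summ_abs// => x; rewrite ?ler_norm//.
by rewrite lerNl -normrN ler_norm.
Qed.

Lemma ler_rsum_sup T (f g : T -> R) : (forall x, `|f x| <= g x) -> summ g -> `|rsum f| <= rsum g.
Proof.
move=> h sg; have sf := summ_le h sg; apply: le_trans (ler_norm_rsum sf) _.
by apply: le_rsum; rewrite ?summ_abs.
Qed.

Lemma rsum_big T (I : Type) (r : seq I) (P : pred I) (f : I -> T -> R) :
  (forall i, P i -> summ (f i)) ->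
  rsum (fun x => \sum_(i <- r | P i) f i x) = \sum_(i <- r | P i) rsum (f i).
Proof.
move=> h; elim: r => [|i r IH].
  by rewrite big_nil (eq_rsum (g := fun=> 0)) ?rsum0// => x; rewrite big_nil.
rewrite big_cons -IH; case: ifP => Pi; last by apply: eq_rsum => x; rewrite big_cons Pi.
rewrite -rsumD ?h ?summ_big//.
by apply: eq_rsum => x; rewrite big_cons Pi.
Qed.

Lemma rsum_bij T1 T2 (e : T1 -> T2) (f : T2 -> R) : bijective e -> rsum f = rsum (fun x => f (e x)).
Proof. by move=> be; rewrite !rsumE !(tsum_bij _ be). Qed.
Lemma summ_bij T1 T2 (e : T1 -> T2) (f : T2 -> R) : bijective e -> summ f = summ (fun x => f (e x)).
Proof. by move=> be; rewrite /summ /asum (tsum_bij _ be). Qed.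

Lemma rsum_delta T (a : T) (f : T -> R) : rsum (fun x => (x == a)%:R * f x) = f a.
Proof.
rewrite -[RHS]toR_pm rsumE -(tsum_delta a (fun x => ofR (f x))) -(tsum_delta a (fun x => ofR (- f x))).
by congr (toR _ - toR _); apply: eq_tsum => x; case: eqP; rewrite ?mul1r// !mul0r ?oppr0 ofR0.
Qed.

Lemma summ_delta T (a : T) (f : T -> R) : summ (fun x => (x == a)%:R * f x).
Proof.
apply: (@efin_le _ _ (ofR `|f a|)) => //; rewrite -(tsum_delta a (fun x => ofR `|f x|)).
by apply: le_tsum => x; case: eqP; rewrite ?mul1r// !mul0r ?normr0 ofR0.
Qed.

Section Fubini.
Variables (T1 T2 : choiceType) (f : T1 -> T2 -> R).
Hypothesis sf : efin (tsum (fun x => asum (f x))).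

Lemma summ_inner x : summ (f x). Proof. exact: efin_tsum sf. Qed.
Lemma summ_outer : summ (fun x => rsum (f x)).
Proof.
apply: efin_le sf; apply: le_tsum => x; rewrite -[X in _ <<= X](toRK (summ_inner x)).
by apply: ele_ofR; rewrite -rsum_abs ler_norm_rsum// summ_inner.
Qed.

Lemma rsum_iter : rsum (fun x => rsum (f x)) =
  toR (tsum (fun x => tsum (fun y => ofR (f x y)))) - toR (tsum (fun x => tsum (fun y => ofR (- f x y)))).
Proof.
have fp : efin (tsum (fun x => tsum (fun y => ofR (f x y)))).
  by apply: efin_le sf; apply: le_tsum => x; apply: le_tsum => y; exact: ofR_absl.
have fq : efin (tsum (fun x => tsum (fun y => ofR (- f x y)))).
  by apply: efin_le sf; apply: le_tsum => x; apply: le_tsum => y; exact: ofR_absr.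
by have [|_ ->//] := @rsum_pm T1 (fun x => rsum (f x)) _ _ _ fp fq.
Qed.
End Fubini.

Lemma rsum_swap T1 T2 (f : T1 -> T2 -> R) : efin (tsum (fun x => asum (f x))) ->
  rsum (fun x => rsum (f x)) = rsum (fun y => rsum (f^~ y)).
Proof.
move=> sf; rewrite (rsum_iter sf) rsum_iter; last by move: sf; rewrite /asum tsum_swap.
by rewrite tsum_swap [X in _ - toR X]tsum_swap.
Qed.

Lemma usum_cond T (D : set T) (f : T -> R) : usum D f = rsum (fun x => if x \in D then f x else 0).
Proof.
rewrite /rsum /usum !(esum_mkcond D); congr (fine _ - fine _); apply: eq_esum => x _.
  by case: ifP => // _; rewrite maxxx.
by case: ifP => // _; rewrite oppr0 maxxx.
Qed.

(** Dominated convergence along any proper filter, in order to cover both n -> oo and k -> 0: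
    outside a finite set the terms are bounded by twice a small tail of g, and on the finite set
    convergence is uniform. *)
Lemma rsum_cvg T (U : topologicalType) (F : set_system U) {FF : ProperFilter F} (f : U -> T -> R) (l g : T -> R) :
  summ g -> (\forall k \near F, forall x, `|f k x| <= g x) ->
  (forall x, f^~ x @ F --> l x) -> (fun k => rsum (f k)) @ F --> rsum l.
Proof.
move=> sg dom cv.
have g0 x : 0 <= g x.
  by have [k hk] := filter_ex dom; exact: le_trans (hk x).
have lg x : `|l x| <= g x.
  have cn : (fun k => `|f k x|) @ F --> `|l x| by apply: cvg_norm; exact: cv.
  by apply: (ler_cvg_to cn (cvg_cst (g x))); near=> k; move: x {cn}; near: k.
apply/cvgrPdist_le => e e0.
have e3 : 0 < e / 3 by rewrite divr_gt0.
have [s us hs] := tsum_tail e3 (summ_pos sg).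
have [ds dp] : (0 < (size s).+1%:R :> R) /\ 0 < e / 3 / (size s).+1%:R by rewrite divr_gt0 ?ltr0Sn.
have cs : \forall k \near F, forall x, x \in s -> `|l x - f k x| <= e / 3 / (size s).+1%:R.
  elim: {us hs ds dp} s (size s).+1%:R (dp) => [|a s IH] c c0; first by near=> k.
  have := IH c c0; move/cvgrPdist_le: (cv a) => /(_ _ c0) h1 h2; near=> k => x.
  rewrite inE => /orP[/eqP->|xs]; first by near: k.
  by move: x xs; near: k.
near=> k.
have fk x : `|f k x| <= g x by move: x; near: k.
have sl : summ l by exact: summ_le lg sg.
have sfk : summ (f k) by exact: summ_le fk sg.
rewrite -rsumB//; pose p x := (x \in s)%:R * (e / 3 / (size s).+1%:R) + (x \notin s)%:R * (2 * g x).
have ps : tsum (fun x => ofR (p x)) <<= ofR e.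
  apply: (ele_trans (tsum (fun x => (x \in s)%:R * ofR (e / 3 / (size s).+1%:R)) +
     2%:R * tsum (fun x => (x \notin s)%:R * ofR (g x)))).
    rewrite -tsumZl -tsumD; apply: le_tsum => x; rewrite /p.
    by case: (x \in s) => /=; rewrite ?(mul0r, mul1r, addr0, add0r, mulr0) ?eleDl// ofRM// ofR_nat.
  rewrite tsum_mem// big_const_seq count_predT iter_addr_0.
  apply: (ele_trans (ofR (e / 3) + 2%:R * ofR (e / 3))).
    apply: eleD; last exact: eleMl.
    rewrite -[_ *+ size s]mulr_natr -(ofR_nat R (size s)) -ofRM ?(ltW dp)//; apply: ele_ofR.
    by rewrite mulrAC ler_pdivrMr// ler_wpM2l ?(ltW e3)// ler_nat.
  have e3' := ltW e3; have e23 : 0 <= 2 * (e / 3) by rewrite mulr_ge0.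
  by rewrite -(ofR_nat R 2) -ofRM// -ofRD//; apply: ele_ofR; lra.
have p0 x : 0 <= p x.
  by rewrite /p; have := ltW dp; have := g0 x; case: (x \in s) => /=; rewrite !(mul1r, mul0r, addr0, add0r)// => h _; rewrite mulr_ge0.
have sp : summ p by rewrite summ_ge0E// (efin_ofR_le ps).
apply: (le_trans (ler_rsum_sup (g := p) _ sp)).
  move=> x; rewrite /p; have [xs|xs] := boolP (x \in s) => /=.
    by rewrite mul1r mul0r addr0; move: x xs; near: k.
  rewrite mul0r add0r mul1r (le_trans (ler_normB _ _))//.
  by have := lg x; have := fk x; lra.
by rewrite rsum_ge0E// toR_le ?(ltW e0).
Unshelve. all: by end_near.
Qed.
End Rsum.

(** * Cosine transforms *)

Section CosTransform.
Variables (R : realType) (d : nat).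
Local Notation V := 'rV[int]_d.
Local Notation E := (enn R).
Implicit Types (x y : V) (k l : 'rV[R]_d) (f g : V -> R).

Definition ph l x : R := dotr l (ztor R x).

Lemma phD l x y : ph l (x + y) = ph l x + ph l y.
Proof.
rewrite /ph /dotr -big_split; apply: eq_bigr => i _ /=.
by rewrite !mxE intrD mulrDr.
Qed.
Lemma phN l x : ph l (- x) = - ph l x.
Proof. by rewrite /ph /dotr -sumrN; apply: eq_bigr => i _; rewrite !mxE mulrNz mulrN. Qed.
Lemma ph0 l : ph l 0 = 0.
Proof. by rewrite /ph /dotr big1// => i _; rewrite !mxE mulr0. Qed.
Lemma phDl l k x : ph (l + k) x = ph l x + ph k x.
Proof. by rewrite /ph /dotr -big_split; apply: eq_bigr => i _ /=; rewrite !mxE mulrDl. Qed.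
Lemma phNl l x : ph (- l) x = - ph l x.
Proof. by rewrite /ph /dotr -sumrN; apply: eq_bigr => i _; rewrite !mxE mulNr. Qed.
Lemma phZl (c : R) l x : ph (c *: l) x = c * ph l x.
Proof. by rewrite /ph /dotr mulr_sumr; apply: eq_bigr => i _; rewrite !mxE mulrA. Qed.
Lemma ph0l x : ph 0 x = 0.
Proof. by rewrite /ph /dotr big1// => i _; rewrite !mxE mul0r. Qed.

(** For even f this is the whole Fourier transform. *)
Definition ct f l : R := rsum (fun x => f x * cos (ph l x)).

Lemma normr_cos (t : R) : `|cos t| <= 1.
Proof. by rewrite ler_norml cos_geN1 cos_le1. Qed.
Lemma normr_sin (t : R) : `|sin t| <= 1.
Proof. by rewrite ler_norml sin_geN1 sin_le1. Qed.

Lemma summ_bnd f (g : V -> R) : summ f -> (forall x, `|g x| <= 1) -> summ (fun x => f x * g x).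
Proof.
move=> sf hg; apply: (@summ_le _ _ _ (fun x => `|f x|)); last by rewrite summ_abs.
by move=> x; rewrite normrM ler_piMr.
Qed.
Lemma summ_cos f l : summ f -> summ (fun x => f x * cos (ph l x)).
Proof. by move=> sf; apply: summ_bnd => // x; exact: normr_cos. Qed.
Lemma summ_sin f l : summ f -> summ (fun x => f x * sin (ph l x)).
Proof. by move=> sf; apply: summ_bnd => // x; exact: normr_sin. Qed.

Lemma ct_norm f l : summ f -> `|ct f l| <= rsum (fun x => `|f x|).
Proof.
move=> sf; apply: ler_rsum_sup; last by rewrite summ_abs.
by move=> x; rewrite normrM ler_piMr// normr_cos.
Qed.

Lemma ct0 f : ct f 0 = rsum f.
Proof. by apply: eq_rsum => x; rewrite ph0l cos0 mulr1. Qed.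
Lemma ctD f g l : summ f -> summ g -> ct (fun x => f x + g x) l = ct f l + ct g l.
Proof.
move=> sf sg; rewrite /ct -rsumD ?summ_cos//; apply: eq_rsum => x; by rewrite mulrDl.
Qed.
Lemma ctB f g l : summ f -> summ g -> ct (fun x => f x - g x) l = ct f l - ct g l.
Proof.
move=> sf sg; rewrite /ct -rsumB ?summ_cos//; apply: eq_rsum => x; by rewrite mulrBl.
Qed.
Lemma ctZ (c : R) f l : ct (fun x => c * f x) l = c * ct f l.
Proof. by rewrite /ct -rsumZ; apply: eq_rsum => x; rewrite mulrA. Qed.
Lemma ct_delta l : ct (fun x => (x == 0)%:R) l = 1.
Proof. by rewrite /ct (rsum_delta 0 (fun x => cos (ph l x))) ph0 cos0. Qed.

Lemma even_sin f l : (forall x, f (- x) = f x) -> rsum (fun x => f x * sin (ph l x)) = 0.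
Proof.
move=> ef; set S := rsum _; suff : S = - S by lra.
rewrite {1}/S (rsum_bij (e := fun x : V => - x)); last by exists (fun x : V => - x) => x; rewrite opprK.
by rewrite -rsumN; apply: eq_rsum => x; rewrite ef phN sinN mulrN.
Qed.

Lemma rsum_sub (y : V) f : rsum (fun x => f (x - y)) = rsum f.
Proof.
by rewrite -(rsum_bij (e := fun x : V => x - y))//; exists (fun x => x + y) => x; rewrite ?subrK ?addrK.
Qed.

Lemma asum_sub (y : V) f : asum (fun x => f (x - y)) = asum f.
Proof. by rewrite /asum -(tsum_subr y (fun x => ofR `|f x|)). Qed.
Lemma summ_sub (y : V) f : summ f -> summ (fun x => f (x - y)).
Proof. by rewrite /summ asum_sub. Qed.

Lemma conv_abs f g : tsum (fun x => asum (fun y => f y * g (x - y))) = asum f * asum g.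
Proof.
rewrite /asum tsum_swap -tsumZr; apply: eq_tsum => y.
by rewrite [in RHS](tsum_subr y) -tsumZl; apply: eq_tsum => x; rewrite normrM ofRM.
Qed.

Lemma summ_conv f g : summ f -> summ g -> summ (zconv f g).
Proof. by move=> sf sg; apply: summ_outer; rewrite conv_abs efinM. Qed.

Lemma summ_conv_inner f g x : summ f -> summ g -> summ (fun y => f y * g (x - y)).
Proof. by move=> sf sg; apply: (summ_inner (f := fun x y => f y * g (x - y))); rewrite conv_abs efinM. Qed.

(* Only g has to be even: the sine part of the transform of g then vanishes. *)
Lemma ct_conv f g l : summ f -> summ g -> (forall x, g (- x) = g x) ->
  ct (zconv f g) l = ct f l * ct g l.
Proof.
move=> sf sg eg; rewrite /ct /zconv /zsum.
transitivity (rsum (fun x => rsum (fun y => f y * g (x - y) * cos (ph l x)))).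
  by apply: eq_rsum => x; rewrite mulrC -rsumZ; apply: eq_rsum => y; rewrite mulrC.
rewrite rsum_swap; last first.
  have h : efin (asum f * asum g) by exact: efinM.
  apply: efin_le h; rewrite -conv_abs; apply: le_tsum => x; apply: le_tsum => y.
  by apply: ele_ofR; rewrite normrM ler_piMr// normr_cos.
rewrite [RHS]mulrC -rsumZ; apply: eq_rsum => y.
rewrite -(rsum_sub (- y)) /=.
under eq_rsum => x.
  rewrite opprK addrK phD cosD mulrBr.
  rewrite [f y * g x]mulrC -!mulrA.
  rewrite (_ : g x * (f y * (cos (ph l x) * cos (ph l y))) =
    (f y * cos (ph l y)) * (g x * cos (ph l x))); last by ring.
  rewrite (_ : g x * (f y * (sin (ph l x) * sin (ph l y))) =
    (f y * sin (ph l y)) * (g x * sin (ph l x))); last by ring.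
  over.
by rewrite rsumB ?summZ ?summ_cos ?summ_sin// !rsumZ even_sin// mulr0 subr0 mulrC.
Qed.

Lemma conv_even f g : (forall x, f (- x) = f x) -> (forall x, g (- x) = g x) ->
  forall x, zconv f g (- x) = zconv f g x.
Proof.
move=> ef eg x; rewrite /zconv /zsum -[LHS]/(rsum _) (rsum_bij (e := fun x : V => - x)).
  by apply: eq_rsum => y; rewrite ef -opprD eg.
by exists (fun x : V => - x) => y; rewrite opprK.
Qed.

Lemma cos_shift (k : nat) (m : int) (t : R) : (2%:Z ^+ k %| m)%Z ->
  cos (t + pi / 2 ^+ k * m%:~R) = (if (2%:Z ^+ k.+1 %| m)%Z then 1 else -1) * cos t.
Proof.
move=> /dvdzP[q ->]; rewrite exprS dvdz_mul2r ?expf_neq0//.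
have -> : t + pi / 2 ^+ k * (q * 2%:Z ^+ k)%:~R = t + q%:~R * pi.
  rewrite intrM rmorphXn /=; congr (_ + _).
  by field; rewrite expf_neq0// pnatr_eq0.
have cosp (u : R) (n : nat) : cos (u + n%:R * pi) = (if (2 %| n)%N then 1 else -1) * cos u.
  elim: n => [|n IH]; first by rewrite mul0r addr0 mul1r.
  rewrite -[in LHS]natr1 mulrDl mul1r addrA cosDpi IH !dvdn2 /= negbK.
  by case: (odd n) => /=; rewrite ?mul1r ?mulN1r ?opprK.
case: q => n; first by rewrite cosp.
rewrite NegzE mulrNz mulNr -[LHS]cosN opprB addrC cosp cosN.
by rewrite dvdzE abszN.
Qed.

Definition dv (k : nat) (i : 'I_d) x : bool := (2%:Z ^+ k %| x ord0 i)%Z.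

(** By [cos_shift], averaging over the frequencies l and l + pi / 2^k e_i doubles the divisibility
    imposed on the i-th coordinate. Restriction to a sublattice therefore preserves non-negativity
    of the transform. *)
Lemma ct_restrict f (i : 'I_d) (k : nat) l : summ f ->
  ct (fun x => (dv k.+1 i x)%:R * ((dv k i x)%:R * f x)) l =
  (ct (fun x => (dv k i x)%:R * f x) l +
   ct (fun x => (dv k i x)%:R * f x) (l + (pi / 2 ^+ k) *: delta_mx 0 i)) / 2.
Proof.
move=> sf; have sb (b : V -> bool) (h : V -> R) : summ h -> summ (fun x => (b x)%:R * h x).
  move=> sh; apply: (@summ_le _ _ _ (fun x => `|h x|)); last by rewrite summ_abs.
  by move=> x; case: (b x); rewrite ?mul1r// mul0r normr0.
rewrite /ct -rsumD ?summ_cos ?sb// mulrC -rsumZ; apply: eq_rsum => x.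
have [h|h] := boolP (dv k i x); last by rewrite !mul0r mulr0 !mul0r addr0 mulr0.
rewrite mul1r phDl phZl.
have -> : ph (delta_mx 0 i) x = (x 0 i)%:~R.
  rewrite /ph /dotr (bigD1 i)//= !mxE !eqxx mul1r big1 ?addr0// => j ji.
  by rewrite !mxE (negbTE ji) andbF mul0r.
by rewrite cos_shift// -/(dv k.+1 i x); case: (dv k.+1 i x); rewrite ?mul1r ?mul0r; field.
Qed.

(** The restriction of f to the sublattice of points divisible by 2^k has a non-negative transform,
    so at frequency 0 its sum is non-negative; as k grows this sum tends to f 0. *)
Lemma ct_pos f : summ f -> (forall l, 0 <= ct f l) -> 0 <= f 0.
Proof.
move=> sf pf.
pose fr (k : nat) (s : seq 'I_d) x := (all (fun i => dv k i x) s)%:R * f x.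
have sfr (k : nat) s : summ (fr k s).
  apply: (@summ_le _ _ _ (fun x => `|f x|)); last by rewrite summ_abs.
  by move=> x; rewrite /fr; case: all; rewrite ?mul1r// mul0r normr0.
have step (g : V -> R) i : summ g -> (forall l, 0 <= ct g l) ->
    forall (k : nat) l, 0 <= ct (fun x => (dv k i x)%:R * g x) l.
  move=> sg pg; elim=> [|k IH] l.
    have -> : (fun x : V => (dv 0 i x)%:R * g x) = g.
      by apply/funext => x; rewrite /dv expr0 dvd1z mul1r.
    exact: pg.
  have -> : (fun x : V => (dv k.+1 i x)%:R * g x) = (fun x => (dv k.+1 i x)%:R * ((dv k i x)%:R * g x)).
    apply/funext => x; have [h|] := boolP (dv k.+1 i x); last by rewrite !mul0r.
    suff -> : dv k i x by rewrite !mul1r.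
    by apply: dvdz_trans h; rewrite exprS dvdz_mull.
  by rewrite ct_restrict// divr_ge0// addr_ge0// IH.
have pfr (k : nat) s l : 0 <= ct (fr k s) l.
  elim: s l => [|i s IH] l.
    by rewrite (_ : fr k [::] = f)//; apply/funext => x; rewrite /fr mul1r.
  rewrite (_ : fr k (i :: s) = fun x => (dv k i x)%:R * fr k s x); first exact: step.
  by apply/funext => x; rewrite /fr /= mulrA -natrM mulnb.
have cv : (fun k : nat => rsum (fr k (enum 'I_d))) @ \oo --> rsum (fun x => (x == 0)%:R * f x).
  apply: (@rsum_cvg _ _ _ _ _ _ _ (fun x => `|f x|)); first by rewrite summ_abs.
    near=> k => x; rewrite /fr; case: all; by rewrite ?mul1r// mul0r normr0.
  move=> x; have [->|x0] := eqVneq x 0.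
    apply: cvg_near_cst; near=> k; rewrite /fr mul1r (_ : all _ _)//.
      by rewrite mul1r.
    by apply/allP => i _; rewrite /dv mxE dvdz0.
  have [i xi] : exists i, x 0 i != 0.
    apply/existsP; apply: contraR x0; rewrite negb_exists => /forallP h.
    by apply/eqP/matrixP => a j; rewrite ord1 mxE; apply/eqP; rewrite -[_ == _]negbK h.
  apply: cvg_near_cst; near=> k; rewrite /fr mul0r (_ : all _ _ = false) ?mul0r//.
  apply/negbTE/allPn; exists i; first by rewrite mem_enum.
  rewrite /dv; apply/negP; rewrite dvdzE abszX => /dvdn_leq.
  rewrite absz_gt0 xi => /(_ isT); rewrite leqNgt => /negP; apply.
  apply: (@leq_ltn_trans k); last exact: ltn_expl.
  near: k; exact: nbhs_infty_ge.
have : 0 <= rsum (fun x => (x == 0)%:R * f x).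
  apply: (ler_cvg_to (cvg_cst 0) cv); near=> k.
  by rewrite -ct0.
by rewrite rsum_delta.
Unshelve. all: by end_near.
Qed.
End CosTransform.

(** * Renewal sequences *)

Section Conv.
Variable R : realType.
Implicit Types a b c : nat -> R.

Definition cv a b (n : nat) : R := \sum_(i < n.+1) a i * b (n - i)%N.

(** Coefficients up to n involve only the truncations to degree n, which are polynomials, and their
    product is associative. *)
Lemma cv_assoc a b c n : cv (cv a b) c n = cv a (cv b c) n.
Proof.
pose P (x : nat -> R) := \poly_(i < n.+1) x i.
have PE x i : (i <= n)%N -> (P x)`_i = x i by move=> h; rewrite coef_poly ltnS h.
have PM x y i : (i <= n)%N -> (P x * P y)`_i = cv x y i.
  move=> h; rewrite coefM; apply: eq_bigr => j _.
  rewrite !PE//; first by rewrite (leq_trans (leq_subr _ _)).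
  by rewrite (leq_trans _ h)// -ltnS.
transitivity ((P a * P b * P c)`_n).
  rewrite coefM; apply: eq_bigr => j _; have h : (j <= n)%N by rewrite -ltnS.
  by rewrite PM// PE// leq_subr.
rewrite -mulrA coefM; apply: eq_bigr => j _; have h : (j <= n)%N by rewrite -ltnS.
by rewrite PM ?leq_subr// PE.
Qed.

Lemma cvC a b n : cv a b n = cv b a n.
Proof.
rewrite /cv (reindex_inj rev_ord_inj) /=; apply: eq_bigr => i _.
by rewrite mulrC subKn// -ltnS.
Qed.

Lemma cv1 a n : cv (fun i => (i == 0%N)%:R) a n = a n.
Proof.
rewrite /cv big_ord_recl /= mul1r subn0 big1 ?addr0// => i _; by rewrite mul0r.
Qed.

Lemma rsum_cv a b : summ a -> summ b -> summ (cv a b) /\ rsum (cv a b) = rsum a * rsum b.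
Proof.
move=> sa sb.
have fe (s : R -> R) : (forall x, `|s x| = `|x|) ->
    tsum (fun i => tsum (fun j => ofR (s (a i * b j)))) <<= asum a * asum b.
  move=> hs; rewrite /asum -tsumZr; apply: le_tsum => i; rewrite -tsumZl; apply: le_tsum => j.
  by rewrite -ofRM// -normrM -(hs (_ * _)); exact: ofR_absl.
have hab : efin (asum a * asum b) by exact: efinM.
have h1 : efin (tsum (fun n => \sum_(i < n.+1) ofR (a i * b (n - i)%N))).
  by rewrite (tsum_tri (fun i j => ofR (a i * b j))); apply: efin_le hab; exact: (fe id).
have h2 : efin (tsum (fun n => \sum_(i < n.+1) ofR (- (a i * b (n - i)%N)))).
  rewrite (tsum_tri (fun i j => ofR (- (a i * b j)))); apply: efin_le hab.
  by apply: (fe -%R) => x; rewrite normrN.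
have [n|sc ->] := rsum_pm (f := cv a b) _ h1 h2.
  rewrite /cv !toR_sum// -sumrB; apply: eq_bigr => i _; by rewrite toR_pm.
split => //; rewrite (tsum_tri (fun i j => ofR (a i * b j))) (tsum_tri (fun i j => ofR (- (a i * b j)))).
have sab : efin (tsum (fun i => asum (fun j => a i * b j))).
  apply: efin_le hab; rewrite /asum -tsumZr; apply: le_tsum => i; rewrite -tsumZl.
  by apply: le_tsum => j; rewrite normrM ofRM.
rewrite -(rsum_iter sab) mulrC -rsumZ; apply: eq_rsum => i.
by rewrite rsumZ mulrC.
Qed.

Lemma sum_cv_le a b K : (forall i, 0 <= a i) -> (forall i, 0 <= b i) ->
  \sum_(n < K) cv a b n <= (\sum_(i < K) a i) * (\sum_(i < K) b i).
Proof.
move=> a0 b0; have -> : \sum_(n < K) cv a b n = \sum_(i < K) a i * \sum_(j < K - i) b j.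
  elim: K => [|K IH]; first by rewrite !big_ord0.
  rewrite big_ord_recr IH [RHS]big_ord_recr /= subSnn big_ord_recl big_ord0 addr0.
  rewrite /cv big_ord_recr /= subnn addrA -big_split; congr (_ + _); apply: eq_bigr => i _ /=.
  by rewrite subSn ?(ltnW (ltn_ord i))// big_ord_recr mulrDr.
rewrite mulr_suml; apply: ler_sum => i _; apply: ler_wpM2l => //.
rewrite -!(big_mkord xpredT) (big_cat_nat (n := K - i) (p := K))//= ?leq_subr//.
by rewrite lerDl sumr_ge0.
Qed.
End Conv.

Section Tails.
Variable R : realType.
Definition tl (F : nat -> R) (k : nat) : R := rsum (fun i => F (k + i)%N).

Lemma summ_shift (F : nat -> R) k : summ F -> summ (fun i => F (k + i)%N).
Proof. by apply: efin_le; apply: (tsum_inj_le (e := addn k) (fun i => ofR `|F i|)); exact: addnI. Qed.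

Lemma tl_norm (f F : nat -> R) k : (forall m, `|f m| <= F m) -> summ F -> `|tl f k| <= tl F k.
Proof. by move=> h sF; apply: ler_rsum_sup => //; exact: summ_shift. Qed.

Lemma rsum_natS (F : nat -> R) : summ F -> rsum F = F 0%N + rsum (fun i => F i.+1).
Proof.
move=> sF; have sF1 : summ (fun i => F i.+1) by exact: (summ_shift 1).
rewrite !rsumE (tsum_natS (fun i => ofR (F i))) (tsum_natS (fun i => ofR (- F i))).
by rewrite !toRD ?(summ_pos sF1) ?(summ_neg sF1)// opprD addrACA toR_pm.
Qed.

Lemma rsum_nat_fin (g : nat -> R) n : rsum (fun j => (j < n)%N%:R * g j) = \sum_(i < n) g i.
Proof.
have e (h : nat -> R) : tsum (fun j => ofR ((j < n)%N%:R * h j)) = \sum_(i < n) ofR (h i).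
  rewrite -(tsum_nat_fin (fun j => ofR (h j))); apply: eq_tsum => j.
  by case: (j < n)%N; rewrite ?mul1r// !mul0r ofR0.
rewrite rsumE e (_ : tsum _ = \sum_(i < n) ofR (- g i)).
  by rewrite !toR_sum// -sumrB; apply: eq_bigr => i _; rewrite toR_pm.
by rewrite -(e (fun i => - g i)); apply: eq_tsum => j; rewrite mulrN.
Qed.

Lemma tl_split (F : nat -> R) k : summ F -> tl F k = F k + tl F k.+1.
Proof.
move=> sF; rewrite /tl (rsum_natS (summ_shift k sF)) addn0; congr (_ + _).
by apply: eq_rsum => i; rewrite addSnnS.
Qed.

Lemma tl_rsum (f : nat -> R) : summ (fun m => m.+1%:R * f m) ->
  summ (tl f) /\ rsum (tl f) = rsum (fun m => m.+1%:R * f m).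
Proof.
move=> sF.
have e (g : nat -> R) : tsum (fun k => tsum (fun i => ofR (g (k + i)%N))) = tsum (fun m => ofR (m.+1%:R * g m)).
  rewrite -(tsum_tri (fun k i => ofR (g (k + i)%N))); apply: eq_tsum => n.
  rewrite (eq_bigr (fun=> ofR (g n))); last by move=> i _; rewrite subnKC// -ltnS.
  rewrite sumr_const card_ord; have [g0|g0] := leP 0 (g n); first by rewrite ofRM// ofR_nat mulr_natl.
  by rewrite !ofR_le0 ?mul0rn ?mulr_ge0_le0 ?(ltW g0).
have h : efin (tsum (fun k => asum (fun i => f (k + i)%N))).
  rewrite /asum (e (fun m => `|f m|)); apply: efin_le sF; apply: le_tsum => m.
  by rewrite normrM ger0_norm.
split; first exact: (summ_outer h).
rewrite /tl (rsum_iter h) (e f) (e (fun m => - f m)) rsumE; congr (_ - toR _).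
by apply: eq_tsum => m; rewrite mulrN.
Qed.

Lemma tl_sum (F : nat -> R) : (forall m, 0 <= F m) -> summ (fun m => m.+1%:R * F m) ->
  summ (tl F) /\ rsum (tl F) = rsum (fun m => m.+1%:R * F m).
Proof.
move=> F0 sF.
have sF0 : summ F.
  apply: summ_le sF => m; rewrite ger0_norm// ler_peMl// ler1n//.
have e : tsum (fun k => ofR (tl F k)) = tsum (fun m => ofR (m.+1%:R * F m)).
  transitivity (tsum (fun k => tsum (fun i => ofR (F (k + i)%N)))).
    apply: eq_tsum => k; rewrite /tl rsum_ge0E// toRK//.
    by rewrite -summ_ge0E// summ_shift.
  rewrite -(tsum_tri (fun k i => ofR (F (k + i)%N))); apply: eq_tsum => n.
  rewrite (eq_bigr (fun=> ofR (F n))); last by move=> i _; rewrite subnKC// -ltnS.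
  by rewrite sumr_const card_ord ofRM// ofR_nat mulr_natl.
have tl0 k : 0 <= tl F k by apply: rsum_ge0.
split; first by rewrite summ_ge0E// e -summ_ge0E// => m; rewrite mulr_ge0.
by rewrite !rsum_ge0E ?e// => m; rewrite mulr_ge0.
Qed.
End Tails.

Section RenewalOne.
Variables (R : realType) (F f : nat -> R) (u : nat -> R).
(* f1 is the renewal weight of 1, and f m the weight of m + 2. *)
Variable f1 : R.
Hypotheses (F0 : forall m, 0 <= F m) (sF : summ (fun m => m.+1%:R * F m)).
Hypothesis F14 : rsum (fun m => m.+1%:R * F m) <= 4^-1.
Hypothesis fF : forall m, `|f m| <= F m.
Definition fw (m : nat) : R := if m is m'.+1 then f m' else f1.
Hypotheses (u0 : u 0 = 1) (uS : forall n, u n.+1 = cv fw u n).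
Definition eps : R := 1 - f1 - rsum f.
Hypothesis eps4 : `|eps| <= 4^-1.

(** The sum of the renewal weights at times greater than j: the total mass is 1 - eps, and [f m]
    sits at time m + 2. For j > 0 it is bounded by [Fb j]. *)
Definition Hc (j : nat) : R := if j is k.+1 then tl f k else 1 - eps.
Definition Fb (j : nat) : R := if j is k.+1 then tl F k else 0.

Lemma sF0 : summ F.
Proof. by apply: summ_le sF => m; rewrite ger0_norm// ler_peMl// ler1n. Qed.
Lemma sf0 : summ f. Proof. exact: summ_le fF sF0. Qed.

(** Identically 1 when the weights have mass 1. In general [ppS] shows that each step loses eps
    u(n+1), so the defect of mass is the only source of variation. *)
Definition pp : nat -> R := cv Hc u.

Lemma pp0 : pp 0 = 1 - eps.
Proof. by rewrite /pp /cv big_ord_recl big_ord0 addr0 u0 mulr1. Qed.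

Lemma ppS n : pp n.+1 = pp n - eps * u n.+1.
Proof.
rewrite /pp {1}/cv big_ord_recl subn0 /= mulrBl mul1r {1}uS.
rewrite addrAC; congr (_ - _); rewrite /cv -big_split; apply: eq_bigr => i _ /=.
rewrite subSS -mulrDl; congr (_ * _); case: i => [[|k] hk] /=; last by rewrite -tl_split// sf0.
rewrite /eps; have := tl_split 0 sf0; rewrite /tl; under eq_rsum => i do rewrite add0n.
by under [in X in _ = _ + X -> _]eq_rsum => i do rewrite add1n; rewrite /= ; lra.
Qed.

(* Jn H is the inverse of H for the Cauchy product; Jl tabulates its first values. *)
Fixpoint Jl (H : nat -> R) (n : nat) : seq R :=
  if n is n'.+1 then
    let s := Jl H n' in rcons s (- (H 0%N)^-1 * \sum_(i < n'.+1) H i.+1 * s`_(n' - i))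
  else [:: (H 0%N)^-1].
Definition Jn H n := (Jl H n)`_n.

Lemma size_Jl H n : size (Jl H n) = n.+1.
Proof. by elim: n => //= n IH; rewrite size_rcons IH. Qed.
Lemma nth_Jl H n m : (m <= n)%N -> (Jl H n)`_m = Jn H m.
Proof.
elim: n => [|n IH]; first by rewrite leqn0 => /eqP ->.
rewrite leq_eqVlt => /orP[/eqP->//|]; rewrite ltnS => h.
by rewrite /= nth_rcons size_Jl ltnS h IH.
Qed.
Lemma JnS H n : Jn H n.+1 = - (H 0%N)^-1 * cv (fun i => H i.+1) (Jn H) n.
Proof.
rewrite /Jn /= nth_rcons size_Jl ltnn eqxx; congr (_ * _); apply: eq_bigr => i _.
by rewrite nth_Jl// leq_subr.
Qed.
Lemma Jn_inv H n : H 0%N != 0 -> cv H (Jn H) n = (n == 0%N)%:R.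
Proof.
move=> H0; case: n => [|n]; rewrite /cv big_ord_recl subn0.
  by rewrite big_ord0 addr0 mulfV.
rewrite JnS mulrA mulrN mulfV// mulN1r; apply/eqP; rewrite addrC subr_eq0; apply/eqP.
by apply: eq_bigr => i _; rewrite subSS.
Qed.

(** The inverse of the sequence 3/4, - tl F 0, - tl F 1, ..., the worst case for [Hc]: a majorant of
    [JJ] that depends on F alone and hence is uniform in the weights. *)
Definition Jb (n : nat) : R := Jn (fun j => if j is k.+1 then - Fb k.+1 else 3 / 4) n.

Lemma Jb0E : Jb 0 = 4 / 3. Proof. by rewrite /Jb /Jn /=; field. Qed.
Lemma JbS n : Jb n.+1 = 4 / 3 * cv (fun i => Fb i.+1) Jb n.
Proof.
rewrite /Jb JnS /cv !mulr_sumr; apply: eq_bigr => i _.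
by rewrite [_ * Jn _ _]mulNr mulrNN; congr (_ * _); field.
Qed.
Lemma tlF0 k : 0 <= tl F k. Proof. exact: rsum_ge0. Qed.
Lemma Jb_ge0 n : 0 <= Jb n.
Proof.
elim/ltn_ind: n => -[|n] IH; first by rewrite Jb0E.
rewrite JbS mulr_ge0// sumr_ge0// => i _; rewrite mulr_ge0 ?tlF0// IH//.
by rewrite ltnS leq_subr.
Qed.
(** The partial sums S satisfy S <= 4/3 + (4/3)(1/4) S, whose fixed point is 2. *)
Lemma Jb_partial K : \sum_(n < K) Jb n <= 2.
Proof.
have tF : \sum_(k < K) tl F k <= 4^-1.
  apply: le_trans F14; have [sT <-] := tl_sum F0 sF.
  rewrite rsum_ge0E; last exact: tlF0.
  apply: ofR_le; first exact: toR_ge0.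
  rewrite toRK -?summ_ge0E//; last exact: tlF0.
  rewrite ofR_sum; last by move=> *; exact: tlF0.
  exact: tsum_nat_ge.
elim: K tF => [|K IH] tF; first by rewrite big_ord0.
have tF' : \sum_(k < K) tl F k <= 4^-1.
  by apply: le_trans tF; rewrite big_ord_recr lerDl tlF0.
have {IH} := IH tF'; rewrite big_ord_recl Jb0E => IH.
under eq_bigr => i _ do rewrite JbS; rewrite -mulr_sumr.
have := sum_cv_le K (fun i => tlF0 i) Jb_ge0; rewrite -/(Fb _).
have S0 : 0 <= \sum_(i < K) Jb i by apply: sumr_ge0 => i _; exact: Jb_ge0.
have T0 : 0 <= \sum_(i < K) tl F i by apply: sumr_ge0 => i _; exact: tlF0.
move=> h; rewrite /=; have : (\sum_(i < K) tl F i) * (\sum_(i < K) Jb i) <= 4^-1 * 2 by nra.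
rewrite /cv in h *; lra.
Qed.
Lemma Jb_summ : summ Jb.
Proof.
rewrite summ_ge0E; last exact: Jb_ge0.
apply: (@efin_ofR_le _ _ 2); apply: tsum_nat_ub => K.
rewrite -ofR_sum; last by move=> *; exact: Jb_ge0.
by apply: ele_ofR; exact: Jb_partial.
Qed.
Lemma Jb_rsum : rsum Jb <= 2.
Proof.
rewrite rsum_ge0E; last exact: Jb_ge0.
apply: toR_le => //; apply: tsum_nat_ub => K.
rewrite -ofR_sum; last by move=> *; exact: Jb_ge0.
by apply: ele_ofR; exact: Jb_partial.
Qed.

Definition JJ : nat -> R := Jn Hc.
Lemma Hc0_ge : 3 / 4 <= 1 - eps.
Proof. by move: eps4; rewrite ler_norml => /andP[_ h]; lra. Qed.
Lemma JJ_le n : `|JJ n| <= Jb n.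
Proof.
have h0 := Hc0_ge; have hi : 0 <= (1 - eps)^-1 <= 4 / 3.
  apply/andP; split; first by rewrite invr_ge0; lra.
  by rewrite -[4/3]invrK lef_pV2 ?posrE ?invr_gt0; lra.
case/andP: hi => hi0 hi1.
elim/ltn_ind: n => -[|n] IH; first by rewrite Jb0E /JJ /Jn /= ger0_norm.
rewrite JbS /JJ JnS normrM normrN; apply: ler_pM => //; first by rewrite ger0_norm.
apply: le_trans (ler_norm_sum _ _ _) _; apply: ler_sum => i _.
rewrite normrM; apply: ler_pM => //; first by apply: tl_norm => //; exact: sF0.
by apply: IH; rewrite ltnS leq_subr.
Qed.
Lemma JJ_summ : summ JJ. Proof. by apply: summ_le JJ_le _; exact: Jb_summ. Qed.

Lemma u_JJ n : u n = cv JJ pp n.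
Proof.
have H0 : Hc 0 != 0 by rewrite /=; have := Hc0_ge; move=> ?; apply/eqP; lra.
rewrite /pp -cv_assoc -[LHS]cv1; apply: eq_bigr => i _; congr (_ * _).
by rewrite cvC Jn_inv.
Qed.

(** The first moment f1 + sum (m + 2) f_m of the weights, which is also the sum of [Hc]. *)
Definition hh : R := 1 - eps + rsum (fun m => m.+1%:R * f m).

Lemma hhJ : rsum JJ * hh = 1.
Proof.
have sw : summ (fun m => m.+1%:R * f m).
  by apply: summ_le sF => m; rewrite normrM ger0_norm// ler_wpM2l.
have [st rt] := tl_rsum sw.
have sH : summ Hc.
  by rewrite /summ /asum tsum_natS efinD// -/(asum (tl f)).
have H0 : Hc 0 != 0 by rewrite /=; have := Hc0_ge; move=> ?; apply/eqP; lra.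
have [_ e] := rsum_cv sH JJ_summ.
move: e; rewrite (eq_rsum (g := fun n => (n == 0%N)%:R * 1)); last by move=> n; rewrite mulr1 Jn_inv.
by rewrite (rsum_delta 0%N (fun=> 1)) (rsum_natS sH) /= rt mulrC => <-.
Qed.

Lemma cv_Jb_const n : \sum_(i < n) Jb i.+1 <= 2 / 3.
Proof. by have := Jb_partial n.+1; rewrite big_ord_recl Jb0E => ?; rewrite /=; lra. Qed.

(** It stays bounded as long as n is of order 1 / |eps|, the only range in which it is used. *)
Definition Bn (n : nat) : R := 5 / 4 * (1 + 4 * `|eps|) ^+ n.
Lemma Bn_mono n m : (n <= m)%N -> Bn n <= Bn m.
Proof.
move=> h; rewrite /Bn ler_wpM2l// ler_weXn2l// ; have := normr_ge0 eps; lra.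
Qed.
Lemma Bn_ge0 n : 0 <= Bn n.
Proof. by rewrite /Bn mulr_ge0// exprn_ge0//; have := normr_ge0 eps; lra. Qed.

(** The bound on u(n+1) contains pp(n+1) itself; its coefficient 4/3 |eps| is at most 1/3 and is
    absorbed on the left. *)
Lemma pp_bound n : `|pp n| <= Bn n.
Proof.
have e0 := normr_ge0 eps; have e4 : `|eps| <= 4^-1 by exact: eps4.
elim/ltn_ind: n => -[|n] IH.
  by rewrite pp0 /Bn expr0 mulr1 (le_trans (ler_normB _ _))// normr1; lra.
have : `|u n.+1| <= 4 / 3 * `|pp n.+1| + 2 / 3 * Bn n.
  rewrite u_JJ /cv big_ord_recl subn0; apply: le_trans (ler_normD _ _) _; apply: lerD.
    by rewrite normrM ler_wpM2r// -Jb0E JJ_le.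
  apply: le_trans (ler_norm_sum _ _ _) _; apply: le_trans (ler_wpM2r (Bn_ge0 n) (cv_Jb_const n.+1)).
  rewrite mulr_suml; apply: ler_sum => i _; rewrite normrM subSS; apply: ler_pM => //; first exact: JJ_le.
  apply: le_trans (IH _ _) _; first by rewrite ltnS leq_subr.
  by apply: Bn_mono; exact: leq_subr.
move=> hu; have : `|pp n.+1| <= Bn n + `|eps| * (4 / 3 * `|pp n.+1| + 2 / 3 * Bn n).
  rewrite ppS; apply: le_trans (ler_normB _ _) _; rewrite normrM; apply: lerD.
    exact: IH.
  by apply: ler_wpM2l => //; rewrite -ppS.
rewrite (_ : Bn n.+1 = Bn n * (1 + 4 * `|eps|)); last by rewrite /Bn exprSr mulrA.
have := Bn_ge0 n; move: (`|pp _|) (Bn n) (`|eps|) e0 e4 => p b e e0 e4 b0 h.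
have k : 0 < 1 - 4 / 3 * e by lra.
have : 0 <= b * e * (2 - 16 / 3 * e) by rewrite !mulr_ge0//; lra.
rewrite -(ler_pM2r k) => ?; nra.
Qed.

(** Error terms: [om1] for replacing pp(n - j) by pp(n), [om2] for the part of [JJ] beyond n, and
    later [om3] for |eps| times the sum of [om2] up to N. Each tends to 0 as N grows with N |eps|
    bounded. *)
Definition om1 : R := rsum (fun j => Jb j * Num.min (`|eps| * j%:R) 1).
Definition om2 (n : nat) : R := rsum (fun j => Jb j * (n < j)%:R).

Lemma Jb_w (w : nat -> R) : (forall j, 0 <= w j <= 1) -> summ (fun j => Jb j * w j).
Proof.
move=> hw; apply: summ_le Jb_summ => j; have /andP[w0 w1] := hw j.
by rewrite ger0_norm ?mulr_ge0 ?Jb_ge0// ler_piMr// Jb_ge0.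
Qed.

Lemma min01 j : 0 <= Num.min (`|eps| * j%:R) 1 <= 1.
Proof. by rewrite le_min ge_min lexx orbT ler01 mulr_ge0. Qed.

Variables (N : nat) (C : R).
Hypothesis BC : Bn N <= C.

Definition err n : R := u n - rsum JJ * pp n.

Lemma u_bound n : (n <= N)%N -> `|u n| <= 2 * C.
Proof.
have C0 : 0 <= C by apply: le_trans BC; exact: Bn_ge0.
move=> nN; rewrite u_JJ; apply: le_trans (ler_norm_sum _ _ _) _.
apply: le_trans (ler_wpM2r C0 (Jb_partial n.+1)).
rewrite mulr_suml; apply: ler_sum => i _; rewrite normrM; apply: ler_pM => //; first exact: JJ_le.
apply: le_trans (pp_bound _) _; apply: le_trans (Bn_mono _) BC.
by rewrite (leq_trans (leq_subr _ _)).
Qed.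

Lemma pp_C n : (n <= N)%N -> `|pp n| <= C.
Proof. by move=> h; apply: le_trans (pp_bound _) _; apply: le_trans (Bn_mono _) BC. Qed.

Lemma pp_diff n j : (j <= n)%N -> (n <= N)%N -> `|pp (n - j) - pp n| <= 2 * C * Num.min (`|eps| * j%:R) 1.
Proof.
have C0 : 0 <= C by apply: le_trans BC; exact: Bn_ge0.
move=> jn nN; rewrite minr_pMr ?mulr_ge0// mulr1 le_min; apply/andP; split; last first.
  by apply: le_trans (ler_normB _ _) _; rewrite mulrDl !mul1r lerD// pp_C// (leq_trans (leq_subr _ _)).
elim: j jn => [|j IH] jn; first by rewrite subn0 subrr normr0 mulr0 mulr0.
have e : (n - j = (n - j.+1).+1)%N by rewrite subnSK.
have := IH (ltnW jn); rewrite e ppS => h.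
rewrite (_ : pp _ - pp n = (pp (n - j.+1) - eps * u (n - j.+1).+1 - pp n) + eps * u (n - j.+1).+1); last by ring.
apply: le_trans (ler_normD _ _) _; rewrite -[j.+1%:R]natr1 !mulrDr mulr1; apply: lerD => //.
rewrite normrM mulrC; apply: ler_wpM2r => //; apply: u_bound.
by rewrite -e (leq_trans (leq_subr _ _)).
Qed.

Lemma err_bound n : (n <= N)%N -> `|err n| <= 2 * C * (om1 + om2 n).
Proof.
have C0 : 0 <= C by apply: le_trans BC; exact: Bn_ge0.
move=> nN.
have w1 : summ (fun j => Jb j * Num.min (`|eps| * j%:R) 1) by apply: Jb_w => j; exact: min01.
have w2 : summ (fun j => Jb j * (n < j)%:R) by apply: Jb_w => j; case: (n < j)%N; rewrite /= ?lexx ler01.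
have sm : summ (fun j => (j < n.+1)%N%:R * (JJ j * pp (n - j))).
  apply: (@summ_le _ _ _ (fun j => C * Jb j)); last exact: summZ Jb_summ.
  move=> j; rewrite normrM; case: (ltnP j n.+1) => jn; last by rewrite normr0 mul0r mulr_ge0 ?Jb_ge0.
  by rewrite normr1 mul1r normrM mulrC; apply: ler_pM => //; [apply: pp_C; rewrite (leq_trans (leq_subr _ _))|exact: JJ_le].
have -> : err n = rsum (fun j => (j < n.+1)%N%:R * (JJ j * pp (n - j)) - pp n * JJ j).
  by rewrite rsumB ?summZ ?JJ_summ// rsumZ rsum_nat_fin /err u_JJ mulrC.
rewrite /om1 /om2 -rsumD// -rsumZ; apply: ler_rsum_sup; last by apply: summZ; exact: summD.
move=> j; rewrite -mulrDr [2 * C * _]mulrCA; case: (ltnP j n.+1) => jn.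
  rewrite mul1r [pp n * _]mulrC -mulrBr normrM; apply: ler_pM => //; first exact: JJ_le.
  apply: le_trans (pp_diff _ nN) _ => //; apply: ler_wpM2l; first by rewrite mulr_ge0.
  by rewrite lerDl.
rewrite mul0r sub0r normrN normrM mulrC; apply: ler_pM => //; first exact: JJ_le.
apply: le_trans (pp_C nN) _; have /andP[m0 m1] := min01 j.
by rewrite /=; nra.
Qed.

(** Up to [err], u is (sum JJ) pp, and then [ppS] reads qq pp(n+1) = pp(n). Hence pp(N) is close to
    qq^(-N). *)
Definition qq : R := 1 + eps * rsum JJ.
Definition om3 : R := rsum (fun j => Jb j * Num.min (`|eps| * j%:R) (`|eps| * N%:R)).

Lemma JJ_rsum : `|rsum JJ| <= 2.
Proof. by apply: le_trans (ler_rsum_sup JJ_le Jb_summ) _; exact: Jb_rsum. Qed.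

Lemma qq_bound : 0 <= qq <= 1 + 4 * `|eps|.
Proof.
have e0 := normr_ge0 eps; have e4 : `|eps| <= 4^-1 by exact: eps4.
have : `|eps * rsum JJ| <= `|eps| * 2 by rewrite normrM ler_wpM2l// JJ_rsum.
by rewrite ler_norml /qq => /andP[? ?]; apply/andP; split; lra.
Qed.

Lemma om2_sum n : (n <= N)%N -> `|eps| * \sum_(i < n) om2 i.+1 <= om3.
Proof.
move=> nN; have e0 := normr_ge0 eps.
have w2 i : summ (fun j => Jb j * (i < j)%N%:R) by apply: Jb_w => j; case: (i < j)%N; rewrite /= ?lexx ler01.
rewrite /om2 -(@rsum_big _ _ _ (index_enum 'I_n) xpredT (fun (i : 'I_n) j => Jb j * (i.+1 < j)%N%:R)); last by move=> i _; exact: w2.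
rewrite -rsumZ; apply: le_rsum.
- by apply: summZ; apply: summ_big => i _; exact: w2.
- apply: (@summ_le _ _ _ (fun j => (`|eps| * N%:R) * Jb j)); last exact: summZ Jb_summ.
  move=> j; rewrite ger0_norm ?mulr_ge0 ?Jb_ge0 ?le_min ?mulr_ge0// mulrC ler_wpM2r ?Jb_ge0//.
  by rewrite ge_min lexx orbT.
- move=> j; rewrite -mulr_sumr mulrCA; apply: ler_wpM2l; first exact: Jb_ge0.
  rewrite le_min !ler_wpM2l// -natr_sum ler_nat.
    apply: leq_trans _ nN; rewrite -[X in (_ <= X)%N]card_ord -sum1_card.
    by apply: leq_sum => i _; case: (_ < _)%N.
  elim: n {nN} => [|n IH]; first by rewrite big_ord0.
  rewrite big_ord_recr /=; case: (ltnP n.+1 j) => h; last by rewrite addn0.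
  rewrite addn1; apply: leq_trans _ (ltnW h); rewrite ltnS.
  by rewrite -[X in (_ <= X)%N]card_ord -sum1_card; apply: leq_sum => i _; case: (_ < _)%N.
Qed.

(** At each step qq^n pp(n) changes by - eps qq^n err(n+1); these changes are added up. *)
Lemma pp_main : `|qq ^+ N * pp N - (1 - eps)| <= 2 * C * C * (`|eps| * N%:R * om1 + om3).
Proof.
have e0 := normr_ge0 eps; have e4 : `|eps| <= 4^-1 by exact: eps4.
have /andP[q0 q1] := qq_bound.
have C0 : 0 <= C by apply: le_trans BC; exact: Bn_ge0.
have qC n : (n <= N)%N -> qq ^+ n <= C.
  move=> nN; apply: le_trans BC; apply: le_trans (Bn_mono nN).
  apply: (le_trans (y := (1 + 4 * `|eps|) ^+ n)); first by apply: lerXn2r; rewrite ?nnegrE//; lra.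
  by rewrite /Bn ler_peMl ?exprn_ge0//; lra.
have om10 : 0 <= om1 by apply: rsum_ge0 => j; have /andP[h _] := min01 j; rewrite mulr_ge0 ?Jb_ge0.
have om20 n : 0 <= om2 n by apply: rsum_ge0 => j; rewrite mulr_ge0 ?Jb_ge0.
have main n : (n <= N)%N -> `|qq ^+ n * pp n - (1 - eps)| <=
    2 * C * C * (`|eps| * \sum_(i < n) (om1 + om2 i.+1)).
  elim: n => [|n IH] nN; first by rewrite expr0 mul1r pp0 subrr normr0 big_ord0 !mulr0.
  have e : qq ^+ n.+1 * pp n.+1 = qq ^+ n * pp n - eps * qq ^+ n * err n.+1.
    have h : pp n = pp n.+1 + eps * u n.+1 by rewrite ppS; ring.
    by rewrite h /err exprS /qq; ring.
  rewrite e addrAC; apply: le_trans (ler_normB _ _) _.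
  rewrite big_ord_recr [`|eps| * (_ + _)]mulrDr [2 * C * C * (_ + _)]mulrDr.
  apply: lerD; first exact: IH (ltnW nN).
  rewrite !normrM (ger0_norm (exprn_ge0 _ q0)).
  have := err_bound nN; have := qC n (ltnW nN); have := exprn_ge0 n q0.
  have := normr_ge0 (err n.+1); have := om20 n.+1.
  move: (qq ^+ n) (`|err _|) (om2 _) => q er o o0 er0 qq0 qC' hb.
  rewrite (_ : 2 * C * C * _ = `|eps| * (C * (2 * C * (om1 + o)))); last by ring.
  by rewrite -mulrA; apply: ler_wpM2l => //; exact: ler_pM.
apply: le_trans (main N (leqnn N)) _.
apply: ler_wpM2l; first by rewrite !mulr_ge0.
rewrite big_split /= mulrDr; apply: lerD; last exact: om2_sum.
by rewrite sumr_const card_ord -[_ *+ N]mulr_natl mulrA.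
Qed.
End RenewalOne.

(** * Renewal equations whose weights vary with N *)

Section RenewalLimit.
Variable R : realType.

Lemma scaled_cvg0 (x : nat -> R) (s : R) : (fun N => N%:R * x N) @ \oo --> s -> x @ \oo --> (0 : R).
Proof.
move=> hx; have iv : (fun N : nat => (N%:R : R)^-1) @ \oo --> (0 : R).
  by apply/gtr0_cvgV0; [near=> n; rewrite ltr0n; near: n; exact: nbhs_infty_gt|exact: cvgr_idn].
have H : (fun N : nat => N%:R * x N * (N%:R : R)^-1) @ \oo --> (0 : R).
  by rewrite -(mulr0 s); apply: cvgM.
apply: cvg_trans H; apply: near_eq_cvg; near=> N.
have N0 : (0 < N)%N by near: N; exact: nbhs_infty_gt.
by rewrite /= mulrAC mulfV ?mul1r// pnatr_eq0 -lt0n.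
Unshelve. all: by end_near.
Qed.

(** N ln(1 + x_N) is squeezed between N x_N / (1 + x_N) and N x_N. *)
Lemma expn_cvg (x : nat -> R) (s : R) : (fun N => N%:R * x N) @ \oo --> s ->
  (fun N => (1 + x N) ^+ N) @ \oo --> expR s.
Proof.
move=> hx.
have x0 := scaled_cvg0 hx.
have xs : \forall N \near \oo, `|x N| <= 2^-1.
  by move/cvgr0_norm_le : x0; apply; rewrite invr_gt0.
have lim1 : (fun N => N%:R * x N / (1 + x N)) @ \oo --> s.
  have d : (fun N => 1 + x N) @ \oo --> (1 : R).
    by rewrite -[X in _ --> X]addr0; apply: cvgD => //; exact: cvg_cst.
  by rewrite -[s]divr1; apply: cvgM => //; apply: cvgV => //; exact: oner_neq0.
have lln : (fun N => N%:R * ln (1 + x N)) @ \oo --> s.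
  apply: (squeeze_cvgr _ lim1 hx); near=> N.
  have : `|x N| <= 2^-1 by near: N.
  rewrite ler_norml => /andP[h1 h2]; have p : 0 < 1 + x N by lra.
  apply/andP; split; last by rewrite ler_wpM2l// le_ln1Dx//; lra.
  rewrite -mulrA ler_wpM2l//.
  have := @le_ln1Dx R ((1 + x N)^-1 - 1); rewrite (_ : 1 + (_ - 1) = (1 + x N)^-1); last by ring.
  rewrite lnV ?posrE// => h.
  have i0 : 0 < (1 + x N)^-1 by rewrite invr_gt0.
  have : -1 < (1 + x N)^-1 - 1 by lra.
  move/h => {}h; have e : x N / (1 + x N) = 1 - (1 + x N)^-1 by field; lra.
  by rewrite e; lra.
have H : (fun N => expR (N%:R * ln (1 + x N))) @ \oo --> expR s.
  by apply: continuous_cvg => //; exact: continuous_expR.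
apply: cvg_trans H; apply: near_eq_cvg; near=> N.
have : `|x N| <= 2^-1 by near: N.
rewrite ler_norml => /andP[h1 h2]; have p : 0 < 1 + x N by lra.
by rewrite /= mulrC expRM_natr lnK.
Unshelve. all: by end_near.
Qed.

Variables (F g : nat -> R) (f : nat -> nat -> R) (f1 : nat -> R) (u : nat -> nat -> R) (t : R).
Hypotheses (F0 : forall m, 0 <= F m) (sF : summ (fun m => m.+1%:R * F m)).
Hypothesis F14 : rsum (fun m => m.+1%:R * F m) <= 4^-1.
Hypothesis fF : forall N m, `|f N m| <= F m.
Hypothesis fg : forall m, f^~ m @ \oo --> g m.
Hypotheses (u0 : forall N, u N 0 = 1) (uS : forall N n, u N n.+1 = cv (fw (f N) (f1 N)) (u N) n).
Hypothesis epst : (fun N => N%:R * eps (f N) (f1 N)) @ \oo --> t.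

Theorem renewal_limit :
  (fun N => u N N) @ \oo -->
   (1 + rsum (fun m => m.+1%:R * g m))^-1 * expR (- (t / (1 + rsum (fun m => m.+1%:R * g m)))).
Proof.
set h := 1 + _.
pose ep N := eps (f N) (f1 N).
have ep0 : ep @ \oo --> (0 : R) by exact: scaled_cvg0 epst.
have epn0 : (fun N => `|ep N|) @ \oo --> (0 : R) by rewrite -(normr0 R); apply: cvg_norm.
have ep4 : \forall N \near \oo, `|ep N| <= 4^-1.
  by move/cvgr0_norm_le : ep0; apply; rewrite invr_gt0.
have [T hT] : exists T, \forall N \near \oo, `|ep N| * N%:R <= T.
  exists (`|t| + 1); have t1 : `|t| + 1 > `|t| by rewrite ltrDl.
  have H : \forall N \near \oo, `|N%:R * ep N| <= `|t| + 1.
    by apply: (cvgr_le _ (cvg_norm epst)).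
  by near=> N; rewrite mulrC -[N%:R]ger0_norm// -normrM; near: N; exact: H.
(* As N |eps| <= T, the growth factor (1 + 4 |eps|)^N is at most exp(4 T). *)
pose C := 5 / 4 * expR (4 * T).
have BC : \forall N \near \oo, Bn (f N) (f1 N) N <= C.
  near=> N; rewrite /Bn /C ler_wpM2l//.
  apply: (le_trans (y := expR (4 * `|ep N|) ^+ N)).
    by apply: lerXn2r; rewrite ?nnegrE ?expR_ge0// ?addr_ge0 ?mulr_ge0// expR_ge1Dx.
  rewrite -expRM_natr ler_expR -mulrA ler_wpM2l//; near: N; exact: hT.
have Jb0 := Jb_ge0 F0; have sJ := Jb_summ F0 sF F14.
have o1 : (fun N => om1 F (f N) (f1 N)) @ \oo --> (0 : R).
  rewrite -(rsum0 R nat); apply: (@rsum_cvg _ _ _ _ _ _ _ (Jb F)) => //.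
    near=> N => j; have /andP[m0 m1] := min01 (f N) (f1 N) j.
    by rewrite ger0_norm ?mulr_ge0// ler_piMr.
  move=> j; rewrite -(mulr0 (Jb F j)); apply: cvgM; first exact: cvg_cst.
  apply: (squeeze_cvgr _ (cvg_cst 0) (_ : (fun N => `|ep N| * j%:R) @ \oo --> (0 : R))).
    near=> N; have /andP[m0 _] := min01 (f N) (f1 N) j; rewrite m0 /=.
    by rewrite ge_min lexx.
  by rewrite -(mul0r j%:R); apply: cvgM => //; exact: cvg_cst.
have o2 : om2 F @ \oo --> (0 : R).
  rewrite -(rsum0 R nat); apply: (@rsum_cvg _ _ _ _ _ _ _ (Jb F)) => //.
    near=> N => j; rewrite ger0_norm ?mulr_ge0// ler_piMr//; by case: (_ < _)%N; rewrite /= ?lexx ?ler01.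
  move=> j; apply: cvg_near_cst; near=> N.
  rewrite ltnNge (_ : (j <= N)%N) ?mulr0//; near: N; exact: nbhs_infty_ge.
have T0 : 0 <= T.
  have [N hN] := filter_ex hT; apply: le_trans hN; exact: mulr_ge0.
have o3 : (fun N => om3 F (f N) (f1 N) N) @ \oo --> (0 : R).
  rewrite -(rsum0 R nat); apply: (@rsum_cvg _ _ _ _ _ _ _ (fun j => T * Jb F j)).
  - exact: summZ.
  - near=> N => j; rewrite ger0_norm ?mulr_ge0 ?le_min ?mulr_ge0// mulrC ler_wpM2r// ge_min.
    by apply/orP; right; near: N; exact: hT.
  - move=> j; rewrite -(mulr0 (Jb F j)); apply: cvgM; first exact: cvg_cst.
    apply: (squeeze_cvgr _ (cvg_cst 0) (_ : (fun N => `|ep N| * j%:R) @ \oo --> (0 : R))).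
      near=> N; rewrite le_min !mulr_ge0//= ge_min lexx//.
    by rewrite -(mul0r j%:R); apply: cvgM => //; exact: cvg_cst.
have sg : summ (fun m => m.+1%:R * g m) /\ (fun N => rsum (fun m => m.+1%:R * f N m)) @ \oo --> rsum (fun m => m.+1%:R * g m).
  split; last first.
    apply: (@rsum_cvg _ _ _ _ _ _ _ (fun m => m.+1%:R * F m)) => //.
      by near=> N => m; rewrite normrM ger0_norm// ler_wpM2l.
    by move=> m; apply: cvgM; [exact: cvg_cst|exact: fg].
  apply: summ_le sF => m; rewrite normrM ger0_norm// ler_wpM2l//.
  by apply: (ler_cvg_to (cvg_norm (@fg m)) (cvg_cst (F m))); near=> N.
have hh_cvg : (fun N => hh (f N) (f1 N)) @ \oo --> h.
  apply: cvgD sg.2; rewrite -[X in _ --> X]subr0; apply: cvgB => //; exact: cvg_cst.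
have h34 : 3 / 4 <= h.
  have : `|rsum (fun m => m.+1%:R * g m)| <= 4^-1.
    apply: (ler_cvg_to (cvg_norm sg.2) (cvg_cst (4^-1 : R))); near=> N.
    apply: le_trans (ler_rsum_sup _ sF) F14 => m.
    by rewrite normrM ger0_norm// ler_wpM2l.
  by rewrite /h ler_norml => /andP[? _]; lra.
have hn : h != 0 by apply/eqP; lra.
have JE : \forall N \near \oo, rsum (JJ (f N) (f1 N)) = (hh (f N) (f1 N))^-1.
  near=> N; have e4 : `|eps (f N) (f1 N)| <= 4^-1 by near: N; exact: ep4.
  have e := hhJ F0 sF F14 (fF N) e4.
  apply: (mulIf (x := hh (f N) (f1 N))).
    by apply/eqP => z; move: e; rewrite z mulr0; lra.
  rewrite e mulVf//; apply/eqP => z; move: e; rewrite z mulr0; lra.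
have Jc : (fun N => rsum (JJ (f N) (f1 N))) @ \oo --> h^-1.
  have H : (fun N => (hh (f N) (f1 N))^-1) @ \oo --> h^-1 by exact: cvgV.
  apply: cvg_trans H; apply: near_eq_cvg; near=> N.
  by rewrite -(near JE N).
have qc : (fun N => qq (f N) (f1 N) ^+ N) @ \oo --> expR (t / h).
  apply: expn_cvg; under eq_fun do rewrite mulrA; exact: cvgM.
have pc : (fun N => qq (f N) (f1 N) ^+ N * pp (f N) (u N) (f1 N) N) @ \oo --> (1 : R).
  have b : (fun N => 2 * C * C * (`|ep N| * N%:R * om1 F (f N) (f1 N) + om3 F (f N) (f1 N) N)) @ \oo --> (0 : R).
    rewrite -(mulr0 (2 * C * C)); apply: cvgM; first exact: cvg_cst.
    rewrite -(addr0 0); apply: cvgD => //.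
    rewrite -(mulr0 `|t|); apply: cvgM => //.
    rewrite (_ : (fun N : nat => `|ep N| * N%:R) = (fun N : nat => `|N%:R * ep N|)); first exact: cvg_norm.
    by apply/funext => N; rewrite mulrC normrM normr_nat.
  have c : (fun N => 1 - ep N) @ \oo --> (1 : R).
    by rewrite -[X in _ --> X]subr0; apply: cvgB => //; exact: cvg_cst.
  rewrite -[X in _ --> X]add0r.
  have H : (fun N => qq (f N) (f1 N) ^+ N * pp (f N) (u N) (f1 N) N - (1 - ep N)) @ \oo --> (0 : R); last first.
    have H2 : (fun N => (qq (f N) (f1 N) ^+ N * pp (f N) (u N) (f1 N) N - (1 - ep N)) + (1 - ep N)) @ \oo --> (0 + 1 : R).
      exact: cvgD.
    by apply: cvg_trans H2; apply: near_eq_cvg; near=> N; rewrite subrK.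
  apply/cvgr0Pnorm_le => e e0; move/cvgr0_norm_le : b => /(_ e e0) b; near=> N.
  have e4 : `|eps (f N) (f1 N)| <= 4^-1 by near: N; exact: ep4.
  have bc : Bn (f N) (f1 N) N <= C by near: N; exact: BC.
  apply: le_trans (pp_main F0 sF F14 (fF N) (u0 N) (uS N) e4 bc) _.
  by apply: le_trans (ler_norm _) _; near: N.
have pc' : (fun N => pp (f N) (u N) (f1 N) N) @ \oo --> expR (- (t / h)).
  rewrite expRN; have en : expR (t / h) != 0 by rewrite gt_eqF// expR_gt0.
  have H : (fun N => (qq (f N) (f1 N) ^+ N)^-1 * (qq (f N) (f1 N) ^+ N * pp (f N) (u N) (f1 N) N)) @ \oo -->
      (expR (t / h))^-1.
    by rewrite -[X in _ --> X]mulr1; apply: cvgM => //; exact: cvgV.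
  apply: cvg_trans H; apply: near_eq_cvg; near=> N.
  rewrite mulrA mulVf ?mul1r//; apply: expf_neq0.
  have e4 : `|eps (f N) (f1 N)| <= 4^-1 by near: N; exact: ep4.
  have := JJ_rsum F0 sF F14 (fF N) e4; rewrite /qq => hJ.
  have : `|eps (f N) (f1 N) * rsum (JJ (f N) (f1 N))| <= 4^-1 * 2 by rewrite normrM ler_pM.
  by rewrite ler_norml => /andP[? ?]; apply/eqP; lra.
have ec : (fun N => err (f N) (u N) (f1 N) N) @ \oo --> (0 : R).
  have b : (fun N => 2 * C * (om1 F (f N) (f1 N) + om2 F N)) @ \oo --> (0 : R).
    rewrite -(mulr0 (2 * C)); apply: cvgM; first exact: cvg_cst.
    by rewrite -(addr0 0); apply: cvgD.
  apply/cvgr0Pnorm_le => e e0; move/cvgr0_norm_le : b => /(_ e e0) b; near=> N.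
  have e4 : `|eps (f N) (f1 N)| <= 4^-1 by near: N; exact: ep4.
  have bc : Bn (f N) (f1 N) N <= C by near: N; exact: BC.
  apply: le_trans (err_bound F0 sF F14 (fF N) (u0 N) (uS N) e4 bc (leqnn N)) _.
  by apply: le_trans (ler_norm _) _; near: N.
have H : (fun N => err (f N) (u N) (f1 N) N + rsum (JJ (f N) (f1 N)) * pp (f N) (u N) (f1 N) N) @ \oo -->
    h^-1 * expR (- (t / h)).
  by rewrite -[X in _ --> X]add0r; apply: cvgD => //; exact: cvgM.
by apply: cvg_trans H; apply: near_eq_cvg; near=> N; rewrite /err subrK.
Unshelve. all: by end_near.
Qed.
End RenewalLimit.

(** * The lace expansion coefficients *)

Section HitMass.
Variables (R : realType) (V : zmodType) (D : V -> enn R).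
Local Notation E := (enn R).

Lemma Hit_tsum n (A T : seq V) u (phi : nat -> seq V -> V -> V -> E) :
  tsum (fun x => Hit D n A T u (fun m' T' u' => phi m' T' u' x)) =
  Hit D n A T u (fun m' T' u' => tsum (phi m' T' u')).
Proof.
elim: n T u => [|n IH] T u /=; first exact: tsum0.
rewrite tsum_swap; apply: eq_tsum => y; rewrite tsumZl; congr (_ * _).
by case: (y \in A).
Qed.

Hypothesis D1 : tsum D = 1.

Lemma Hit_const n (A T : seq V) u (phi : nat -> seq V -> V -> E) :
  (forall m T' u', phi m T' u' <<= 1) -> Hit D n A T u phi <<= 1.
Proof.
move=> h; elim: n T u => [|n IH] T u /=; first exact: ele0.
apply: (ele_trans (tsum (fun y => D (y - u)))).
  apply: le_tsum => y; rewrite -[X in _ <<= X]mulr1; apply: eleM.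
    by rewrite mulrC ele_bool.
  by case: (y \in A).
by rewrite -(tsum_subr u D) D1.
Qed.

(** Crude bounds without z: they make every single coefficient finite and summable before anything
    is known about convergence of the series. *)
Lemma Qw_mass N m (A : seq V) u : tsum (Qw D N m A u) <<= 1.
Proof.
elim: N m A u => [|N IH] m A u /=.
  apply: (ele_trans (tsum (fun x => (x == u)%:R * 1))); last by rewrite (tsum_delta u (fun=> 1)).
  by apply: le_tsum => x; rewrite mulr1 [u == x]eq_sym; case: (x == u); case: (m == 0%N); rewrite ?ele0 ?elexx.
rewrite (Hit_tsum m A [::] u (fun m' T' u' x => Qw D N m' T' u' x)).
by apply: Hit_const => m' T' u'; exact: IH.
Qed.

Lemma Pw_mass N m : tsum (Pw D N m) <<= 1.
Proof.
rewrite /Pw tsum_swap; apply: (ele_trans (tsum (fun y => D y * 1))).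
  by apply: le_tsum => y; rewrite tsumZl; apply: eleMl; exact: Qw_mass.
by rewrite tsumZr D1 mulr1.
Qed.

Lemma cw_mass n : tsum (cw D n) <<= 1.
Proof.
elim: n => [|n IH].
  apply: (ele_trans (tsum (fun x : V => (x == 0)%:R * 1))); last by rewrite (tsum_delta 0 (fun=> 1)).
  by apply: le_tsum => x; rewrite mulr1 cw0.
apply: (ele_trans (tsum (fun x => tsum (fun y => D y * cw D n (x - y))))).
  by apply: le_tsum => x; exact: cwS.
rewrite tsum_swap; apply: (ele_trans (tsum (fun y => D y * 1))).
  by apply: le_tsum => y; rewrite tsumZl -(tsum_subr y (cw D n)); exact: eleMl.
by rewrite tsumZr D1 mulr1.
Qed.

Lemma Pt_finite m x : Pt D m x = \sum_(N < m) Pw D N.+1 m x.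
Proof.
rewrite /Pt -(tsum_nat_fin (fun N => Pw D N.+1 m x)); apply: eq_tsum => N.
case: ltnP => h; first by rewrite mul1r.
by rewrite mul0r Pw_eq0// ltnS (leq_trans (leq_pred m)).
Qed.

Lemma Pt_mass m : tsum (Pt D m) <<= m%:R.
Proof.
under eq_tsum => x do rewrite Pt_finite.
rewrite tsum_big -[m in m%:R]card_ord -sumr_const.
by apply: ele_sum => N _; exact: Pw_mass.
Qed.
End HitMass.

Section Lace.
Variables (R : realType) (d : nat).
Local Notation V := 'rV[int]_d.
Local Notation E := (enn R).
Variable Dr : V -> R.
Hypotheses (Dr0 : forall x, 0 <= Dr x) (sD : summ Dr) (D1 : rsum Dr = 1).
Hypotheses (D00 : Dr 0 = 0) (Dsym : forall x, Dr (- x) = Dr x).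

Definition De (x : V) : E := ofR (Dr x).

Lemma De_sym x : De (- x) = De x. Proof. by rewrite /De Dsym. Qed.
Lemma De1 : tsum De = 1.
Proof.
move: D1; rewrite rsum_ge0E// => h.
by rewrite -ofR1 -h toRK// -summ_ge0E.
Qed.
Lemma De0 : De 0 = 0. Proof. by rewrite /De D00 ofR0. Qed.

Definition cr (n : nat) (x : V) : R := toR (cw De n x).
(** The term N has N + 1 loops. Each piece takes at least one step, so terms with N >= m vanish and
    the sum is finite. *)
Definition pir (m : nat) (x : V) : R := \sum_(N < m) (-1) ^+ N.+1 * toR (Pw De N.+1 m x).

Lemma cw_fin n x : efin (cw De n x).
Proof. by apply: (efin_tsum x); apply: efin_le (cw_mass De1 n) _. Qed.
Lemma Pw_fin N m x : efin (Pw De N m x).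
Proof. by apply: (efin_tsum x); apply: efin_le (Pw_mass De1 N m) _. Qed.
Lemma cr_ge0 n x : 0 <= cr n x. Proof. exact: toR_ge0. Qed.
Lemma cr_sym n x : cr n (- x) = cr n x.
Proof. by rewrite /cr cw_sym//; exact: De_sym. Qed.
Lemma summ_cr n : summ (cr n).
Proof. by apply: summ_toR; apply: efin_le (cw_mass De1 n) _. Qed.
Lemma pir_le m x : ofR `|pir m x| <<= Pt De m x.
Proof.
rewrite Pt_finite//; apply: (ele_trans (ofR (\sum_(N < m) toR (Pw De N.+1 m x)))).
  apply: ele_ofR; apply: le_trans (ler_norm_sum _ _ _) _; apply: ler_sum => N _.
  by rewrite normrM normrX normrN1 expr1n mul1r ger0_norm// toR_ge0.
rewrite ofR_sum; last by move=> *; exact: toR_ge0.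
by apply: ele_sum => N _; rewrite toRK// Pw_fin.
Qed.
Lemma summ_pir m : summ (pir m).
Proof.
apply: efin_le (efin_le (Pt_mass De1 m) _); last by [].
by apply: le_tsum => x; exact: pir_le.
Qed.

Lemma pir_ext K m x : (m <= K)%N -> pir m x = \sum_(N < K) (-1) ^+ N.+1 * toR (Pw De N.+1 m x).
Proof.
move=> mK; rewrite /pir (big_ord_widen K (fun N : nat => (-1) ^+ N.+1 * toR (Pw De N.+1 m x)) mK).
rewrite big_mkcond; apply: eq_bigr => N _; case: ltnP => // h.
by rewrite Pw_eq0 ?ltnS ?(leq_trans (leq_pred m))// toR0 mulr0.
Qed.

Lemma zconv_toR (p q : V -> E) x : efin (tsum p) -> (forall y, q y <<= 1) ->
  toR (tsum (fun y => p y * q (x - y))) = zconv (fun y => toR (p y)) (fun y => toR (q y)) x.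
Proof.
move=> fp q1; rewrite /zconv -[RHS]/(rsum _).
have fq y : efin (q y) by exact: efin_le (q1 y) _.
rewrite -rsum_toR; last first.
  apply: efin_le fp; apply: le_tsum => y; rewrite -[X in _ <<= X]mulr1; exact: eleMl.
by apply: eq_rsum => y; rewrite toRM// (efin_tsum y fp).
Qed.

(** Telescoping: c_(n+1) is the remainder of order 0 by [PR0], and [Pw_conv] replaces a remainder by
    a convolution minus the next remainder. Order 0 contributes D * c_n; the remainder of order n +
    2 vanishes because every hit takes a step. *)
Lemma lace_real n x : cr n.+1 x = zconv Dr (cr n) x +
   \sum_(2 <= m < n.+2) zconv (pir m) (cr (n.+1 - m)) x.
Proof.
have cwle m y : cw De m y <<= 1 by apply: ele_trans (cw_mass De1 m); exact: tsum_ge1.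
have PRle N : efin (PR De N n x) /\ efin (PR De N.+1 n x).
  have : efin (PR De N n x + PR De N.+1 n x).
    rewrite -(Pw_conv De N n x); apply: efin_sum => m _.
    apply: (@efin_le _ _ 1) => //; apply: ele_trans (Pw_mass De1 N m.+1); apply: le_tsum => v.
    by rewrite -[X in _ <<= X]mulr1; exact: eleMl.
  by move=> h; split; apply: efin_le h; [exact: eleDl|exact: eleDr].
pose cn N := \sum_(m < n.+1) zconv (fun y => toR (Pw De N m.+1 y)) (cr (n - m)) x.
have cnE N : cn N = toR (PR De N n x) + toR (PR De N.+1 n x).
  have [h1 h2] := PRle N; rewrite -toRD// -(Pw_conv De N n x) toR_sum; last first.
    move=> m _; apply: (@efin_le _ _ 1) => //; apply: ele_trans (Pw_mass De1 N m.+1).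
    by apply: le_tsum => v; rewrite -[X in _ <<= X]mulr1; exact: eleMl.
  apply: eq_bigr => m _; rewrite zconv_toR//; exact: efin_le (Pw_mass De1 N m.+1) _.
have alt K : cr n.+1 x = \sum_(N < K) (-1) ^+ N * cn N + (-1) ^+ K * toR (PR De K n x).
  elim: K => [|K IH]; first by rewrite big_ord0 add0r mul1r /cr PR0// De0.
  by rewrite big_ord_recr /= IH cnE exprS; ring.
rewrite (alt n.+2) PR_eq0// toR0 mulr0 addr0 big_ord_recl mul1r.
congr (_ + _).
  rewrite /cn big_ord_recl subn0 /= big1 ?addr0.
    rewrite (_ : (fun y => toR (Pw De 0 1 y)) = Dr)//.
    by apply/funext => y; rewrite Pw0 mul1r ofRK.
  move=> m _; rewrite /zconv -[LHS]/(rsum _) -[RHS](rsum0 R V); apply: eq_rsum => y.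
  by rewrite Pw0 mul0r toR0 mul0r.
have zl (I : Type) (r : seq I) (c : I -> R) (f : I -> V -> R) (g : V -> R) :
    (forall i, summ (f i)) -> summ g ->
    zconv (fun y => \sum_(i <- r) c i * f i y) g x = \sum_(i <- r) c i * zconv (f i) g x.
  move=> sf sg; rewrite /zconv /zsum.
  under [RHS]eq_bigr => i _ do rewrite -[usum _ _]/(rsum _) -rsumZ.
  rewrite -rsum_big; last by move=> i _; apply: summZ; exact: summ_conv_inner.
  by apply: eq_rsum => y; rewrite mulr_suml; apply: eq_bigr => i _; rewrite mulrA.
rewrite big_add1 /= big_add1 /= big_mkord.
transitivity (\sum_(N < n.+1) \sum_(m < n.+1) (-1) ^+ N.+1 * zconv (fun y => toR (Pw De N.+1 m.+1 y)) (cr (n - m)) x).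
  by apply: eq_bigr => N _; rewrite mulr_sumr.
rewrite exchange_big big_ord_recl /= big1 ?add0r; last first.
  move=> N _; rewrite (_ : zconv _ _ x = 0) ?mulr0//.
  rewrite /zconv -[LHS]/(rsum _) -[RHS](rsum0 R V); apply: eq_rsum => y.
  by rewrite Pw_eq0// toR0 mul0r.
apply: eq_bigr => m _; rewrite /bump /= add1n subSS.
rewrite -(zl _ _ (fun N : 'I_n.+1 => (-1) ^+ N.+1) (fun N y => toR (Pw De N.+1 m.+2 y))); first last.
- exact: summ_cr.
- by move=> N; apply: summ_toR; exact: efin_le (Pw_mass De1 N.+1 m.+2) _.
rewrite (_ : (fun y => _) = pir m.+2)//; apply/funext => y.
by rewrite (@pir_ext n.+1)//; have := ltn_ord m.
Qed.

Definition Dh k : R := ct Dr k.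
Definition ch n k : R := ct (cr n) k.
Definition ph_ m k : R := ct (pir m) k.

Lemma lace_fourier n k : ch n.+1 k = Dh k * ch n k + \sum_(2 <= m < n.+2) ph_ m k * ch (n.+1 - m) k.
Proof.
rewrite {1}/ch (_ : cr n.+1 = fun x => zconv Dr (cr n) x + \sum_(2 <= m < n.+2) zconv (pir m) (cr (n.+1 - m)) x); last first.
  by apply/funext => x; exact: lace_real.
have sz m j : summ (zconv (pir m) (cr j)) by apply: summ_conv; [exact: summ_pir|exact: summ_cr].
rewrite ctD; [|by apply: summ_conv => //; exact: summ_cr|by apply: summ_big => m _; exact: sz].
rewrite ct_conv//; [|exact: summ_cr|exact: cr_sym]; congr (_ + _).
rewrite /ct; under eq_rsum => x do rewrite mulr_suml.
rewrite rsum_big; last by move=> m _; exact: summ_cos.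
by apply: eq_bigr => m _; rewrite -[LHS]/(ct _ k) ct_conv//; [exact: summ_pir|exact: summ_cr|exact: cr_sym].
Qed.

Lemma ch0 k : ch 0 k = 1.
Proof.
rewrite /ch (_ : cr 0 = fun x => (x == 0)%:R) ?ct_delta//.
apply/funext => x; rewrite /cr cw0; by rewrite -ofR_nat ofRK.
Qed.

Lemma lace_renewal (z : R) n k : z ^+ n.+1 * ch n.+1 k =
  cv (fw (fun m => z ^+ m.+2 * ph_ m.+2 k) (z * Dh k)) (fun n => z ^+ n * ch n k) n.
Proof.
rewrite lace_fourier /cv big_ord_recl subn0 /= mulrDr exprS; congr (_ + _); first by ring.
rewrite big_add1 big_add1 /= big_mkord mulr_sumr; apply: eq_bigr => m _.
rewrite /bump /= add1n subSS.
have h : (n.+1 = m.+2 + (n - m.+1))%N by rewrite addSn subnKC.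
rewrite -exprS {1}h exprD; ring.
Qed.
End Lace.

(** * Convergence of the expansion *)

Section GenFun.
Variables (R : realType) (d : nat).
Local Notation V := 'rV[int]_d.
Implicit Types (x y : V) (k l : 'rV[R]_d).

Lemma ct_gen (a : nat -> V -> R) k : efin (tsum (fun x => asum (a^~ x))) ->
  [/\ summ (fun x => rsum (a^~ x)), summ (fun n => ct (a n) k) &
      ct (fun x => rsum (a^~ x)) k = rsum (fun n => ct (a n) k)].
Proof.
move=> h.
have h' : efin (tsum (fun x => asum (fun n : nat => a n x * cos (ph k x)))).
  apply: efin_le h; apply: le_tsum => x; apply: le_tsum => n; apply: ele_ofR.
  by rewrite normrM ler_piMr// normr_cos.
have h'' : efin (tsum (fun n => asum (fun x => a n x * cos (ph k x)))).
  by rewrite /asum tsum_swap.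
split; first exact: summ_outer h.
  exact: (summ_outer h'').
rewrite /ct -(rsum_swap h'); apply: eq_rsum => x.
by rewrite mulrC -rsumZ; apply: eq_rsum => n; rewrite mulrC.
Qed.

Lemma cos_addl (t u : R) : (cos (t + u) + cos (t - u)) / 2 = cos t * cos u.
Proof. by rewrite cosD cosB; field. Qed.

Lemma ct_shift2 (g : V -> R) l k : summ g ->
  (ct g (l + k) + ct g (l - k)) / 2 = ct (fun x => g x * cos (ph k x)) l.
Proof.
move=> sg; rewrite /ct -rsumD; [|exact: summ_cos|exact: summ_cos].
rewrite mulrC -rsumZ; apply: eq_rsum => x.
by rewrite !phDl phNl -mulrA [cos (ph k x) * _]mulrC -cos_addl; field.
Qed.

Lemma ct_sub (g : V -> R) y l : summ g -> (forall v, g (- v) = g v) ->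
  ct (fun v => g (v - y)) l = cos (ph l y) * ct g l.
Proof.
move=> sg ge; rewrite /ct -(rsum_sub (- y)).
rewrite (eq_rsum (g := fun v => cos (ph l y) * (g v * cos (ph l v)) - sin (ph l y) * (g v * sin (ph l v)))).
  rewrite rsumB; [|by apply/summZ/summ_cos|by apply/summZ/summ_sin].
  by rewrite !rsumZ even_sin// mulr0 subr0.
by move=> v; rewrite opprK addrK phD cosD; ring.
Qed.

(** [ct_pos] is applied to M minus the mean of the translates of g by x and - x, whose transform
    M^(l) - cos(l.x) g^(l) is non-negative. *)
Lemma ct_dom (g M : V -> R) x : summ g -> summ M -> (forall y, g (- y) = g y) ->
  (forall l, `|ct g l| <= ct M l) -> g x <= M 0.
Proof.
move=> sg sM ge h.
have sgx (y : V) : summ (fun v => g (v + y)).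
  by have := summ_sub (- y) sg; under eq_summ => v do rewrite opprK.
have Es l : ct (fun v => 2^-1 * (g (v + x) + g (v - x))) l = cos (ph l x) * ct g l.
  rewrite ctZ ctD; [|exact: sgx|exact: summ_sub].
  rewrite ct_sub// (_ : (fun v => g (v + x)) = fun v => g (v - - x)); last by apply/funext => v; rewrite opprK.
  by rewrite ct_sub// phN cosN; field.
have := @ct_pos R d (fun v => M v - 2^-1 * (g (v + x) + g (v - x))).
rewrite add0r sub0r ge => /(_ _ _)/= P; rewrite -subr_ge0.
have -> : M 0 - g x = M 0 - 2^-1 * (g x + g x) by field.
apply: P.
  by apply: summB => //; apply: summZ; apply: summD => //; exact: summ_sub.
move=> l; rewrite ctB//; last by apply: summZ; apply: summD => //; exact: summ_sub.
rewrite Es subr_ge0; apply: le_trans (h l); apply: le_trans (ler_norm _) _.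
by rewrite normrM ler_piMl// normr_cos.
Qed.

(** The sum of w (s p + t q)^2 is non-negative at s = Q, t = - A; if Q = 0, another choice of s and
    t excludes A <> 0. *)
Lemma rsum_CS (T : choiceType) (w p q : T -> R) : (forall x : T, 0 <= w x) -> summ w ->
  (forall x : T, `|p x| <= 1) -> (forall x : T, `|q x| <= 1) ->
  rsum (fun x : T => w x * (p x * q x)) ^+ 2 <=
  rsum (fun x : T => w x * p x ^+ 2) * rsum (fun x : T => w x * q x ^+ 2).
Proof.
move=> w0 sw p1 q1.
have sm (f : T -> R) : (forall x : T, `|f x| <= 1) -> summ (fun x : T => w x * f x).
  by move=> hf; apply: summ_le sw => x; rewrite normrM (ger0_norm (w0 x)) ler_piMr.
have s2 (f : T -> R) : (forall x : T, `|f x| <= 1) -> summ (fun x : T => w x * f x ^+ 2).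
  by move=> hf; apply: sm => x; rewrite normrX exprn_ile1.
have spq : summ (fun x : T => w x * (p x * q x)).
  by apply: sm => x; rewrite normrM mulr_ile1.
set A := rsum _; set P := rsum _; set Q := rsum (fun x : T => w x * q x ^+ 2).
have P0 : 0 <= P by apply: rsum_ge0 => x; rewrite mulr_ge0// sqr_ge0.
have Q0 : 0 <= Q by apply: rsum_ge0 => x; rewrite mulr_ge0// sqr_ge0.
have key (s t : R) : 0 <= s ^+ 2 * P + 2 * s * t * A + t ^+ 2 * Q.
  rewrite -!rsumZ -rsumD; [|by apply/summZ/s2|by apply: summZ].
  rewrite -rsumD; [|by apply: summD; apply: summZ; [exact: s2|]|by apply/summZ/s2].
  apply: rsum_ge0 => x.
  rewrite (_ : _ + _ = w x * (s * p x + t * q x) ^+ 2); last by ring.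
  by rewrite mulr_ge0// sqr_ge0.
have [Q00|Qp] := eqVneq Q 0.
  have [->|A0] := eqVneq A 0; first by rewrite expr0n mulr_ge0.
  have := key 1 (- (P + 1) / (2 * A)); rewrite Q00 mulr0 addr0.
  by rewrite (_ : _ + _ = -1); [rewrite ler0N1|field].
have := key Q (- A).
rewrite (_ : _ + _ = Q * (P * Q - A ^+ 2)); last by ring.
by rewrite pmulr_rge0 ?subr_ge0// lt_def Qp.
Qed.
End GenFun.

Section Bootstrap.
Variables (R : realType) (d : nat).
Local Notation V := 'rV[int]_d.
Local Notation E := (enn R).
Implicit Types (k l : 'rV[R]_d).
Variable Dr : V -> R.
Hypotheses (Dr0 : forall x, 0 <= Dr x) (sD : summ Dr) (D1 : rsum Dr = 1).
Hypotheses (D00 : Dr 0 = 0) (Dsym : forall x, Dr (- x) = Dr x).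
Local Notation De := (De Dr).
Local Notation Dh := (Dh Dr).

Definition sk k : R := 1 - Dh k.

Lemma skE k : sk k = rsum (fun x => Dr x * (1 - cos (ph k x))).
Proof.
rewrite /sk -[X in X - _]D1 -rsumB//; last exact: summ_cos.
by apply: eq_rsum => x; rewrite mulrBr mulr1.
Qed.

Lemma Dh_le1 k : `|Dh k| <= 1.
Proof.
apply: le_trans (ct_norm k sD) _; rewrite (eq_rsum (g := Dr)) ?D1// => x.
by rewrite ger0_norm.
Qed.

Lemma sk_bnd k : 0 <= sk k <= 2.
Proof. by move: (Dh_le1 k); rewrite /sk ler_norml => /andP[? ?]; apply/andP; split; lra. Qed.

Definition Cn n : E := tsum (cw De n).
Definition chi (z : R) : E := tsum (fun n => ofR z ^+ n * Cn n).
Definition Gr (z : R) x : R := toR (Gf De (ofR z) x).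
Definition Pir (z : R) x : R := rsum (fun m => z ^+ m.+2 * pir Dr m.+2 x).
(** The reciprocal of the transform of the two-point function, see [GF1]. *)
Definition FF (z : R) k : R := 1 - z * Dh k - ct (Pir z) k.

Lemma chiE z : chi z = tsum (Gf De (ofR z)).
Proof. by rewrite /Gf tsum_swap; apply: eq_tsum => n; rewrite tsumZl. Qed.

Section FixedZ.
Variable z : R.
Hypothesis z0 : 0 <= z.

Lemma Pir_le x : ofR `|Pir z x| <<= tsum (fun m => ofR z ^+ m * Pt De m x).
Proof.
have [h|h] := boolP (efin (tsum (fun m => ofR z ^+ m * Pt De m x))); last first.
  case: (ele_total (tsum (fun m => ofR z ^+ m * Pt De m x)) (ofR `|Pir z x|)) => // h'.
  by rewrite (efin_le h') in h.
rewrite -[X in _ <<= X]toRK//; apply: ele_ofR.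
have hm m : ofR `|z ^+ m.+2 * pir Dr m.+2 x| <<= ofR z ^+ m.+2 * Pt De m.+2 x.
  rewrite normrM normrX (ger0_norm z0) ofRM ?exprn_ge0// ofRX//; apply: eleMl.
  exact: pir_le.
have hs : asum (fun m => z ^+ m.+2 * pir Dr m.+2 x) <<= tsum (fun m => ofR z ^+ m * Pt De m x).
  apply: (ele_trans (tsum (fun m => ofR z ^+ m.+2 * Pt De m.+2 x))); first exact: le_tsum.
  by apply: (@tsum_inj_le _ _ _ (fun m => m.+2) (fun m => ofR z ^+ m * Pt De m x)) => i j [].
apply: le_trans (ler_norm_rsum _) _; first exact: efin_le hs h.
by rewrite rsum_abs; exact: toR_mono.
Qed.

Section Fin.
Hypothesis fP : efin (tsum (fun x => tsum (fun m => ofR z ^+ m * Pt De m x))).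

Lemma fPi : efin (tsum (fun x => asum (fun m => z ^+ m.+2 * pir Dr m.+2 x))).
Proof.
apply: efin_le fP; apply: le_tsum => x.
apply: (ele_trans (tsum (fun m => ofR z ^+ m.+2 * Pt De m.+2 x))).
  apply: le_tsum => m.
  rewrite normrM normrX (ger0_norm z0) ofRM ?exprn_ge0// ofRX//; apply: eleMl.
  exact: pir_le.
by apply: (@tsum_inj_le _ _ _ (fun m => m.+2) (fun m => ofR z ^+ m * Pt De m x)) => i j [].
Qed.

Lemma summ_Pir : summ (Pir z).
Proof. by have [] := @ct_gen R d (fun m x => z ^+ m.+2 * pir Dr m.+2 x) 0 fPi. Qed.

Lemma ct_Pir k : summ (fun m => z ^+ m.+2 * ph_ Dr m.+2 k) /\
  ct (Pir z) k = rsum (fun m => z ^+ m.+2 * ph_ Dr m.+2 k).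
Proof.
have [_ h1 h2] := @ct_gen R d (fun m x => z ^+ m.+2 * pir Dr m.+2 x) k fPi.
split; first by apply: etrans h1; apply: eq_summ => m; rewrite ctZ.
by rewrite h2; apply: eq_rsum => m; rewrite ctZ.
Qed.

Lemma FF_split k : FF z k = FF z 0 + rsum (fun x => (z * Dr x + Pir z x) * (1 - cos (ph k x))).
Proof.
have sP := summ_Pir.
have -> : rsum (fun x => (z * Dr x + Pir z x) * (1 - cos (ph k x))) =
   (z + rsum (Pir z)) - (z * Dh k + ct (Pir z) k).
  have sz : summ (fun x => z * Dr x) by exact: summZ.
  have -> : z + rsum (Pir z) = rsum (fun x => z * Dr x + Pir z x) by rewrite (rsumD sz sP) rsumZ D1 mulr1.
  have hc := ctD k sz sP; rewrite ctZ in hc.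
  rewrite /Dh -hc /ct -(rsumB (summD sz sP) (summ_cos k (summD sz sP))).
  by apply: eq_rsum => x; ring.
by rewrite /FF ct0 /Dh ct0 D1; ring.
Qed.

Hypothesis fchi : efin (chi z).

Lemma fG : efin (tsum (fun x => asum (fun n => z ^+ n * cr Dr n x))).
Proof.
apply: efin_le fchi; rewrite chiE; apply: le_tsum => x; apply: le_tsum => n.
rewrite ger0_norm ?mulr_ge0 ?exprn_ge0 ?cr_ge0// ofRM ?exprn_ge0 ?cr_ge0// ofRX//.
by rewrite toRK ?elexx// cw_fin.
Qed.

Lemma Gr_fin x : efin (Gf De (ofR z) x).
Proof. by apply: (efin_tsum x); rewrite -chiE. Qed.

Lemma GrE x : Gr z x = rsum (fun n => z ^+ n * cr Dr n x).
Proof.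
rewrite /Gr /Gf -rsum_toR; last exact: Gr_fin.
apply: eq_rsum => n; rewrite toRM ?cw_fin//; first by rewrite -ofRX// ofRK// exprn_ge0.
by rewrite -ofRX.
Qed.

Lemma summ_Gr : summ (Gr z).
Proof. by apply: summ_toR; rewrite -chiE. Qed.

Lemma Gr_sym x : Gr z (- x) = Gr z x.
Proof. by rewrite /Gr Gf_sym//; exact: De_sym. Qed.

Lemma ct_Gr k : summ (fun n => z ^+ n * ch Dr n k) /\
  ct (Gr z) k = rsum (fun n => z ^+ n * ch Dr n k).
Proof.
have [_ h1 h2] := @ct_gen R d (fun n x => z ^+ n * cr Dr n x) k fG.
split; first by apply: etrans h1; apply: eq_summ => n; rewrite ctZ.
rewrite -[LHS]/(ct (fun x => Gr z x) k) (_ : (fun x => Gr z x) = fun x => rsum (fun n => z ^+ n * cr Dr n x)).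
  by rewrite h2; apply: eq_rsum => m; rewrite ctZ.
by apply/funext => x; rewrite GrE.
Qed.

(** The renewal equation summed over n reads G = 1 + (z D + Pi) G for the transforms. *)
Lemma GF1 k : ct (Gr z) k * FF z k = 1.
Proof.
have [sg ->] := ct_Gr k; have [sp pE] := ct_Pir k.
set g := fun n => z ^+ n * ch Dr n k.
set f := fun m => z ^+ m.+2 * ph_ Dr m.+2 k.
have sf : summ (fw f (z * Dh k)).
  rewrite /summ /asum tsum_natS; apply: efinD => //.
have [_ hc] := rsum_cv sf sg.
have gS n : g n.+1 = cv (fw f (z * Dh k)) g n by exact: lace_renewal.
have := rsum_natS sg; rewrite -/g (eq_rsum gS) hc /g expr0 mul1r ch0.
rewrite (rsum_natS sf) /= -/f -/g -pE /FF => h.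
by move: h; set G := rsum g; set p := ct _ _; set t := Dh k => h; rewrite [LHS]mulrC; lra.
Qed.

Lemma FF0_gt0 : 0 < FF z 0.
Proof.
have := GF1 0; rewrite ct0 => h.
have g0 : 0 <= rsum (Gr z) by apply: rsum_ge0 => x; exact: toR_ge0.
rewrite lt_neqAle; apply/andP; split.
  by apply/eqP => h'; rewrite -h' mulr0 in h; lra.
have [//|hn] := leP 0 (FF z 0).
by have := mulr_ge0_le0 g0 (ltW hn); rewrite h; lra.
Qed.
End Fin.
End FixedZ.
End Bootstrap.

(** * The bootstrap *)

Section Trig.
Variable R : realType.
Lemma onemcos_ge0 (t : R) : 0 <= 1 - cos t.
Proof. by rewrite subr_ge0 cos_le1. Qed.

Lemma onemcosD (t u : R) : 1 - cos (t + u) <= 2 * ((1 - cos t) + (1 - cos u)).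
Proof.
have h (v : R) : 1 - cos (v *+ 2) = 2 * sin v ^+ 2.
  by rewrite cos_mulr2n sin2cos2; ring.
have -> : t + u = (t / 2 + u / 2) *+ 2 by rewrite mulr2n; field.
have -> : cos t = cos ((t / 2) *+ 2) by congr cos; rewrite mulr2n; field.
have -> : cos u = cos ((u / 2) *+ 2) by congr cos; rewrite mulr2n; field.
rewrite !h sinD.
set a := sin (t / 2); set b := sin (u / 2); set c := cos (t / 2); set e := cos (u / 2).
have ha : a ^+ 2 + c ^+ 2 = 1 by rewrite addrC cos2Dsin2.
have hb : b ^+ 2 + e ^+ 2 = 1 by rewrite addrC cos2Dsin2.
have : 0 <= (a * e - c * b) ^+ 2 by exact: sqr_ge0.
have : 0 <= (a * b) ^+ 2 by exact: sqr_ge0.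
nra.
Qed.

Lemma sin2_le (t : R) : sin t ^+ 2 <= 2 * (1 - cos t).
Proof.
have := sin2cos2 t; have := cos_le1 t; have := cos_geN1 t => h1 h2 ->.
nra.
Qed.

(** With e = (G + H)/2 - F and o = (G - H)/2 the difference is e p (q + r)/2 - o^2 p q r, where p,
    q, r are the reciprocals. Products are estimated by squares, because squares of resolvents are
    again transforms. *)
Lemma resolvent_diff (F G H : R) : 0 < F -> 0 < G -> 0 < H ->
  `|F^-1 - (G^-1 + H^-1) / 2| <=
  `|(G + H) / 2 - F| / 2 * (F^-1 ^+ 2 + (G^-1 ^+ 2 + H^-1 ^+ 2) / 2)
  + ((G - H) / 2) ^+ 2 * F^-1 * ((G^-1 ^+ 2 + H^-1 ^+ 2) / 2).
Proof.
move=> F0 G0 H0.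
set p := F^-1; set q := G^-1; set r := H^-1.
have p0 : 0 < p by rewrite invr_gt0.
have q0 : 0 < q by rewrite invr_gt0.
have r0 : 0 < r by rewrite invr_gt0.
set e := (G + H) / 2 - F; set o := (G - H) / 2.
have E : p - (q + r) / 2 = e * (p * (q + r) / 2) - o ^+ 2 * (p * q * r).
  by rewrite /p /q /r /e /o; field; rewrite !gt_eqF.
rewrite E; apply: le_trans (ler_normB _ _) _; apply: lerD.
  rewrite normrM (ger0_norm (x := p * (q + r) / 2)); last by rewrite divr_ge0// mulr_ge0 ?addr_ge0 ?ltW.
  rewrite -[leRHS]mulrA; apply: ler_wpM2l => //.
  have : 0 <= (p - q) ^+ 2 by exact: sqr_ge0.
  have : 0 <= (p - r) ^+ 2 by exact: sqr_ge0.
  nra.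
rewrite ger0_norm; last by rewrite mulr_ge0 ?sqr_ge0// !mulr_ge0 ?ltW.
have := sqr_ge0 o; move: (o ^+ 2) => o2 o20.
rewrite -!mulrA; apply: (ler_wpM2l o20); apply: (ler_wpM2l (ltW p0)).
have : 0 <= (q - r) ^+ 2 by exact: sqr_ge0.
by nra.
Qed.
(** Source of the constant 285: 16 (4.04)^2 + 1.01 is about 262. *)
Lemma boot_const (s p q : R) : 0 <= s * p -> 0 <= s * q ->
  101 / 100 * s * (p + q) + 16 * (404 / 100) ^+ 2 * s * q <= 285 * s * (p + q).
Proof. by move=> h1 h2; lra. Qed.
End Trig.

Section BootStep.
Variables (R : realType) (d : nat).
Local Notation V := 'rV[int]_d.
Local Notation E := (enn R).
Implicit Types (k l : 'rV[R]_d).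
Variable Dr : V -> R.
Hypotheses (Dr0 : forall x, 0 <= Dr x) (sD : summ Dr) (D1 : rsum Dr = 1).
Hypotheses (D00 : Dr 0 = 0) (Dsym : forall x, Dr (- x) = Dr x).
Local Notation De := (De Dr).
Local Notation Dh := (Dh Dr).
Local Notation sk := (sk Dr).
Local Notation chi := (chi Dr).
Local Notation Gr := (Gr Dr).
Local Notation Pir := (Pir Dr).
Local Notation FF := (FF Dr).

Definition oc k (x : V) : R := 1 - cos (ph k x).
Definition bub (z b : R) : Prop := tsum (fun x => Hf De (ofR z) x * Hf De (ofR z) x) <<= ofR (b ^+ 2).
Definition wbd (z W : R) : Prop := forall k x, ofR (oc k x) * Hf De (ofR z) x <<= ofR (sk k) * ofR W.

Lemma oc_ge0 k x : 0 <= oc k x. Proof. exact: onemcos_ge0. Qed.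
Lemma oc_le2 k x : oc k x <= 2.
Proof. by rewrite /oc; have := cos_geN1 (ph k x); lra. Qed.

Section FixedZ.
Variables (z b W W2 : R).
Hypotheses (z0 : 0 <= z) (b0 : 0 <= b) (bs : 100 * b <= 1) (W0 : 0 <= W).
Hypotheses (bW : 16 * b * W <= 1 / 100) (hW2 : 8 * 285 <= W2).
Hypotheses (HB : bub z b).

Let b16 : 16 * b <= 1. Proof. by move: bs b0; lra. Qed.
Local Notation Pia := (fun x => tsum (fun m => ofR z ^+ m * Pt De m x)).

Lemma Pi_sum : tsum Pia <<= ofR (2 * b * z).
Proof.
apply: (ele_trans _ (Pt_sum0 (De_sym Dsym) b0 b16 HB (De1 Dr0 sD D1))).
by rewrite -ofRM 1?mulrC// ?mulr_ge0// mulrC -ofRM// mulr_ge0.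
Qed.

Lemma Pi_efin : efin (tsum Pia).
Proof. exact: efin_ofR_le Pi_sum. Qed.

Lemma rsum_Pir : rsum (fun x => `|Pir z x|) <= 2 * b * z.
Proof.
rewrite rsum_abs; apply: toR_le; first by rewrite !mulr_ge0.
by apply: ele_trans Pi_sum; apply: le_tsum => x; exact: Pir_le.
Qed.

Hypothesis HW : wbd z W.

Lemma gW_Pir k x : ofR (oc k x) * tsum (fun m => ofR z ^+ m * Pt De m x) <<= ofR (sk k) * gW De (ofR z) (ofR W) x.
Proof.
apply: (gW_bound (De_sym Dsym) (wt := fun x => ofR (oc k x))) => //.
  by rewrite /oc ph0 cos0 subrr ofR0.
move=> v y; have vy0 := addr_ge0 (oc_ge0 k v) (oc_ge0 k y).
rewrite -(ofRD (oc_ge0 k v) (oc_ge0 k y)) -ofR_nat -ofRM//; rewrite /oc phD.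
by apply: ele_ofR; exact: onemcosD.
Qed.

Lemma gW_tsum : tsum (gW De (ofR z) (ofR W)) <<= ofR (z / 100).
Proof.
apply: (ele_trans _ (gW_sum b0 b16 HB (De1 Dr0 sD D1) (ofR W))).
have b16W : 0 <= 16 * b by rewrite mulr_ge0.
rewrite -(ofRM b16W W0) -(ofRM z0 (mulr_ge0 b16W W0)); apply: ele_ofR.
by move: bW z0; nra.
Qed.

Lemma Pir_W k : rsum (fun x => `|Pir z x| * oc k x) <= z / 100 * sk k.
Proof.
have /andP[s0 _] := sk_bnd Dr0 sD D1 k.
rewrite rsum_ge0E; last by move=> x; rewrite mulr_ge0 ?oc_ge0.
apply: toR_le; first by rewrite mulr_ge0 ?divr_ge0.
rewrite [X in ofR X]mulrC ofRM ?divr_ge0//.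
apply: (ele_trans (ofR (sk k) * tsum (gW De (ofR z) (ofR W)))); last by apply: eleMl; exact: gW_tsum.
rewrite -tsumZl; apply: le_tsum => x; apply: ele_trans (gW_Pir k x).
rewrite mulrC ofRM ?oc_ge0//; apply: eleMl; exact: Pir_le.
Qed.

Let sP : summ (Pir z). Proof. by apply: summ_Pir => //; exact: Pi_efin. Qed.
Let aa x := z * Dr x + `|Pir z x|.

Lemma saa : summ aa. Proof. by apply: summD; [exact: summZ|rewrite summ_abs]. Qed.
Lemma aa0 x : 0 <= aa x. Proof. by rewrite addr_ge0 ?mulr_ge0. Qed.
Lemma aa_le x : `|z * Dr x + Pir z x| <= aa x.
Proof. by apply: le_trans (ler_normD _ _) _; rewrite ger0_norm ?mulr_ge0. Qed.

Lemma summ_oc (f : V -> R) k : summ f -> summ (fun x => f x * oc k x).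
Proof.
move=> sf; rewrite (eq_summ (g := fun x => f x - f x * cos (ph k x))).
  by apply: summB => //; exact: summ_cos.
by move=> x; rewrite /oc mulrBr mulr1.
Qed.

Lemma aa_W k : rsum (fun x => aa x * oc k x) <= (101 / 100) * z * sk k.
Proof.
rewrite (eq_rsum (g := fun x => z * (Dr x * oc k x) + `|Pir z x| * oc k x)); last first.
  by move=> x; rewrite /aa; ring.
rewrite rsumD; [|by apply: summZ; exact: summ_oc|by apply: summ_oc; rewrite summ_abs].
rewrite rsumZ -skE//; have := Pir_W k; lra.
Qed.

Lemma FF_ge k : FF z 0 + (99 / 100) * z * sk k <= FF z k.
Proof.
rewrite (FF_split Dr0 sD D1 z0 Pi_efin k) lerD2l.
rewrite (eq_rsum (g := fun x => z * (Dr x * oc k x) + Pir z x * oc k x)); last first.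
  by move=> x; rewrite /oc; ring.
rewrite rsumD; [|by apply: summZ; exact: summ_oc|exact: summ_oc].
rewrite rsumZ -skE//.
have h : `|rsum (fun x => Pir z x * oc k x)| <= z / 100 * sk k.
  apply: le_trans (Pir_W k); apply: ler_rsum_sup; last by apply: summ_oc; rewrite summ_abs.
  by move=> x; rewrite normrM (ger0_norm (oc_ge0 k x)).
by move: h; rewrite ler_norml => /andP[h _]; lra.
Qed.

Hypothesis fchi : efin (chi z).

Let F0 : 0 < FF z 0.
Proof. by apply: FF0_gt0 => //; exact: Pi_efin. Qed.

(** Positivity of [FF z 0] says that z is less than 1 minus the sum of Pi, and |Pi| sums to at most
    2 b z. *)
Lemma z_lt2 : z < 2.
Proof.
move: F0; rewrite /FF /Dh ct0 D1 ct0 => h.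
have h1 := ler_norm_rsum sP; have h2 := rsum_Pir.
move: h1; rewrite ler_norml => /andP[h1 _].
by move: bs b0 z0; nra.
Qed.

(** The factor z has to be removed from [FF_ge]. For z > 1/2 it is bounded below; for smaller z the
    value at 0 is at least 1/4, while 1 - D is at most 2. *)
Lemma FF_low k : (8 * FF z 0 + sk k) / 16 <= FF z k.
Proof.
have h := FF_ge k; have /andP[s0 s2] := sk_bnd Dr0 sD D1 k.
have [z2|z2] := leP z (1/2); last by move: F0 h s0 s2 z2; nra.
have : 1/4 <= FF z 0.
  rewrite /FF /Dh ct0 D1 ct0.
  have h1 := ler_norm_rsum sP; have h2 := rsum_Pir.
  move: h1; rewrite ler_norml => /andP[_ h1].
  by move: bs b0 z0; nra.
by move: F0 h s0 s2 z2 z0; nra.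
Qed.

Lemma FF_gt0 k : 0 < FF z k.
Proof.
apply: lt_le_trans (FF_low k); have /andP[s0 s2] := sk_bnd Dr0 sD D1 k.
by move: F0; lra.
Qed.

Lemma ct_GrE k : ct (Gr z) k = (FF z k)^-1.
Proof.
have := GF1 Dr0 sD D1 D00 Dsym z0 Pi_efin fchi k => h.
by apply: (mulIf (lt0r_neq0 (FF_gt0 k))); rewrite h mulVf// gt_eqF// FF_gt0.
Qed.

Variable beta : R.
Hypothesis Hrw : forall e : R, 0 < e -> exists M : V -> R,
  [/\ summ M, (forall l, Dh l ^+ 2 / (e + sk l) ^+ 2 <= ct M l) & M 0 <= beta].

Let sG : summ (Gr z). Proof. exact: summ_Gr. Qed.

(** Since H <= z D * G, the bubble is at most z^2 times the value at 0 of (D * G) convolved with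
    itself, whose transform D^2 / FF^2 is at most 256 D^2 / (8 FF(0) + 1 - D)^2. With z < 2 this
    gives 4 * 256 = 1024. *)
Lemma bub_strong : tsum (fun x => Hf De (ofR z) x * Hf De (ofR z) x) <<= ofR (1024 * beta).
Proof.
have [M [sM hM M0]] := Hrw (mulr_gt0 (ltr0n _ 8) F0).
pose A := zconv Dr (Gr z).
have sA : summ A by exact: summ_conv.
have eA x : A (- x) = A x by apply: conv_even => // y; exact: Gr_sym.
have ctA l : ct A l = Dh l * (FF z l)^-1.
  by rewrite /A ct_conv// ?ct_GrE// => y; exact: Gr_sym.
have A0 x : 0 <= A x by apply: rsum_ge0 => y; rewrite mulr_ge0 ?toR_ge0.
have AE x : ofR (A x) = tsum (fun y => De y * Gf De (ofR z) (x - y)).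
  have s : summ (fun y => Dr y * Gr z (x - y)) by exact: summ_conv_inner.
  rewrite /A /zconv -[zsum _]/(rsum _) rsum_ge0E; last by move=> y; rewrite mulr_ge0 ?toR_ge0.
  rewrite summ_ge0E in s; last by move=> y; rewrite mulr_ge0 ?toR_ge0.
  rewrite toRK//; apply: eq_tsum => y; rewrite ofRM ?toR_ge0// toRK//.
  by apply: (efin_tsum (x - y)); rewrite -chiE.
have HA x : Hf De (ofR z) x <<= ofR (z * A x).
  rewrite ofRM// AE; apply: (ele_trans (tsum (fun n => ofR z * tsum (fun y => De y * (ofR z ^+ n * cw De n (x - y)))))).
    apply: le_tsum => n; rewrite exprS -mulrA; apply: eleMl.
    apply: (ele_trans (ofR z ^+ n * tsum (fun y => De y * cw De n (x - y)))).
      apply: eleMl; exact: cwS.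
    by rewrite -tsumZl; apply: le_tsum => y; rewrite mulrCA elexx.
  rewrite tsumZl; apply: eleMl; rewrite tsum_swap; apply: le_tsum => y.
  by rewrite tsumZl elexx.
have h0 : rsum (fun x => A x * A x) <= 256 * M 0.
  have -> : rsum (fun x => A x * A x) = zconv A A 0.
    by rewrite /zconv -[RHS]/(rsum _); apply: eq_rsum => x; rewrite sub0r eA.
  apply: (@ct_dom _ _ (zconv A A) (fun x => 256 * M x)).
  - exact: summ_conv.
  - exact: summZ.
  - exact: conv_even.
  move=> l; rewrite ct_conv// ctA ctZ.
  have F0l := FF_gt0 l; have Fl := FF_low l; have /andP[s0 _] := sk_bnd Dr0 sD D1 l.
  have e0 : 0 < 8 * FF z 0 + sk l by move: F0; lra.
  rewrite ger0_norm; last by rewrite -expr2 sqr_ge0.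
  apply: (le_trans (y := 256 * (Dh l ^+ 2 / (8 * FF z 0 + sk l) ^+ 2))); last by rewrite ler_wpM2l.
  rewrite (_ : _ * (_ / _) = Dh l ^+ 2 * (FF z l)^-1 ^+ 2); last by ring.
  rewrite [leRHS]mulrCA; apply: ler_wpM2l; first exact: sqr_ge0.
  rewrite (_ : 256 / _ = ((8 * FF z 0 + sk l) / 16)^-1 ^+ 2); last first.
    by field; rewrite gt_eqF.
  have e16 : 0 < (8 * FF z 0 + sk l) / 16 by rewrite divr_gt0.
  by rewrite ler_sqr ?nnegrE ?invr_ge0 ?(ltW F0l) ?(ltW e16)// lef_pV2 ?posrE.
have sAA : summ (fun x => (z * A x) * (z * A x)).
  have := summ_conv_inner 0 (summZ z sA) (summZ z sA).
  by under eq_summ => x do rewrite sub0r eA.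
rewrite summ_ge0E in sAA; last by move=> x; rewrite -expr2 sqr_ge0.
apply: (ele_trans (tsum (fun x => ofR ((z * A x) * (z * A x))))).
  by apply: le_tsum => x; rewrite ofRM ?mulr_ge0//; apply: eleM; exact: HA.
rewrite -[X in X <<= _]toRK//; apply: ele_ofR.
rewrite -rsum_ge0E; last by move=> x; rewrite -expr2 sqr_ge0.
rewrite (eq_rsum (g := fun x => z ^+ 2 * (A x * A x))); last by move=> x; ring.
rewrite rsumZ; have := z_lt2 => z2.
have r0 : 0 <= rsum (fun x => A x * A x) by apply: rsum_ge0 => x; rewrite -expr2 sqr_ge0.
have z4 : z ^+ 2 <= 4 by move: z0 z2; nra.
by have := ler_wpM2r r0 z4; lra.
Qed.

(** The transform of (1 - cos k.x) G is the resolvent at l minus its mean at l + k and l - k, so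
    [resolvent_diff] applies. The right side is the transform of a function whose value at 0 is
    known. *)
Lemma ct_oc_Gr l k : `|ct (fun x => Gr z x * oc k x) l| <=
  ct (fun x => (285 * sk k) * (zconv (Gr z) (Gr z) x * (1 + cos (ph k x)))) l.
Proof.
have F1 := FF_gt0 l; have F2 := FF_gt0 (l + k); have F3 := FF_gt0 (l - k).
have sGG : summ (zconv (Gr z) (Gr z)) by exact: summ_conv.
have /andP[s0 s2] := sk_bnd Dr0 sD D1 k; have /andP[sl0 sl2] := sk_bnd Dr0 sD D1 l.
have eL : ct (fun x => Gr z x * oc k x) l = (FF z l)^-1 - ((FF z (l + k))^-1 + (FF z (l - k))^-1) / 2.
  rewrite -!ct_GrE ct_shift2//.
  rewrite (_ : (fun x => Gr z x * oc k x) = fun x => Gr z x - Gr z x * cos (ph k x)).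
    by rewrite ctB//; exact: summ_cos.
  by apply/funext => x; rewrite /oc mulrBr mulr1.
have eR : ct (fun x => (285 * sk k) * (zconv (Gr z) (Gr z) x * (1 + cos (ph k x)))) l =
   285 * sk k * ((FF z l)^-1 ^+ 2 + ((FF z (l + k))^-1 ^+ 2 + (FF z (l - k))^-1 ^+ 2) / 2).
  have h v : ct (zconv (Gr z) (Gr z)) v = (FF z v)^-1 ^+ 2.
    by rewrite ct_conv// ?ct_GrE ?expr2// => y; exact: Gr_sym.
  rewrite ctZ -!h ct_shift2// -ctD//; last exact: summ_cos.
  by congr (_ * ct _ l); apply/funext => x; rewrite mulrDr mulr1.
rewrite eL eR; apply: le_trans (resolvent_diff F1 F2 F3) _.
have sa : summ (fun x => z * Dr x + Pir z x) by apply: summ_le saa => x; exact: aa_le.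
have FE v : FF z v = 1 - ct (fun x => z * Dr x + Pir z x) v.
  by rewrite (ctD v (summZ z sD) sP) ctZ opprD addrA.
have z2 := z_lt2.
have aW v : rsum (fun x => aa x * oc v x) <= (202 / 100) * sk v.
  by apply: le_trans (aa_W v) _; have /andP[? _] := sk_bnd Dr0 sD D1 v; move: z0; nra.
have he : `|(FF z (l + k) + FF z (l - k)) / 2 - FF z l| <= (202 / 100) * sk k.
  rewrite !FE (_ : _ - _ = ct (fun x => z * Dr x + Pir z x) l - (ct (fun x => z * Dr x + Pir z x) (l + k) + ct (fun x => z * Dr x + Pir z x) (l - k)) / 2); last by field.
  rewrite ct_shift2// -ctB//; last exact: summ_cos.
  apply: le_trans (aW k); apply: ler_rsum_sup; last by apply: summ_oc; exact: saa.
  move=> x; rewrite -[X in X - _ * cos _]mulr1 -mulrBr !normrM -/(oc k x) (ger0_norm (oc_ge0 k x)).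
  apply: (le_trans (y := `|z * Dr x + Pir z x| * oc k x)).
    by rewrite ler_piMr ?mulr_ge0 ?oc_ge0// normr_cos.
  by apply: ler_wpM2r; [exact: oc_ge0|exact: aa_le].
have hs2 v : rsum (fun x => aa x * sin (ph v x) ^+ 2) <= (404 / 100) * sk v.
  apply: (le_trans (y := rsum (fun x => 2 * (aa x * oc v x)))).
    apply: le_rsum.
    - by apply: summ_bnd saa _ => x; rewrite normrX; apply: exprn_ile1 => //; exact: normr_sin.
    - by apply: summZ; apply: summ_oc; exact: saa.
    by move=> x; rewrite [leRHS]mulrCA; apply: ler_wpM2l; [exact: aa0|exact: sin2_le].
  by rewrite rsumZ; have := aW v; lra.
(* Cauchy-Schwarz and sin^2 <= 2 (1 - cos) bound the square of the odd part by a multiple of sk(l)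
   sk(k); sk(l) cancels against the reciprocal of FF(l) by [FF_low], so that only sk(k) remains. *)
have ho : ((FF z (l + k) - FF z (l - k)) / 2) ^+ 2 * (FF z l)^-1 <= 16 * (404 / 100) ^+ 2 * sk k.
  have -> : (FF z (l + k) - FF z (l - k)) / 2 = rsum (fun x => (z * Dr x + Pir z x) * (sin (ph l x) * sin (ph k x))).
    rewrite !FE (_ : _ / 2 = 2^-1 * (ct (fun x => z * Dr x + Pir z x) (l - k) - ct (fun x => z * Dr x + Pir z x) (l + k))); last by field.
    rewrite /ct -rsumB; [|exact: summ_cos|exact: summ_cos].
    rewrite -rsumZ; apply: eq_rsum => x.
    by rewrite !phDl phNl !cosD cosN sinN; field.
  have hN : `|rsum (fun x => (z * Dr x + Pir z x) * (sin (ph l x) * sin (ph k x)))| <= rsum (fun x => aa x * (`|sin (ph l x)| * `|sin (ph k x)|)).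
    apply: ler_rsum_sup.
      by move=> x; rewrite !normrM; apply: ler_wpM2r => //; exact: aa_le.
    apply: summ_bnd saa _ => x.
    by rewrite normrM !normr_id mulr_ile1// normr_sin.
  have hCS := @rsum_CS R _ aa (fun x => `|sin (ph l x)|) (fun x => `|sin (ph k x)|) aa0 saa _ _.
  have {hCS} : rsum (fun x => aa x * (`|sin (ph l x)| * `|sin (ph k x)|)) ^+ 2 <= ((404 / 100) * sk l) * ((404 / 100) * sk k).
    apply: le_trans (hCS _ _) _; [by move=> x; rewrite normr_id normr_sin..|].
    under eq_rsum => x do rewrite real_normK ?num_real//.
    under [X in _ * X]eq_rsum => x do rewrite real_normK ?num_real//.
    apply: ler_pM; [| |exact: hs2|exact: hs2]; by apply: rsum_ge0 => x; rewrite mulr_ge0 ?sqr_ge0 ?aa0.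
  move=> hCS.
  have h1 : rsum (fun x => (z * Dr x + Pir z x) * (sin (ph l x) * sin (ph k x))) ^+ 2 <= ((404 / 100) * sk l) * ((404 / 100) * sk k).
    apply: le_trans hCS; rewrite -(@real_normK _ (rsum (fun x => (z * Dr x + Pir z x) * _))) ?num_real//.
    by rewrite ler_sqr ?nnegrE//; apply: rsum_ge0 => x; rewrite !mulr_ge0 ?aa0.
  rewrite ler_pdivrMr//; apply: le_trans h1 _.
  have := FF_low l => h2.
  have h3 : sk l <= 16 * FF z l by move: F0; lra.
  rewrite (_ : 16 * (404 / 100) ^+ 2 * sk k * FF z l = (404 / 100) * (16 * FF z l) * ((404 / 100) * sk k)); last by ring.
  have q0 : 0 <= 404 / 100 :> R by [].
  by apply: ler_wpM2r; [exact: mulr_ge0|exact: ler_wpM2l].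
set P := (FF z l)^-1 ^+ 2; set Q := ((FF z (l + k))^-1 ^+ 2 + (FF z (l - k))^-1 ^+ 2) / 2.
have P0 : 0 <= P by exact: sqr_ge0.
have Q0 : 0 <= Q by rewrite divr_ge0// addr_ge0// sqr_ge0.
have t1 : `|(FF z (l + k) + FF z (l - k)) / 2 - FF z l| / 2 * (P + Q) <= (101 / 100) * sk k * (P + Q).
  by apply: ler_wpM2r; [exact: addr_ge0|lra].
have t2 := ler_wpM2r Q0 ho.
apply: le_trans (lerD t1 t2) _.
exact: boot_const (mulr_ge0 s0 P0) (mulr_ge0 s0 Q0).
Qed.

(** By [ct_dom] and [ct_oc_Gr] the left side is at most 285 sk(k) times (G * G)(0) times 2, and (G *
    G)(0) <= 4 by [GG_sup]; whence 8 * 285. *)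
Lemma wbd_strong : wbd z W2.
Proof.
move=> k x; have /andP[s0 s2] := sk_bnd Dr0 sD D1 k.
have fG : efin (Gf De (ofR z) x) by apply: (efin_tsum x); rewrite -chiE.
apply: (ele_trans (ofR (oc k x) * Gf De (ofR z) x)).
  by apply: eleMl; rewrite GfE; exact: eleDr.
have W20 : 0 <= W2 by move: hW2; lra.
rewrite -(toRK fG) -(ofRM (oc_ge0 k x) (toR_ge0 _)) -(ofRM s0 W20); apply: ele_ofR; rewrite -/(Gr z x) [_ * Gr z x]mulrC.
have sGG : summ (zconv (Gr z) (Gr z)) by exact: summ_conv.
apply: (le_trans (ct_dom (g := fun x => Gr z x * oc k x) x _ _ _ (fun l => ct_oc_Gr l k))).
- exact: summ_oc.
- apply: summZ; rewrite (eq_summ (g := fun x => zconv (Gr z) (Gr z) x + zconv (Gr z) (Gr z) x * cos (ph k x))).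
    by apply: summD => //; exact: summ_cos.
  by move=> y; rewrite mulrDr mulr1.
- by move=> y; rewrite Gr_sym// /oc phN cosN.
have gg : zconv (Gr z) (Gr z) 0 <= 4.
  rewrite /zconv -[zsum _]/(rsum _) rsum_ge0E; last by move=> y; rewrite mulr_ge0 ?toR_ge0.
  have GG := GG_sup b0 b16 HB (0 : V).
  apply: toR_le; first by []; apply: ele_trans GG.
  apply: le_tsum => y; have fGy v : efin (Gf De (ofR z) v) by apply: (efin_tsum v); rewrite -chiE.
  by rewrite sub0r Gr_sym// add0r ofRM ?toR_ge0// !toRK// elexx.
rewrite ph0 cos0; have g0 : 0 <= zconv (Gr z) (Gr z) 0.
  by apply: rsum_ge0 => y; rewrite mulr_ge0 ?toR_ge0.
have h1 : 285 * sk k * (zconv (Gr z) (Gr z) 0 * (1 + 1)) <= 285 * sk k * 8.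
  by apply: ler_wpM2l; lra.
apply: le_trans h1 _; have := ler_wpM2l s0 hW2; lra.
Qed.
End FixedZ.
End BootStep.

(** * Gaps between powers and Abel limits *)

Section Power.
Variable R : realType.

Lemma exprS_gap (r s : R) n : 0 <= s -> s <= r -> n.+1%:R * s ^+ n * (r - s) <= r ^+ n.+1 - s ^+ n.+1.
Proof.
move=> s0 sr; have r0 := le_trans s0 sr; elim: n => [|n IH]; first by rewrite !expr1 expr0; lra.
have h : s ^+ n.+1 <= r ^+ n.+1 by rewrite lerXn2r ?nnegrE.
have -> : r ^+ n.+2 - s ^+ n.+2 = r ^+ n.+1 * (r - s) + s * (r ^+ n.+1 - s ^+ n.+1).
  by rewrite !(exprS _ n.+1); ring.
have -> : n.+2%:R * s ^+ n.+1 * (r - s) = s ^+ n.+1 * (r - s) + s * (n.+1%:R * s ^+ n * (r - s)).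
  by rewrite -[n.+2%:R]natr1 exprS; ring.
by apply: lerD; [apply: ler_wpM2r => //; rewrite subr_ge0|exact: ler_wpM2l].
Qed.

Lemma expr_gap_le (s t : R) n : 0 <= s -> s <= t -> t ^+ n.+1 - s ^+ n.+1 <= n.+1%:R * t ^+ n * (t - s).
Proof.
move=> s0 st; have t0 := le_trans s0 st; elim: n => [|n IH]; first by rewrite !expr1 expr0; lra.
have h : s ^+ n.+1 <= t ^+ n.+1 by rewrite lerXn2r ?nnegrE.
have -> : t ^+ n.+2 - s ^+ n.+2 = t * (t ^+ n.+1 - s ^+ n.+1) + s ^+ n.+1 * (t - s).
  by rewrite !(exprS _ n.+1); ring.
have -> : n.+2%:R * t ^+ n.+1 * (t - s) = t * (n.+1%:R * t ^+ n * (t - s)) + t ^+ n.+1 * (t - s).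
  by rewrite -[n.+2%:R]natr1 exprS; ring.
by apply: lerD; [exact: ler_wpM2l|apply: ler_wpM2r => //; rewrite subr_ge0].
Qed.

(** The condition on the weight in [Fw_mark]: with 1 - cos written as 2 sin^2 of the half angle it
    is N (a + c)^2 <= (N + 1)(a^2 + N c^2). *)
Lemma onemcosD_mark (n : nat) (t u : R) :
  n.+1%:R * (1 - cos (t + u)) <= n.+2%:R * ((1 - cos t) + n.+1%:R * (1 - cos u)).
Proof.
have h (v : R) : 1 - cos (v *+ 2) = 2 * sin v ^+ 2 by rewrite cos_mulr2n sin2cos2; ring.
have -> : t + u = (t / 2 + u / 2) *+ 2 by rewrite mulr2n; field.
have -> : cos t = cos ((t / 2) *+ 2) by congr cos; rewrite mulr2n; field.
have -> : cos u = cos ((u / 2) *+ 2) by congr cos; rewrite mulr2n; field.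
rewrite !h; set p := sin (t / 2); set q := sin (u / 2).
have hs : sin (t / 2 + u / 2) ^+ 2 <= (`|p| + `|q|) ^+ 2.
  rewrite -(@real_normK _ (sin _)) ?num_real// ler_sqr ?nnegrE ?addr_ge0//.
  rewrite sinD; apply: le_trans (ler_normD _ _) _; rewrite !normrM.
  by apply: lerD; rewrite ?ler_piMr ?ler_piMl// normr_cos.
have hp : p ^+ 2 = `|p| ^+ 2 by rewrite real_normK ?num_real.
have hq : q ^+ 2 = `|q| ^+ 2 by rewrite real_normK ?num_real.
rewrite hp hq -[n.+2%:R]natr1; move: hs; move: (sin _ ^+ 2) `|p| `|q| => s a c hs.
have N0 : 0 <= n.+1%:R :> R by [].
have h1 := ler_wpM2l N0 hs; have h2 := sqr_ge0 (a - n.+1%:R * c).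
by move: h1 h2; move: (n.+1%:R : R) => N h1 h2; nra.
Qed.

Lemma pow_lim (s c : R) (N : nat) : 0 <= s ->
  (forall th : R, 0 < th -> th < 1 -> th ^+ N * s <= c) -> s <= c.
Proof.
move=> s0 h; have [//|cs] := leP s c.
have bern (th : R) : 0 <= th -> th <= 1 -> 1 - N%:R * (1 - th) <= th ^+ N.
  move=> t0 t1; case: N {h} => [|n]; first by rewrite mul0r expr0; lra.
  have := expr_gap_le n t0 t1; rewrite !expr1n; lra.
set M : R := N.+1%:R * (s + 1).
have M0 : 0 < M by rewrite mulr_gt0//; lra.
set e := Num.min (1/2) ((s - c) / (2 * M)).
have e0 : 0 < e by rewrite lt_min; apply/andP; split; [lra|rewrite divr_gt0 ?subr_gt0//; lra].
have e1 : e <= 1/2 by rewrite ge_min lexx.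
have e2 : e * (2 * M) <= s - c by rewrite -ler_pdivlMr ?ge_min ?lexx ?orbT// mulr_gt0.
have b := bern (1 - e); have {}b := b ltac:(lra) ltac:(lra).
have {}h := h (1 - e) ltac:(lra) ltac:(lra).
have h1 := ler_wpM2r s0 b.
have : N%:R * e * s <= e * M.
  rewrite /M mulrAC mulrC; apply: ler_wpM2l; first exact: ltW.
  by apply: ler_pM => //; [rewrite ler_nat|lra].
by nra.
Qed.

(** On a finite set the exponents are bounded by some N, and th^N tends to 1. *)
Lemma tsum_abel (T : choiceType) (e : T -> nat) (a : T -> enn R) (c : enn R) :
  (forall th : R, 0 < th -> th < 1 -> tsum (fun x => ofR th ^+ e x * a x) <<= c) ->
  tsum a <<= c.
Proof.
move=> h; apply: tsum_ub => s us.
pose N := \max_(x <- s) e x.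
have hN (th : R) : 0 < th -> th < 1 -> ofR (th ^+ N) * \sum_(x <- s) a x <<= c.
  move=> t0 t1; apply: (ele_trans _ _ (h th t0 t1)).
  apply: (ele_trans _ _ (tsum_ge_seq _ us)); rewrite mulr_sumr big_seq [X in _ <<= X]big_seq.
  apply: ele_sum => x xs; apply: eleMr; rewrite -ofRX ?ltW//; apply: ele_ofR.
  by apply: ler_wiXn2l; rewrite ?ltW//; exact: leq_bigmax_seq.
case: (ele_total (\sum_(x <- s) a x) c) => // cS.
have [fS|nS] := boolP (efin (\sum_(x <- s) a x)).
  have fc := efin_le cS fS.
  rewrite -(toRK fc) -(toRK fS); apply: ele_ofR; apply: (@pow_lim _ _ N) => // th t0 t1.
  have tN : 0 <= th ^+ N by rewrite exprn_ge0 ?ltW.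
  have := hN th t0 t1; rewrite -{1}(toRK fS) -(ofRM tN (toR_ge0 _)) => h3.
  by apply: (ofR_le (toR_ge0 c)); rewrite toRK.
have := hN (1/2) ltac:(lra) ltac:(lra) => h2.
have p0 : 0 < (1/2 : R) ^+ N by rewrite exprn_gt0//; lra.
have : ofR ((1/2) ^+ N)^-1 * (ofR ((1/2) ^+ N) * \sum_(x <- s) a x) <<= ofR ((1/2) ^+ N)^-1 * c by exact: eleMl.
rewrite mulrA -ofRM ?invr_ge0 ?(ltW p0)// mulVf ?gt_eqF// ofR1 mul1r => h3.
have [fc|nc] := boolP (efin c); last first.
  by case: (ele_total (\sum_(x <- s) a x) c) => // h4; move: nS nc h4; rewrite /efin /enn_le -!leNgt !leye_eq => /eqP-> /eqP->.
by rewrite (efin_le h3) ?efinM in nS.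
Qed.
End Power.

(** * The bootstrap up to the radius of convergence *)

Section Iteration.
Variables (R : realType) (d : nat).
Local Notation V := 'rV[int]_d.
Local Notation E := (enn R).
Implicit Types (k l : 'rV[R]_d).
Variable Dr : V -> R.
Hypotheses (Dr0 : forall x, 0 <= Dr x) (sD : summ Dr) (D1 : rsum Dr = 1).
Hypotheses (D00 : Dr 0 = 0) (Dsym : forall x, Dr (- x) = Dr x).
Local Notation De := (De Dr).
Local Notation sk := (sk Dr).
Local Notation chi := (chi Dr).
Local Notation Cn := (Cn Dr).
Local Notation FF := (FF Dr).
Local Notation bub := (bub Dr).
Local Notation wbd := (wbd Dr).

Lemma oc_De k : tsum (fun x => ofR (oc k x) * De x) = ofR (sk k).
Proof.
have h x : 0 <= oc k x * Dr x by rewrite mulr_ge0 ?oc_ge0.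
under eq_tsum => x do rewrite -ofRM ?oc_ge0//.
have s : summ (fun x => oc k x * Dr x).
  by under eq_summ => x do rewrite mulrC; exact: summ_oc.
rewrite summ_ge0E// in s; rewrite -[LHS]toRK// -rsum_ge0E// skE//; congr ofR.
by apply: eq_rsum => x; rewrite mulrC.
Qed.

(** An a priori constant for the weighted bound, see [oc_Hf], obtained by cutting walks at a marked
    step. Only its finiteness matters; its size affects nothing but the step length in
    [bootstrap]. *)
Definition dC (r : R) : E := tsum (fun n => n.+1%:R * ofR r ^+ n.+1 * \sum_(i < n.+1) Cn i * Cn (n - i)%N).

Lemma oc_cw k n x : ofR (oc k x) * cw De n x <<= ofR (sk k) * (n%:R * \sum_(i < n) Cn i * Cn (n - i.+1)%N).
Proof.
have oc0 := oc_ge0 k.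
have h := @Fw_mark R _ De (fun x => ofR (oc k x)) n [::] 0 x.
rewrite subr0 in h; apply: ele_trans (h _ _) _.
- by rewrite /oc ph0 cos0 subrr ofR0.
- move=> m u v; have s0 := mulr_ge0 (ler0n R m.+1) (oc0 v).
  rewrite -!(ofR_nat R) -(ofRM (ler0n R m.+1) (oc0 _)) -(ofRM (ler0n R m.+1) (oc0 v)) -(ofRD (oc0 u) s0).
  rewrite -(ofRM (ler0n R m.+2) (addr_ge0 (oc0 u) s0)); apply: ele_ofR.
  by rewrite /oc phD; exact: onemcosD_mark.
rewrite mulrCA; apply: eleMl; apply: ele_trans (Fmark_le _ _ _ _ _ _) _.
rewrite mulr_sumr; apply: ele_sum => i _.
apply: (ele_trans (tsum (fun v => cw De i v * (ofR (sk k) * Cn (n - i.+1)%N)))); last first.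
  by rewrite tsumZr mulrCA elexx.
apply: le_tsum => v; apply: eleMl.
rewrite -(oc_De k) [X in _ <<= X * _](tsum_subr v) -tsumZr; apply: le_tsum => y.
by apply: eleMl; exact: tsum_ge1.
Qed.

Lemma oc_Hf (r : R) k x : ofR (oc k x) * Hf De (ofR r) x <<= ofR (sk k) * dC r.
Proof.
rewrite -!tsumZl; apply: le_tsum => n; rewrite mulrCA.
apply: (ele_trans (ofR r ^+ n.+1 * (ofR (sk k) * (n.+1%:R * \sum_(i < n.+1) Cn i * Cn (n.+1 - i.+1)%N)))).
  by apply: eleMl; exact: oc_cw.
by apply: ele_eq; under [in RHS]eq_bigr => i _ do rewrite -subSS; ring.
Qed.

Lemma chi_mono (r s : R) : 0 <= r -> r <= s -> chi r <<= chi s.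
Proof. by move=> r0 rs; apply: le_tsum => n; apply: eleMr; apply: eleX; exact: ele_ofR. Qed.

(** The factor n + 1 is absorbed by passing from r to the larger s. *)
Lemma dC_fin (r s : R) : 0 <= r -> r < s -> efin (chi s) -> efin (dC r).
Proof.
move=> r0 rs fs; have s0 : 0 < s by exact: le_lt_trans rs.
have c0 : 0 <= r * s / (s - r) by apply: divr_ge0; [apply: mulr_ge0; lra|lra].
apply: (@efin_le _ _ (ofR (r * s / (s - r)) * (chi s * chi s))); last by rewrite !efinM.
rewrite /chi tsum_prod2 -(tsum_tri (fun i j => ofR s ^+ i * Cn i * (ofR s ^+ j * Cn j))) -tsumZl.
apply: le_tsum => n.
have -> : \sum_(i < n.+1) ofR s ^+ i * Cn i * (ofR s ^+ (n - i) * Cn (n - i)%N) = ofR s ^+ n * \sum_(i < n.+1) Cn i * Cn (n - i)%N.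
  rewrite mulr_sumr; apply: eq_bigr => i _; rewrite mulrACA -exprD subnKC//.
  by rewrite -ltnS.
rewrite mulrA; apply: eleMr.
rewrite -ofRX// -(ofR_nat R) -ofRM ?exprn_ge0// -ofRX ?(ltW s0)// -ofRM ?exprn_ge0 ?(ltW s0)//.
apply: ele_ofR; rewrite mulrAC ler_pdivlMr ?subr_gt0//.
have h := exprS_gap n r0 (ltW rs).
have rn : 0 <= r ^+ n.+1 by rewrite exprn_ge0.
rewrite (_ : r * s * s ^+ n = r * s ^+ n.+1); last by rewrite exprS; ring.
rewrite (_ : _ * _ * _ = r * (n.+1%:R * r ^+ n * (s - r))); last by rewrite exprS; ring.
by apply: ler_wpM2l => //; lra.
Qed.

(** Quantitative continuity in z: the increment of H is a small multiple of H at a larger r,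
    uniformly in x. *)
Lemma Hf_lip (z z' z1 r : R) x : 0 <= z -> z <= z' -> z' <= z1 -> z1 < r ->
  Hf De (ofR z') x <<= Hf De (ofR z) x + ofR ((z' - z) / (r - z1)) * Hf De (ofR r) x.
Proof.
move=> z0 zz zz1 z1r; rewrite -tsumZl -tsumD; apply: le_tsum => n.
have z'0 := le_trans z0 zz; have z10 := le_trans z'0 zz1; have r0 : 0 <= r by rewrite (le_trans z10)// ltW.
have e0 : 0 <= (z' - z) / (r - z1) by rewrite divr_ge0// subr_ge0// ltW.
rewrite mulrA -mulrDl; apply: eleMr.
have rn := exprn_ge0 n.+1 r0; rewrite -!ofRX// -(ofRM e0 rn) -(ofRD (exprn_ge0 _ z0) (mulr_ge0 e0 rn)); apply: ele_ofR.
rewrite -lerBlDl; apply: le_trans (expr_gap_le n z0 zz) _.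
rewrite [leRHS]mulrAC ler_pdivlMr ?subr_gt0//.
have h1 := exprS_gap n z10 (ltW z1r).
have h2 : 0 <= z1 ^+ n.+1 by rewrite exprn_ge0.
have h3 : z' ^+ n <= z1 ^+ n by rewrite lerXn2r ?nnegrE.
rewrite mulrAC [leRHS]mulrC; apply: ler_wpM2r; first by rewrite subr_ge0.
apply: le_trans (_ : n.+1%:R * z1 ^+ n * (r - z1) <= _); last lra.
by apply: ler_wpM2r; [rewrite subr_ge0 ltW|apply: ler_wpM2l].
Qed.

Lemma Hf_mono (z r : R) x : 0 <= z -> z <= r -> Hf De (ofR z) x <<= Hf De (ofR r) x.
Proof. by move=> z0 zr; apply: le_tsum => n; apply: eleMr; apply: eleX; exact: ele_ofR. Qed.

Lemma HH_chi (r : R) : tsum (fun x => Hf De (ofR r) x * Hf De (ofR r) x) <<= chi r * chi r.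
Proof.
rewrite chiE tsum_prod2; apply: le_tsum => x.
apply: (ele_trans (Gf De (ofR r) x * Gf De (ofR r) x)).
  by apply: eleM; rewrite GfE; exact: eleDr.
exact: (tsum_ge1 (fun y => Gf De (ofR r) x * Gf De (ofR r) y) x).
Qed.

Variables (b beta W : R).
Hypotheses (b0 : 0 < b) (bs : 100 * b <= 1) (bb : b ^+ 2 = 2048 * beta).
Hypotheses (WE : W = 16 * 285) (bW : 16 * b * W <= 1 / 100).
Hypothesis Hrw : forall e : R, 0 < e -> exists M : V -> R,
  [/\ summ M, (forall l, Dh Dr l ^+ 2 / (e + sk l) ^+ 2 <= ct M l) & M 0 <= beta].

Let W0 : 0 <= W. Proof. by rewrite WE; lra. Qed.

Definition strong z := tsum (fun x => Hf De (ofR z) x * Hf De (ofR z) x) <<= ofR (b ^+ 2 / 2) /\ wbd z (W / 2).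

Lemma weak_strong (z : R) : 0 <= z -> efin (chi z) -> bub z b -> wbd z W -> strong z.
Proof.
move=> z0 fz hb hw; split.
  have -> : b ^+ 2 / 2 = 1024 * beta by rewrite bb; lra.
  exact: (bub_strong Dr0 sD D1 D00 Dsym z0 (ltW b0) bs W0 bW hb hw).
apply: (wbd_strong Dr0 sD D1 D00 Dsym z0 (ltW b0) bs W0 bW _ hb hw fz).
by rewrite WE; lra.
Qed.

Lemma strong_weak z : strong z -> bub z b /\ wbd z W.
Proof.
move=> [h1 h2]; split.
  by apply: ele_trans h1 _; apply: ele_ofR; have := sqr_ge0 b; lra.
move=> k x; apply: ele_trans (h2 k x) _; apply: eleMl; apply: ele_ofR.
by move: W0; lra.
Qed.

Lemma strong0 : strong 0.
Proof.
have H0 x : Hf De (ofR 0) x = 0 by apply: tsum_eq0 => n; rewrite ofR0 expr0n mul0r.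
split; first by rewrite tsum_eq0 ?ele0// => x; rewrite H0 mul0r.
by move=> k x; rewrite H0 mulr0 ele0.
Qed.

(** The strong bounds at z imply the weak ones at z + h, which [weak_strong] improves again. The
    step h depends only on z1, r and s, so finitely many steps lead from 0 to z1. *)
Lemma bootstrap (z1 r s : R) : 0 <= z1 -> z1 < r -> r < s -> efin (chi s) -> strong z1.
Proof.
move=> z10 z1r rs fs; have r0 : 0 <= r by rewrite (le_trans z10)// ltW.
have fr : efin (chi r) by apply: efin_le fs; apply: chi_mono => //; exact: ltW.
have fB := dC_fin r0 rs fs.
pose A := toR (chi r * chi r); pose B := toR (dC r).
have A0 : 0 <= A by exact: toR_ge0.
have B0 : 0 <= B by exact: toR_ge0.
(* The three terms serve 2e + e^2 <= 3e, 3 e A <= b^2 / 2 and e B <= W / 2: the two bounds at most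
   double within a step. *)
pose e := Num.min 1 (Num.min (b ^+ 2 / (6 * (A + 1))) (W / (2 * (B + 1)))).
have W1 : 0 < W by rewrite WE; lra.
have e0 : 0 < e by rewrite !lt_min ltr01 !divr_gt0 ?exprn_gt0//; lra.
have e1 : e <= 1 by rewrite ge_min lexx.
have eA : e * (6 * (A + 1)) <= b ^+ 2.
  by rewrite -ler_pdivlMr ?mulr_gt0 ?ltr_wpDl// !ge_min lexx !orbT.
have eB : e * (2 * (B + 1)) <= W.
  by rewrite -ler_pdivlMr ?mulr_gt0 ?ltr_wpDl// !ge_min lexx !orbT.
have step (z z' : R) : 0 <= z -> z <= z' -> z' <= z1 -> z' - z <= e * (r - z1) -> strong z -> strong z'.
  move=> z0 zz zz1 zd [h1 h2]; have z'0 := le_trans z0 zz.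
  have rz : 0 < r - z1 by rewrite subr_gt0.
  have q0 : 0 <= (z' - z) / (r - z1) by apply: divr_ge0; lra.
  have qe : (z' - z) / (r - z1) <= e by rewrite ler_pdivrMr.
  have hl x : Hf De (ofR z') x <<= Hf De (ofR z) x + ofR e * Hf De (ofR r) x.
    apply: ele_trans (Hf_lip x z0 zz zz1 z1r) _; apply: eleD => //; apply: eleMr; exact: ele_ofR.
  apply: (weak_strong z'0).
  - by apply: efin_le fr; apply: chi_mono => //; rewrite (le_trans zz1)// ltW.
  - apply: (ele_trans (ofR (b ^+ 2 / 2) + ofR (3 * e) * (chi r * chi r))); last first.
      have fcc : efin (chi r * chi r) by rewrite efinM.
      have e3 : 0 <= 3 * e by rewrite mulr_ge0 ?ltW.
      have b2 : 0 <= b ^+ 2 / 2 by rewrite divr_ge0// sqr_ge0.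
      rewrite -(toRK fcc) -(ofRM e3 A0) -(ofRD b2 (mulr_ge0 e3 A0)).
      by apply: ele_ofR; rewrite -/A; move: eA e0; lra.
    apply: (ele_trans (ofR (b ^+ 2 / 2) + ofR (3 * e) * tsum (fun x => Hf De (ofR r) x * Hf De (ofR r) x))); last first.
      by apply: eleD => //; apply: eleMl; exact: HH_chi.
    apply: (ele_trans _ _ (eleD h1 (elexx _))); rewrite -tsumZl -tsumD; apply: le_tsum => x.
    have h3 : Hf De (ofR z) x <<= Hf De (ofR r) x.
      by apply: Hf_mono => //; rewrite (le_trans zz)// (le_trans zz1)// ltW.
    apply: ele_trans (eleM (hl x) (hl x)) _.
    rewrite (_ : _ * _ = Hf De (ofR z) x * Hf De (ofR z) x + (2%:R * (Hf De (ofR z) x * (ofR e * Hf De (ofR r) x)) + ofR e * ofR e * (Hf De (ofR r) x * Hf De (ofR r) x))); last by ring.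
    apply: eleD => //.
    rewrite (_ : 3 * e = 2 * e + e); last by ring.
    have e2 : 0 <= 2 * e by rewrite mulr_ge0// ltW.
    rewrite (ofRD e2 (ltW e0)) (ofRM (ler0n R 2) (ltW e0)) ofR_nat [X in _ <<= X]mulrDl; apply: eleD.
      by rewrite -mulrA; apply: eleMl; rewrite mulrCA; apply: eleMl; exact: eleMr.
    apply: eleMr; rewrite -ofRM ?ltW//; apply: ele_ofR; move: e0 e1; nra.
  move=> k x; apply: (ele_trans (ofR (sk k) * ofR (W / 2) + ofR e * (ofR (sk k) * dC r))).
    apply: (ele_trans (ofR (oc k x) * (Hf De (ofR z) x + ofR e * Hf De (ofR r) x))); first exact: eleMl.
    by rewrite mulrDr; apply: eleD; [exact: h2|rewrite mulrCA; apply: eleMl; exact: oc_Hf].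
  rewrite mulrCA -mulrDr; apply: eleMl; rewrite -(toRK fB) -(ofRM (ltW e0) B0).
  rewrite -ofRD ?divr_ge0 ?mulr_ge0 ?(ltW e0)//; apply: ele_ofR; rewrite -/B.
  by move: eB e0; lra.
pose h := e * (r - z1).
have h0 : 0 < h by rewrite mulr_gt0 ?subr_gt0.
have [N hN] : exists N : nat, z1 <= N.+1%:R * h.
  exists (Num.truncn (z1 / h)); rewrite -ler_pdivrMr//; exact: ltW (truncnS_gt _).
have hj (j : nat) : (j <= N.+1)%N -> strong (z1 * j%:R / N.+1%:R).
  elim: j => [|j IH] jN; first by rewrite mulr0 mul0r; exact: strong0.
  have N1 : 0 < N.+1%:R :> R by [].
  apply: (step _ _ _ _ _ _ (IH (ltnW jN))).
  - by rewrite divr_ge0 ?mulr_ge0.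
  - by rewrite ler_pM2r ?invr_gt0//; apply: ler_wpM2l => //; rewrite ler_nat.
  - by rewrite ler_pdivrMr//; apply: ler_wpM2l => //; rewrite ler_nat.
  - rewrite (_ : _ - _ = z1 / N.+1%:R) ?ler_pdivrMr// 1?[h * _]mulrC//.
    by rewrite -[j.+1%:R]natr1; ring.
by have := hj N.+1 (leqnn _); rewrite mulfK ?pnatr_eq0.
Qed.

Lemma Cn_add n m : Cn (n + m) <<= Cn n * Cn m.
Proof.
apply: (ele_trans (tsum (fun x => tsum (fun v => cw De n v * cw De m (x - v))))).
  by apply: le_tsum => x; exact: cw_add.
rewrite tsum_swap -tsumZr; apply: le_tsum => v.
by rewrite tsumZl -(tsum_subr v (cw De m)) elexx.
Qed.

Lemma Cn_le1 n : Cn n <<= 1.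
Proof. exact: cw_mass (De1 Dr0 sD D1) n. Qed.

Lemma Cn_fin n : efin (Cn n).
Proof. exact: efin_le (Cn_le1 n) _. Qed.

Lemma geom_fin (q : R) : 0 <= q -> q < 1 -> tsum (fun n => ofR q ^+ n) = ofR (1 - q)^-1.
Proof.
move=> q0 q1; have q1' : 0 < 1 - q by rewrite subr_gt0.
have sumE n : \sum_(i < n) ofR q ^+ i = ofR ((1 - q ^+ n) / (1 - q)).
  rewrite (eq_bigr (fun i : 'I_n => ofR (q ^+ i))); last by move=> i _; rewrite ofRX.
  rewrite -ofR_sum; last by move=> i _; rewrite exprn_ge0.
  congr ofR; apply: (mulIf (lt0r_neq0 q1')); rewrite divfK ?gt_eqF//.
  by rewrite -opprB mulrN mulrC -subrX1 opprB.
apply: ele_anti.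
  apply: tsum_nat_ub => n; rewrite sumE; apply: ele_ofR.
  by rewrite ler_piMl ?invr_ge0 ?(ltW q1')// lerBlDr lerDl exprn_ge0.
set S := tsum _.
have [fS|nS] := boolP (efin S); last first.
  by case: (ele_total (ofR (1 - q)^-1) S) => // h; rewrite (efin_le h) in nS.
rewrite -(toRK fS); apply: ele_ofR.
have hS : S = 1 + ofR q * S.
  by rewrite {1}/S tsum_natS expr0 -tsumZl; congr (_ + _); apply: eq_tsum => n; rewrite exprS.
have : toR S = 1 + q * toR S.
  by rewrite {1}hS toRD ?efinM// toRM// ofRK// -ofR1 ofRK.
move=> h; rewrite -[leLHS]mul1r ler_pdivrMr//; lra.
Qed.

Lemma chi_sub1 (z : R) : 0 <= z -> z < 1 -> efin (chi z).
Proof.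
move=> z0 z1; apply: (@efin_le _ _ (tsum (fun n => ofR z ^+ n))); last by rewrite geom_fin.
by apply: le_tsum => n; rewrite -[X in _ <<= X]mulr1; apply: eleMl; exact: Cn_le1.
Qed.

(** Writing n = j N + i and using submultiplicativity compares the series with a geometric series of
    ratio z^N C_N. *)
Lemma chi_mult N (z : R) : 0 <= z -> (0 < N)%N -> z ^+ N * toR (Cn N) < 1 -> efin (chi z).
Proof.
move=> z0 N0; set q := _ * _ => q1; have q0 : 0 <= q by rewrite mulr_ge0 ?exprn_ge0 ?toR_ge0.
have Cp j : Cn (j * N) <<= Cn N ^+ j.
  elim: j => [|j IH]; first by rewrite expr0; exact: Cn_le1.
  by rewrite mulSn exprS; apply: ele_trans (Cn_add _ _) _; exact: eleMl.
have qE : ofR q = ofR z ^+ N * Cn N.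
  by rewrite /q (ofRM (exprn_ge0 N z0) (toR_ge0 _)) (ofRX _ z0) (toRK (Cn_fin N)).
apply: (@efin_le _ _ (tsum (fun j => ofR q ^+ j) * \sum_(i < N) ofR z ^+ i * Cn i)); last first.
  by rewrite geom_fin// efinM// efin_sum// => i _; rewrite efinM ?Cn_fin// -ofRX.
rewrite -tsumZr -(tsum_finType (fun i : 'I_N => ofR z ^+ i * Cn i)).
rewrite (eq_tsum (g := fun j => tsum (fun i : 'I_N => ofR q ^+ j * (ofR z ^+ i * Cn i)))); last by move=> j; rewrite tsumZl.
rewrite (tsum_pair (fun j (i : 'I_N) => ofR q ^+ j * (ofR z ^+ i * Cn i))) /chi.
apply: (ele_trans (tsum (fun n => (fun p : nat * 'I_N => ofR q ^+ p.1 * (ofR z ^+ p.2 * Cn p.2)) (n %/ N, Ordinal (ltn_pmod n N0))%N))).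
  apply: le_tsum => n /=; rewrite {1 2}(divn_eq n N) exprD qE exprMn -exprM -mulrACA [(N * _)%N]mulnC.
  apply: eleMl; apply: ele_trans (Cn_add _ _) _; apply: eleMr; exact: Cp.
apply: (tsum_inj_le (e := fun n => (n %/ N, Ordinal (ltn_pmod n N0))%N)).
by move=> m n [h1 h2]; rewrite (divn_eq m N) (divn_eq n N) h1 h2.
Qed.

Variable zc : R.
Hypotheses (zca : forall z : R, 0 <= z -> z < zc -> efin (chi z)) (zcb : forall z : R, zc < z -> efin (chi z) = false).

Lemma zc_ge1 : 1 <= zc.
Proof.
have [//|h] := leP 1 zc.
have h1 : zc < (Num.max zc 0 + 1) / 2.
  have : zc <= Num.max zc 0 by rewrite le_max lexx.
  by move: h; lra.
have h0 : Num.max zc 0 < 1 by rewrite gt_max h ltr01.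
have h2 : 0 <= Num.max zc 0 by rewrite le_max lexx orbT.
by have := zcb h1; rewrite chi_sub1//; lra.
Qed.

Lemma zc_strong (z : R) : 0 <= z -> z < zc -> strong z.
Proof.
move=> z0 zz; apply: (@bootstrap z ((2 * z + zc) / 3) ((z + 2 * zc) / 3)) => //; [lra|lra|].
by apply: zca; lra.
Qed.

Lemma zc_le2 : zc <= 2.
Proof.
have z1 := zc_ge1.
have h (z : R) : 0 <= z -> z < zc -> z < 2.
  move=> z0 zz; have [h1 h2] := strong_weak (zc_strong z0 zz).
  exact: (z_lt2 Dr0 sD D1 D00 Dsym z0 (ltW b0) bs h1 (zca z0 zz)).
have [//|h2] := leP zc 2.
by have := h 2 ltac:(lra) h2; lra.
Qed.

(** The bubble is a power series in z with non-negative coefficients, so the bound for z < zc passes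
    to zc by [tsum_abel]. *)
Lemma zc_bub : bub zc b.
Proof.
have z1 := zc_ge1; have zc0 : 0 <= zc by lra.
have E (z : R) : tsum (fun x => Hf De (ofR z) x * Hf De (ofR z) x) =
   tsum (fun p : V * (nat * nat) => ofR z ^+ (p.2.1.+1 + p.2.2.+1) * (cw De p.2.1.+1 p.1 * cw De p.2.2.+1 p.1)).
  rewrite -(tsum_pair (fun x (q : nat * nat) => ofR z ^+ (q.1.+1 + q.2.+1) * (cw De q.1.+1 x * cw De q.2.+1 x))).
  apply: eq_tsum => x; rewrite /Hf tsum_prod2 (tsum_pair (fun i j => ofR z ^+ i.+1 * cw De i.+1 x * (ofR z ^+ j.+1 * cw De j.+1 x))).
  by apply: eq_tsum => q; rewrite mulrACA -exprD.
rewrite /bub E; apply: (tsum_abel (e := fun p : V * (nat * nat) => (p.2.1.+1 + p.2.2.+1)%N)) => th t0 t1.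
have t0' := ltW t0.
have tz : 0 <= th * zc by rewrite mulr_ge0.
have tz1 : th * zc < zc by nra.
have [h _] := strong_weak (zc_strong tz tz1).
apply: (ele_trans _ _ h); rewrite E; apply: le_tsum => p.
by rewrite mulrA -exprMn -ofRM// elexx.
Qed.

Lemma zc_wbd : wbd zc W.
Proof.
have z1 := zc_ge1; have zc0 : 0 <= zc by lra.
move=> k x; rewrite -tsumZl; apply: (tsum_abel (e := fun n : nat => n.+1)) => th t0 t1.
have t0' := ltW t0.
have tz : 0 <= th * zc by rewrite mulr_ge0.
have tz1 : th * zc < zc by nra.
have [_ h] := strong_weak (zc_strong tz tz1).
apply: ele_trans (h k x); rewrite -tsumZl; apply: le_tsum => n.
by rewrite mulrCA; apply: eleMl; rewrite mulrA -exprMn -ofRM// elexx.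
Qed.

Lemma Cn_zc n : 1 <<= ofR zc ^+ n * Cn n.
Proof.
have z1 := zc_ge1; have zc0 : 0 <= zc by lra.
case: n => [|n].
  rewrite expr0 mul1r; apply: (ele_trans (cw De 0 0)); first by rewrite cw0 eqxx.
  exact: tsum_ge1.
rewrite -(ofRX _ zc0) -(toRK (Cn_fin n.+1)) -(ofRM (exprn_ge0 _ zc0) (toR_ge0 _)).
apply: (ele_trans (ofR 1)); first by rewrite ofR1 elexx.
apply: ele_ofR.
set C := toR (Cn n.+1); have C0 : 0 <= C by exact: toR_ge0.
have [//|h] := leP 1 (zc ^+ n.+1 * C).
(* By continuity the strict inequality would persist slightly above zc. *)
suff [z zz hz] : exists2 z, zc < z & z ^+ n.+1 * C < 1.
  have := zcb zz; rewrite (@chi_mult n.+1 z)//; lra.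
have hc : (fun z : R => z ^+ n.+1 * C) z @[z --> zc^'+] --> zc ^+ n.+1 * C.
  apply: cvg_at_right_filter; apply: cvgMl; exact: exprn_continuous.
have [z [zz hz]] : exists z, zc < z /\ z ^+ n.+1 * C < 1.
  have hn : \forall z \near zc^'+, z ^+ n.+1 * C < 1 by apply: (cvgr_lt _ hc).
  have hr : \forall z \near zc^'+, zc < z by exact: nbhs_right_gt.
  by have [z [h1 h2]] := @filter_ex _ _ _ _ (filterI hr hn); exists z.
by exists z.
Qed.

(** [Cn_zc] gives chi(th zc) >= 1 / (1 - th), so its reciprocal [FF] is at most 1 - th there. As th
    tends to 1, [FF] at 0 converges to its value at zc, because the series of Pi is dominated at
    zc. *)
Lemma FF_zc : FF zc 0 = 0.
Proof.
have z1 := zc_ge1; have zc0 : 0 <= zc by lra.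
have b0' := ltW b0.
have hb := zc_bub.
have fPc := Pi_efin Dr0 sD D1 Dsym zc0 b0' bs hb.
pose th (N : nat) : R := 1 - N.+2%:R^-1.
have th0 N : 0 < th N by rewrite subr_gt0 invf_lt1// ltr1n.
have th1 N : th N < 1 by rewrite ltrBlDr ltrDl invr_gt0.
have tz N : 0 <= th N * zc by rewrite mulr_ge0// ltW.
have tz1 N : th N * zc < zc by rewrite gtr_pMl ?th1//; lra.
have hs N := strong_weak (zc_strong (tz N) (tz1 N)).
have fP N := Pi_efin Dr0 sD D1 Dsym (tz N) b0' bs (hs N).1.
have hF N : 0 <= FF (th N * zc) 0 <= 1 - th N.
  have F0 := FF0_gt0 Dr0 sD D1 D00 Dsym (tz N) (fP N) (zca (tz N) (tz1 N)).
  rewrite (ltW F0) /=.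
  have := GF1 Dr0 sD D1 D00 Dsym (tz N) (fP N) (zca (tz N) (tz1 N)) 0.
  rewrite ct0 rsum_toR -?chiE; last exact: zca.
  have : (1 - th N)^-1 <= toR (chi (th N * zc)).
    rewrite -(@ofRK R (1 - th N)^-1); last by rewrite invr_ge0 subr_ge0 ltW.
    apply: toR_mono; first exact: zca.
    rewrite -geom_fin ?th1 ?(ltW (th0 N))//; apply: le_tsum => n.
    rewrite ofRM ?(ltW (th0 N))// exprMn -mulrA -[X in X <<= _]mulr1; apply: eleMl; exact: Cn_zc.
  move=> h1 h2; have p0 : 0 < 1 - th N by rewrite subr_gt0.
  have h3 := ler_wpM2r (ltW F0) h1; rewrite h2 mulrC ler_pdivrMr ?mul1r// in h3.
have cth : th @ \oo --> (1 : R).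
  rewrite -[X in _ --> X]subr0; apply: cvgB; first exact: cvg_cst.
  apply/cvgrPdist_lt => e e0; near=> N; rewrite sub0r normrN ger0_norm ?invr_ge0//.
  apply: (le_lt_trans (y := N.+1%:R^-1)); first by rewrite lef_pV2 ?posrE// ler_nat.
  near: N; exact: (near_infty_natSinv_lt (PosNum e0)).
have FE (z : R) : 0 <= z -> efin (tsum (fun x => tsum (fun m => ofR z ^+ m * Pt De m x))) ->
    FF z 0 = 1 - z - rsum (fun m => z ^+ m.+2 * ph_ Dr m.+2 0).
  by move=> z0 fz; rewrite /FF (ct_Pir Dr0 sD D1 z0 fz 0).2 /Dh ct0 D1 mulr1.
have c1 : (fun N => FF (th N * zc) 0) @ \oo --> FF zc 0.
  have h : (fun N => 1 - th N * zc - rsum (fun m => (th N * zc) ^+ m.+2 * ph_ Dr m.+2 0)) @ \oo --> FF zc 0.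
    rewrite (FE zc zc0 fPc); apply: cvgB.
      apply: cvgB; first exact: cvg_cst.
      by rewrite -[X in _ --> X]mul1r; apply: cvgMl.
    apply: (rsum_cvg (g := fun m => `|zc ^+ m.+2 * ph_ Dr m.+2 0|)).
    - by rewrite summ_abs; exact: (ct_Pir Dr0 sD D1 zc0 fPc 0).1.
    - near=> N => m; rewrite normrM [leRHS]normrM; apply: ler_wpM2r => //.
      by rewrite normrX [leRHS]normrX lerXn2r ?nnegrE// ger0_norm// ger0_norm// ltW.
    - move=> m; apply: cvgMl; rewrite -[zc in X in _ --> X]mul1r.
      have := @exprn_continuous R m.+2 (1 * zc) => hc.
      by apply: (continuous_cvg _ hc); apply: cvgMl.
  by rewrite (_ : (fun N => FF (th N * zc) 0) = fun N => 1 - th N * zc - rsum (fun m => (th N * zc) ^+ m.+2 * ph_ Dr m.+2 0))//; apply/funext => N; exact: FE (tz N) (fP N).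
have c0 : (fun N => FF (th N * zc) 0) @ \oo --> (0 : R).
  apply: (@squeeze_cvgr _ _ _ _ (fun=> 0) (fun N => 1 - th N)).
  - by near=> N; exact: hF.
  - exact: cvg_cst.
  - by rewrite -[X in _ --> X](subrr 1); apply: cvgB => //; exact: cvg_cst.
exact: (cvg_unique _ c1 c0).
Unshelve. all: by end_near.
Qed.
End Iteration.

(** * Resolvent bounds for the step distribution *)

Section Kernel.
Variables (R : realType) (d : nat).
Local Notation V := 'rV[int]_d.
Local Notation E := (enn R).
Implicit Types (x y : V) (k l : 'rV[R]_d) (i m : 'I_d) (f g : V -> R).

Definition ev i (s : nat) : V := delta_mx 0 i *+ s.

Lemma ph_ev l i s : ph l (ev i s) = s%:R * l ord0 i.
Proof.
rewrite /ph /dotr (bigD1 i)//= big1 ?addr0.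
  by rewrite /ztor /ev !mxE mulmxnE mxE !eqxx /= pmulrn -pmulrn mulrz_nat mulrC.
by move=> j ji; rewrite /ztor /ev !mxE mulmxnE mxE (negbTE ji) andbF mul0rn mulr0z mulr0.
Qed.

(** Averaging with a translate along axis i. The transform of the autocorrelation [Rc] is the
    squared modulus of that of f; averaging f acts on [Rc] as [As], which multiplies its transform
    by (1 + cos) / 2. *)
Definition Hs i s f x : R := (f x + f (x + ev i s)) / 2.
Definition Rc f y : R := rsum (fun x => f x * f (x + y)).
Definition As i s g y : R := (2 * g y + (g (y - ev i s) + g (y + ev i s))) / 4.

Lemma summ_addr f y : summ f -> summ (fun x => f (x + y)).
Proof. by move=> sf; have := summ_sub (- y) sf; under eq_summ => v do rewrite opprK. Qed.

Lemma rsum_addr f y : rsum (fun x => f (x + y)) = rsum f.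
Proof. by rewrite -[RHS](rsum_sub (- y)); apply: eq_rsum => x; rewrite opprK. Qed.

Lemma summ_prod_add f y : summ f -> summ (fun x => f x * f (x + y)).
Proof.
move=> sf; have sN : summ (fun x => f (- x)) by rewrite -(summ_bij (e := -%R))//; exact: inv_bij opprK.
have := summ_conv_inner (- y) sf sN; rewrite (eq_summ (g := fun x => f x * f (x + y)))// => x.
by rewrite opprB opprK.
Qed.

Lemma Rc_conv f y : Rc f y = zconv (fun x => f (- x)) f y.
Proof.
rewrite /zconv -[RHS]/(rsum _) (rsum_bij (e := -%R)); last exact: inv_bij opprK.
by apply: eq_rsum => x; rewrite !opprK addrC.
Qed.

Lemma summ_Rc f : summ f -> summ (Rc f).
Proof.
move=> sf; rewrite (eq_summ (g := zconv (fun x => f (- x)) f)); last exact: Rc_conv.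
by apply: summ_conv => //; rewrite -(summ_bij (e := -%R))//; exact: inv_bij opprK.
Qed.

Lemma Rc_even f y : Rc f (- y) = Rc f y.
Proof.
rewrite /Rc -(rsum_addr _ y); apply: eq_rsum => x.
by rewrite addrK mulrC.
Qed.

Lemma summ_Hs i s f : summ f -> summ (Hs i s f).
Proof.
move=> sf; rewrite (eq_summ (g := fun x => 2^-1 * (f x + f (x + ev i s)))).
  by apply: summZ; apply: summD => //; exact: summ_addr.
by move=> x; rewrite mulrC.
Qed.

Lemma rsum_Hs i s f : summ f -> rsum (Hs i s f) = rsum f.
Proof.
move=> sf; rewrite (eq_rsum (g := fun x => 2^-1 * (f x + f (x + ev i s)))).
  by rewrite rsumZ rsumD ?rsum_addr//; [field|exact: summ_addr].
by move=> x; rewrite mulrC.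
Qed.

Lemma Rc_Hs i s f y : summ f -> Rc (Hs i s f) y = As i s (Rc f) y.
Proof.
move=> sf; set e := ev i s.
have s1 v : summ (fun x => f x * f (x + v)) by exact: summ_prod_add.
have s2 v : summ (fun x => f (x + e) * f (x + e + v)) by have := summ_addr e (s1 v).
have e1 : rsum (fun x => f (x + e) * f (x + e + y)) = Rc f y.
  by rewrite (rsum_addr (fun x => f x * f (x + y)) e).
have e2 : rsum (fun x => f (x + e) * f (x + e + (y - e))) = Rc f (y - e).
  by rewrite (rsum_addr (fun x => f x * f (x + (y - e))) e).
transitivity (rsum (fun x => 4^-1 * (f x * f (x + y) + f (x + e) * f (x + e + y) + (f (x + e) * f (x + e + (y - e)) + f x * f (x + (y + e)))))).
  apply: eq_rsum => x; rewrite /Hs -/e.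
  have -> : x + e + (y - e) = x + y by rewrite addrACA subrr addr0.
  have -> : x + e + y = x + y + e by rewrite addrAC.
  by rewrite (addrA x y e); field.
rewrite rsumZ !rsumD ?e1 ?e2//; try by [|exact: summD].
by rewrite /As /Rc -/e; field.
Qed.

Lemma ct_As i s g l : summ g -> (forall y, g (- y) = g y) ->
  ct (As i s g) l = (1 - (1 - cos (s%:R * l ord0 i)) / 2) * ct g l.
Proof.
move=> sg ge; have sa := summ_addr (ev i s) sg; have sb := summ_sub (ev i s) sg.
rewrite (_ : As i s g = fun y => 4^-1 * (2 * g y + (g (y - ev i s) + g (y + ev i s)))); last first.
  by apply/funext => y; rewrite mulrC.
rewrite ctZ ctD; [|exact: summZ|exact: summD].
rewrite ctZ (ctD l sb sa) ct_sub//.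
rewrite (_ : (fun y => g (y + ev i s)) = fun y => g (y - - ev i s)); last by apply/funext => v; rewrite opprK.
by rewrite ct_sub// phN cosN ph_ev; field.
Qed.

Variable r : nat.

(** Doubling the distance at each stage gives the uniform average over 2^p translates with spacing r
    ([Us_sum]), while the transform of the autocorrelation picks up the product [pv]. *)
Fixpoint Us (p : nat) i f : V -> R :=
  if p is p'.+1 then Hs i (2 ^ p' * r) (Us p' i f) else f.

Lemma Us_sum p i f x : Us p i f x = (2 ^+ p)^-1 * \sum_(j < 2 ^ p) f (x + ev i (j * r)).
Proof.
elim: p x => [|p IH] x /=.
  by rewrite expr0 invr1 mul1r big_ord1 mul0n /ev mulr0n addr0.
rewrite /Hs !IH expnS mul2n -addnn big_split_ord /= exprS invfM.
rewrite [_ / 2]mulrC -!mulrA -mulrDr; congr (_ * (_ * (_ + _))).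
apply: eq_bigr => j _; congr (f _); rewrite -addrA /ev -mulrnDr; congr (_ + _ *+ _).
by rewrite mulnDl addnC.
Qed.

Fixpoint Ua (p : nat) (S : seq 'I_d) f : V -> R :=
  if S is i :: S' then Ua p S' (Us p i f) else f.

Lemma Us_ind p i f (P : (V -> R) -> Prop) :
  (forall s g, P g -> P (Hs i s g)) -> P f -> P (Us p i f).
Proof. by move=> h pf; elim: p => //= p IH; exact: h. Qed.

Lemma Ua_ind p S f (P : (V -> R) -> Prop) :
  (forall i s g, P g -> P (Hs i s g)) -> P f -> P (Ua p S f).
Proof.
move=> h; elim: S f => //= i S IH f' pf; apply: IH; apply: (@Us_ind p i f' P) => // s g; exact: h.
Qed.

Lemma Ua_prob p S f : (forall x, 0 <= f x) -> summ f ->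
  [/\ (forall x, 0 <= Ua p S f x), summ (Ua p S f) & rsum (Ua p S f) = rsum f].
Proof.
move=> f0 sf; pose P g := [/\ (forall x : V, 0 <= g x :> R), summ g & rsum g = rsum f].
apply: (@Ua_ind p S f P) => //.
move=> i s g [g0 sg gf]; split; first by move=> x; rewrite divr_ge0 ?addr_ge0.
  exact: summ_Hs.
by rewrite rsum_Hs.
Qed.

Definition vv (p : nat) i l : R := 1 - cos ((2 ^ p * r)%:R * l ord0 i).
Definition pv p i l : R := \prod_(q < p) (1 - vv q i l / 2).

Lemma ct_Rc_Us p i f l : summ f -> ct (Rc (Us p i f)) l = pv p i l * ct (Rc f) l.
Proof.
move=> sf; elim: p => [|p IH] /=; first by rewrite /pv big_ord0 mul1r.
have su : summ (Us p i f) by apply: (@Us_ind p i f (fun g : V -> R => summ g)) => // s g; exact: summ_Hs.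
rewrite (_ : Rc _ = As i (2 ^ p * r) (Rc (Us p i f))); last by apply/funext => y; rewrite Rc_Hs.
rewrite ct_As ?IH; [|exact: summ_Rc|exact: Rc_even].
by rewrite /pv big_ord_recr /= mulrA [_ * \prod_(_ < _) _]mulrC.
Qed.

Lemma ct_Rc_Ua p S f l : summ f -> ct (Rc (Ua p S f)) l = (\prod_(i <- S) pv p i l) * ct (Rc f) l.
Proof.
elim: S f => [|i S IH] f sf /=; first by rewrite big_nil mul1r.
rewrite IH; last by apply: (@Us_ind p i f (fun g : V -> R => summ g)) => // s g; exact: summ_Hs.
by rewrite ct_Rc_Us// big_cons mulrCA mulrA.
Qed.

Lemma vvS p i l : vv p.+1 i l = 2 * vv p i l * (2 - vv p i l).
Proof.
rewrite /vv expnS -mulnA mul2n -addnn natrD; move: (2 ^ p * r)%:R => s.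
rewrite mulrDl cosD -!expr2 sin2cos2; ring.
Qed.

Lemma vv_bnd p i l : 0 <= vv p i l <= 2.
Proof. by rewrite /vv; have := cos_le1 ((2 ^ p * r)%:R * l ord0 i); have := cos_geN1 ((2 ^ p * r)%:R * l ord0 i); lra. Qed.

Lemma prod_low (I : Type) (S : seq I) (a : I -> R) : (forall j : I, 0 <= a j <= 1) ->
  0 <= \prod_(i <- S) (1 - a i) <= 1 /\ 1 - \sum_(i <- S) a i <= \prod_(i <- S) (1 - a i).
Proof.
move=> ha; elim: S => [|j S [/andP[h0 h1] h2]]; first by rewrite !big_nil; split; lra.
rewrite !big_cons; have /andP[a0 a1] := ha j.
by move: h0 h1 h2; move: (\prod_(_ <- S) _) (\sum_(_ <- S) _) => P Q h0 h1 h2; split; nra.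
Qed.

Lemma pv01 p i l : 0 <= pv p i l <= 1.
Proof.
by have [] := @prod_low _ (index_enum 'I_p) (fun q => vv q i l / 2) (fun q => ltac:(have := vv_bnd q i l; lra)).
Qed.

(** By [vvS], a value at most 1 at least doubles at the next scale, so all earlier values together
    are below the next one. *)
Lemma vv_sum p i l : (forall q, (q < p)%N -> vv q i l <= 1) -> \sum_(q < p) vv q i l <= vv p i l.
Proof.
elim: p => [|p IH] h; first by rewrite big_ord0; have /andP[] := vv_bnd 0 i l.
rewrite big_ord_recr /= vvS; have := IH (fun q qp => h q (ltnW qp)); have := h p (ltnSn p).
have /andP[v0 _] := vv_bnd p i l; move: (\sum_(_ < p) _) => S h1 h2; nra.
Qed.

Lemma pv_low p i l (e : R) : 0 <= e <= 1 -> (forall q, (q < p)%N -> vv q i l <= e) -> 1 - e <= pv p i l.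
Proof.
move=> /andP[e0 e1] h.
have [_ hp] := @prod_low _ (index_enum 'I_p) (fun q => vv q i l / 2) (fun q => ltac:(have := vv_bnd q i l; lra)).
apply: le_trans hp; rewrite lerD2l lerN2 -mulr_suml ler_pdivrMr//.
case: p h => [|p] h; first by rewrite big_ord0; lra.
rewrite big_ord_recr /=.
have := @vv_sum p i l (fun q qp => le_trans (h q (ltnW qp)) e1); have := h p (ltnSn p).
by move: (\sum_(_ < p) _) => S; lra.
Qed.

(** * The dyadic majorant of the squared resolvent *)

Section Main.
Variable Dr : V -> R.
Hypotheses (Dr0 : forall x, 0 <= Dr x) (sD : summ Dr) (D1 : rsum Dr = 1).
Hypothesis Dsym : forall x, Dr (- x) = Dr x.
Hypothesis d0 : (0 < d)%N.
Variables (C1 K Q : R).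
Hypotheses (C10 : 0 < C1) (K0 : 0 <= K) (Q1 : 1 < Q) (Qd : Q ^+ 2 < 2 ^+ d).
Hypothesis H1 : forall p i l, vv p i l <= C1 * Q ^+ p * sk Dr l.
Hypothesis H2 : forall p x, Ua p (enum 'I_d) Dr x <= K / 2 ^+ (p * d).

Definition Mk p : V -> R := Rc (Ua p (enum 'I_d) Dr).

Lemma summ_Mk p : summ (Mk p).
Proof. by apply: summ_Rc; have [] := Ua_prob p (enum 'I_d) Dr0 sD. Qed.

Lemma ct_Mk p l : ct (Mk p) l = (\prod_i pv p i l) * Dh Dr l ^+ 2.
Proof.
rewrite ct_Rc_Ua// big_enum /=; congr (_ * _).
rewrite (_ : Rc Dr = zconv Dr Dr); first by rewrite ct_conv.
have DE : (fun x => Dr (- x)) = Dr by apply/funext => x; rewrite Dsym.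
by apply/funext => y; rewrite Rc_conv DE.
Qed.

Lemma Mk0 p : Mk p 0 <= K / 2 ^+ (p * d).
Proof.
have [u0 su u1] := Ua_prob p (enum 'I_d) Dr0 sD.
rewrite D1 in u1; rewrite -[leRHS]mulr1 -[X in _ <= _ * X]u1 -rsumZ /Mk /Rc; apply: le_rsum.
- by exact: summ_prod_add.
- exact: summZ.
by move=> x; rewrite addr0; apply: ler_wpM2r => //; exact: H2.
Qed.

(** Chosen so that (2 d C1 Q^p)^2 = Ck Q^(2p) / 2; [qk] is the ratio of the series that bounds
    M(0). *)
Definition Ck : R := 8 * d%:R ^+ 2 * C1 ^+ 2.
Definition qk : R := Q ^+ 2 / 2 ^+ d.

Lemma prod_pv_low p l : (forall q i, (q < p)%N -> vv q i l <= (2 * d%:R)^-1) -> 1 / 2 <= \prod_i pv p i l.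
Proof.
move=> h; have d0R : 0 < d%:R :> R by rewrite ltr0n.
have e01 : 0 <= (2 * d%:R : R)^-1 <= 1.
  rewrite invr_ge0 mulr_ge0//= invf_le1 ?mulr_gt0//.
  have : 1 <= d%:R :> R by rewrite ler1n.
  by lra.
have [_] := @prod_low _ (index_enum 'I_d) (fun i => 1 - pv p i l) (fun i => ltac:(have := pv01 p i l; lra)).
have -> : \prod_i (1 - (1 - pv p i l)) = \prod_i pv p i l by apply: eq_bigr => i _; rewrite subKr.
apply: le_trans.
have : \sum_(i < d) (1 - pv p i l) <= \sum_(i < d) (2 * d%:R)^-1.
  apply: ler_sum => i _; have := @pv_low p i l _ e01 (fun q => h q i); lra.
have -> : \sum_(i < d) (2 * d%:R)^-1 = 1 / 2 :> R.
  by rewrite sumr_const card_ord -mulr_natr; field; rewrite gt_eqF.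
by move: (\sum_(_ < d) _) => S; lra.
Qed.

(** M is Ck times the sum of Q^(2p) [Mk p] for p <= P. Given l, take the least p at which some
    [vv p i l] exceeds 1 / (2d). By minimality the product of the [pv] is still at least 1/2, and
    [H1] gives 1 - D(l) >= 1 / (2 d C1 Q^p); this one term suffices. If there is no such p, the term
    P suffices, P being so large that it exceeds 1 / e^2. *)
Theorem resolvent_kernel (e : R) : 0 < e -> exists M : V -> R,
  [/\ summ M, (forall l, Dh Dr l ^+ 2 / (e + sk Dr l) ^+ 2 <= ct M l) & M 0 <= Ck * K / (1 - qk)].
Proof.
move=> e0; have d0R : 0 < d%:R :> R by rewrite ltr0n.
have Ck0 : 0 < Ck by rewrite /Ck !mulr_gt0 ?exprn_gt0.
have Q0 : 0 < Q by move: Q1; lra.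
have q0 : 0 <= qk by rewrite divr_ge0 ?exprn_ge0// ltW.
have q1 : qk < 1 by rewrite ltr_pdivrMr ?exprn_gt0// mul1r.
have [P hP] : exists P : nat, 2 / (e ^+ 2 * Ck) <= (Q ^+ 2) ^+ P.
  have Q2 : 1 < Q ^+ 2 by rewrite exprn_egt1.
  have hb n : 1 + n%:R * (Q ^+ 2 - 1) <= (Q ^+ 2) ^+ n.
    move: (Q ^+ 2) Q2 => Y Y1; elim: n => [|n IH]; first by rewrite mul0r addr0 expr0.
    rewrite exprS -natr1; move: IH (ler0n R n); move: (n%:R : R) (Y ^+ n) => N X IH N0.
    have : 0 <= N * (Y - 1) ^+ 2 by rewrite mulr_ge0 ?sqr_ge0.
    by nra.
  exists (Num.truncn (2 / (e ^+ 2 * Ck) / (Q ^+ 2 - 1))).+1.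
  have q10 : 0 < Q ^+ 2 - 1 by lra.
  apply: le_trans (hb _); have := truncnS_gt (2 / (e ^+ 2 * Ck) / (Q ^+ 2 - 1)).
  by rewrite ltr_pdivrMr//; lra.
exists (fun x => Ck * \sum_(p < P.+1) Q ^+ (2 * p) * Mk p x); split.
- by apply: summZ; apply: summ_big => p _; apply: summZ; exact: summ_Mk.
- move=> l; rewrite ctZ.
  have -> : ct (fun x => \sum_(p < P.+1) Q ^+ (2 * p) * Mk p x) l = \sum_(p < P.+1) Q ^+ (2 * p) * ct (Mk p) l.
    rewrite /ct; under eq_rsum => x do rewrite mulr_suml.
    rewrite rsum_big; last by move=> p _; apply: summ_cos; apply: summZ; exact: summ_Mk.
    by apply: eq_bigr => p _; rewrite -rsumZ; apply: eq_rsum => x; rewrite mulrA.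
  under eq_bigr => p _ do rewrite ct_Mk mulrA.
  rewrite -mulr_suml mulrA mulrC; apply: ler_wpM2r; first exact: sqr_ge0.
  have /andP[s0 s2] := sk_bnd Dr0 sD D1 l.
  have es : 0 < (e + sk Dr l) ^+ 2 by rewrite exprn_gt0//; lra.
  have term (p : 'I_P.+1) : Ck * (Q ^+ (2 * p) * \prod_i pv p i l) <= Ck * \sum_(p < P.+1) Q ^+ (2 * p) * \prod_i pv p i l.
    apply: ler_wpM2l; first exact: ltW.
    rewrite (bigD1 p)//= lerDl; apply: sumr_ge0 => q _; rewrite mulr_ge0 ?exprn_ge0 ?(ltW Q0)//.
    by apply: prodr_ge0 => i _; have /andP[] := pv01 q i l.
  pose bad p := [exists i : 'I_d, (2 * d%:R)^-1 < vv p i l].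
  have good q i : ~~ bad q -> vv q i l <= (2 * d%:R)^-1.
    by move=> /existsPn/(_ i); rewrite -leNgt.
  have [/existsP hex|hno] := boolP [exists p : 'I_P.+1, bad p].
    have hex' : exists p : nat, bad p && (p < P.+1)%N by case: hex => p hp; exists p; rewrite hp ltn_ord.
    case: (ex_minnP hex') => p /andP[/existsP[i bp] pP] pmin.
    apply: le_trans (term (Ordinal pP)) => /=.
    have hpv : 1 / 2 <= \prod_i pv p i l.
      apply: prod_pv_low => q j qp; apply: good; apply/negP => bq.
      by have := pmin q; rewrite bq (ltn_trans qp pP) leqNgt qp => /(_ isT).
    have h3 : (2 * d%:R)^-1 <= C1 * Q ^+ p * sk Dr l by apply: le_trans (ltW bp) (H1 p i l).
    have h4 : 1 <= 2 * d%:R * (C1 * Q ^+ p) * (e + sk Dr l).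
      move: h3; rewrite -[_^-1]mul1r ler_pdivrMr ?mulr_gt0// => h3.
      have : 0 <= C1 * Q ^+ p * e by rewrite !mulr_ge0 ?exprn_ge0 ?ltW.
      have d1 : 0 <= 2 * d%:R :> R by rewrite mulr_ge0.
      move=> h5; have := mulr_ge0 d1 h5; lra.
    apply: (le_trans (y := (2 * d%:R * (C1 * Q ^+ p)) ^+ 2)).
      rewrite -[_^-1]mul1r ler_pdivrMr// -exprMn -[leLHS](expr1n _ 2) ler_sqr ?nnegrE//.
      by apply: le_trans h4.
    rewrite (_ : _ ^+ 2 = Ck * (Q ^+ (2 * p) * (1 / 2))); last by rewrite /Ck mulnC exprM; field.
    apply: ler_wpM2l; first exact: ltW.
    by apply: ler_wpM2l; rewrite // exprn_ge0// ltW.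
  apply: le_trans (term ord_max) => /=.
  have hpv : 1 / 2 <= \prod_i pv P i l.
    apply: prod_pv_low => q j qp; apply: good; apply: contra hno => bq.
    by apply/existsP; exists (widen_ord (leqnSn P) (Ordinal qp)).
  apply: (le_trans (y := Ck * (Q ^+ (2 * P) * (1 / 2)))); last first.
    apply: ler_wpM2l; first exact: ltW.
    by apply: ler_wpM2l; rewrite // exprn_ge0// ltW.
  apply: (le_trans (y := (e ^+ 2)^-1)).
    have es1 : 0 < e + sk Dr l by lra.
    by rewrite lef_pV2 ?posrE ?exprn_gt0// lerXn2r ?nnegrE ?(ltW es1) ?(ltW e0)//; lra.
  move: hP; rewrite -exprM ler_pdivrMr ?mulr_gt0 ?exprn_gt0// => hP.
  by rewrite -[_^-1]mul1r ler_pdivrMr ?exprn_gt0//; lra.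
- rewrite -mulrA; apply: ler_wpM2l; first exact: ltW.
  apply: (le_trans (y := K * \sum_(p < P.+1) qk ^+ p)).
    rewrite mulr_sumr; apply: ler_sum => p _; rewrite /qk exprMn exprVn -!exprM mulrCA [(d * p)%N]mulnC.
    by apply: ler_wpM2l; [rewrite exprn_ge0// ltW|exact: Mk0].
  apply: ler_wpM2l => //; rewrite -[leRHS]mul1r ler_pdivlMr ?subr_gt0//.
  have -> : (\sum_(p < P.+1) qk ^+ p) * (1 - qk) = 1 - qk ^+ P.+1.
    by rewrite -opprB mulrN mulrC -subrX1 opprB.
  by rewrite lerBlDr lerDl exprn_ge0.
Qed.
End Main.
End Kernel.

(** * Steps with a power-law tail *)

Section Counting.
Variables (R : realType) (d : nat).
Local Notation V := 'rV[int]_d.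
Local Notation E := (enn R).

Lemma box_count (T : nat) :
  tsum (fun x : V => [forall m, (`|x ord0 m| <= T)%N]%:R : E) <<= ((2 * T).+1 ^ d)%:R.
Proof.
apply: tsum_ub => s us.
pose b (x : V) := [forall m, (`|x ord0 m| <= T)%N].
pose phi (x : V) : {ffun 'I_d -> 'I_(2 * T).+1} := [ffun m => inord `|x ord0 m + T%:Z|].
have -> : \sum_(x <- s) (b x)%:R = (size [seq x <- s | b x])%:R :> E.
  by rewrite size_filter -sum1_count natr_sum [RHS]big_mkcond /=; apply: eq_bigr => x _; case: (b x).
have -> : (size (seq.filter b s) = size (map phi (seq.filter b s)))%N by rewrite size_map.
have um : uniq (map phi (seq.filter b s)).
  rewrite map_inj_in_uniq ?filter_uniq// => x y; rewrite !mem_filter => /andP[/forallP bx _] /andP[/forallP by_ _] e.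
  apply/matrixP => i j; rewrite !ord1; have := congr1 (fun f : {ffun 'I_d -> 'I_(2 * T).+1} => nat_of_ord (f j)) e.
  rewrite !ffunE /= !inordK; [|by have := by_ j; lia|by have := bx j; lia].
  change (`|(x ord0 j + T)%R|%N = `|(y ord0 j + T)%R|%N -> x ord0 j = y ord0 j).
  by move: (bx j) (by_ j); move: (x ord0 j) (y ord0 j) => u v; clear; lia.
rewrite -!(ofR_nat R); apply: ele_ofR; rewrite ler_nat.
rewrite -(card_uniqP um); apply: leq_trans (max_card _) _.
by rewrite card_ffun !card_ord.
Qed.

Lemma line_count (a : int) (r N M : nat) (T : R) : T *+ 2 <= (M * r)%:R -> (0 < r)%N ->
  \sum_(j < N) ((`|(a + (j * r)%N%:Z)%:~R| <= T :> R)%:R : E) <<= M.+1%:R.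
Proof.
move=> hT r0; pose g (j : nat) := `|(a + (j * r)%N%:Z)%:~R| <= T :> R.
have -> : \sum_(j < N) (g j)%:R = (size (seq.filter g (iota 0 N)))%:R :> E.
  rewrite size_filter -sum1_count natr_sum [RHS]big_mkcond /= -(big_mkord xpredT (fun j => (g j)%:R)) /index_iota subn0.
  by apply: eq_bigr => x _; case: (g x).
rewrite -!(ofR_nat R); apply: ele_ofR; rewrite ler_nat.
case E0 : (seq.filter g (iota 0 N)) => [//|j0 s]; rewrite -E0.
have hmin j : j \in seq.filter g (iota 0 N) -> (j0 <= j)%N.
  have : sorted leq (seq.filter g (iota 0 N)) by apply: sorted_filter; [exact: leq_trans|exact: iota_sorted].
  rewrite E0 /= => hp; rewrite inE => /orP[/eqP->//|js].
  by have := order_path_min leq_trans hp => /allP/(_ j js).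
rewrite -(size_iota j0 M.+1); apply: uniq_leq_size; first by rewrite filter_uniq// iota_uniq.
move=> j hj; rewrite mem_iota (hmin j hj) /=.
have g0 : g j0 by have := mem_head j0 s; rewrite -E0 mem_filter => /andP[].
have gj : g j by move: hj; rewrite mem_filter => /andP[].
move: g0 gj; rewrite /g !ler_norml => /andP[h1 _] /andP[_ h2].
have h3 : (j * r)%:R <= ((j0 + M) * r)%:R :> R.
  rewrite mulnDl natrD; move: h1 h2; rewrite !intrD -!pmulrn; lra.
by move: h3; rewrite ler_nat leq_pmul2r// addnS ltnS.
Qed.
End Counting.

Section Profile.
Variables (R : realType) (d : nat) (alpha : R) (h : 'rV[R]_d -> R).
Hypotheses (al0 : 0 < alpha) (d1 : (1 <= d)%N) (hh : step_profile alpha h).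
Local Notation V := 'rV[int]_d.
Local Notation E := (enn R).

Lemma powR2_gt1 (x : R) : 0 < x -> 1 < 2 `^ x.
Proof. by move=> x0; have := gt0_ltr_powR x0 (x := 1) (y := 2); rewrite !powR1 => ->//; rewrite ?nnegrE ?ltr1n. Qed.

Lemma powR_expn (x y : R) (n : nat) : 0 <= x -> (x ^+ n) `^ y = (x `^ y) ^+ n.
Proof. by move=> x0; rewrite -powR_mulrn// -powRrM mulrC powRrM powR_mulrn// powR_ge0. Qed.

(** Reciprocal of the tail profile, |x|^(d+alpha). *)
Definition pw (t : R) : R := t `^ (d%:R + alpha).

Lemma pwM s t : 0 <= s -> 0 <= t -> pw (s * t) = pw s * pw t.
Proof. by move=> s0 t0; rewrite /pw powRM. Qed.
Lemma pw_gt0 t : 0 < t -> 0 < pw t. Proof. exact: powR_gt0. Qed.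
Lemma pw_ge0 t : 0 <= pw t. Proof. exact: powR_ge0. Qed.
Lemma pw_le s t : 0 <= s -> s <= t -> pw s <= pw t.
Proof. by move=> s0 st; apply: ge0_ler_powR; rewrite ?nnegrE ?(le_trans s0 st)// addr_ge0// ltW. Qed.
Lemma pw1 : pw 1 = 1. Proof. by rewrite /pw powR1. Qed.
Lemma pw_split t : 0 < t -> pw t = t ^+ d * t `^ alpha.
Proof. by move=> t0; rewrite /pw powRD ?powR_mulrn ?ltW// (gt_eqF t0) implybT. Qed.

Lemma coord_enorm (x : 'rV[R]_d) m : `|x ord0 m| <= enorm x.
Proof.
rewrite /enorm -sqrtr_sqr ler_wsqrtr// /dotr (bigD1 m)//= expr2 lerDl.
by apply: sumr_ge0 => i _; rewrite -expr2 sqr_ge0.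
Qed.

Lemma enorm_coord (x : 'rV[R]_d) (T : R) : 0 <= T -> (forall m, `|x ord0 m| <= T) -> enorm x <= d%:R * T.
Proof.
move=> T0 hx; rewrite -[leRHS]ger0_norm ?mulr_ge0// -sqrtr_sqr /enorm ler_wsqrtr// /dotr.
apply: (le_trans (y := \sum_(i < d) T ^+ 2)).
  apply: ler_sum => i _; rewrite -expr2 -(@real_normK _ (x _ _)) ?num_real//.
  by rewrite lerXn2r ?nnegrE.
rewrite sumr_const card_ord -[leLHS]mulr_natl [leRHS]exprMn; apply: ler_wpM2r; first exact: sqr_ge0.
rewrite -natrX ler_nat; case: (d) d1 => // n _; exact: (leq_pmulr n.+1 (ltn0Sn n)).
Qed.

Lemma profile_tail_two : exists c M : R, [/\ 0 < c, 1 <= M &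
  forall x, M < enorm x -> c <= h x * pw (enorm x) <= 3 * c].
Proof.
have [c c0 hc] := profile_tail hh; have [M hM] := hc (1/2) ltac:(lra).
exists (c / 2), (Num.max M 1); split; [lra|by rewrite le_max lexx orbT|].
move=> x; rewrite gt_max => /andP[/hM h1 x1].
have x0 : 0 < enorm x by lra.
have p0 : 0 < pw (enorm x) by exact: pw_gt0.
have E0 : enorm x `^ (- d%:R - alpha) = (pw (enorm x))^-1 by rewrite -opprD powRN.
move: h1; rewrite E0 invfM invrK mulrA ltr_norml => /andP[h1 h2].
have E1 : h x * c^-1 * pw (enorm x) = (h x * pw (enorm x)) / c by rewrite mulrAC.
have h3 : 1 / 2 <= (h x * pw (enorm x)) / c by rewrite -E1 -mulrA; lra.
have h4 : (h x * pw (enorm x)) / c <= 3 / 2 by rewrite -E1 -mulrA; lra.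
by move: h3 h4; rewrite ler_pdivlMr// ler_pdivrMr//; lra.
Qed.

(** Dyadic form of the upper tail bound: s is the least scale whose box contains x, and h is
    dominated by a superposition of boxes weighted by 1 / pw(2^s). Boxes are used because averaging
    along an axis acts on them one coordinate at a time. *)
Lemma profile_upper : exists2 C : R, 0 < C & forall x : 'rV[R]_d, exists s : nat,
  (forall m, `|x ord0 m| <= 2 ^+ s) /\ h x * pw (2 ^+ s) <= C.
Proof.
have [c [M [c0 M1 hM]]] := profile_tail_two; have [Mh hMh] := profile_bounded hh.
have Mh0 : 0 <= Mh by apply: le_trans (profile_ge0 hh 0) (hMh 0).
have p2 : 0 < pw 2 by exact: pw_gt0.
have pM : 0 <= pw (2 * M) by exact: pw_ge0.
exists (Mh + pw 2 * (3 * c) + Mh * pw (2 * M)).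
  have := mulr_gt0 p2 c0; have := mulr_ge0 Mh0 pM; lra.
move=> x.
have hex : exists s : nat, [forall m, `|x ord0 m| <= 2 ^+ s].
  exists (Num.truncn (enorm x)).+1; apply/forallP => m; apply: le_trans (coord_enorm x m) _.
  apply: le_trans (ltW (truncnS_gt _)) _.
  by rewrite -natrX ler_nat ltnW// ltn_expl.
case: (ex_minnP hex) => s /forallP hs smin; exists s; split; first exact: hs.
have h0 := profile_ge0 hh x; have hMx := hMh x.
case: s hs smin => [|s] hs smin.
  rewrite expr0 pw1 mulr1; have := mulr_gt0 p2 c0; have := mulr_ge0 Mh0 pM; lra.
have [m hm] : exists m, 2 ^+ s < `|x ord0 m|.
  apply/existsP; rewrite -[X in is_true X]negbK negb_exists; apply/negP => /forallP hn.
  have := smin s; rewrite ltnn => /(_ _)/negP; case=> //.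
  by apply/forallP => m; rewrite leNgt; exact: hn.
have xs : 2 ^+ s <= enorm x by apply: le_trans (ltW hm) (coord_enorm x m).
have s0 : 0 <= 2 ^+ s :> R by rewrite exprn_ge0.
rewrite exprS pwM//.
have hp := pw_le s0 xs.
have [hx|hx] := leP (enorm x) M.
  have : h x * (pw 2 * pw (2 ^+ s)) <= Mh * pw (2 * M).
    rewrite -pwM//; apply: ler_pM => //; first exact: pw_ge0.
    by apply: pw_le; [rewrite mulr_ge0|apply: ler_wpM2l => //; exact: le_trans xs hx].
  have := mulr_gt0 p2 c0; lra.
have /andP[_ h2] := hM x hx.
have h3 := ler_wpM2l h0 hp.
have : h x * (pw 2 * pw (2 ^+ s)) <= pw 2 * (3 * c).
  by rewrite mulrCA; apply: ler_wpM2l; [exact: ltW|exact: le_trans h3 h2].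
by have := mulr_ge0 Mh0 pM; lra.
Qed.

Lemma profile_lower : exists c : R, exists s0 : nat, 0 < c /\
  forall x, 2 ^+ s0 <= enorm x -> c <= h x * pw (enorm x).
Proof.
have [c [M [c0 M1 hM]]] := profile_tail_two; exists c, (Num.truncn M).+1; split=> // x hx.
suff /hM/andP[] : M < enorm x by [].
apply: lt_le_trans hx; apply: lt_le_trans (truncnS_gt _) _.
by rewrite -natrX ler_nat ltnW// ltn_expl.
Qed.

Lemma profile_even x : h (- x) = h x.
Proof.
pose fl (s : seq 'I_d) (x : 'rV[R]_d) : 'rV[R]_d := \row_l (if l \in s then - x 0 l else x 0 l).
have H s : uniq s -> h (fl s x) = h x.
  elim: s => [|i s IH] /=; first by move=> _; congr h; apply/rowP => j; rewrite mxE.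
  move=> /andP[nis us]; rewrite -(IH us) -(profile_reflect hh i (fl s x)); congr h.
  apply/rowP => j; rewrite !mxE inE; have [->|ji] := eqVneq j i; rewrite ?eqxx ?(negbTE nis)//=.
rewrite -(H (enum 'I_d) (enum_uniq _)); congr h.
by apply/rowP => j; rewrite !mxE mem_enum.
Qed.

(** * The step distribution for fixed L *)

Section FixedL.
Variable L : R.
Hypothesis L1 : 1 <= L.
Variables (C c : R) (s0 : nat).
Hypotheses (C0 : 0 < C) (c0 : 0 < c).
Hypothesis hC : forall x : 'rV[R]_d, exists s : nat, (forall m, `|x ord0 m| <= 2 ^+ s) /\ h x * pw (2 ^+ s) <= C.
Hypothesis hc : forall x : 'rV[R]_d, 2 ^+ s0 <= enorm x -> c <= h x * pw (enorm x).

Let L0 : 0 < L. Proof. by move: L1; lra. Qed.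

Definition hL (x : V) : R := h (L^-1 *: ztor R x).
Definition A_ : R := 2 `^ alpha.
Definition ind (s : nat) (x : V) (m : 'I_d) : E := (`|(x ord0 m)%:~R| <= 2 ^+ s * L :> R)%:R.
Definition Ws (s : nat) : R := C / (2 ^+ (s * d) * A_ ^+ s).

Lemma A_gt1 : 1 < A_.
Proof. exact: powR2_gt1. Qed.
Let A0 : 0 < A_. Proof. by have := A_gt1; lra. Qed.

Lemma pw2s (s : nat) : pw (2 ^+ s) = 2 ^+ (s * d) * A_ ^+ s.
Proof.
rewrite pw_split ?exprn_gt0// -exprM; congr (_ * _).
exact: powR_expn.
Qed.

Lemma Ws_ge0 s : 0 <= Ws s.
Proof. by rewrite divr_ge0 ?mulr_ge0 ?exprn_ge0// ltW. Qed.

Lemma hL_ge0 x : 0 <= hL x. Proof. exact: profile_ge0 hh _. Qed.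

Lemma ztor_scale (x : V) m : (L^-1 *: ztor R x) ord0 m = L^-1 * (x ord0 m)%:~R.
Proof. by rewrite !mxE. Qed.

Lemma hL_upper x : ofR (hL x) <<= tsum (fun s => ofR (Ws s) * \prod_m ind s x m).
Proof.
have [s [h1 h2]] := hC (L^-1 *: ztor R x).
apply: (ele_trans _ _ (tsum_ge1 (fun s => ofR (Ws s) * \prod_m ind s x m) s)).
rewrite big1 ?mulr1.
  apply: ele_ofR; rewrite /Ws -pw2s ler_pdivlMr ?pw_gt0 ?exprn_gt0//.
move=> m _; rewrite /ind; have := h1 m; rewrite ztor_scale normrM gtr0_norm ?invr_gt0//.
by rewrite mulrC ler_pdivrMr// => ->.
Qed.

Lemma geomA : tsum (fun s => ofR (A_^-1) ^+ s) = ofR (1 - A_^-1)^-1.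
Proof. by rewrite geom_fin ?invr_ge0 ?(ltW A0)// invf_lt1// A_gt1. Qed.

Definition CS : R := C * 3 ^+ d / (1 - A_^-1).

Lemma CS_gt0 : 0 < CS.
Proof.
rewrite divr_gt0 ?mulr_gt0 ?exprn_gt0// subr_gt0 invf_lt1//; exact: A_gt1.
Qed.

Lemma hL_sum : tsum (fun x => ofR (hL x)) <<= ofR (CS * L ^+ d).
Proof.
have q1 : 0 < 1 - A_^-1 by rewrite subr_gt0 invf_lt1// A_gt1.
have e3 : 0 <= C * 3 ^+ d * L ^+ d by rewrite !mulr_ge0 ?exprn_ge0// ltW.
apply: (ele_trans (tsum (fun s => ofR (C * 3 ^+ d * L ^+ d) * ofR (A_^-1) ^+ s))); last first.
  rewrite tsumZl geomA -ofRM ?invr_ge0 ?(ltW q1)//; apply: ele_ofR.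
  by rewrite /CS; apply: eq_ler; ring.
apply: (ele_trans (tsum (fun x => tsum (fun s => ofR (Ws s) * \prod_m ind s x m)))).
  by apply: le_tsum => x; exact: hL_upper.
rewrite tsum_swap; apply: le_tsum => s; rewrite tsumZl.
pose T := Num.truncn (2 ^+ s * L).
have TL : T%:R <= 2 ^+ s * L by rewrite truncn_le mulr_ge0 ?exprn_ge0// ltW.
have sL1 : 1 <= 2 ^+ s * L.
  by rewrite -[leLHS]mul1r; apply: ler_pM => //; rewrite ?ler01// exprn_ege1// ler1n.
apply: (ele_trans (ofR (Ws s) * ((2 * T).+1 ^ d)%:R)).
  apply: eleMl; apply: (ele_trans _ _ (box_count R d T)); apply: le_tsum => x.
  have [_|/forallPn[m hm]] := boolP [forall m, (`|x ord0 m| <= T)%N].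
    elim/big_ind: _ => //; first by move=> u v h1 h2; rewrite -[X in _ <<= X]mulr1; exact: eleM.
    by move=> m _; rewrite /ind; case: (_ <= _); rewrite ?elexx ?ele0.
  rewrite (bigD1 m)//= /ind [X in X * _](_ : _ = 0) ?mul0r ?ele0//.
  suff -> : (`|(x ord0 m)%:~R| <= 2 ^+ s * L) = false by [].
  apply/negbTE; rewrite -ltNge -intr_norm; apply: lt_le_trans (truncnS_gt _) _.
  by rewrite -/T -abszE -pmulrn ler_nat ltnNge.
rewrite -(ofR_nat R) -ofRM ?Ws_ge0// -ofRX ?invr_ge0 ?(ltW A0)// -ofRM ?exprn_ge0 ?invr_ge0 ?(ltW A0)//.
apply: ele_ofR; rewrite /Ws.
have -> : C * 3 ^+ d * L ^+ d * A_^-1 ^+ s = C / (2 ^+ (s * d) * A_ ^+ s) * (3 * (2 ^+ s * L)) ^+ d.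
  rewrite !exprMn -exprM exprVn; field.
  by rewrite !expf_neq0// gt_eqF.
apply: ler_wpM2l; first exact: Ws_ge0.
rewrite natrX lerXn2r ?nnegrE//; first by rewrite mulr_ge0//; lra.
by rewrite -natr1 natrM; lra.
Qed.

Definition SL : R := rsum hL.

Lemma summ_hL : summ hL.
Proof. by rewrite summ_ge0E; [exact: efin_ofR_le hL_sum|exact: hL_ge0]. Qed.

Lemma SL_upper : SL <= CS * L ^+ d.
Proof.
rewrite /SL rsum_ge0E; last exact: hL_ge0.
apply: toR_le hL_sum; rewrite mulr_ge0 ?exprn_ge0 ?(ltW L0)//; exact: ltW CS_gt0.
Qed.

(** The lattice spacing of the translates: an integer between L and 2 L. *)
Definition rr : nat := (Num.truncn L).+1.
Lemma rr_bnd : L <= rr%:R <= 2 * L.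
Proof.
rewrite (ltW (truncnS_gt L)) /rr -natr1 /=.
have : (Num.truncn L)%:R <= L by rewrite truncn_le ltW.
by move: L1; lra.
Qed.

(** The lower bound on the coordinates puts x / L into the tail region. The factor 3 leaves room for
    a box and a shift by n rr; 6 d arises from rr <= 2 L and from comparing the Euclidean norm with
    the coordinates. *)
Lemma far_low (n : nat) (x : V) : (0 < n)%N ->
  (forall m, (2 ^ s0 * n * rr)%:R <= ((x ord0 m)%:~R : R) <= (3 * (2 ^ s0 * n * rr))%:R) ->
  c / pw ((6 * d * 2 ^ s0 * n)%:R) <= hL x.
Proof.
move=> n0 hx; have /andP[r1 r2] := rr_bnd.
have m0 : 'I_d by exact: (Ordinal d1).
have K0 : 0 < (2 ^ s0)%:R :> R by rewrite ltr0n expn_gt0.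
have n1 : 1 <= n%:R :> R by rewrite ler1n.
have hx2 m : 0 <= (x ord0 m)%:~R :> R by have /andP[h1 _] := hx m; apply: le_trans h1.
have low : 2 ^+ s0 <= enorm (L^-1 *: ztor R x).
  apply: le_trans (coord_enorm _ m0); rewrite ztor_scale ger0_norm ?mulr_ge0 ?invr_ge0 ?(ltW L0)//.
  rewrite mulrC ler_pdivlMr//; have /andP[h1 _] := hx m0; apply: le_trans h1.
  rewrite !natrM -natrX -mulrA; apply: ler_wpM2l; first exact: ltW.
  by rewrite -[leLHS]mul1r; apply: ler_pM => //; exact: ltW.
have up : enorm (L^-1 *: ztor R x) <= (6 * d * 2 ^ s0 * n)%:R.
  apply: (le_trans (enorm_coord (T := (6 * 2 ^ s0 * n)%:R) _ _)) => //.
    move=> m; rewrite ztor_scale ger0_norm ?mulr_ge0 ?invr_ge0 ?(ltW L0)//.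
    rewrite mulrC ler_pdivrMr//; have /andP[_ h2] := hx m; apply: le_trans h2 _.
    rewrite !natrM; have := mulr_ge0 (ltW K0) (ler0n R n) => kn.
    have := ler_wpM2l kn r2; lra.
  by rewrite -natrM ler_nat !mulnA [(d * 6)%N]mulnC.
have e0 : 0 < enorm (L^-1 *: ztor R x) by apply: lt_le_trans low; rewrite exprn_gt0.
have := hc low; rewrite -ler_pdivrMr ?pw_gt0// => h3; apply: le_trans h3.
apply: ler_wpM2l; first exact: ltW.
rewrite lef_pV2 ?posrE ?pw_gt0//; first exact: pw_le (ltW e0) up.
exact: lt_le_trans up.
Qed.

Definition boxpt (b : nat) (t : {ffun 'I_d -> 'I_b}) : V := \row_m (b + t m)%:Z.

Lemma boxpt_inj b : injective (@boxpt b).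
Proof.
move=> t u /rowP e; apply/ffunP => m; have := e m; rewrite !mxE => -[/addnI h1].
exact: val_inj.
Qed.

Definition cS : R := c / pw ((6 * d * 2 ^ s0)%:R).

Lemma pwc_gt0 : 0 < pw ((6 * d * 2 ^ s0)%:R).
Proof. by rewrite pw_gt0// ltr0n !muln_gt0 d1 expn_gt0. Qed.

Lemma cS_gt0 : 0 < cS. Proof. by rewrite divr_gt0 ?pwc_gt0. Qed.

Lemma inj_sum_le (I : finType) (e : I -> V) (f : V -> R) : injective e -> (forall x, 0 <= f x) -> summ f ->
  \sum_t f (e t) <= rsum f.
Proof.
move=> ei f0 sf; rewrite rsum_ge0E//; rewrite summ_ge0E// in sf.
have -> : \sum_t f (e t) = toR (\sum_t ofR (f (e t))).
  by rewrite toR_sum//; apply: eq_bigr => t _; rewrite ofRK.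
apply: toR_mono => //; rewrite -(tsum_finType (fun t => ofR (f (e t)))).
exact: (tsum_inj_le (fun x => ofR (f x)) ei).
Qed.

Lemma boxpt_far (n : nat) (t : {ffun 'I_d -> 'I_(2 ^ s0 * n * rr)}) m :
  (2 ^ s0 * n * rr)%:R <= ((boxpt t ord0 m)%:~R : R) <= (2 * (2 ^ s0 * n * rr))%:R.
Proof.
rewrite mxE -pmulrn !ler_nat leq_addr /= mul2n -addnn leq_add2l; exact: ltnW.
Qed.

Lemma SL_lower : cS * L ^+ d <= SL.
Proof.
have /andP[r1 r2] := rr_bnd.
apply: le_trans (inj_sum_le (@boxpt_inj (2 ^ s0 * 1 * rr)) hL_ge0 summ_hL).
apply: (le_trans (y := \sum_(t : {ffun 'I_d -> 'I_(2 ^ s0 * 1 * rr)}) cS)); last first.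
  apply: ler_sum => t _; rewrite /cS -[(6 * d * 2 ^ s0)%N]muln1; apply: far_low => // m.
  have /andP[-> h2] := boxpt_far t m; apply: le_trans h2 _.
  by rewrite ler_nat leq_mul.
rewrite sumr_const card_ffun !card_ord -mulr_natr; apply: ler_wpM2l; first exact: ltW cS_gt0.
rewrite natrX lerXn2r ?nnegrE ?(ltW L0)//; apply: le_trans r1 _.
by rewrite ler_nat muln1 leq_pmull ?expn_gt0.
Qed.

Lemma SL_gt0 : 0 < SL.
Proof. by apply: lt_le_trans SL_lower; rewrite mulr_gt0 ?exprn_gt0 ?cS_gt0. Qed.

Local Notation Dr := (stepD h L).

Lemma stepDE x : Dr x = hL x / SL. Proof. by []. Qed.
Lemma stepD_ge0 x : 0 <= Dr x.
Proof. by rewrite stepDE divr_ge0 ?hL_ge0 ?(ltW SL_gt0). Qed.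
Lemma stepD_summ : summ Dr.
Proof.
rewrite (eq_summ (g := fun x => SL^-1 * hL x)); last by move=> x; rewrite mulrC.
exact/summZ/summ_hL.
Qed.
Lemma stepD_sum1 : rsum Dr = 1.
Proof.
rewrite (eq_rsum (g := fun x => SL^-1 * hL x)); last by move=> x; rewrite mulrC.
by rewrite rsumZ mulVf// gt_eqF ?SL_gt0.
Qed.
Lemma stepD_sym x : Dr (- x) = Dr x.
Proof.
rewrite !stepDE /hL (_ : L^-1 *: ztor R (- x) = - (L^-1 *: ztor R x)) ?profile_even//.
by apply/rowP => m; rewrite !mxE rmorphN mulrN.
Qed.

Definition C1 : R := 4 * CS * pw ((6 * d * 2 ^ s0)%:R) / c.

Lemma C1_gt0 : 0 < C1.
Proof. by apply: divr_gt0 => //; apply: mulr_gt0 pwc_gt0; apply: mulr_gt0 CS_gt0. Qed.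

Lemma far_oc (n : nat) (k : 'rV[R]_d) (I : finType) (e : I -> V) : (0 < n)%N -> injective e ->
  (forall t m, (2 ^ s0 * n * rr)%:R <= ((e t ord0 m)%:~R : R) <= (3 * (2 ^ s0 * n * rr))%:R) ->
  \sum_t oc k (e t) <= SL * pw ((6 * d * 2 ^ s0 * n)%:R) / c * sk Dr k.
Proof.
move=> n0 ei he; have p0 : 0 < pw ((6 * d * 2 ^ s0 * n)%:R).
  by rewrite pw_gt0// ltr0n !muln_gt0 d1 expn_gt0.
have s1 := SL_gt0.
rewrite skE; [|exact: stepD_summ|exact: stepD_sum1].
have f0 x : 0 <= Dr x * (1 - cos (ph k x)) by rewrite mulr_ge0 ?stepD_ge0 ?onemcos_ge0.
rewrite mulrC -ler_pdivrMr; last by rewrite divr_gt0// mulr_gt0.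
apply: (le_trans _ (inj_sum_le ei f0 (summ_oc k stepD_summ))).
rewrite mulr_suml; apply: ler_sum => t _; rewrite mulrC -/(oc k (e t)).
apply: ler_wpM2r; first exact: oc_ge0.
rewrite stepDE invfM invrK invfM -mulrA mulrC [_ * c]mulrC.
by apply: ler_wpM2r; [rewrite invr_ge0 ltW|apply: far_low].
Qed.

(** The points of a box at distance of order n L, and their shifts by n rr along the axis, all lie
    where D is at least of order L^(-d) n^(-d-alpha). The phase of the shift is a difference of two
    phases, so [onemcosD] bounds its 1 - cos by theirs; averaging over at least (n L)^d points
    leaves the factor n^alpha. *)
Lemma osc_bound (n : nat) (i : 'I_d) (k : 'rV[R]_d) : (0 < n)%N ->
  1 - cos ((n * rr)%:R * k ord0 i) <= C1 * n%:R `^ alpha * sk Dr k.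
Proof.
move=> n0; have /andP[r1 r2] := rr_bnd.
set b := (2 ^ s0 * n * rr)%N.
have b0 : (0 < b)%N by rewrite !muln_gt0 expn_gt0 n0.
have nrb : (n * rr <= b)%N by rewrite /b -mulnA leq_pmull ?expn_gt0.
have hb := @boxpt_far n; rewrite -/b in hb.
pose e2 (t : {ffun 'I_d -> 'I_b}) : V := boxpt t + ev i (n * rr).
have h1 : \sum_(t : {ffun 'I_d -> 'I_b}) oc k (boxpt t) <= SL * pw ((6 * d * 2 ^ s0 * n)%:R) / c * sk Dr k.
  apply: far_oc => //; first exact: boxpt_inj.
  move=> t m; have /andP[-> h2] := hb t m; apply: le_trans h2 _; rewrite ler_nat -/b; lia.
have h2 : \sum_(t : {ffun 'I_d -> 'I_b}) oc k (e2 t) <= SL * pw ((6 * d * 2 ^ s0 * n)%:R) / c * sk Dr k.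
  apply: far_oc => //; first by move=> t u /addIr; exact: boxpt_inj.
  move=> t m; have -> : e2 t ord0 m = boxpt t ord0 m + (m == i)%:R *+ (n * rr).
    by rewrite /e2 /ev [LHS]mxE mulmxnE; congr (_ + _ *+ _); rewrite mxE eqxx.
  rewrite intrD.
  have /andP[g1 g2] := hb t m.
  have : 0 <= (((m == i)%:R *+ (n * rr) : int)%:~R : R) <= (n * rr)%:R.
    by case: (m == i); rewrite ?mulr1n ?mulr0n ?mul0rn ?natz -?pmulrn ?lexx ?ler0n.
  have nrb' : (n * rr)%:R <= b%:R :> R by rewrite ler_nat.
  rewrite -/b (natrM R 3); move: g1 g2; rewrite (natrM R 2); lra.
have h3 : b%:R ^+ d * (1 - cos ((n * rr)%:R * k ord0 i)) <= \sum_(t : {ffun 'I_d -> 'I_b}) 2 * (oc k (e2 t) + oc k (boxpt t)).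
  have -> : b%:R ^+ d * (1 - cos ((n * rr)%:R * k ord0 i)) = \sum_(t : {ffun 'I_d -> 'I_b}) (1 - cos ((n * rr)%:R * k ord0 i)).
    by rewrite sumr_const card_ffun !card_ord -natrX mulr_natl.
  apply: ler_sum => t _; rewrite -ph_ev.
  have -> : ph k (ev i (n * rr)) = ph k (e2 t) + - ph k (boxpt t) by rewrite /e2 phD addrAC subrr add0r.
  apply: le_trans (onemcosD _ _) _; by rewrite cosN.
have h4 : b%:R ^+ d * (1 - cos ((n * rr)%:R * k ord0 i)) <= 4 * (SL * pw ((6 * d * 2 ^ s0 * n)%:R) / c * sk Dr k).
  apply: le_trans h3 _; rewrite -mulr_sumr big_split /=; lra.
have bL : (n%:R * L) ^+ d <= b%:R ^+ d.
  rewrite lerXn2r ?nnegrE ?mulr_ge0 ?(ltW L0)//; apply: le_trans (ler_wpM2l (ler0n R n) r1) _.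
  by rewrite -natrM ler_nat.
have nL : 0 < (n%:R * L) ^+ d by rewrite exprn_gt0// mulr_gt0// ltr0n.
have v0 : 0 <= 1 - cos ((n * rr)%:R * k ord0 i) by exact: onemcos_ge0.
have s0' : 0 <= sk Dr k by have /andP[] := sk_bnd stepD_ge0 stepD_summ stepD_sum1 k.
have h5 : (n%:R * L) ^+ d * (1 - cos ((n * rr)%:R * k ord0 i)) <= 4 * (CS * L ^+ d * pw ((6 * d * 2 ^ s0 * n)%:R) / c * sk Dr k).
  apply: le_trans (ler_wpM2r v0 bL) _; apply: le_trans h4 _; apply: ler_wpM2l => //.
  apply: ler_wpM2r => //; apply: ler_wpM2r; first by rewrite invr_ge0 ltW.
  by apply: ler_wpM2r; [exact: pw_ge0|exact: SL_upper].
rewrite -(ler_pM2l nL); apply: le_trans h5 _; apply: eq_ler.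
have n0R : 0 < n%:R :> R by rewrite ltr0n.
rewrite natrM pwM// (pw_split n0R) /C1 exprMn; field.
by rewrite gt_eqF.
Qed.

Definition QQ : R := 2 `^ Num.min alpha 2.

Lemma QQ_gt1 : 1 < QQ.
Proof. by apply: powR2_gt1; rewrite lt_min al0 ltr0n. Qed.

(** For alpha > 2 the tail alone would give 2^(alpha p); instead 1 - cos 2t <= 4 (1 - cos t) is
    iterated from p = 0. *)
Lemma vv_bound p (i : 'I_d) (k : 'rV[R]_d) : vv rr p i k <= C1 * QQ ^+ p * sk Dr k.
Proof.
have s0' : 0 <= sk Dr k by have /andP[] := sk_bnd stepD_ge0 stepD_summ stepD_sum1 k.
rewrite /QQ; case: (leP alpha 2) => ha.
  have := @osc_bound (2 ^ p) i k; rewrite expn_gt0 => /(_ isT).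
  by rewrite natrX powR_expn.
have v0 : vv rr 0 i k <= C1 * sk Dr k.
  by have := @osc_bound 1 i k isT; rewrite powR1 mulr1 /vv expn0.
have -> : 2 `^ 2 = 4 :> R by rewrite powR_mulrn//; lra.
elim: p => [|p IH]; first by rewrite expr0 mulr1.
rewrite vvS exprS; have /andP[u0 u2] := vv_bnd rr p i k.
apply: (le_trans (y := 4 * vv rr p i k)); first nra.
by rewrite (mulrCA C1) -mulrA; apply: ler_wpM2l.
Qed.

(** Of the 2^p translates at most 2^(s+1) + 1 <= 3 2^s meet an interval of half-width 2^s L, so
    averaging along axis i replaces its indicator by this fraction. *)
Lemma Us_layer p (i : 'I_d) (f : V -> R) (w : nat -> V -> E) : (forall s (x y : V), (forall m, m != i -> x ord0 m = y ord0 m) -> w s x = w s y) ->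
  (forall x, 0 <= f x) ->
  (forall x, ofR (f x) <<= tsum (fun s => w s x * ind s x i)) ->
  forall x, ofR (Us rr p i f x) <<= tsum (fun s => w s x * ofR (3 * 2 ^+ s / 2 ^+ p)).
Proof.
move=> hw f0 hf x; rewrite Us_sum.
have p2 : 0 <= (2 ^+ p)^-1 :> R by rewrite invr_ge0 exprn_ge0.
rewrite (ofRM p2) ?sumr_ge0// ofR_sum//.
apply: (ele_trans (ofR (2 ^+ p)^-1 * \sum_(j < 2 ^ p) tsum (fun s => w s x * ind s (x + ev i (j * rr)) i))).
  apply: eleMl; apply: ele_sum => j _; apply: ele_trans (hf _) _; apply: le_tsum => s; apply: eleMr.
  apply: ele_eq; apply: hw => m mi; rewrite /ev mxE mulmxnE mxE (negbTE mi) andbF mul0rn addr0//.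
rewrite -tsum_big -tsumZl; apply: le_tsum => s; rewrite -mulr_sumr mulrCA; apply: eleMl.
have /andP[r1 r2] := rr_bnd.
apply: (ele_trans (ofR (2 ^+ p)^-1 * (2 * 2 ^ s).+1%:R)).
  apply: eleMl; apply: (ele_trans _ _ (@line_count R (x ord0 i) rr (2 ^ p) (2 * 2 ^ s) (2 ^+ s * L) _ _)) => //.
    apply: ele_eq; apply: eq_bigr => j _; rewrite /ind /ev mxE mulmxnE mxE !eqxx /=.
    by congr (nat_of_bool (`|(_ + _)%:~R| <= _)%R)%:R; exact: natz.
  have := ler_wpM2l (exprn_ge0 s (ler0n R 2)) r1.
  by rewrite mulr2n !natrM natrX; lra.
rewrite -(ofR_nat R) -(ofRM p2)//; apply: ele_ofR; rewrite mulrC; apply: ler_wpM2r => //.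
rewrite -natr1 natrM natrX; have : 1 <= 2 ^+ s :> R by rewrite exprn_ege1// ler1n.
by lra.
Qed.

Lemma Ua_layer p S (f : V -> R) (w : nat -> E) : uniq S -> (forall x, 0 <= f x) ->
  (forall x, ofR (f x) <<= tsum (fun s => w s * \prod_(m <- S) ind s x m)) ->
  forall x, ofR (Ua rr p S f x) <<= tsum (fun s => w s * ofR (3 * 2 ^+ s / 2 ^+ p) ^+ size S).
Proof.
elim: S f w => [|i S IH] f w /=.
  move=> _ f0 hf x; apply: ele_trans (hf x) _; apply: le_tsum => s; by rewrite big_nil expr0.
move=> /andP[iS uS] f0 hf x.
have f0' y : 0 <= Us rr p i f y.
  by rewrite Us_sum mulr_ge0 ?invr_ge0 ?exprn_ge0 ?sumr_ge0.
have := IH (Us rr p i f) (fun s => w s * ofR (3 * 2 ^+ s / 2 ^+ p)) uS f0'.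
move=> H; apply: ele_trans (H _ x) _; last first.
  by apply: le_tsum => s; rewrite exprS mulrA elexx.
move=> y; apply: ele_trans (@Us_layer p i f (fun s x => w s * \prod_(m <- S) ind s x m) _ f0 _ y) _.
- move=> s u v huv; congr (_ * _); apply: eq_big_seq => m mS; rewrite /ind huv//.
  by apply: contraNneq iS => <-.
- move=> u; apply: ele_trans (hf u) _; apply: le_tsum => s.
  by rewrite big_cons -mulrA [ind _ _ _ * _]mulrC elexx.
by apply: le_tsum => s; rewrite mulrAC elexx.
Qed.

(** The factor L^(-d), which later makes [beta] small, comes from the lower bound on the normalising
    sum. *)
Definition K_ : R := CS / (cS * L ^+ d).

Lemma K_ge0 : 0 <= K_.
Proof.
apply: divr_ge0; first exact: ltW CS_gt0.
by apply: mulr_ge0; [exact: ltW cS_gt0|rewrite exprn_ge0// ltW].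
Qed.

(** The d averagings turn the layer s into (3 2^s / 2^p)^d, which cancels the volume in [Ws] and
    leaves a geometric series of ratio 2^(-alpha). *)
Lemma Ua_bound p x : Ua rr p (enum 'I_d) Dr x <= K_ / 2 ^+ (p * d).
Proof.
have S0 := SL_gt0; have q1 : 0 < 1 - A_^-1 by rewrite subr_gt0 invf_lt1// A_gt1.
have hD y : ofR (Dr y) <<= tsum (fun s => ofR (Ws s / SL) * \prod_(m <- enum 'I_d) ind s y m).
  rewrite stepDE mulrC ofRM ?invr_ge0 ?hL_ge0 ?(ltW S0)//.
  apply: ele_trans (eleMl _ (hL_upper y)) _; rewrite -tsumZl; apply: le_tsum => s.
  by rewrite mulrA -ofRM ?invr_ge0 ?Ws_ge0 ?(ltW S0)// mulrC big_enum mulrC [_^-1 * _]mulrC elexx.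
have := Ua_layer p (enum_uniq 'I_d) stepD_ge0 hD x.
rewrite size_enum_ord => H.
have K2 : 0 <= K_ / 2 ^+ (p * d) by rewrite divr_ge0 ?K_ge0 ?exprn_ge0.
apply: (ofR_le K2); apply: ele_trans H _.
apply: (ele_trans (tsum (fun s => ofR (C * 3 ^+ d / SL / 2 ^+ (p * d)) * ofR (A_^-1) ^+ s))).
  apply: le_tsum => s; apply: ele_eq.
  have a1 : 0 <= Ws s / SL by rewrite divr_ge0 ?Ws_ge0 ?(ltW S0).
  have a2 : 0 <= 3 * 2 ^+ s / 2 ^+ p :> R by rewrite divr_ge0 ?mulr_ge0 ?exprn_ge0.
  have a3 : 0 <= A_^-1 by rewrite invr_ge0 ltW.
  have a4 : 0 <= C * 3 ^+ d / SL / 2 ^+ (p * d) by rewrite !divr_ge0 ?mulr_ge0 ?exprn_ge0 ?(ltW S0) ?(ltW C0).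
  rewrite -(ofRX _ a2) -(ofRM a1 (exprn_ge0 _ a2)) -(ofRX _ a3) -(ofRM a4 (exprn_ge0 _ a3)); congr ofR.
  rewrite /Ws !exprMn !exprVn -!exprM; field.
  by rewrite !expf_neq0 ?gt_eqF.
rewrite tsumZl geomA -ofRM ?invr_ge0 ?(ltW q1)//; last first.
  by rewrite !divr_ge0 ?mulr_ge0 ?exprn_ge0 ?(ltW S0) ?(ltW C0).
apply: ele_ofR; rewrite /K_.
rewrite (_ : _ / (1 - A_^-1) = CS / SL / 2 ^+ (p * d)); last by rewrite /CS; ring.
apply: ler_wpM2r; first by rewrite invr_ge0 exprn_ge0.
apply: ler_wpM2l; first exact: ltW CS_gt0.
by rewrite lef_pV2 ?posrE// ?SL_lower// mulr_gt0 ?cS_gt0 ?exprn_gt0.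
Qed.
End FixedL.

Hypothesis hd : 2 * Num.min alpha 2 < d%:R.

Theorem step_resolvent : exists2 B : R, 0 < B & forall L : R, 1 <= L -> forall e : R, 0 < e ->
  exists M : V -> R, [/\ summ M,
    (forall l, Dh (stepD h L) l ^+ 2 / (e + sk (stepD h L) l) ^+ 2 <= ct M l) & M 0 <= B / L ^+ d].
Proof.
have [C C0 hC] := profile_upper; have [c [s0 [c0 hc]]] := profile_lower.
have Q1 := QQ_gt1.
have Qd : QQ ^+ 2 < 2 ^+ d.
  rewrite -[ltLHS](powR_mulrn 2) ?powR_ge0// -powRrM -[ltRHS](powR_mulrn d)//.
  rewrite (_ : d%:R = Num.min alpha 2 * 2 + (d%:R - Num.min alpha 2 * 2)); last by ring.
  rewrite powRD ?pnatr_eq0 ?implybT// ltr_pMr ?powR_gt0//.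
  by apply: powR2_gt1; rewrite subr_gt0 mulrC.
have q1 : 0 < 1 - qk d QQ by rewrite subr_gt0 ltr_pdivrMr ?exprn_gt0// mul1r.
have C1p := C1_gt0 s0 C0 c0.
have Cp : 0 < Ck d (C1 C c s0).
  by rewrite /Ck; apply: mulr_gt0; [apply: mulr_gt0 => //|]; rewrite exprn_gt0 ?ltr0n.
exists (Ck d (C1 C c s0) * (CS C / cS c s0) / (1 - qk d QQ)).
  by rewrite divr_gt0// mulr_gt0// divr_gt0 ?CS_gt0 ?cS_gt0.
move=> L L1 e e0.
have [M [sM hM M0]] := resolvent_kernel (stepD_ge0 L1 C0 c0 hC hc) (stepD_summ L1 C0 hC)
  (stepD_sum1 L1 C0 c0 hC hc) (stepD_sym L) d1 C1p (K_ge0 L1 s0 C0 c0) Q1 Qd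
  (vv_bound L1 C0 c0 hC hc) (Ua_bound L1 C0 c0 hC hc) e0.
exists M; split=> //; apply: le_trans M0 _; apply: eq_ler; rewrite /K_ invfM; ring.
Qed.
End Profile.

(** * Riemann sums of monotone functions *)

Section RiemannSums.
Variable R : realType.
Local Notation E := (enn R).

(** Cauchy condensation; the blocks start at 2^j - 1 because the sum starts at 0. *)
Lemma tsum_condense (a : nat -> E) : (forall m n, (m <= n)%N -> a n <<= a m) ->
  tsum a <<= tsum (fun j => (2 ^ j)%:R * a (2 ^ j).-1).
Proof.
move=> ha; apply: tsum_nat_ub => n.
have h J : \sum_(i < (2 ^ J).-1) a i <<= \sum_(j < J) (2 ^ j)%:R * a (2 ^ j).-1.
  elim: J => [|J IH]; first by rewrite !big_ord0 elexx.
  have e : ((2 ^ J.+1).-1 = (2 ^ J).-1 + 2 ^ J)%N.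
    by rewrite expnS mul2n -addnn; case: (2 ^ J)%N (expn_gt0 2 J) => // m _; rewrite addSn.
  rewrite e big_split_ord /= big_ord_recr /=; apply: eleD => //.
  apply: (ele_trans (\sum_(i < 2 ^ J) a (2 ^ J).-1)).
    by apply: ele_sum => i _; apply: ha; exact: leq_addr.
  by rewrite sumr_const card_ord -[X in X <<= _]mulr_natl elexx.
apply: (ele_trans _ _ (tsum_nat_ge _ n)); apply: ele_trans (h n).
have le1 : (n <= (2 ^ n).-1)%N by have := ltn_expl n (ltnSn 1); lia.
rewrite -(subnKC le1) big_split_ord /=; exact: eleDl.
Qed.

Lemma geom_tsum (q : R) : 0 <= q -> q < 1 -> tsum (fun n => ofR q ^+ n) = ofR (1 - q)^-1.
Proof. exact: geom_fin. Qed.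

(** The right-end Riemann sum with mesh v for the integral of psi over (0, oo). *)
Definition rs (psi : R -> R) (v : R) : E := tsum (fun n => ofR (v * psi (n.+1%:R * v))).

Lemma rs_le (f g : R -> R) v : 0 < v -> (forall t, 0 < t -> f t <= g t) -> rs f v <<= rs g v.
Proof.
move=> v0 fg; apply: le_tsum => n; apply: ele_ofR; apply: ler_wpM2l; first exact: ltW.
by apply: fg; rewrite mulr_gt0.
Qed.

Lemma powR_decr (p s t : R) : 0 <= p -> 0 < s -> s <= t -> t `^ (- p) <= s `^ (- p).
Proof.
move=> p0 s0 st; have t0 := lt_le_trans s0 st.
rewrite !powRN lef_pV2 ?posrE ?powR_gt0//.
by apply: ge0_ler_powR => //; rewrite nnegrE ltW.
Qed.

Lemma powR_pow2 (y : R) (n : nat) : (2 ^+ n) `^ y = (2 `^ y) ^+ n.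
Proof. by rewrite -powR_mulrn// -powRrM mulrC powRrM powR_mulrn// powR_ge0. Qed.

Lemma powR2_lt1 (y : R) : y < 0 -> 2 `^ y < 1.
Proof.
move=> y0; have := @gt0_ltr_powR R (- y) ltac:(lra) 1 2; rewrite !nnegrE powR1.
by rewrite powRN => /(_ ltac:(lra) ltac:(lra) ltac:(lra)) h; rewrite -invf_gt1 ?powR_gt0.
Qed.

Lemma scale_one (v : R) : 0 < v -> v <= 1 -> exists J : nat, 1 <= 2 ^+ J * v <= 2.
Proof.
move=> v0 v1.
have hex : exists J : nat, 1 <= 2 ^+ J * v.
  exists (Num.truncn v^-1).+1; rewrite -ler_pdivrMr// mul1r.
  apply: le_trans (ltW (truncnS_gt _)) _.
  by rewrite -natrX ler_nat ltnW// ltn_expl.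
case: (ex_minnP hex) => J hJ Jmin; exists J; rewrite hJ /=.
case: J hJ Jmin => [|J] hJ Jmin; first by rewrite expr0; lra.
have : ~~ (1 <= 2 ^+ J * v) by apply/negP => /Jmin; rewrite ltnn.
by rewrite -ltNge exprS => h; lra.
Qed.

(** The decreasing majorant min(t^(-p), t^(-q)) is condensed; the terms form two geometric series,
    on either side of the scale j = J where 2^j v is about 1. The condition p < 1 < q makes both
    converge. *)
Lemma rs_bound (psi : R -> R) (K p q : R) : 0 <= K -> 0 <= p -> p < 1 -> 1 < q ->
  (forall t, 0 < t -> psi t <= K * t `^ (- p)) -> (forall t, 0 < t -> psi t <= K * t `^ (- q)) ->
  exists2 B : R, 0 <= B & forall v, 0 < v -> v <= 1 -> rs psi v <<= ofR B.
Proof.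
move=> K0 p0 p1 q1 hp hq.
pose g1 : R := 2 `^ (p - 1); pose g2 : R := 2 `^ (1 - q).
have g10 : 0 <= g1 by exact: powR_ge0.
have g20 : 0 <= g2 by exact: powR_ge0.
have g11 : g1 < 1 by apply: powR2_lt1; lra.
have g21 : g2 < 1 by apply: powR2_lt1; lra.
have i1 : 0 <= (1 - g1)^-1 by rewrite invr_ge0; lra.
have i2 : 0 <= (1 - g2)^-1 by rewrite invr_ge0; lra.
exists (K * 2 * (1 - g1)^-1 + K * (1 - g2)^-1); first by rewrite addr_ge0 ?mulr_ge0.
move=> v v0 v1; pose chi (t : R) := K * Num.min (t `^ (- p)) (t `^ (- q)).
apply: (ele_trans (rs chi v)).
  apply: rs_le => // t t0; rewrite /chi /Num.min; case: ifP => _; [exact: hp|exact: hq].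
apply: ele_trans (tsum_condense _) _.
  move=> m n mn; apply: ele_ofR; apply: ler_wpM2l; first exact: ltW.
  apply: ler_wpM2l => //; have s0 : 0 < m.+1%:R * v by rewrite mulr_gt0.
  have st : m.+1%:R * v <= n.+1%:R * v by apply: ler_wpM2r; [exact: ltW|rewrite ler_nat].
  have h1 := powR_decr p0 s0 st; have h2 := powR_decr (p := q) ltac:(lra) s0 st.
  by rewrite le_min !ge_min h1 h2 orbT.
have [J /andP[J1 J2]] := scale_one v0 v1.
set w := 2 ^+ J * v in J1 J2; have w0 : 0 < w by lra.
have termE j : (2 ^ j)%:R * ofR (v * chi ((2 ^ j).-1.+1%:R * v)) = ofR (2 ^+ j * v * chi (2 ^+ j * v)).
  have c0 : 0 <= v * chi ((2 ^ j).-1.+1%:R * v).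
    by rewrite mulr_ge0 ?(ltW v0)// mulr_ge0// le_min !powR_ge0.
  by rewrite -(ofR_nat R) -(ofRM (ler0n R _) c0) mulrA prednK ?expn_gt0// natrX.
under eq_tsum => j do rewrite termE.
have tpow (t : R) y : 0 < t -> t * t `^ (- y) = t `^ (1 - y).
  by move=> t0; rewrite -{1}(powRr1 (ltW t0)) -powRD ?(gt_eqF t0) ?implybT.
apply: (ele_trans (tsum (fun j => (j < J)%N%:R * ofR (K * (2 * g1 ^+ (J - j))) + (J <= j)%N%:R * ofR (K * g2 ^+ (j - J))))).
  apply: le_tsum => j; have t0 : 0 < 2 ^+ j * v by rewrite mulr_gt0 ?exprn_gt0.
  have [jJ|Jj] := ltnP j J; rewrite ?mul1r ?mul0r ?addr0 ?add0r; apply: ele_ofR; rewrite /chi mulrCA.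
    apply: ler_wpM2l => //; apply: (le_trans (y := (2 ^+ j * v) `^ (1 - p))).
      rewrite -tpow//; apply: ler_wpM2l; first exact: ltW.
      by rewrite ge_min lexx.
    have -> : 2 ^+ j * v = w * (2 ^+ (J - j))^-1.
      by rewrite /w -{1}(subnK (ltnW jJ)) exprD; field; rewrite expf_neq0.
    rewrite powRM ?invr_ge0 ?exprn_ge0// ?(ltW w0)//.
    apply: ler_pM; rewrite ?powR_ge0//.
      apply: le_trans (ler1_powR _ _) _ => //; lra.
    by rewrite -powR_inv1 ?exprn_ge0// -powRrM mulN1r opprB powR_pow2 lexx.
  apply: ler_wpM2l => //; apply: (le_trans (y := (2 ^+ j * v) `^ (1 - q))).
    rewrite -tpow//; apply: ler_wpM2l; first exact: ltW.
    by rewrite ge_min lexx orbT.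
  have -> : 2 ^+ j * v = w * 2 ^+ (j - J).
    by rewrite /w -{1}(subnKC Jj) exprD mulrAC.
  rewrite powRM ?exprn_ge0// ?(ltW w0)// powR_pow2 -/g2 ler_piMl ?exprn_ge0//.
  rewrite -[1 - q]opprB powRN invf_le1 ?powR_gt0//.
  by rewrite -[leLHS](powRr0 w); apply: ler_powR => //; lra.
rewrite tsumD tsum_nat_fin (tsum_nat_shift (fun n => ofR (K * g2 ^+ n)) J).
rewrite ofRD ?mulr_ge0//; apply: eleD.
  rewrite -ofR_sum; last by move=> i _; rewrite !mulr_ge0 ?exprn_ge0.
  apply: ele_ofR; rewrite -mulr_sumr -mulrA; apply: ler_wpM2l => //.
  rewrite -mulr_sumr; apply: ler_wpM2l => //.
  have hJ (j : nat) : \sum_(i < j) g1 ^+ (j - i) <= g1 / (1 - g1).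
    elim: j => [|j IH]; first by rewrite big_ord0 divr_ge0//; lra.
    rewrite big_ord_recr /= subSnn expr1.
    have -> : \sum_(i < j) g1 ^+ (j.+1 - i) = g1 * \sum_(i < j) g1 ^+ (j - i).
      by rewrite mulr_sumr; apply: eq_bigr => i _; rewrite subSn ?exprS// ltnW.
    have -> : g1 / (1 - g1) = g1 * (g1 / (1 - g1)) + g1 by field; rewrite subr_eq0 gt_eqF.
    by rewrite lerD2r; apply: ler_wpM2l.
  by apply: le_trans (hJ J) _; rewrite -[leRHS]mul1r; apply: ler_wpM2r => //; exact: ltW.
under eq_tsum => n do rewrite (ofRM K0 (exprn_ge0 n g20)) (ofRX n g20).
by rewrite tsumZl geom_tsum// -ofRM// elexx.
Qed.

Section Monotone.
Variables (psi : R -> R) (B : R).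
Hypotheses (psi0 : forall t, 0 < t -> 0 <= psi t) (psid : forall s t, 0 < s -> s <= t -> psi t <= psi s).
Hypotheses (B0 : 0 <= B) (hB : forall v : R, 0 < v -> v <= 1 -> rs psi v <<= ofR B).

Definition rsR (v : R) : R := toR (rs psi v).

Lemma rs_fin (v : R) : 0 < v -> v <= 1 -> efin (rs psi v).
Proof. by move=> v0 v1; apply: efin_ofR_le (hB v0 v1). Qed.

Lemma rsR_ge0 v : 0 <= rsR v. Proof. exact: toR_ge0. Qed.
Lemma rsR_le (v : R) : 0 < v -> v <= 1 -> rsR v <= B.
Proof. by move=> v0 v1; apply: toR_le => //; exact: hB. Qed.

(* Each cell of length w contains at least w / v - 1 points of the finer grid. *)
Lemma rs_refine (v w : R) : 0 < v -> v <= w -> w <= 1 -> (1 - v / w) * rsR w <= rsR v.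
Proof.
move=> v0 vw w1; have w0 := lt_le_trans v0 vw; have v1 := le_trans vw w1.
have q1 : 0 <= 1 - v / w by rewrite subr_ge0 ler_pdivrMr// mul1r.
have fw := rs_fin w0 w1; have fv := rs_fin v0 v1.
rewrite -(ofRK q1) -toRM//; apply: toR_mono => //.
pose a (n : nat) := Num.truncn (n%:R * (w / v)).
have wv : 1 <= w / v by rewrite ler_pdivlMr// mul1r.
have ab n : (a n)%:R <= n%:R * (w / v) < (a n)%:R + 1.
  apply/andP; split; last by rewrite natr1; exact: truncnS_gt.
  by rewrite truncn_le mulr_ge0// divr_ge0// ltW.
have am n : (a n <= a n.+1)%N.
  have /andP[h1 _] := ab n; have /andP[_ h2] := ab n.+1.
  by rewrite -ltnS -(ltr_nat R) -natr1; move: h1 h2; rewrite -[n.+1%:R]natr1 mulrDl mul1r; lra.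
have blk N : \sum_(n < N) ofR (1 - v / w) * ofR (w * psi (n.+1%:R * w)) <<= \sum_(m < a N) ofR (v * psi (m.+1%:R * v)).
  elim: N => [|N IH]; first by rewrite big_ord0 ele0.
  rewrite big_ord_recr -(subnKC (am N)) big_split_ord /=; apply: eleD => //.
  have p0 : 0 <= psi (N.+1%:R * w) by apply: psi0; rewrite mulr_gt0.
  apply: (ele_trans (\sum_(i < a N.+1 - a N) ofR (v * psi (N.+1%:R * w)))); last first.
    apply: ele_sum => i _; apply: ele_ofR; apply: ler_wpM2l; first exact: ltW.
    apply: psid; first by rewrite mulr_gt0.
    have hi : (a N + i).+1%:R <= (a N.+1)%:R :> R.
      by have hi2 : (i < a N.+1 - a N)%N := ltn_ord i; rewrite ler_nat -addnS -leq_subRL.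
    have /andP[h1 _] := ab N.+1; rewrite -ler_pdivlMr// -mulrA.
    exact: le_trans hi h1.
  rewrite sumr_const card_ord -[X in _ <<= X]mulr_natl -(ofR_nat R) -ofRM ?mulr_ge0 ?(ltW w0)//.
  rewrite -ofRM ?mulr_ge0 ?(ltW v0)//; apply: ele_ofR.
  have /andP[h1 h2] := ab N; have /andP[h3 h4] := ab N.+1.
  rewrite natrB// !mulrA; apply: ler_wpM2r => //.
  have -> : (1 - v / w) * w = (w / v - 1) * v by field; rewrite !gt_eqF.
  apply: ler_wpM2r; first exact: ltW.
  by move: h2 h3 h4 h1; rewrite -[N.+1%:R]natr1 mulrDl mul1r; lra.
rewrite -tsumZl; apply: tsum_nat_ub => N; apply: ele_trans (blk N) _.
exact: (tsum_nat_ge (fun m => ofR (v * psi (m.+1%:R * v)))).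
Qed.

Lemma rs_cvg : exists2 I : R, (forall v : R, 0 < v -> v <= 1 -> rsR v <= I) &
  forall e : R, 0 < e -> exists2 v0 : R, 0 < v0 & forall v : R, 0 < v -> v < v0 -> `|rsR v - I| <= e.
Proof.
pose S : set R := [set rsR v | v in [set v | 0 < v <= 1]].
have S1 : S (rsR 1) by exists 1 => //=; rewrite ltr01 lexx.
have hS : has_sup S.
  split; first by exists (rsR 1).
  by exists B => _ [v /andP[v0 v1] <-]; exact: rsR_le.
have le_sup (v : R) : 0 < v -> v <= 1 -> rsR v <= sup S.
  by move=> v0 v1; apply: sup_upper_bound hS _ _; exists v => //=; rewrite v0 v1.
exists (sup S) => // e e0.
have [_ [w /andP[w0 w1] <-] hw] := sup_adherent (eps := e / 2) ltac:(lra) hS.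
have B1 : 0 < B + 1 by move: B0; lra.
exists (Num.min w (w * (e / (2 * (B + 1))))).
  by rewrite lt_min w0 mulr_gt0// divr_gt0// mulr_gt0.
move=> v v0; rewrite lt_min => /andP[vw vB].
have v1 : v <= 1 by lra.
have h1 := rs_refine v0 (ltW vw) w1; have h2 := le_sup v v0 v1; have h3 := rsR_le w0 w1.
have h4 : v / w * rsR w <= e / 2.
  apply: (le_trans (y := e / (2 * (B + 1)) * (B + 1))); last by rewrite invfM; apply/eq_ler; field; rewrite gt_eqF.
  apply: ler_pM; rewrite ?rsR_ge0 ?divr_ge0 ?ltW//; last lra.
  by rewrite ltr_pdivrMr// mulrC.
by rewrite ler_norml; apply/andP; split; lra.
Qed.
End Monotone.
End RiemannSums.

(** * A comparison kernel: mixtures of binomial distributions *)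

Section Binomial.
Variable R : realType.

(** The centred binomial law: half the position of simple random walk after 2n steps. *)
Definition bk (n j : nat) : R := 'C(2 * n, n + j)%:R / 4 ^+ n.

Lemma bk_ge0 n j : 0 <= bk n j. Proof. by rewrite divr_ge0 ?exprn_ge0. Qed.

Lemma bk00 : bk 0 0 = 1. Proof. by rewrite /bk bin0 expr0 divr1. Qed.
Lemma bk0S j : bk 0 j.+1 = 0. Proof. by rewrite /bk muln0 add0n bin0n mul0r. Qed.

Lemma bk_rec0 n : bk n.+1 0 = (2 * bk n 0 + 2 * bk n 1) / 4.
Proof.
have e : 'C(2 * n.+1, n.+1 + 0) = (2 * ('C(2 * n, n + 1) + 'C(2 * n, n + 0)))%N.
  rewrite addn0 mulnS add2n binS.
  have -> : 'C((2 * n).+1, n) = 'C((2 * n).+1, n.+1).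
    by rewrite -bin_sub; [congr 'C(_, _); lia|lia].
  by rewrite addnn -mul2n binS addn1 addn0.
by rewrite /bk e natrM natrD exprS; field; rewrite expf_neq0.
Qed.

Lemma bk_recS n j : bk n.+1 j.+1 = (bk n j + 2 * bk n j.+1 + bk n j.+2) / 4.
Proof.
have e : 'C(2 * n.+1, n.+1 + j.+1) = ('C(2 * n, n + j) + 2 * 'C(2 * n, n + j.+1) + 'C(2 * n, n + j.+2))%N.
  rewrite mulnS add2n addSn addnS !binS !addnS; lia.
by rewrite /bk e natrD natrD natrM exprS; field; rewrite expf_neq0.
Qed.

Lemma bk_step n j : bk n j.+1 * (n + j).+1%:R = bk n j * (n - j)%:R.
Proof.
have := mul_bin_left (2 * n) (n + j).
have -> : (2 * n - (n + j) = n - j)%N by lia.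
move=> /(congr1 (fun m => m%:R : R)); rewrite !natrM /bk addnS => h.
transitivity (((n + j).+1%:R * 'C(2 * n, (n + j).+1)%:R) / 4 ^+ n : R); first by ring.
by rewrite h; ring.
Qed.

(** Successive quotients are 1 - (2i+1)/(n+i+1) <= exp(- (2i+1)/(n+M)), and the odd numbers below 2j
    add up to j^2. The denominator is fixed through M so that the exponents can be added. *)
Lemma bk_upper n j : (0 < n)%N -> bk n j <= bk n 0 * expR (- (j%:R ^+ 2 / (n + j)%:R)).
Proof.
move=> n0; suff h M : forall i, (i <= M)%N -> bk n i <= bk n 0 * expR (- (i%:R ^+ 2 / (n + M)%:R)) by exact: h.
have nM0 : 0 < (n + M)%:R :> R by rewrite ltr0n addn_gt0 n0.
elim=> [|i IH] iM; first by rewrite expr0n mul0r oppr0 expR0 mulr1.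
have {}IH := IH (ltnW iM).
have D0 : 0 < (n + i).+1%:R :> R by [].
have -> : bk n i.+1 = bk n i * ((n - i)%:R / (n + i).+1%:R).
  by rewrite mulrA -bk_step mulfK// gt_eqF.
have f : (n - i)%:R / (n + i).+1%:R <= expR (- ((2 * i).+1%:R / (n + M)%:R)) :> R.
  have [ni|ni] := leqP n i.
    by move: (ni); rewrite -subn_eq0 => /eqP->; rewrite mul0r expR_ge0.
  apply: (le_trans (y := 1 + - ((2 * i).+1%:R / (n + i).+1%:R))).
    apply/eq_ler; rewrite natrB; last exact: ltnW.
    rewrite -!natr1 natrD natrM; field.
    by rewrite -natrD natr1 gt_eqF.
  apply: le_trans (expR_ge1Dx _) _; rewrite ler_expR lerN2.
  by apply: ler_wpM2l => //; rewrite lef_pV2 ?posrE// ler_nat -addnS leq_add2l.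
apply: le_trans (ler_pM (bk_ge0 n i) _ IH f) _; first by rewrite divr_ge0.
rewrite -mulrA -expRD; apply/eq_ler; congr (_ * expR _).
rewrite -[i.+1%:R]natr1 -[(2 * i).+1%:R]natr1 natrM; field.
by rewrite -natrD gt_eqF.
Qed.

Lemma expR_lower (y : R) : 0 <= y -> y <= 1 / 2 -> expR (- y - 2 * y ^+ 2) <= 1 - y.
Proof.
move=> y0 y1.
have h : 1 + (y + 2 * y ^+ 2) <= expR (y + 2 * y ^+ 2) by exact: expR_ge1Dx.
rewrite -opprD expRN -[_^-1]mul1r ler_pdivrMr ?expR_gt0//.
apply: (le_trans (y := (1 - y) * (1 + (y + 2 * y ^+ 2)))); last by apply: ler_wpM2l => //; lra.
by have := mulr_ge0 (sqr_ge0 y) (_ : 0 <= 1 - 2 * y); rewrite subr_ge0 => /(_ ltac:(lra)); lra.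
Qed.

(** As for the upper bound, with 1 - y >= exp(- y - 2 y^2); the quadratic terms are at most 8 j^2 /
    n^2 each, and there are j of them. *)
Lemma bk_lower n j : (0 < n)%N -> (4 * j <= n)%N ->
  bk n 0 * expR (- (j%:R ^+ 2 / n%:R) - 8 * (j%:R ^+ 3 / n%:R ^+ 2)) <= bk n j.
Proof.
move=> n0 jn.
suff h i : (i <= j)%N -> bk n 0 * expR (- (i%:R ^+ 2 / n%:R) - 8 * (i%:R * (j%:R ^+ 2 / n%:R ^+ 2))) <= bk n i.
  have := h j (leqnn j); apply: le_trans; apply/eq_ler; congr (_ * expR _).
  by rewrite exprS; ring.
have nR : 0 < n%:R :> R by rewrite ltr0n.
elim: i => [|i IH] ij; first by rewrite expr0n !mul0r mulr0 oppr0 addr0 expR0 mulr1.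
have {}IH := IH (ltnW ij).
have D0 : 0 < (n + i).+1%:R :> R by [].
have -> : bk n i.+1 = bk n i * ((n - i)%:R / (n + i).+1%:R).
  by rewrite mulrA -bk_step mulfK// gt_eqF.
set y : R := (2 * i).+1%:R / (n + i).+1%:R.
have y0 : 0 <= y by rewrite divr_ge0.
have i4 : (4 * i).+1%:R <= n%:R :> R by rewrite ler_nat; lia.
have yE : (n - i)%:R / (n + i).+1%:R = 1 - y :> R.
  rewrite /y natrB; last by lia.
  rewrite -!natr1 natrD natrM; field.
  by rewrite -natrD natr1 gt_eqF.
have y1 : y <= 1 / 2.
  have h : (2 * (2 * i).+1)%:R <= (n + i).+1%:R :> R by rewrite ler_nat; lia.
  by rewrite natrM in h; rewrite /y ler_pdivrMr//; lra.
have yn : y <= (2 * i).+1%:R / n%:R.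
  by apply: ler_wpM2l => //; rewrite lef_pV2 ?posrE// ler_nat; lia.
have y2 : y <= 2 * (j%:R / n%:R).
  apply: le_trans yn _; rewrite mulrA; apply: ler_wpM2r; first by rewrite invr_ge0 ltW.
  by rewrite -natrM ler_nat; lia.
have y3 : y ^+ 2 <= 4 * (j%:R ^+ 2 / n%:R ^+ 2).
  have -> : 4 * (j%:R ^+ 2 / n%:R ^+ 2) = (2 * (j%:R / n%:R)) ^+ 2 :> R by field; rewrite gt_eqF.
  by rewrite lerXn2r ?nnegrE// mulr_ge0// divr_ge0.
rewrite yE; apply: le_trans (ler_pM _ _ IH (expR_lower y0 y1)).
- rewrite -[X in _ <= X]mulrA -expRD; apply: ler_wpM2l; first exact: bk_ge0.
  rewrite ler_expR.
  have e1 : i.+1%:R ^+ 2 / n%:R = i%:R ^+ 2 / n%:R + (2 * i).+1%:R / n%:R :> R.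
    by rewrite -[i.+1%:R]natr1 -[(2 * i).+1%:R]natr1 natrM; field; rewrite gt_eqF.
  rewrite e1 -[i.+1%:R]natr1 mulrDl mul1r; lra.
- by rewrite mulr_ge0 ?bk_ge0 ?expR_ge0.
- exact: expR_ge0.
Qed.

Lemma bk_center n : bk n.+1 0 * (2 * n.+1)%:R = bk n 0 * (2 * n).+1%:R.
Proof.
have h := bk_step n 0; rewrite addn0 subn0 in h.
by rewrite bk_rec0 natrM -[(2 * n).+1%:R]natr1 natrM; move: h; rewrite -[n.+1%:R]natr1; lra.
Qed.

Definition qn (n : nat) : R := n%:R * bk n 0 ^+ 2.

Lemma bk_pos n : 0 < bk n 0.
Proof. by rewrite divr_gt0 ?exprn_gt0// ltr0n bin_gt0; lia. Qed.

Lemma qn_le1 n : n.+1%:R * bk n 0 ^+ 2 <= 1.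
Proof.
elim: n => [|n IH]; first by rewrite bk00 expr1n mulr1.
have c := bk_center n; have N0 : 0 < n.+1%:R :> R by [].
have -> : bk n.+1 0 = bk n 0 * ((2 * n).+1%:R / (2 * n.+1)%:R) by rewrite mulrA -c mulfK// pnatr_eq0.
move: IH; rewrite natrM -[(2 * n).+1%:R]natr1 natrM -[n.+2%:R]natr1 -[n.+1%:R]natr1.
move: (bk n 0) (ler0n R n); move: (n%:R : R) => N b N1 IH.
have e : (2 * N + 1) / (2 * (N + 1)) * ((2 * N + 1) / (2 * (N + 1))) * (N + 1 + 1) <= N + 1.
  rewrite -ler_pdivlMr; last lra.
  rewrite -subr_ge0 (_ : _ - _ = (3 * N + 2) / (4 * (N + 1) ^+ 2 * (N + 1 + 1))); last by field; rewrite !gt_eqF//; lra.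
  by rewrite divr_ge0// ?mulr_ge0// ?sqr_ge0//; lra.
apply: le_trans IH; rewrite [leRHS]mulrC; apply: le_trans (ler_wpM2l (sqr_ge0 b) e).
by apply/eq_ler; ring.
Qed.

Lemma qn_mono n : qn n <= qn n.+1.
Proof.
rewrite /qn; have c := bk_center n.
have -> : bk n.+1 0 = bk n 0 * ((2 * n).+1%:R / (2 * n.+1)%:R) by rewrite mulrA -c mulfK// pnatr_eq0.
rewrite natrM -[(2 * n).+1%:R]natr1 natrM -[n.+1%:R]natr1.
move: (bk n 0) (ler0n R n); move: (n%:R : R) => N b N1.
rewrite mulrC (_ : (N + 1) * _ = b ^+ 2 * (((2 * N + 1) / (2 * (N + 1))) ^+ 2 * (N + 1))); last by ring.
apply: ler_wpM2l; first exact: sqr_ge0.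
rewrite -subr_ge0 (_ : _ - _ = 1 / (4 * (N + 1))); last by field; rewrite !gt_eqF//; lra.
by rewrite divr_ge0//; lra.
Qed.

Lemma qn_cvg : exists2 c : R, 0 < c <= 1 & (forall n, qn n <= c) /\ qn @ \oo --> c.
Proof.
have ub n : qn n <= 1.
  by apply: le_trans (qn_le1 n); apply: ler_wpM2r; [exact: sqr_ge0|rewrite ler_nat].
have nd : {homo qn : n m / (n <= m)%N >-> n <= m} by apply/nondecreasing_seqP; exact: qn_mono.
have cv : cvgn qn by apply: nondecreasing_is_cvgn => //; exists 1 => _ [n _ <-].
have le n : qn n <= limn qn by exact: nondecreasing_cvgn_le.
exists (limn qn); last by split.
apply/andP; split; last by apply: limr_le => //; near=> n.
apply: lt_le_trans (le 1%N); rewrite mulr_gt0 ?exprn_gt0 ?bk_pos//.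
Unshelve. all: by end_near.
Qed.
End Binomial.

Section ProductKernel.
Variables (R : realType) (d : nat).
Local Notation V := 'rV[int]_d.
Local Notation E := (enn R).
Implicit Types (x y : V) (k l : 'rV[R]_d) (nu : 'I_d -> nat).

(** The exponent may vary with the coordinate, so that one averaging along axis i is one increment
    of [nu], see [As_bP]. *)
Definition bP nu x : R := \prod_i bk R (nu i) `|x ord0 i|%N.
Definition pk (n : nat) x : R := bP (fun=> n) x.

Lemma bP_ge0 nu x : 0 <= bP nu x. Proof. by apply: prodr_ge0 => i _; exact: bk_ge0. Qed.

Lemma bP_even nu x : bP nu (- x) = bP nu x.
Proof. by apply: eq_bigr => i _; rewrite mxE abszN. Qed.

Lemma bk_absz (n : nat) (a : int) : bk R n.+1 `|a| = (2 * bk R n `|a| + (bk R n `|a - 1| + bk R n `|a + 1|)) / 4.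
Proof.
case: a => [[|a]|a].
- by rewrite bk_rec0 /=; ring.
- have e1 : `|(Posz a.+1 - 1)%R|%N = a by lia.
  have e2 : `|(Posz a.+1 + 1)%R|%N = a.+2 by lia.
  by rewrite e1 e2 bk_recS; ring.
- have e1 : `|(Negz a - 1)%R|%N = a.+2 by lia.
  have e2 : `|(Negz a + 1)%R|%N = a by lia.
  by rewrite e1 e2 bk_recS; ring.
Qed.

Lemma As_bP i nu x : As i 1 (bP nu) x = bP (fun j => (nu j + (j == i))%N) x.
Proof.
have bD m y : bP m y = bk R (m i) `|y ord0 i| * \prod_(j < d | j != i) bk R (m j) `|y ord0 j| by rewrite /bP (bigD1 i).
rewrite /As !bD eqxx addn1 bk_absz; set xm := x - ev i 1; set xp := x + ev i 1.
have e1 : xm ord0 i = x ord0 i - 1 by rewrite /xm /xp /ev mulr1n !mxE !eqxx.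
have e2 : xp ord0 i = x ord0 i + 1 by rewrite /xm /xp /ev mulr1n !mxE !eqxx.
have e3 j : j != i -> xm ord0 j = x ord0 j by move=> ji; rewrite /xm /xp /ev mulr1n !mxE (negbTE ji) andbF subr0.
have e4 j : j != i -> xp ord0 j = x ord0 j by move=> ji; rewrite /xm /xp /ev mulr1n !mxE (negbTE ji) andbF addr0.
rewrite e1 e2.
have -> : \prod_(j < d | j != i) bk R (nu j) (absz (xm ord0 j)) = \prod_(j < d | j != i) bk R (nu j) (absz (x ord0 j)).
  by apply: eq_bigr => j ji; rewrite e3.
have -> : \prod_(j < d | j != i) bk R (nu j) (absz (xp ord0 j)) = \prod_(j < d | j != i) bk R (nu j) (absz (x ord0 j)).
  by apply: eq_bigr => j ji; rewrite e4.
have -> : \prod_(j < d | j != i) bk R (nu j + (j == i)) (absz (x ord0 j)) = \prod_(j < d | j != i) bk R (nu j) (absz (x ord0 j)).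
  by apply: eq_bigr => j ji; rewrite (negbTE ji) addn0.
ring.
Qed.

(** The transform of the product kernel with n = 1. *)
Definition wh k : R := \prod_(i < d) (1 - (1 - cos (k ord0 i)) / 2).

Lemma summ_As i s (g : V -> R) : summ g -> summ (As i s g).
Proof.
move=> sg; rewrite (eq_summ (g := fun y => 4^-1 * (2 * g y + (g (y - ev i s) + g (y + ev i s))))).
  by apply: summZ; apply: summD; [exact: summZ|apply: summD; [exact: summ_sub|exact: summ_addr]].
by move=> y; rewrite mulrC.
Qed.

Lemma bP_list (S : seq 'I_d) nu k : summ (bP nu) ->
  summ (bP (fun j => nu j + count_mem j S)%N) /\
  ct (bP (fun j => nu j + count_mem j S)%N) k = (\prod_(i <- S) (1 - (1 - cos (k ord0 i)) / 2)) * ct (bP nu) k.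
Proof.
move=> sn; elim: S => [|i S [IH1 IH2]].
  rewrite big_nil mul1r (_ : (fun j => (nu j + _)%N) = nu)//; by apply/funext => j; rewrite addn0.
have E : bP (fun j => (nu j + count_mem j (i :: S))%N) = As i 1 (bP (fun j => (nu j + count_mem j S)%N)).
  apply/funext => x; rewrite As_bP; congr (bP _ x); apply/funext => j /=.
  by rewrite eq_sym addnCA addnC.
rewrite E; split; first exact: summ_As.
by rewrite ct_As// ?IH2 ?mul1r ?big_cons ?mulrA//; exact: bP_even.
Qed.

Lemma pk_all n k : summ (pk n) /\ ct (pk n) k = wh k ^+ n.
Proof.
elim: n => [|n [s1 c1]].
  have E : pk 0 = fun x => (x == 0)%:R.
    apply/funext => x; rewrite /pk /bP; have [->|x0] := eqVneq x 0.
      by rewrite big1// => i _; rewrite mxE absz0 bk00.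
    have [i xi] : exists i, x ord0 i != 0.
      apply/existsP; rewrite -[X in is_true X]negbK negb_exists; apply/negP => /forallP h.
      by move/eqP: x0; apply; apply/rowP => i; rewrite mxE; apply/eqP; have := h i; rewrite negbK.
    rewrite (bigD1 i)//=; case: (`|x ord0 i|%N) (absz_gt0 (x ord0 i)); first by rewrite xi.
    by move=> m _; rewrite bk0S mul0r.
    rewrite E ct_delta expr0; split=> //; have := @summ_delta R V 0 (fun=> 1).
  by under eq_summ => x do rewrite mulr1.
have [h1 h2] := bP_list (enum 'I_d) k s1.
have E : (fun j : 'I_d => (n + count_mem j (enum 'I_d))%N) = fun=> n.+1.
  by apply/funext => j; rewrite count_uniq_mem ?enum_uniq// mem_enum addn1.
rewrite E in h1 h2; split=> //.
by rewrite [LHS]h2 c1 exprS /wh big_enum.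
Qed.

Lemma summ_pk n : summ (pk n). Proof. by have [] := pk_all n 0. Qed.
Lemma pk_sum1 n : rsum (pk n) = 1.
Proof.
rewrite -ct0 (pk_all n 0).2 /wh big1 ?expr1n// => i _.
by rewrite mxE cos0 subrr mul0r subr0.
Qed.
Lemma pk_ge0 n x : 0 <= pk n x. Proof. exact: bP_ge0. Qed.

Lemma pk_oc n k : rsum (fun x => pk n x * oc k x) = 1 - wh k ^+ n.
Proof.
rewrite -(pk_all n k).2 -(pk_sum1 n) -rsumB; [|exact: summ_pk|exact/summ_cos/summ_pk].
by apply: eq_rsum => x; rewrite /oc mulrBr mulr1.
Qed.
End ProductKernel.

(** * Small frequencies of the step distribution *)

Section LevySide.
Variable R : realType.
Local Notation E := (enn R).

(** Mixing weights n^(-1-th), later with th = alpha / 2 for alpha <= 2; [FS] is the mixture of 1 -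
    exp(- n v), to be evaluated at v = - ln of the one-step transform. *)
Definition nw (th : R) (n : nat) : R := n.+1%:R `^ (- (1 + th)).
Definition FS (th v : R) : R := rsum (fun n => nw th n * (1 - expR (- (n.+1%:R * v)))).

Lemma nw_ge0 th n : 0 <= nw th n. Proof. exact: powR_ge0. Qed.

Lemma onemexp_ge0 (t : R) : 0 <= t -> 0 <= 1 - expR (- t).
Proof. by move=> t0; rewrite subr_ge0 expR_le1 oppr_le0. Qed.

Lemma onemexp_le (t : R) : 1 - expR (- t) <= t.
Proof. by have := expR_ge1Dx (- t); lra. Qed.

Lemma onemexp_le1 (t : R) : 1 - expR (- t) <= 1.
Proof. by have := expR_ge0 (- t); lra. Qed.

Lemma onemexp_ge (t : R) : 0 <= t -> t - t ^+ 2 <= 1 - expR (- t).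
Proof.
move=> t0; have h := expR_ge1Dx t; have e0 := expR_gt0 t.
rewrite expRN; suff : (expR t)^-1 <= 1 - t + t ^+ 2 by lra.
rewrite -[leLHS]mul1r ler_pdivrMr//.
apply: (le_trans (y := (1 - t + t ^+ 2) * (1 + t))).
  have : 0 <= t ^+ 3 by rewrite exprn_ge0.
  by rewrite (_ : _ * _ = 1 + t ^+ 3); [lra|ring].
by apply: ler_wpM2l => //; nra.
Qed.

Lemma onemexp_ratio (s t : R) : 0 < s -> s <= t -> s * (1 - expR (- t)) <= t * (1 - expR (- s)).
Proof.
move=> s0 st; have h := expR_ge1Dx s; have e0 := expR_gt0 (- s).
have e1 : expR (- s) * (1 + s) <= 1.
  by rewrite expRN mulrC ler_pdivrMr ?expR_gt0// mul1r.
have h1 := expR_ge1Dx (- (t - s)).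
have -> : expR (- t) = expR (- s) * expR (- (t - s)) by rewrite -expRD; congr expR; ring.
have h2 := ler_wpM2l (ltW e0) h1.
move: (expR (- s)) (expR (- (t - s))) e0 e1 h2 {h h1} => a b a0 a1 h2.
have h3 : 0 <= (t - s) * (1 - a * (1 + s)) by rewrite mulr_ge0; lra.
have h4 := ler_wpM2l (ltW s0) h2.
rewrite mulrBr mulr1.
by apply: (le_trans (y := s - s * (a * (1 + - (t - s))))); [lra|move: h3; nra].
Qed.

Definition psiF (th t : R) : R := t `^ (- (1 + th)) * (1 - expR (- t)).

Lemma psiF_ge0 th t : 0 <= t -> 0 <= psiF th t.
Proof. by move=> t0; rewrite mulr_ge0 ?powR_ge0// onemexp_ge0. Qed.

Lemma powR_succ (t p : R) : 0 < t -> t `^ (- (1 + p)) = t `^ (- p) / t.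
Proof.
move=> t0; rewrite opprD powRD ?(gt_eqF t0) ?implybT// powR_inv1 ?(ltW t0)// mulrC //.
Qed.

Lemma psiF_decr th s t : 0 <= th -> 0 < s -> s <= t -> psiF th t <= psiF th s.
Proof.
move=> th0 s0 st; have t0 := lt_le_trans s0 st.
rewrite /psiF !powR_succ// -!mulrA; apply: ler_pM; rewrite ?powR_ge0//.
- by rewrite mulr_ge0 ?invr_ge0 ?(ltW t0)// onemexp_ge0// ltW.
- exact: powR_decr.
rewrite mulrC [leRHS]mulrC ler_pdivrMr// mulrAC ler_pdivlMr// mulrC [leRHS]mulrC.
exact: onemexp_ratio.
Qed.

Lemma FS_rs th v : 0 < v -> toR (rs (psiF th) v) = FS th v / v `^ th.
Proof.
move=> v0; rewrite /rs -(@rsum_ge0E _ _ (fun n : nat => v * psiF th (n.+1%:R * v))); last first.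
  by move=> n; rewrite mulr_ge0 ?psiF_ge0 ?mulr_ge0// ltW.
rewrite /FS mulrC -rsumZ; apply: eq_rsum => n.
rewrite /psiF /nw powRM ?(ltW v0)// (powR_succ th v0) (powRN v th).
have := powR_gt0 th v0; move: (v `^ th) (_ `^ _) (expR _) => p q r p0.
by field; rewrite !gt_eqF.
Qed.

(** FS(v) / v^th is the Riemann sum with mesh v of t^(-1-th) (1 - exp(- t)), a decreasing function;
    th < 1 makes it integrable at 0 and th > 0 at infinity. *)
Lemma FS_pow th : 0 < th -> th < 1 -> exists2 I : R, 0 < I & forall e : R, 0 < e ->
  exists2 v0 : R, 0 < v0 & forall v : R, 0 < v -> v < v0 -> `|FS th v / v `^ th - I| <= e.
Proof.
move=> th0 th1.
have [B B0 hB] : exists2 B : R, 0 <= B & forall v, 0 < v -> v <= 1 -> rs (psiF th) v <<= ofR B.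
  apply: (@rs_bound _ _ 1 th (1 + th)) => //; rewrite ?(ltW th0)//; first lra.
  - move=> t t0; rewrite mul1r /psiF powR_succ// -mulrA ler_piMr ?powR_ge0// mulrC ler_pdivrMr// mul1r.
    exact: onemexp_le.
  - by move=> t t0; rewrite mul1r /psiF ler_piMr ?powR_ge0// onemexp_le1.
have p0 t : 0 < t -> 0 <= psiF th t by move=> t0; exact/psiF_ge0/ltW.
have pd s t : 0 < s -> s <= t -> psiF th t <= psiF th s by move=> s0 st; exact: psiF_decr (ltW th0) s0 st.
have [I hI hl] := rs_cvg p0 pd B0 hB; exists I; last first.
  move=> e e0; have [v0 v00 h] := hl e e0; exists v0 => // v v1 v2.
  by rewrite -FS_rs//; exact: h.
apply: lt_le_trans (hI 1 ltr01 (lexx 1)).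
apply: (@lt_le_trans _ _ (psiF th 1)).
  rewrite /psiF powR1 mul1r subr_gt0 expR_lt1; lra.
apply: ofR_le; first exact: toR_ge0.
rewrite /rsR toRK; last exact: rs_fin hB _ _ _.
by have := tsum_ge1 (fun n : nat => ofR (1 * psiF th (n.+1%:R * 1))) 0%N; rewrite !mul1r.
Qed.

Lemma sum_invsq (N M : nat) : \sum_(i < M) (((N + i).+1.+1%:R : R) ^+ 2)^-1 <= (N.+1%:R)^-1 - ((N + M).+1%:R)^-1.
Proof.
elim: M => [|M IH]; first by rewrite big_ord0 addn0 subrr.
rewrite big_ord_recr /= addnS; apply: le_trans (lerD IH (lexx _)) _.
set m := (N + M)%N; have m0 : 0 < m.+1%:R :> R by [].
rewrite -addrA lerD2l -[m.+2%:R]natr1.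
move: (m.+1%:R) m0 => y y0.
have -> : (- (y + 1)^-1 : R) = - y^-1 + (y * (y + 1))^-1 by field; rewrite !gt_eqF; lra.
rewrite lerD2l lef_pV2 ?posrE; [|nra..]; nra.
Qed.

Lemma nw1 n : nw 1 n = (n.+1%:R ^+ 2)^-1.
Proof. by rewrite /nw -(powR_invn 2 (ler0n R n.+1)). Qed.

Lemma harm_ln (N : nat) : \sum_(i < N) (i.+1%:R)^-1 <= 1 + ln (N%:R : R) \/ N = 0%N.
Proof.
case: N => [|N]; first by right.
left; elim: N => [|N IH]; first by rewrite big_ord1 invr1 ln1 addr0.
rewrite big_ord_recr /=; apply: le_trans (lerD IH (lexx _)) _.
rewrite -addrA lerD2l; set y := N.+1%:R : R.
have y0 : 0 < y by [].
have -> : N.+2%:R = y + 1 by rewrite natr1.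
have h : ln (y / (y + 1)) <= - (y + 1)^-1.
  rewrite (_ : y / (y + 1) = 1 + - (y + 1)^-1); last by field; rewrite gt_eqF; lra.
  apply: le_ln1Dx; rewrite ltrN2 invf_lt1; lra.
by move: h; rewrite ln_div ?posrE//; lra.
Qed.

Lemma harm_ge (N : nat) : ln (N.+1%:R : R) <= \sum_(i < N) (i.+1%:R)^-1.
Proof.
elim: N => [|N IH]; first by rewrite big_ord0 ln1.
rewrite big_ord_recr /=; apply: le_trans _ (lerD IH (lexx _)).
set y := N.+1%:R : R; have y0 : 0 < y by [].
have -> : N.+2%:R = y * (1 + y^-1) by rewrite mulrDr mulr1 mulfV ?gt_eqF// natr1.
have y1 : 0 < y^-1 by rewrite invr_gt0.
have y2 : 0 < 1 + y^-1 by rewrite addr_gt0.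
rewrite lnM ?posrE// lerD2l; apply: le_ln1Dx; apply: lt_trans y1; lra.
Qed.

(* The sum is split at n ~ 1/v. *)
Lemma FS_log (v : R) : 0 < v -> v <= 1 / 2 -> `|FS 1 v - v * ln v^-1| <= 4 * v.
Proof.
move=> v0 v1; pose a (n : nat) : R := nw 1 n * (1 - expR (- (n.+1%:R * v))).
have a0 n : 0 <= a n by rewrite mulr_ge0 ?nw_ge0 ?onemexp_ge0// mulr_ge0// ltW.
pose N := Num.truncn v^-1.
have iv : 2 <= v^-1 by rewrite -div1r ler_pdivlMr//; lra.
have /andP[N1 N2] : N%:R <= v^-1 < N.+1%:R.
  by rewrite truncn_le ?truncnS_gt ?andbT//; lra.
have Npos : (0 < N)%N by rewrite lt0n; apply/eqP => e; move: N2; rewrite e; lra.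
have NR : 1 <= N%:R :> R by rewrite ler1n.
have vN : v * N%:R <= 1 by rewrite -ler_pdivlMl// mulr1.
have vN1 : 1 <= v * N.+1%:R by rewrite -ler_pdivrMl// mulr1 ltW.
have lnN : ln (N%:R : R) <= ln v^-1 by rewrite ler_ln ?posrE ?invr_gt0//; lra.
have lnN1 : ln v^-1 <= ln (N.+1%:R : R) by rewrite ler_ln ?posrE ?invr_gt0//; exact: ltW.
have aE n : a n = nw 1 n * (1 - expR (- (n.+1%:R * v))) by [].
have term n : v / n.+1%:R - v ^+ 2 <= a n <= v / n.+1%:R.
  rewrite aE nw1; have y0 : 0 < n.+1%:R :> R by [].
  move: (n.+1%:R) y0 => y y0; have yv : 0 <= y * v by rewrite mulr_ge0// ltW.
  have y2 : 0 <= (y ^+ 2)^-1 by rewrite invr_ge0 sqr_ge0.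
  have h1 := ler_wpM2l y2 (onemexp_le (y * v)); have h2 := ler_wpM2l y2 (onemexp_ge yv).
  have e1 : (y ^+ 2)^-1 * (y * v) = v / y by field; rewrite gt_eqF.
  have e2 : (y ^+ 2)^-1 * (y * v - (y * v) ^+ 2) = v / y - v ^+ 2 by field; rewrite gt_eqF.
  by rewrite -e1 h1 andbT e1 -e2.
have up : tsum (fun n => ofR (a n)) <<= ofR (v * (1 + ln (N%:R : R)) + 2 * v).
  have l0 : 0 <= ln (N%:R : R) by rewrite ln_ge0.
  apply: tsum_nat_ub => M; rewrite -ofR_sum//; apply: ele_ofR.
  apply: (le_trans (y := \sum_(i < N + M) a i)).
    rewrite addnC big_split_ord /= lerDl; exact: sumr_ge0.
  rewrite big_split_ord /=; apply: lerD.
    apply: (le_trans (y := \sum_(i < N) v / i.+1%:R)).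
      by apply: ler_sum => i _; have /andP[] := term i.
    rewrite -mulr_sumr; apply: ler_wpM2l; first exact: ltW.
    by case: (harm_ln N) => // e; move: Npos; rewrite e.
  have NP : N.-1.+1 = N by rewrite prednK.
  apply: (le_trans (y := \sum_(i < M) (((N.-1 + i).+1.+1%:R : R) ^+ 2)^-1)).
    apply: ler_sum => i _; rewrite aE nw1 (_ : (N.-1 + i).+2 = (N + i).+1); last by rewrite -addSn NP.
by apply: ler_piMr; [rewrite invr_ge0 sqr_ge0|exact: onemexp_le1].
  apply: le_trans (sum_invsq _ _) _; rewrite NP.
  apply: (le_trans (y := (N%:R : R)^-1)); first by rewrite gerBl invr_ge0.
  rewrite -div1r ler_pdivrMr; last lra.
  by move: vN1; rewrite -natr1; nra.
have fa : summ a by rewrite summ_ge0E//; exact: efin_ofR_le up.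
have l0 : 0 <= ln (N%:R : R) by rewrite ln_ge0.
have fse : FS 1 v = toR (tsum (fun n => ofR (a n))) by rewrite -rsum_ge0E.
have h1 : FS 1 v <= v * (1 + ln (N%:R : R)) + 2 * v.
  by rewrite fse; apply: toR_le up; rewrite addr_ge0// mulr_ge0//; lra.
have h2 : v * ln v^-1 - v <= FS 1 v.
  apply: (le_trans (y := \sum_(i < N) a i)); last first.
    apply: ofR_le; first by rewrite fse toR_ge0.
    rewrite fse toRK; last by rewrite -summ_ge0E.
    by rewrite ofR_sum//; exact: tsum_nat_ge.
  apply: (le_trans (y := \sum_(i < N) (v / i.+1%:R - v ^+ 2))); last first.
    by apply: ler_sum => i _; have /andP[] := term i.
  rewrite big_split /= sumr_const card_ord -mulr_sumr -mulr_natr mulNr.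
  have h3 := ler_wpM2l (ltW v0) (le_trans lnN1 (harm_ge N)).
  have h4 := ler_wpM2l (ltW v0) vN; rewrite mulr1 in h4.
  by move: h3; rewrite expr2 -mulrA; lra.
have h3 := ler_wpM2l (ltW v0) lnN.
by rewrite ler_norml; apply/andP; split; lra.
Qed.
End LevySide.

(** * Riemann sums of a unimodal function *)

Section Unimodal.
Variables (R : realType) (p : R).
Hypothesis p1 : 1 < p.
Local Notation E := (enn R).

(** With t = n / |x|^2 this is the Gaussian profile of the n-th term of the mixture at x; its
    maximum is at 1 / p. *)
Definition psiX (t : R) : R := t `^ (- p) * expR (- t^-1).
Definition GX : R := psiX p^-1.

Let p0 : 0 < p. Proof. by move: p1; lra. Qed.

Lemma psiXE (t : R) : 0 < t -> psiX t = expR (- (p * ln t) - t^-1).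
Proof. by move=> t0; rewrite /psiX expRD /powR (gt_eqF t0) mulNr. Qed.

Lemma psiX_ge0 t : 0 <= psiX t. Proof. by rewrite mulr_ge0 ?powR_ge0 ?expR_ge0. Qed.

Lemma psiX_le_pow (t : R) : 0 < t -> psiX t <= t `^ (- p).
Proof.
by move=> t0; rewrite /psiX ler_piMr ?powR_ge0// expR_le1 oppr_le0 invr_ge0 ltW.
Qed.

Lemma ln_ratio_le (s t : R) : 0 < s -> s <= t -> ln t - ln s <= t / s - 1.
Proof.
move=> s0 st; have t0 := lt_le_trans s0 st; rewrite -ln_div ?posrE//.
have h : 0 < t / s by rewrite divr_gt0.
have -> : ln (t / s) = ln (1 + (t / s - 1)) by congr ln; ring.
by apply: le_ln1Dx; lra.
Qed.

Lemma ln_ratio_ge (s t : R) : 0 < s -> s <= t -> 1 - s / t <= ln t - ln s.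
Proof.
move=> s0 st; have t0 := lt_le_trans s0 st.
have h : 0 < s / t by rewrite divr_gt0.
have : ln (1 + (s / t - 1)) <= s / t - 1 by apply: le_ln1Dx; lra.
rewrite (_ : 1 + _ = s / t); last by ring.
by rewrite ln_div ?posrE//; lra.
Qed.

Lemma psiX_incr (s t : R) : 0 < s -> s <= t -> t <= p^-1 -> psiX s <= psiX t.
Proof.
move=> s0 st tp; have t0 := lt_le_trans s0 st.
rewrite !psiXE// ler_expR.
have h1 := ler_wpM2l (ltW p0) (ln_ratio_le s0 st).
have h2 : p * (t / s - 1) <= s^-1 - t^-1.
  have -> : s^-1 - t^-1 = t^-1 * (t / s - 1) by field; rewrite !gt_eqF.
  apply: ler_wpM2r; first by rewrite subr_ge0 ler_pdivlMr// mul1r.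
  by rewrite -[leLHS]invrK lef_pV2 ?posrE ?invr_gt0.
by move: h1; rewrite mulrBr; lra.
Qed.

Lemma psiX_decr (s t : R) : p^-1 <= s -> s <= t -> psiX t <= psiX s.
Proof.
move=> ps st; have s0 : 0 < s by apply: lt_le_trans ps; rewrite invr_gt0.
have t0 := lt_le_trans s0 st.
rewrite !psiXE// ler_expR.
have h1 := ler_wpM2l (ltW p0) (ln_ratio_ge s0 st).
have h2 : s^-1 - t^-1 <= p * (1 - s / t).
  have -> : s^-1 - t^-1 = s^-1 * (1 - s / t) by field; rewrite !gt_eqF.
  apply: ler_wpM2r; first by rewrite subr_ge0 ler_pdivrMr// mul1r.
  by rewrite -[leRHS]invrK lef_pV2 ?posrE ?invr_gt0.
by move: h1; rewrite mulrBr; lra.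
Qed.

Lemma psiX_le (t : R) : 0 < t -> psiX t <= GX.
Proof.
by move=> t0; have [h|h] := leP t p^-1; rewrite /GX; [exact: psiX_incr|apply: psiX_decr => //; exact: ltW].
Qed.

(** The unimodal function is the difference of two non-negative non-increasing ones, to each of
    which [rs_cvg] applies. *)
Definition psiX1 (t : R) : R := if t <= p^-1 then GX else psiX t.
Definition psiX2 (t : R) : R := if t <= p^-1 then GX - psiX t else 0.

Lemma psiX12 t : psiX t = psiX1 t - psiX2 t.
Proof. by rewrite /psiX1 /psiX2; case: ifP => _; ring. Qed.

Lemma GX_ge0 : 0 <= GX. Proof. exact: psiX_ge0. Qed.

Lemma psiX1_ge0 t : 0 < t -> 0 <= psiX1 t.
Proof. by move=> t0; rewrite /psiX1; case: ifP => _; rewrite psiX_ge0. Qed.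
Lemma psiX2_ge0 t : 0 < t -> 0 <= psiX2 t.
Proof. by move=> t0; rewrite /psiX2; case: ifP => _ //; rewrite subr_ge0 psiX_le. Qed.

Lemma psiX1_decr s t : 0 < s -> s <= t -> psiX1 t <= psiX1 s.
Proof.
move=> s0 st; have t0 := lt_le_trans s0 st; rewrite /psiX1.
case: (leP t p^-1) => tp; case: (leP s p^-1) => sp //; try lra.
- exact: psiX_le.
- by apply: psiX_decr => //; exact: ltW.
Qed.
Lemma psiX2_decr s t : 0 < s -> s <= t -> psiX2 t <= psiX2 s.
Proof.
move=> s0 st; have t0 := lt_le_trans s0 st; rewrite /psiX2.
case: (leP t p^-1) => tp; case: (leP s p^-1) => sp //; try lra.
- by rewrite lerD2l lerN2 psiX_incr.
- by rewrite subr_ge0 psiX_le.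
Qed.

Let K : R := GX + 1.
Let K0 : 0 <= K. Proof. by rewrite addr_ge0 ?GX_ge0. Qed.

Lemma psiX_dom (f : R -> R) : (forall t, 0 < t -> t <= p^-1 -> f t <= GX) ->
  (forall t, 0 < t -> p^-1 < t -> f t <= psiX t) ->
  exists2 B : R, 0 <= B & forall v, 0 < v -> v <= 1 -> rs f v <<= ofR B.
Proof.
move=> h1 h2; apply: (@rs_bound _ _ K 0 p) => //.
- move=> t t0; rewrite oppr0 powRr0 mulr1 /K; have [h|h] := leP t p^-1.
    by apply: le_trans (h1 t t0 h) _; rewrite lerDl.
  by apply: le_trans (h2 t t0 h) _; apply: le_trans (psiX_le t0) _; rewrite lerDl.
- move=> t t0; have [h|h] := leP t p^-1.
    apply: le_trans (h1 t t0 h) _; apply: (le_trans (y := K * 1)).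
      by rewrite mulr1 lerDl.
    have e1 : 1 `^ (- p) = 1 :> R by rewrite powR1.
    apply: ler_wpM2l => //; rewrite -[leLHS]e1; apply: powR_decr => //; first exact: ltW.
    by apply: le_trans h _; rewrite invf_le1//; exact: ltW.
  apply: le_trans (h2 t t0 h) _; apply: le_trans (psiX_le_pow t0) _.
  by rewrite ler_peMl ?powR_ge0// /K lerDr GX_ge0.
Qed.

Lemma psiX_cvg : exists I B : R, [/\ 0 < I, 0 <= B,
  forall v, 0 < v -> v <= 1 -> rs psiX v <<= ofR B &
  forall e : R, 0 < e -> exists2 v0 : R, 0 < v0 & forall v : R, 0 < v -> v < v0 -> `|toR (rs psiX v) - I| <= e].
Proof.
have [B1 B10 hB1] := @psiX_dom psiX1
  ltac:(by move=> t t0 h; rewrite /psiX1 h) ltac:(by move=> t t0 h; rewrite /psiX1 (lt_geF h)).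
have [B2 B20 hB2] := @psiX_dom psiX2
  ltac:(by move=> t t0 h; rewrite /psiX2 h gerBl psiX_ge0)
  ltac:(by move=> t t0 h; rewrite /psiX2 (lt_geF h) psiX_ge0).
have [B B0 hB] := @psiX_dom psiX ltac:(by move=> t t0 h; exact: psiX_le) ltac:(by []).
have [I1 _ c1] := rs_cvg psiX1_ge0 psiX1_decr B10 hB1.
have [I2 _ c2] := rs_cvg psiX2_ge0 psiX2_decr B20 hB2.
have lim e : 0 < e -> exists2 v0 : R, 0 < v0 & forall v : R, 0 < v -> v < v0 -> `|toR (rs psiX v) - (I1 - I2)| <= e.
  move=> e0; have [v1 v10 h1] := c1 (e / 2) ltac:(lra); have [v2 v20 h2] := c2 (e / 2) ltac:(lra).
  exists (Num.min 1 (Num.min v1 v2)); first by rewrite !lt_min ltr01 v10.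
  move=> v v0; rewrite !lt_min => /and3P[w1 w2 w3].
  have v_le1 : v <= 1 by exact: ltW.
  have -> : toR (rs psiX v) = rsR psiX1 v - rsR psiX2 v.
    have z (f : R -> R) : (forall t, 0 < t -> 0 <= f t) -> toR (rs f v) = rsum (fun n : nat => v * f (n.+1%:R * v)).
      move=> hf; rewrite rsum_ge0E// => n; rewrite mulr_ge0 ?(ltW v0)// hf// mulr_gt0//.
    have zs (f : R -> R) (C : R) : (forall t, 0 < t -> 0 <= f t) -> rs f v <<= ofR C -> summ (fun n : nat => v * f (n.+1%:R * v)).
      move=> hf hC; rewrite summ_ge0E; first exact: efin_ofR_le hC.
      by move=> n; rewrite mulr_ge0 ?(ltW v0)// hf// mulr_gt0//.
    rewrite /rsR z; last by move=> t _; exact: psiX_ge0.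
    rewrite (z _ psiX1_ge0) (z _ psiX2_ge0) -rsumB.
    - by apply: eq_rsum => n; rewrite psiX12 mulrBr.
    - by apply: (zs _ B1) => //; [exact: psiX1_ge0|exact: hB1].
    - by apply: (zs _ B2) => //; [exact: psiX2_ge0|exact: hB2].
  have := h1 v v0 w2; have := h2 v v0 w3; rewrite !ler_norml => /andP[??] /andP[??].
  by apply/andP; split; lra.
exists (I1 - I2), B; split => //.
(* For mesh 1/j the j points in (1, 2] contribute at least c, which keeps the limit positive. *)
pose c : R := 2 `^ (- p) * expR (- 1); have c0 : 0 < c by rewrite mulr_gt0 ?powR_gt0 ?expR_gt0.
apply: lt_le_trans c0 _; apply/ler_addgt0Pr => e e0.
have [v0 v00 hv] := lim e e0.
pose j := (Num.truncn v0^-1).+1; have jR : 0 < j%:R :> R by [].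
have jv : (j%:R)^-1 < v0 by rewrite -[ltRHS]invrK ltf_pV2 ?posrE ?invr_gt0// truncnS_gt.
have j1 : (j%:R)^-1 <= 1 :> R by rewrite invf_le1// ler1n.
clearbody j; have := hv _ (_ : 0 < (j%:R)^-1) jv; rewrite invr_gt0 => /(_ jR).
rewrite ler_norml => /andP[_ h].
suff : c <= toR (rs psiX (j%:R)^-1) by lra.
apply: ofR_le; first exact: toR_ge0.
rewrite toRK; last by apply: efin_ofR_le (hB _ _ j1); rewrite invr_gt0.
apply: ele_trans (tsum_nat_ge _ (j + j)%N).
rewrite -ofR_sum; last by move=> i _; rewrite mulr_ge0 ?psiX_ge0 ?invr_ge0.
apply: ele_ofR; rewrite big_split_ord /=.
apply: (le_trans (y := \sum_(i < j) (j%:R)^-1 * c)).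
  by rewrite -mulr_sumr sumr_const card_ord -[c *+ _]mulr_natl mulrA mulVf ?mul1r// gt_eqF.
rewrite -[leLHS]add0r; apply: lerD.
  by apply: sumr_ge0 => i _; rewrite mulr_ge0 ?psiX_ge0 ?invr_ge0.
apply: ler_sum => i _; apply: ler_wpM2l; first by rewrite invr_ge0.
set t := _ * _; have t1 : 1 <= t.
  by rewrite /t ler_pdivlMr// mul1r ler_nat -addnS leq_addr.
have t2 : t <= 2.
  by rewrite /t ler_pdivrMr// -natrM ler_nat mul2n -addnn -addnS leq_add2l.
rewrite /c /psiX; apply: ler_pM; rewrite ?powR_ge0 ?expR_ge0//.
  by apply: powR_decr => //; [exact: ltW|lra].
by rewrite ler_expR lerN2 invf_le1//; lra.
Qed.

Lemma psiX_small (t : R) : 0 < t -> t `^ (- p) * expR (- (2 * t)^-1) <= 2 `^ p * GX.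
Proof.
move=> t0; have t2 : 0 < 2 * t by rewrite mulr_gt0.
have h := psiX_le t2; rewrite /psiX powRM ?(ltW t0)// powRN in h.
have q0 : 0 < 2 `^ p :> R by exact: powR_gt0.
have := ler_wpM2l (ltW q0) h; rewrite !mulrA mulfV ?mul1r//; exact: lt0r_neq0.
Qed.
End Unimodal.

(** * Local limit estimates for the product kernel *)

Section KernelTail.
Variables (R : realType) (d : nat).
Local Notation V := 'rV[int]_d.
Local Notation E := (enn R).
Implicit Types (x y : V).

Definition Sq x : R := dotr (ztor R x) (ztor R x).
Definition jx x (i : 'I_d) : R := (`|x ord0 i|%N)%:R.
Definition PX (m : nat) x : R := m%:R `^ (d%:R / 2) * pk R m x.

Lemma Sq_sum x : Sq x = \sum_i jx x i ^+ 2.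
Proof.
rewrite /Sq /dotr; apply: eq_bigr => i _; rewrite /ztor !mxE /jx -expr2.
by rewrite -[RHS]natrX -[in RHS]abszX pmulrn gez0_abs ?sqr_ge0// rmorphXn.
Qed.

Lemma Sq_ge0 x : 0 <= Sq x.
Proof. by rewrite Sq_sum; apply: sumr_ge0 => i _; exact: sqr_ge0. Qed.

Lemma enorm_Sq x : enorm (ztor R x) ^+ 2 = Sq x.
Proof. by rewrite /enorm sqr_sqrtr//; exact: Sq_ge0. Qed.

Lemma jx_le x i : jx x i ^+ 2 <= Sq x.
Proof. by rewrite Sq_sum (bigD1 i)//= lerDl; apply: sumr_ge0 => j _; exact: sqr_ge0. Qed.

Lemma PX_prod m x : PX m x = \prod_i (Num.sqrt m%:R * bk R m `|x ord0 i|).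
Proof.
rewrite /PX (_ : m%:R `^ _ = Num.sqrt m%:R ^+ d); last first.
  by rewrite mulrC powRrM powR12_sqrt// powR_mulrn// sqrtr_ge0.
by rewrite big_split prodr_const card_ord.
Qed.

Definition am (m : nat) : R := Num.sqrt m%:R * bk R m 0.

Lemma am_ge0 m : 0 <= am m. Proof. by rewrite mulr_ge0 ?sqrtr_ge0 ?bk_ge0. Qed.
Lemma am_sq m : am m ^+ 2 = qn R m.
Proof. by rewrite /am exprMn sqr_sqrtr. Qed.

Lemma am_cvg : exists2 c : R, 0 < c <= 1 & (forall m, am m <= c) /\
  forall t, 0 < t -> exists n0 : nat, forall m, (n0 <= m)%N -> c - t <= am m.
Proof.
have [c0 /andP[c00 c01] [h1 h2]] := qn_cvg R.
have s0 : 0 < Num.sqrt c0 by rewrite sqrtr_gt0.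
exists (Num.sqrt c0).
  by rewrite s0 -[leRHS]sqrtr1 ler_wsqrtr.
have up m : am m <= Num.sqrt c0.
  by rewrite -(ger0_norm (am_ge0 m)) -sqrtr_sqr am_sq ler_wsqrtr.
split => // t t0.
have t1 : 0 < t * Num.sqrt c0 by rewrite mulr_gt0.
have /cvgrPdist_lt /(_ _ t1) [n0 _ hn] := h2.
exists n0 => m /hn /=; rewrite -am_sq => h; rewrite leNgt; apply/negP => h3.
have e0 : c0 = Num.sqrt c0 ^+ 2 by rewrite sqr_sqrtr// ltW.
move: h; rewrite [in X in X - _]e0 => h.
have u := up m; have a0 := am_ge0 m.
move: h; apply/negP; rewrite -leNgt; apply: le_trans (ler_norm _).
rewrite subr_sqr; apply: ler_pM; rewrite ?(ltW t0) ?(ltW s0)//; [by move: h3; lra|by rewrite lerDl].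
Qed.

Lemma PX_ge0 m x : 0 <= PX m x.
Proof. by rewrite mulr_ge0 ?powR_ge0 ?pk_ge0. Qed.

(** For |x_i| <= m the exponent in [bk_upper] has denominator at most 2m; for |x_i| > m the factor
    vanishes. The bound needs no relation between x and m, as the small times in [Wr_tail]
    require. *)
Lemma PX_up m x : (0 < m)%N -> PX m x <= expR (- (Sq x / (2 * m%:R))).
Proof.
move=> m0; rewrite PX_prod Sq_sum mulr_suml -sumrN expR_sum.
have mR : 0 < m%:R :> R by rewrite ltr0n.
apply: ler_prod => i _; rewrite mulr_ge0 ?sqrtr_ge0 ?bk_ge0//=.
have am1 : am m <= 1.
  have [c /andP[_ c1] [h _]] := am_cvg; exact: le_trans (h m) c1.
rewrite /jx; set j := `|x ord0 i|%N.
have [mj|jm] := ltnP m j.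
  by rewrite /bk bin_small ?mul0r ?mulr0 ?expR_ge0//; lia.
apply: (le_trans (y := am m * expR (- (j%:R ^+ 2 / (m + j)%:R)))).
  rewrite -mulrA; apply: ler_wpM2l; first exact: sqrtr_ge0.
  exact: bk_upper.
rewrite -[leRHS]mul1r; apply: ler_pM; rewrite ?am_ge0 ?expR_ge0// ler_expR lerN2.
apply: ler_wpM2l; first exact: sqr_ge0.
rewrite lef_pV2 ?posrE ?mulr_gt0 ?ltr0n ?addn_gt0 ?m0//.
by rewrite natrD; have : j%:R <= m%:R :> R by [rewrite ler_nat|]; lra.
Qed.

Lemma PX_coord (m j : nat) (c t e : R) : (0 < m)%N -> (4 * j <= m)%N -> c - t <= am m -> am m <= c -> 0 <= c - t ->
  j%:R ^+ 3 / m%:R ^+ 2 <= e ->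
  (c - t) * expR (- (8 * e)) * expR (- (j%:R ^+ 2 / m%:R)) <= Num.sqrt m%:R * bk R m j <=
  c * expR e * expR (- (j%:R ^+ 2 / m%:R)).
Proof.
move=> m0 jm ct ac ct0 he; have mR : 0 < m%:R :> R by rewrite ltr0n.
have a0 := am_ge0 m.
apply/andP; split.
  apply: (le_trans (y := am m * expR (- (j%:R ^+ 2 / m%:R) - 8 * (j%:R ^+ 3 / m%:R ^+ 2)))).
    rewrite -mulrA -expRD; apply: ler_pM; rewrite ?expR_ge0// ler_expR; lra.
  by rewrite /am -mulrA; apply: ler_wpM2l; [exact: sqrtr_ge0|exact: bk_lower].
apply: (le_trans (y := am m * expR (- (j%:R ^+ 2 / (m + j)%:R)))).
  by rewrite /am -mulrA; apply: ler_wpM2l; [exact: sqrtr_ge0|exact: bk_upper].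
rewrite -mulrA -expRD; apply: ler_pM; rewrite ?expR_ge0// ler_expR.
suff : j%:R ^+ 2 / m%:R - j%:R ^+ 2 / (m + j)%:R <= (j%:R ^+ 3 / m%:R ^+ 2 : R) by lra.
rewrite natrD; have : 0 <= j%:R :> R by [].
move: (j%:R) (m%:R) mR => J M M0 J0.
have -> : J ^+ 2 / M - J ^+ 2 / (M + J) = J ^+ 3 / (M * (M + J)).
  by field; rewrite !gt_eqF//; lra.
apply: ler_wpM2l; first exact: exprn_ge0.
rewrite lef_pV2 ?posrE; [|nra..]; nra.
Qed.

(** Where m >= eta |x|^2 and |x| is large, |x_i|^3 / m^2 is of order 1 / |x|, so that [bk_upper] and
    [bk_lower] agree up to a factor close to 1. The error is relative to the Gaussian factor, hence
    still summable over m. *)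
Lemma PX_lim : (0 < d)%N -> exists2 c : R, 0 < c & forall eta del : R, 0 < eta -> 0 < del ->
  exists N0 : R, forall x m, N0 <= Sq x -> eta * Sq x <= m%:R ->
  `|PX m x - c * expR (- (Sq x / m%:R))| <= del * expR (- (Sq x / m%:R)).
Proof.
move=> d0; have [c /andP[c0 c1] [up low]] := am_cvg.
exists (c ^+ d) => [|eta del eta0 del0]; first exact: exprn_gt0.
have dR : 1 <= d%:R :> R by rewrite ler1n.
pose t : R := Num.min c (del / (2 * d%:R)).
have t0 : 0 < t by rewrite lt_min c0 divr_gt0// mulr_gt0//; lra.
have tc : 0 <= c - t by rewrite subr_ge0 ge_min lexx.
have td : d%:R * t <= del / 2.
  apply: (le_trans (y := d%:R * (del / (2 * d%:R)))).
    by apply: ler_wpM2l => //; rewrite ge_min lexx orbT.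
  by apply/eq_ler; field; rewrite gt_eqF//; lra.
pose e : R := Num.min (2 * d%:R)^-1 (del / (16 * d%:R)).
have e0 : 0 < e by rewrite lt_min invr_gt0 divr_gt0 ?mulr_gt0//; lra.
have e1 : d%:R * e <= 1 / 2.
  apply: (le_trans (y := d%:R * (2 * d%:R)^-1)).
    by apply: ler_wpM2l => //; rewrite ge_min lexx.
  by apply/eq_ler; field; rewrite gt_eqF//; lra.
have e2 : d%:R * e <= del / 16.
  apply: (le_trans (y := d%:R * (del / (16 * d%:R)))).
    by apply: ler_wpM2l => //; rewrite ge_min lexx orbT.
  by apply/eq_ler; field; rewrite gt_eqF//; lra.
have [n0 hn0] := low t t0.
(* The summands ensure in turn |x_i|^3 / m^2 <= e, 4 |x_i| <= m, n0 <= m and |x| >= 1. *)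
exists ((eta ^+ 2 * e)^-1 ^+ 2 + (4 / eta) ^+ 2 + n0%:R / eta + 1) => x m hN hm.
have q1 : 0 < eta ^+ 2 * e by rewrite mulr_gt0 ?exprn_gt0.
have q2 : 0 <= (eta ^+ 2 * e)^-1 ^+ 2 by exact: sqr_ge0.
have q3 : 0 <= (4 / eta) ^+ 2 by exact: sqr_ge0.
have q4 : 0 <= n0%:R / eta by rewrite divr_ge0// ltW.
have S1 : 1 <= Sq x by lra.
pose s := Num.sqrt (Sq x); have s0 : 0 < s by rewrite sqrtr_gt0; lra.
have sE : Sq x = s ^+ 2 by rewrite sqr_sqrtr//; lra.
have s1 : (eta ^+ 2 * e)^-1 <= s.
  by rewrite -(@ler_pXn2r _ 2)// ?nnegrE ?invr_ge0 ?(ltW q1) ?(ltW s0)// -sE; lra.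
have s2 : 4 / eta <= s.
  by rewrite -(@ler_pXn2r _ 2)// ?nnegrE ?divr_ge0 ?(ltW eta0) ?(ltW s0)// -sE; lra.
have mge : 0 < m%:R :> R by apply: lt_le_trans hm; rewrite mulr_gt0//; lra.
have m0 : (0 < m)%N by rewrite -(ltr0n R).
have mn0 : (n0 <= m)%N.
  rewrite -(ler_nat R); apply: le_trans hm; rewrite -ler_pdivrMl//.
  by rewrite mulrC; lra.
have js i : jx x i <= s.
  by rewrite -(@ler_pXn2r _ 2)// ?nnegrE ?(ltW s0)// -sE; exact: jx_le.
have jm i : (4 * `|x ord0 i| <= m)%N.
  rewrite -(ler_nat R) natrM; apply: le_trans hm; rewrite sE.
  apply: (le_trans (y := 4 * s)); first by apply: ler_wpM2l => //; exact: js.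
  by rewrite expr2 mulrA; apply: ler_wpM2r; [exact: ltW|rewrite -ler_pdivrMl// mulrC].
have jc i : jx x i ^+ 3 / m%:R ^+ 2 <= e.
  apply: (le_trans (y := s ^+ 3 / (eta * s ^+ 2) ^+ 2)).
    apply: ler_pM; rewrite ?invr_ge0 ?exprn_ge0//.
      by rewrite ler_pXn2r// ?nnegrE// ltW.
    rewrite lef_pV2 ?posrE ?exprn_gt0 ?mulr_gt0 ?exprn_gt0// ler_pXn2r ?nnegrE//.
      by rewrite -sE.
    by rewrite mulr_ge0 ?sqr_ge0// ltW.
  have -> : s ^+ 3 / (eta * s ^+ 2) ^+ 2 = (eta ^+ 2 * s)^-1 by field; rewrite !gt_eqF.
  rewrite invf_ple ?posrE ?mulr_gt0 ?exprn_gt0//.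
  rewrite -ler_pdivrMl ?exprn_gt0//; move: s1; rewrite invfM//.
have bnd i := PX_coord m0 (jm i) (hn0 m mn0) (up m) tc (jc i).
have prodE (a : R) : \prod_(i < d) (a * expR (- ((`|x ord0 i|%N)%:R ^+ 2 / m%:R))) = a ^+ d * expR (- (Sq x / m%:R)).
  rewrite big_split /= prodr_const card_ord; congr (_ * _).
  by rewrite Sq_sum mulr_suml -sumrN expR_sum.
have ea0 := expR_ge0 (- (8 * e)); have eb0 := expR_ge0 e.
have E0 := expR_ge0 (- (Sq x / m%:R)).
have H1 : ((c - t) * expR (- (8 * e))) ^+ d * expR (- (Sq x / m%:R)) <= PX m x.
  rewrite -prodE PX_prod; apply: ler_prod => i _; have /andP[-> _] := bnd i.
  by rewrite !mulr_ge0// expR_ge0.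
have H2 : PX m x <= (c * expR e) ^+ d * expR (- (Sq x / m%:R)).
  rewrite -prodE PX_prod; apply: ler_prod => i _; have /andP[_ ->] := bnd i.
  by rewrite mulr_ge0 ?sqrtr_ge0 ?bk_ge0.
have cd1 : c ^+ d <= 1 by rewrite exprn_ile1// ltW.
have cd0 : 0 <= c ^+ d by rewrite exprn_ge0// ltW.
have K1 : c ^+ d - del <= ((c - t) * expR (- (8 * e))) ^+ d.
  rewrite exprMn -expRM_natr mulNr.
  have g1 : c ^+ d - del / 2 <= (c - t) ^+ d.
    have := expr_gap_le d.-1 tc (_ : c - t <= c); rewrite prednK// gerBl (ltW t0) => /(_ isT).
    rewrite (_ : c - (c - t) = t); last ring.
    have : d%:R * c ^+ d.-1 * t <= d%:R * t.
      by apply: ler_wpM2r; [exact: ltW|rewrite ler_piMr// exprn_ile1// ltW].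
    by lra.
  have g2 : 1 - del / 2 <= expR (- (8 * e * d%:R)).
    by apply: le_trans (expR_ge1Dx _); lra.
  have g3 : expR (- (8 * e * d%:R)) <= 1 by rewrite expR_le1 oppr_le0 !mulr_ge0// ltW.
  have g0 : 0 <= (c - t) ^+ d by exact: exprn_ge0.
  have g4 : (c - t) ^+ d <= 1 by rewrite exprn_ile1//; lra.
  have := ler_wpM2l g0 g2; have : (c - t) ^+ d * (del / 2) <= del / 2 by rewrite ler_piMl//; lra.
  by rewrite mulrBr mulr1; lra.
have K2 : (c * expR e) ^+ d <= c ^+ d + del.
  rewrite exprMn -expRM_natr.
  have de : 0 <= e * d%:R by rewrite mulr_ge0// ltW.
  have g1 : expR (e * d%:R) <= 1 + del.
    have g2 := expR_ge1Dx (- (e * d%:R)).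
    have g3 : 0 < 1 - e * d%:R by lra.
    rewrite -[e * _]opprK expRN; apply: (le_trans (y := (1 - e * d%:R)^-1)).
      by rewrite lef_pV2 ?posrE ?expR_gt0.
    rewrite -div1r ler_pdivrMr//.
    have : 0 <= del * (1 / 2 - e * d%:R) by rewrite mulr_ge0//; lra.
    by rewrite mulrBr; nra.
  have := ler_wpM2l cd0 g1; have : c ^+ d * del <= del by rewrite ler_piMl// ltW.
  by rewrite mulrDr mulr1; lra.
have := ler_wpM2r E0 K1; have := ler_wpM2r E0 K2; rewrite mulrBl mulrDl.
by move=> *; rewrite ler_norml; apply/andP; split; lra.
Qed.
End KernelTail.

(** * The mixture: tail and transform *)

Section LevyKernel.
Variables (R : realType) (d : nat) (th : R).
Local Notation V := 'rV[int]_d.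
Local Notation E := (enn R).
Implicit Types (x y : V).
Hypotheses (d0 : (0 < d)%N) (th0 : 0 < th).

Lemma summ_nw : summ (nw th).
Proof.
pose f (t : R) := Num.min 1 (t `^ (- (1 + th))).
have [B B0 hB] : exists2 B : R, 0 <= B & forall v, 0 < v -> v <= 1 -> rs f v <<= ofR B.
  apply: (@rs_bound _ _ 1 0 (1 + th)) => //; first by move: th0; lra.
  - by move=> t t0; rewrite oppr0 powRr0 mulr1 /f ge_min lexx.
  - by move=> t t0; rewrite mul1r /f ge_min lexx orbT.
rewrite summ_ge0E; last by move=> n; exact: nw_ge0.
apply: (@efin_le _ _ (rs f 1)); last by apply: efin_ofR_le (hB 1 ltr01 (lexx 1)).
apply: le_tsum => n; apply: ele_ofR; rewrite mul1r mulr1 /f /nw le_min lexx andbT.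
have e1 : 1 `^ (- (1 + th)) = 1 :> R by rewrite powR1.
by rewrite -[leRHS]e1; apply: powR_decr; rewrite ?ler1n//; move: th0; lra.
Qed.

Definition Wr x : R := rsum (fun n => nw th n * pk R n.+1 x).

Lemma Wr_fin : efin (tsum (fun x => asum (fun n => nw th n * pk R n.+1 x))).
Proof.
have -> : tsum (fun x => asum (fun n => nw th n * pk R n.+1 x)) = asum (nw th).
  rewrite /asum tsum_swap; apply: eq_tsum => n.
  have e x : ofR `|nw th n * pk R n.+1 x| = ofR `|nw th n| * ofR `|pk R n.+1 x|.
    by rewrite normrM ofRM.
  under eq_tsum => x do rewrite e.
  rewrite tsumZl (_ : tsum _ = 1) ?mulr1//.
  have h : rsum (fun x : V => `|pk R n.+1 x|) = 1.
    by rewrite -(pk_sum1 R d n.+1); apply: eq_rsum => x; rewrite ger0_norm ?pk_ge0.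
  by rewrite -ofR1 -h rsum_abs toRK//; exact: summ_pk.
exact: summ_nw.
Qed.

Lemma summ_Wr : summ Wr. Proof. exact: summ_outer Wr_fin. Qed.

Lemma Wr_ge0 x : 0 <= Wr x.
Proof. by apply: rsum_ge0 => n; rewrite mulr_ge0 ?nw_ge0 ?pk_ge0. Qed.

(** An exact identity: the transform of the n-th component is the n-th power of [wh], that is exp(-
    n v) with v = - ln(wh k). *)
Lemma Wr_oc k : 0 < wh k -> rsum (fun x => Wr x * oc k x) = FS th (- ln (wh k)).
Proof.
move=> w0.
transitivity (rsum (fun x => rsum (fun n => nw th n * pk R n.+1 x * oc k x))).
  apply: eq_rsum => x; rewrite mulrC -rsumZ; apply: eq_rsum => n; exact: mulrC.
rewrite rsum_swap; last first.
  apply: (@efin_le _ _ (tsum (fun x => asum (fun n => nw th n * pk R n.+1 x) * 2%:R))).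
    apply: le_tsum => x; rewrite /asum -tsumZr; apply: le_tsum => n.
    rewrite normrM -(ofR_nat R) -ofRM//; apply: ele_ofR; apply: ler_wpM2l => //.
    by rewrite ger0_norm ?oc_ge0 ?oc_le2.
  by rewrite tsumZr; apply: efinM (efin_nat _ _); exact: Wr_fin.
apply: eq_rsum => n; rewrite (eq_rsum (g := fun x => nw th n * (pk R n.+1 x * oc k x))); last first.
  by move=> x; rewrite mulrA.
by rewrite rsumZ pk_oc mulrN opprK expRM_natl lnK// posrE.
Qed.

Lemma initial_terms (v eta : R) : 0 < v -> 0 <= eta ->
  tsum (fun n : nat => ofR (if n.+1%:R * v <= eta then v else 0)) <<= ofR eta.
Proof.
move=> v0 e0; apply: tsum_nat_ub => M.
rewrite -ofR_sum; last by move=> i _; case: ifP => // _; exact: ltW.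
apply: ele_ofR.
suff : \sum_(i < M) (if i.+1%:R * v <= eta then v else 0) <= eta /\
  \sum_(i < M) (if i.+1%:R * v <= eta then v else 0) <= M%:R * v by case.
elim: M => [|M [IH1 IH2]]; first by rewrite big_ord0 mul0r.
rewrite big_ord_recr /=; have e1 : M.+1%:R * v = M%:R * v + v by rewrite -natr1 mulrDl mul1r.
case: ifP => h; rewrite ?addr0; split; rewrite ?e1 ?lerD2r//.
- by apply: le_trans h; rewrite e1 lerD2r.
- by apply: le_trans IH2 _; rewrite lerDl ltW.
Qed.

(** Multiplied by |x|^(d+2th), the mixture at x is a Riemann sum of [psiX] with mesh 1 / |x|^2, up
    to the error in the local limit. Times with n / |x|^2 <= eta are bounded crudely by [PX_up] and
    [psiX_small] and contribute O(eta); the others are covered by [PX_lim]. *)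
Lemma Wr_tail : exists2 C : R, 0 < C & forall e : R, 0 < e -> exists M : R, forall x, M < enorm (ztor R x) ->
  `|enorm (ztor R x) `^ (d%:R + 2 * th) * Wr x - C| <= e.
Proof.
pose p : R := 1 + (d%:R / 2 + th).
have dR : 1 <= d%:R :> R by rewrite ler1n.
have p1 : 1 < p by rewrite /p ltrDl addr_gt0// divr_gt0//; lra.
have [c c0 hc] := PX_lim R d0.
have [I [B [I0 B0 hB hI]]] := psiX_cvg p1.
exists (c * I) => [|e e0]; first exact: mulr_gt0.
pose G : R := 2 `^ p * GX p.
have G0 : 0 <= G by rewrite mulr_ge0 ?powR_ge0 ?GX_ge0.
pose eta : R := e / (4 * ((1 + c) * G + 1)).
have k0 : 0 < (1 + c) * G + 1 by rewrite ltr_wpDl// mulr_ge0// addr_ge0// ltW.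
have eta0 : 0 < eta by rewrite divr_gt0// mulr_gt0.
pose del : R := e / (4 * (B + 1)).
have B1 : 0 < B + 1 by rewrite ltr_wpDl.
have del0 : 0 < del by rewrite divr_gt0// mulr_gt0.
have [N0 hN0] := hc eta del eta0 del0.
have [v0 v00 hv0] := hI (e / (4 * c)) ltac:(by rewrite divr_gt0// mulr_gt0).
exists (1 + `|N0| + v0^-1) => x hx.
set r := enorm (ztor R x); set N := Sq R x.
have rN : r ^+ 2 = N by exact: enorm_Sq.
have iv0 : 0 < v0^-1 by rewrite invr_gt0.
have n0 := normr_ge0 N0.
have r1 : 1 < r by rewrite /r; lra.
have rr : r <= N by rewrite -rN expr2 ler_peMl//; lra.
have N1 : 1 < N by lra.
have hN : N0 <= N by have := ler_norm N0; rewrite -/r in hx; lra.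
pose v := N^-1; have vp : 0 < v by rewrite invr_gt0; lra.
have v1 : v <= 1 by rewrite invf_le1; lra.
have vv0 : v < v0 by rewrite -[ltRHS]invrK ltf_pV2 ?posrE//; [rewrite -/r in hx; lra|lra].
have Np : 0 < N by lra.
pose a (n : nat) : R := v * ((n.+1%:R * v) `^ (- p) * PX R n.+1 x).
pose b (n : nat) : R := v * psiX p (n.+1%:R * v).
have aE n : r `^ (d%:R + 2 * th) * (nw th n * pk R n.+1 x) = a n.
  have -> : r `^ (d%:R + 2 * th) = N `^ (d%:R / 2 + th).
    rewrite -rN -powR_mulrn; last lra.
    by rewrite -powRrM; congr (_ `^ _); field.
  have m0 : 0 < n.+1%:R :> R by [].
  rewrite /a /PX /nw /v powRM ?invr_ge0 ?(ltW Np)// -(powR_inv1 (ltW Np)) -powRrM mulN1r opprK.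
  have e1 : N `^ p = N * N `^ (d%:R / 2 + th).
    by rewrite /p powRD ?(gt_eqF Np) ?implybT// powRr1// ltW.
  have e2 : n.+1%:R `^ (- p) * n.+1%:R `^ (d%:R / 2) = n.+1%:R `^ (- (1 + th)) :> R.
    by rewrite -powRD ?(gt_eqF m0) ?implybT//; congr (_ `^ _); rewrite /p; ring.
  rewrite e1 -e2 powR_inv1 ?(ltW Np)//.
  move: (N `^ (d%:R / 2 + th)) (n.+1%:R `^ (- p)) (_ `^ (d%:R / 2)) (pk _ _ _) => p1' p2' p3' p4'.
  by field; rewrite gt_eqF.
have tE n : (n.+1%:R * v)^-1 = N / n.+1%:R by rewrite invfM /v invrK mulrC.
have t0 n : 0 < n.+1%:R * v by rewrite mulr_gt0.
pose g (n : nat) : R := del * b n + (1 + c) * G * (if n.+1%:R * v <= eta then v else 0).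
have dom n : `|a n - c * b n| <= g n.
  have -> : a n - c * b n = v * ((n.+1%:R * v) `^ (- p) * (PX R n.+1 x - c * expR (- (N / n.+1%:R)))).
    by rewrite /a /b /psiX tE; ring.
  rewrite normrM (gtr0_norm vp) normrM (ger0_norm (powR_ge0 _ _)) /g.
  have g1 : 0 <= del * b n by rewrite mulr_ge0 ?(ltW del0)// mulr_ge0 ?psiX_ge0// ltW.
  have [le|gt] := leP (n.+1%:R * v) eta.
    apply: ler_wpDl => //; rewrite [leRHS]mulrC.
    apply: ler_wpM2l; first exact: ltW.
    have h1 := psiX_small p1 (t0 n); rewrite -/G invfM tE in h1.
    have h2 := PX_up R x (ltn0Sn n); rewrite -/N in h2.
    have E2 : 2^-1 * (N / n.+1%:R) = N / (2 * n.+1%:R) by field; rewrite nat1r.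
    rewrite E2 in h1.
    have h3 : expR (- (N / n.+1%:R)) <= expR (- (N / (2 * n.+1%:R))).
      rewrite ler_expR lerN2 -E2 ler_piMl ?divr_ge0 ?(ltW Np)//; lra.
    have h4 : `|PX R n.+1 x - c * expR (- (N / n.+1%:R))| <= (1 + c) * expR (- (N / (2 * n.+1%:R))).
      apply: le_trans (ler_normB _ _) _; rewrite ger0_norm ?PX_ge0//.
      rewrite ger0_norm ?mulr_ge0 ?expR_ge0 ?(ltW c0)// mulrDl mul1r; apply: lerD => //.
      by apply: ler_wpM2l => //; exact: ltW.
    apply: le_trans (ler_wpM2l (powR_ge0 _ _) h4) _.
    by rewrite mulrCA; apply: ler_wpM2l => //; rewrite addr_ge0// ltW.
  rewrite mulr0 addr0 /b [leRHS]mulrCA; apply: ler_wpM2l; first exact: ltW.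
  rewrite /psiX tE [leRHS]mulrCA; apply: ler_wpM2l; first exact: powR_ge0.
  apply: hN0 => //; rewrite -/N -ler_pdivlMr//; exact: ltW.
have b0 n : 0 <= b n by rewrite mulr_ge0 ?psiX_ge0// ltW.
have sb : summ b by rewrite summ_ge0E//; exact: efin_ofR_le (hB v vp v1).
have rb : rsum b = toR (rs (psiX p) v) by rewrite rsum_ge0E.
have rbB : rsum b <= B by rewrite rb; apply: toR_le => //; exact: hB.
pose i_ (n : nat) : R := if n.+1%:R * v <= eta then v else 0.
have i0 n : 0 <= i_ n by rewrite /i_; case: ifP => // _; exact: ltW.
have hi := initial_terms vp (ltW eta0).
have si : summ i_ by rewrite summ_ge0E//; exact: efin_ofR_le hi.
have ri : rsum i_ <= eta by rewrite rsum_ge0E//; apply: toR_le => //; exact: ltW.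
have sg : summ g by apply: summD; apply: summZ.
have sab : summ (fun n => a n - c * b n) by exact: summ_le dom sg.
have scb : summ (fun n => c * b n) by exact: summZ.
have sa : summ a.
  rewrite (eq_summ (g := fun n => (a n - c * b n) + c * b n)); first exact: summD.
  by move=> n; rewrite subrK.
have -> : r `^ (d%:R + 2 * th) * Wr x = rsum a.
  by rewrite /Wr -rsumZ; apply: eq_rsum => n; exact: aE.
have h1 : `|rsum a - c * rsum b| <= e / 2.
  rewrite -rsumZ -rsumB//; apply: le_trans (ler_rsum_sup dom sg) _.
  rewrite rsumD; [|exact: summZ|exact: summZ]; rewrite (rsumZ del b) (rsumZ _ i_).
  have h2 : del * rsum b <= e / 4.
    apply: (le_trans (y := del * (B + 1))).
      by apply: ler_wpM2l; [exact: ltW|lra].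
    by apply/eq_ler; rewrite /del; field; rewrite gt_eqF.
  have h3 : (1 + c) * G * rsum i_ <= e / 4.
    apply: (le_trans (y := ((1 + c) * G + 1) * eta)); last first.
      by apply/eq_ler; rewrite /eta; field; rewrite gt_eqF.
    have cG : 0 <= (1 + c) * G by rewrite mulr_ge0// addr_ge0// ltW.
    have ip : 0 <= rsum i_ by exact: rsum_ge0.
    by apply: ler_pM => //; rewrite lerDl.
  lra.
have h2 : `|c * rsum b - c * I| <= e / 4.
  rewrite -mulrBr normrM (gtr0_norm c0) rb.
  apply: le_trans (ler_wpM2l (ltW c0) (hv0 v vp vv0)) _.
  by apply/eq_ler; field; rewrite gt_eqF.
apply: le_trans (ler_distD (c * rsum b) _ _) _; apply: le_trans (lerD h1 h2) _; lra.
Qed.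
End LevyKernel.

(** * Elementary estimates near frequency 0 *)

Section SmallFrequency.
Variable R : realType.

Lemma sin_mvt (t : R) : 0 < t -> exists2 c : R, 0 < c < t & sin t = cos c * t.
Proof.
move=> t0.
have [c] := @MVT R sin cos 0 t t0 (fun x _ => is_derive_sin x)
  (continuous_subspaceT (@continuous_sin R)).
by rewrite in_itv /= => ct; rewrite sin0 !subr0 => h; exists c.
Qed.

Lemma sin_sq_le (t : R) : sin t ^+ 2 <= t ^+ 2.
Proof.
wlog t0 : t / 0 <= t => [H|].
  by have [/H//|/ltW t0] := leP 0 t; have := H (- t); rewrite sinN !sqrrN oppr_ge0 => /(_ t0).
move: t0; rewrite le_eqVlt => /orP[/eqP <-|t0]; first by rewrite sin0.
by have [c _ ->] := sin_mvt t0; rewrite exprMn ler_piMl ?sqr_ge0.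
Qed.

Lemma sin_sq_ge (t : R) : t ^+ 2 - t ^+ 4 <= sin t ^+ 2.
Proof.
wlog t0 : t / 0 <= t => [H|].
  have [/H//|/ltW t0] := leP 0 t; have := H (- t); rewrite sinN !sqrrN oppr_ge0.
  by rewrite (_ : (- t) ^+ 4 = t ^+ 4); [move/(_ t0)|ring].
move: t0; rewrite le_eqVlt => /orP[/eqP <-|t0]; first by rewrite sin0 !expr0n subrr.
have [c /andP[c0 ct] ->] := sin_mvt t0; rewrite exprMn cos2sin2.
have h1 := sin_sq_le c.
have h2 : c ^+ 2 <= t ^+ 2 by rewrite ler_pXn2r// ?nnegrE ltW.
have h3 : 0 <= t ^+ 2 by exact: sqr_ge0.
rewrite (_ : t ^+ 4 = t ^+ 2 * t ^+ 2); last by ring.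
move: (t ^+ 2) (c ^+ 2) (sin c ^+ 2) h1 h2 h3 => a b e h1 h2 h3.
have := ler_wpM2r h3 (le_trans h1 h2); lra.
Qed.

Lemma onemcos_sin (t : R) : 1 - cos t = 2 * sin (t / 2) ^+ 2.
Proof.
have -> : cos t = cos ((t / 2) *+ 2) by congr cos; rewrite -mulr_natr; field.
by rewrite cos_mulr2n cos2sin2 -mulr_natr; ring.
Qed.

Lemma onemcos_le (t : R) : 1 - cos t <= t ^+ 2 / 2.
Proof. by rewrite onemcos_sin; have := sin_sq_le (t / 2); rewrite expr_div_n; lra. Qed.

Lemma onemcos_ge (t : R) : t ^+ 2 / 2 - t ^+ 4 / 8 <= 1 - cos t.
Proof.
rewrite onemcos_sin; have := sin_sq_ge (t / 2).
have -> : (t / 2) ^+ 2 = t ^+ 2 / 4 by field.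
have -> : (t / 2) ^+ 4 = t ^+ 4 / 16 by field.
lra.
Qed.

Variable d : nat.
Implicit Types k : 'rV[R]_d.

Lemma enorm_ge0 k : 0 <= enorm k. Proof. exact: sqrtr_ge0. Qed.

Lemma enorm_sq k : enorm k ^+ 2 = \sum_i k ord0 i ^+ 2.
Proof.
rewrite /enorm sqr_sqrtr; last by apply: sumr_ge0 => i _; rewrite -expr2 sqr_ge0.
by apply: eq_bigr => i _; rewrite expr2.
Qed.

Lemma sum4_le k : \sum_i k ord0 i ^+ 4 <= enorm k ^+ 4.
Proof.
rewrite (_ : enorm k ^+ 4 = enorm k ^+ 2 * enorm k ^+ 2); last by ring.
rewrite {1}enorm_sq mulr_suml; apply: ler_sum => i _.
rewrite (_ : k ord0 i ^+ 4 = k ord0 i ^+ 2 * k ord0 i ^+ 2); last by ring.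
apply: ler_wpM2l; first exact: sqr_ge0.
by rewrite -[X in X <= _]real_normK ?num_real// ler_pXn2r ?nnegrE ?enorm_ge0 ?coord_enorm.
Qed.

Lemma wh_quad k : enorm k <= 1 -> 0 < wh k /\ `|- ln (wh k) - enorm k ^+ 2 / 4| <= enorm k ^+ 4 / 8.
Proof.
move=> k1; pose u i := (1 - cos (k ord0 i)) / 2.
have ki i : k ord0 i ^+ 2 <= 1.
  have := coord_enorm k i; rewrite -[_ ^+ 2]real_normK ?num_real// => h.
  by rewrite -(expr1n _ 2) ler_pXn2r// ?nnegrE//; exact: le_trans h k1.
have u0 i : 0 <= u i by rewrite divr_ge0 ?onemcos_ge0.
have u1 i : u i <= k ord0 i ^+ 2 / 4 by have := onemcos_le (k ord0 i); rewrite /u; lra.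
have u2 i : k ord0 i ^+ 2 / 4 - k ord0 i ^+ 4 / 16 <= u i by have := onemcos_ge (k ord0 i); rewrite /u; lra.
have u3 i : u i <= 1 / 2 by have := u1 i; have := ki i; lra.
have u4 i : u i ^+ 2 <= k ord0 i ^+ 4 / 16.
  have := u1 i; have k0 : 0 <= k ord0 i ^+ 2 := sqr_ge0 _ => h.
  rewrite (_ : k ord0 i ^+ 4 / 16 = (k ord0 i ^+ 2 / 4) ^+ 2); last by field.
  by rewrite ler_pXn2r ?nnegrE//; lra.
have p0 i : 0 < 1 - u i by have := u3 i; lra.
have w0 : 0 < wh k by apply: prodr_gt0 => i _; exact: p0.
split => //.
have lo : expR (- \sum_i (u i + 2 * u i ^+ 2)) <= wh k.
  rewrite -sumrN expR_sum; apply: ler_prod => i _; rewrite expR_ge0 /=.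
  by rewrite opprD; apply: expR_lower.
have hi : wh k <= expR (- \sum_i u i).
  rewrite -sumrN expR_sum; apply: ler_prod => i _; rewrite (ltW (p0 i)) /=.
  exact: expR_ge1Dx.
have l1 : - \sum_i (u i + 2 * u i ^+ 2) <= ln (wh k).
  by rewrite -[leLHS]expRK ler_ln ?posrE ?expR_gt0.
have l2 : ln (wh k) <= - \sum_i u i.
  by rewrite -[leRHS]expRK ler_ln ?posrE ?expR_gt0.
have s1 : \sum_i u i <= enorm k ^+ 2 / 4.
  by rewrite enorm_sq mulr_suml; apply: ler_sum => i _; exact: u1.
have s4 := sum4_le k.
have s2 : enorm k ^+ 2 / 4 - enorm k ^+ 4 / 16 <= \sum_i u i.
  apply: (le_trans (y := enorm k ^+ 2 / 4 - (\sum_i k ord0 i ^+ 4) / 16)); first lra.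
  rewrite enorm_sq !mulr_suml -sumrB; apply: ler_sum => i _; exact: u2.
have s3 : \sum_i u i ^+ 2 <= enorm k ^+ 4 / 16.
  apply: (le_trans (y := (\sum_i k ord0 i ^+ 4) / 16)); last lra.
  by rewrite mulr_suml; apply: ler_sum => i _; exact: u4.
rewrite big_split /= -mulr_sumr in l1.
have e4 : 0 <= enorm k ^+ 4 by exact: exprn_ge0 (enorm_ge0 k).
rewrite ler_norml; apply/andP; split; lra.
Qed.

Lemma ph_bound k (x : 'rV[int]_d) : `|ph k x| <= d%:R * (enorm k * enorm (ztor R x)).
Proof.
rewrite /ph /dotr; apply: le_trans (ler_norm_sum _ _ _) _.
apply: (le_trans (y := \sum_(i < d) enorm k * enorm (ztor R x))).
  by apply: ler_sum => i _; rewrite normrM; apply: ler_pM => //; exact: coord_enorm.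
by rewrite sumr_const card_ord -[leLHS]mulr_natl.
Qed.

Lemma oc_quad k x : oc k x <= (d%:R * (enorm k * enorm (ztor R x))) ^+ 2 / 2.
Proof.
apply: le_trans (onemcos_le _) _; apply: ler_wpM2r => //.
rewrite -[X in X <= _]real_normK ?num_real// ler_pXn2r ?nnegrE ?ph_bound//.
by rewrite mulr_ge0// mulr_ge0 ?enorm_ge0.
Qed.

Lemma coord_norm k m : `|k ord0 m| <= `|k|.
Proof.
have -> : `|k| = \big[Num.max/0]_ij `|k ij.1 ij.2| := mx_normrE k.
exact: (le_bigmax _ (fun ij : 'I_1 * 'I_d => `|k ij.1 ij.2|) (ord0, m)).
Qed.

Lemma enorm_eq0 k : enorm k = 0 -> k = 0.
Proof.
move=> h; apply/rowP => m; rewrite mxE; apply/eqP; rewrite -normr_le0 -h.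
exact: coord_enorm.
Qed.

Lemma enorm_gt0 : \forall k \near (0 : 'rV[R]_d)^', 0 < enorm k.
Proof.
near=> k; rewrite lt_neqAle enorm_ge0 andbT eq_sym; apply/eqP => /enorm_eq0/eqP; apply/negP.
by near: k; exact: nbhs_dnbhs_neq.
Unshelve. all: by end_near. Qed.

Hypothesis d0 : (0 < d)%N.

Lemma enorm_cvg0 : enorm k @[k --> (0 : 'rV[R]_d)^'] --> (0 : R).
Proof.
have dR : 0 < d%:R :> R by rewrite ltr0n.
apply/cvgrPdist_le => e e0.
have h : 0 < e / d%:R by rewrite divr_gt0.
near=> k.
have hk : `|k| < e / d%:R.
  by near: k; exact: dnbhs0_lt.
rewrite sub0r normrN ger0_norm ?enorm_ge0//.
have -> : e = d%:R * (e / d%:R) by field; rewrite gt_eqF.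
apply: enorm_coord => //; first exact: ltW.
by move=> m; apply: le_trans (ltW hk); exact: coord_norm.
Unshelve. all: by end_near. Qed.

Lemma enorm_lt (e : R) : 0 < e -> \forall k \near (0 : 'rV[R]_d)^', enorm k < e.
Proof.
move=> e0; have /cvgr0_norm_lt /(_ _ e0) := enorm_cvg0.
by apply: filterS => k; apply: le_lt_trans; exact: ler_norm.
Qed.

Let F := (0 : 'rV[R]_d)^'.
Let rho (k : 'rV[R]_d) : R := enorm k.
Let vk (k : 'rV[R]_d) : R := - ln (wh k).
Let qk (k : 'rV[R]_d) : R := vk k / rho k ^+ 2.

Lemma vk_ratio : qk k @[k --> F] --> (1 / 4 : R).
Proof.
apply/cvgrPdist_le => e e0; near=> k.
have k0 : 0 < rho k by near: k; exact: enorm_gt0.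
have k1 : rho k < 1 by near: k; exact: enorm_lt.
have ke : rho k < e by near: k; exact: enorm_lt.
have [w0 h] := wh_quad (ltW k1); rewrite -/(vk k) -/(rho k) in h.
have r2 : 0 < rho k ^+ 2 by exact: exprn_gt0.
have -> : 1 / 4 - qk k = - ((vk k - rho k ^+ 2 / 4) / rho k ^+ 2).
  by rewrite /qk; field; rewrite gt_eqF.
rewrite normrN normrM normfV (gtr0_norm r2) ler_pdivrMr//; apply: le_trans h _.
rewrite (_ : rho k ^+ 4 / 8 = rho k ^+ 2 / 8 * rho k ^+ 2); last by field.
apply: ler_wpM2r; first exact: ltW.
have : rho k ^+ 2 <= rho k by rewrite expr2 ler_piMl// ltW.
lra.
Unshelve. all: by end_near. Qed.

Lemma vk_near (e : R) : 0 < e -> \forall k \near F, 0 < vk k < e.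
Proof.
move=> e0; near=> k.
have k0 : 0 < rho k by near: k; exact: enorm_gt0.
have k1 : rho k < 1 by near: k; exact: enorm_lt.
have ke : rho k < e by near: k; exact: enorm_lt.
have [w0] := wh_quad (ltW k1); rewrite -/(vk k) -/(rho k) ler_norml.
have h2 : rho k ^+ 2 <= rho k by rewrite expr2 ler_piMl// ltW.
have h4 : rho k ^+ 4 <= rho k ^+ 2.
  rewrite (_ : rho k ^+ 4 = rho k ^+ 2 * rho k ^+ 2); last by ring.
  by rewrite ler_piMl ?sqr_ge0//; lra.
have h0 : 0 < rho k ^+ 2 by exact: exprn_gt0.
by move=> /andP[? ?]; apply/andP; split; lra.
Unshelve. all: by end_near. Qed.

Lemma ln_inv_cvg : (ln (1 / rho k))^-1 @[k --> F] --> (0 : R).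
Proof.
apply/cvgrPdist_le => e e0; near=> k.
have k0 : 0 < rho k by near: k; exact: enorm_gt0.
have ke : rho k < expR (- e^-1) by near: k; apply: enorm_lt; exact: expR_gt0.
have h : e^-1 <= ln (1 / rho k).
  rewrite div1r lnV ?posrE// lerNr -[leRHS]expRK ler_ln ?posrE ?expR_gt0//; exact: ltW.
have i0 : 0 < e^-1 by rewrite invr_gt0.
have l0 : 0 < ln (1 / rho k) by exact: lt_le_trans h.
rewrite sub0r normrN gtr0_norm ?invr_gt0// -[leRHS]invrK lef_pV2 ?posrE//.
Unshelve. all: by end_near. Qed.

(** Here v = - ln(wh k) is asymptotic to |k|^2 / 4. For alpha < 2 the power law for [FS] applies.
    For alpha = 2, FS(v) is v ln(1/v) up to O(v), and ln(1/v) is asymptotic to 2 ln(1/|k|); the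
    limit is 2/4. *)
Lemma FS_scale (alpha : R) : 0 < alpha -> alpha <= 2 -> exists2 C : R, 0 < C &
  FS (alpha / 2) (vk k) / v_scale alpha k @[k --> F] --> C.
Proof.
move=> a0 a2; have lnq : ln (qk k) @[k --> F] --> (ln (1 / 4) : R).
  by apply: (cvg_comp _ _ vk_ratio); apply: continuous_ln; lra.
have [ae|ane] := eqVneq alpha 2.
  exists (1 / 2); first lra.
  rewrite ae (_ : 2 / 2 = 1); last by field.
  have l1 : qk k * (2 - ln (qk k) * (ln (1 / rho k))^-1) @[k --> F] --> (1 / 4 * (2 - ln (1 / 4) * 0) : R).
    apply: cvgM; first exact: vk_ratio.
    apply: cvgB; [exact: cvg_cst|apply: cvgM => //; exact: ln_inv_cvg].
  have l2 : 4 * qk k * (ln (1 / rho k))^-1 @[k --> F] --> (4 * (1 / 4) * 0 : R).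
    apply: cvgM; last exact: ln_inv_cvg.
    by apply: cvgM; [exact: cvg_cst|exact: vk_ratio].
  rewrite mulr0 in l2.
  rewrite (_ : 1 / 2 = 1 / 4 * (2 - ln (1 / 4) * 0) + 0 :> R); last by rewrite mulr0; field.
  pose E k := FS 1 (vk k) / v_scale 2 k - qk k * (2 - ln (qk k) * (ln (1 / rho k))^-1).
  rewrite (_ : (fun k => FS 1 (vk k) / v_scale 2 k) =
    (fun k => qk k * (2 - ln (qk k) * (ln (1 / rho k))^-1) + E k)); last first.
    by apply/funext => k; rewrite /E addrC subrK.
  apply: cvgD => //.
  apply/cvgrPdist_le => e e0; near=> k; rewrite sub0r normrN.
  have k0 : 0 < rho k by near: k; exact: enorm_gt0.
  have k1 : rho k < 1 by near: k; exact: enorm_lt.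
  have /andP[v0 v1] : 0 < vk k < 1 / 2 by near: k; apply: vk_near; lra.
  have r2 : 0 < rho k ^+ 2 by exact: exprn_gt0.
  have l0 : 0 < ln (1 / rho k) by rewrite ln_gt0// ltr_pdivlMr// mul1r.
  have q0 : 0 < qk k by rewrite divr_gt0.
  have lnE : ln (vk k)^-1 = 2 * ln (1 / rho k) - ln (qk k).
    rewrite /qk ln_div ?posrE// lnXn// div1r !lnV ?posrE// mulr2n; ring.
  apply: (le_trans (y := 4 * qk k * (ln (1 / rho k))^-1)); last first.
    have : `|0 - 4 * qk k * (ln (1 / rho k))^-1| <= e by near: k; exact: (cvgr_dist_le _ _ l2).
    by rewrite sub0r normrN; apply: le_trans (ler_norm _).
  have -> : E k = (FS 1 (vk k) - vk k * ln (vk k)^-1) / (rho k ^+ 2 * ln (1 / rho k)).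
    rewrite /E lnE /v_scale eqxx -!/(rho k) -/(qk k).
    have vE : vk k = qk k * rho k ^+ 2 by rewrite /qk mulfVK// gt_eqF.
    move: (FS 1 (vk k)) => f; rewrite vE; move: (ln (1 / rho k)) l0 (ln (qk k)) => l l0 lq.
    by field; rewrite !gt_eqF.
  have d1 : 0 < rho k ^+ 2 * ln (1 / rho k) by exact: mulr_gt0.
  rewrite normrM normfV (gtr0_norm d1) ler_pdivrMr//.
  rewrite (_ : 4 * qk k * _ * _ = 4 * vk k); last first.
    by rewrite /qk; move: (ln _) l0 => l l0; field; rewrite !gt_eqF.
  by apply: FS_log => //; exact: ltW.
have ne2 : (alpha == 2) = false by apply/negbTE.
have al2 : alpha < 2 by rewrite lt_neqAle ane.
have th0 : 0 < alpha / 2 by lra.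
have th1 : alpha / 2 < 1 by lra.
have [I I0 hI] := FS_pow th0 th1.
exists (I * expR (alpha / 2 * ln (1 / 4))); first by rewrite mulr_gt0 ?expR_gt0.
have c1 : FS (alpha / 2) (vk k) / vk k `^ (alpha / 2) @[k --> F] --> I.
  apply/cvgrPdist_le => e e0; have [v0 v00 hv] := hI e e0; near=> k.
  have /andP[p0 p1] : 0 < vk k < v0 by near: k; exact: vk_near.
  by rewrite distrC; exact: hv.
have c2 : expR (alpha / 2 * ln (qk k)) @[k --> F] --> (expR (alpha / 2 * ln (1 / 4)) : R).
  apply: (cvg_comp (fun k => alpha / 2 * ln (qk k)) expR); last exact: continuous_expR.
  exact: (cvgM (cvg_cst (alpha / 2)) lnq).
  apply: (cvg_trans _ (cvgM c1 c2)); apply: near_eq_cvg; near=> k.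
have k0 : 0 < rho k by near: k; exact: enorm_gt0.
have /andP[v0 v1] : 0 < vk k < 1 / 2 by near: k; apply: vk_near; lra.
have r2 : 0 < rho k ^+ 2 by exact: exprn_gt0.
have q0 : 0 < qk k by rewrite divr_gt0.
have e1 : expR (alpha / 2 * ln (qk k)) = qk k `^ (alpha / 2) by rewrite /powR gt_eqF.
have e2 : v_scale alpha k = (rho k ^+ 2) `^ (alpha / 2).
  rewrite /v_scale ne2 min_l// -powR_mulrn ?(ltW k0)// -powRrM; congr (_ `^ _).
  by field.
have e3 : vk k = qk k * rho k ^+ 2 by rewrite /qk mulfVK// gt_eqF.
rewrite /= e1 e2; rewrite [in X in _ / X * _ = _]e3 powRM ?(ltW q0) ?(ltW r2)//.
have a1 := powR_gt0 (alpha / 2) q0; have a2' := powR_gt0 (alpha / 2) r2.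
move: (qk k `^ _) ((rho k ^+ 2) `^ _) (FS _ _) a1 a2' => a b c a1 a2'.
by field; rewrite !gt_eqF.
Unshelve. all: by end_near. Qed.

Lemma scale_gt0 (alpha : R) : 0 < alpha -> \forall k \near F, 0 < v_scale alpha k.
Proof.
move=> a0; near=> k.
have k0 : 0 < rho k by near: k; exact: enorm_gt0.
have k1 : rho k < 1 by near: k; exact: enorm_lt.
rewrite /v_scale; case: ifP => _; last exact: powR_gt0.
by rewrite mulr_gt0 ?exprn_gt0// ln_gt0// ltr_pdivlMr// mul1r.
Unshelve. all: by end_near. Qed.

(** For this reason steps of bounded size, which contribute O(|k|^2), do not affect the asymptotics
    when alpha <= 2. *)
Lemma scale_small (alpha : R) : 0 < alpha -> alpha <= 2 ->
  rho k ^+ 2 / v_scale alpha k @[k --> F] --> (0 : R).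
Proof.
move=> a0 a2; rewrite /v_scale; case: eqVneq => [ae|ane].
  have := ln_inv_cvg; apply: cvg_trans; apply: near_eq_cvg; near=> k.
  have k0 : 0 < rho k by near: k; exact: enorm_gt0.
  by rewrite invfM mulrA mulfV ?mul1r// expf_neq0// gt_eqF.
have al2 : alpha < 2 by rewrite lt_neqAle ane.
apply/cvgrPdist_le => e e0; near=> k; rewrite sub0r normrN.
have k0 : 0 < rho k by near: k; exact: enorm_gt0.
have ke : rho k < e `^ (2 - alpha)^-1 by near: k; apply: enorm_lt; exact: powR_gt0.
rewrite min_l// -powR_mulrn ?(ltW k0)// -powRB ?(gt_eqF k0) ?implybT// ger0_norm ?powR_ge0//.
have b0 : 0 < 2 - alpha by lra.
have ee : (e `^ (2 - alpha)^-1) `^ (2 - alpha) = e.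
  by rewrite -powRrM mulVf ?powRr1 ?(ltW e0)// gt_eqF.
rewrite -[leRHS]ee.
by apply: ge0_ler_powR; rewrite ?nnegrE ?powR_ge0 ?(ltW b0) ?(ltW k0)// ltW.
Unshelve. all: by end_near. Qed.
End SmallFrequency.

(** * Second moments of symmetric functions *)

Section SecondMoment.
Variables (R : realType) (d : nat).
Local Notation V := 'rV[int]_d.
Implicit Types (x : V) (k : 'rV[R]_d).

Definition zrefl (i : 'I_d) x : V := \row_l (if l == i then - x ord0 l else x ord0 l).
Definition zrot (i j : 'I_d) x : V :=
  \row_l (if l == i then - x ord0 j else if l == j then x ord0 i else x ord0 l).

Lemma zrefl_bij i : bijective (zrefl i).
Proof.
by exists (zrefl i) => x; apply/rowP => l; rewrite !mxE; case: (l == i); rewrite ?opprK.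
Qed.

Lemma zrot_bij i j : i != j -> bijective (zrot i j).
Proof.
move=> ij; have ji : (j == i) = false by rewrite eq_sym; apply/negbTE.
exists (zrot j i) => x; apply/rowP => l; rewrite !mxE ?eqxx ?ji ?(negbTE ij) ?opprK.
- by case: (eqVneq l j) => [->//|lj]; case: (eqVneq l i) => [->|li].
- by case: (eqVneq l i) => [->//|li]; case: (eqVneq l j) => [->|lj].
Qed.

Lemma enorm_zsq x : enorm (ztor R x) ^+ 2 = \sum_i ((x ord0 i)%:~R : R) ^+ 2.
Proof. by rewrite enorm_sq; apply: eq_bigr => i _; rewrite mxE. Qed.

Variable f : V -> R.
Hypothesis sf : summ f.
Let nx x : R := enorm (ztor R x).
Hypothesis sf2 : summ (fun x => nx x ^+ 2 * f x).
Hypothesis fr : forall i x, f (zrefl i x) = f x.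
Hypothesis ft : forall i j x, i != j -> f (zrot i j x) = f x.
Hypothesis d0 : (0 < d)%N.

Let X i x : R := (x ord0 i)%:~R.

Lemma X_le i x : `|X i x| <= nx x.
Proof. by have := coord_enorm (ztor R x) i; rewrite mxE. Qed.

Lemma summ_XX i j : summ (fun x => X i x * X j x * f x).
Proof.
apply: (summ_le (g := fun x => `|nx x ^+ 2 * f x|)); last by rewrite summ_abs.
move=> x; rewrite !normrM; apply: ler_wpM2r => //.
by apply: ler_pM => //; apply: le_trans (X_le _ _) (ler_norm _).
Qed.

Lemma XX_off i j : i != j -> rsum (fun x => X i x * X j x * f x) = 0.
Proof.
move=> ij; have ji : (j == i) = false by rewrite eq_sym; apply/negbTE.
set s := rsum _; suff : s = - s by lra.
rewrite /s [in LHS](rsum_bij _ (zrefl_bij i)) -rsumN; apply: eq_rsum => x.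
by rewrite fr /X !mxE eqxx ji rmorphN /= !mulNr.
Qed.

Lemma XX_diag i j : rsum (fun x => X i x * X i x * f x) = rsum (fun x => X j x * X j x * f x).
Proof.
have [->//|ij] := eqVneq i j.
rewrite [in LHS](rsum_bij _ (zrot_bij ij)); apply: eq_rsum => x.
by rewrite ft// /X !mxE eqxx rmorphN /= mulrNN.
Qed.

Definition M2 : R := rsum (fun x => nx x ^+ 2 * f x).

Lemma M2_diag i : rsum (fun x => X i x * X i x * f x) = M2 / d%:R.
Proof.
have -> : M2 = \sum_(j < d) rsum (fun x => X j x * X j x * f x).
  rewrite /M2 -rsum_big; last by move=> j _; exact: summ_XX.
  apply: eq_rsum => x; rewrite /nx enorm_zsq mulr_suml; apply: eq_bigr => j _.
  by rewrite expr2.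
have dn : d%:R != 0 :> R by rewrite pnatr_eq0 -lt0n.
under eq_bigr => j _ do rewrite (XX_diag j i).
by rewrite sumr_const card_ord -[X in _ = X / _]mulr_natr mulfK.
Qed.

(** Reflections remove the mixed moments and quarter turns make the diagonal ones equal, so the
    quadratic form is isotropic. *)
Lemma ph_sq_sum k : summ (fun x => ph k x ^+ 2 * f x) /\
  rsum (fun x => ph k x ^+ 2 * f x) = enorm k ^+ 2 * (M2 / d%:R).
Proof.
have e x : ph k x ^+ 2 * f x = \sum_(i < d) \sum_(j < d) k ord0 i * k ord0 j * (X i x * X j x * f x).
  rewrite expr2 /ph /dotr big_distrlr /= mulr_suml; apply: eq_bigr => i _.
  rewrite mulr_suml; apply: eq_bigr => j _; rewrite !mxE /X; ring.
have s i j : summ (fun x => k ord0 i * k ord0 j * (X i x * X j x * f x)) by apply: summZ; exact: summ_XX.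
have s' i : summ (fun x => \sum_(j < d) k ord0 i * k ord0 j * (X i x * X j x * f x)).
  by apply: summ_big => j _; exact: s.
split; first by rewrite (eq_summ e); apply: summ_big => i _; exact: s'.
rewrite (eq_rsum e) rsum_big; last by move=> i _; exact: s'.
rewrite enorm_sq mulr_suml; apply: eq_bigr => i _.
rewrite rsum_big; last by move=> j _; exact: s.
rewrite (bigD1 i)//= big1 ?addr0; first by rewrite rsumZ M2_diag expr2.
by move=> j ji; rewrite rsumZ XX_off ?mulr0// eq_sym.
Qed.

(** In dimension 0 the punctured neighbourhoods would be empty; multiples of a constant vector are
    the witnesses otherwise. *)
Lemma dnbhs_proper : ProperFilter (0 : 'rV[R]_d)^'.
Proof.
apply: Build_ProperFilter_ex => P /nbhs_normP[e /= e0 he].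
pose u : 'rV[R]_d := const_mx 1.
have u0 : u != 0.
  apply/eqP => /rowP /(_ (Ordinal d0)); rewrite !mxE => /eqP; apply/negP; exact: oner_neq0.
have n0 : 0 < `|u| by rewrite normr_gt0.
have c0 : 0 < e / 2 / `|u| by rewrite !divr_gt0.
exists ((e / 2 / `|u|) *: u); apply: he; last by rewrite scaler_eq0 negb_or u0 gt_eqF.
rewrite /= sub0r normrN normrZ (gtr0_norm c0) mulfVK ?gt_eqF//; lra.
Qed.

(** Dominated convergence for f times (oc - (k.x)^2 / 2) / |k|^2: it is bounded by d^2 |x|^2 |f| / 2
    and tends to 0 for each x. The quadratic part is evaluated by [ph_sq_sum]. *)
Lemma oc_moment : rsum (fun x => f x * oc k x) / enorm k ^+ 2 @[k --> (0 : 'rV[R]_d)^'] --> M2 / (2 * d%:R).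
Proof.
have dR : 0 < d%:R :> R by rewrite ltr0n.
have PF := dnbhs_proper.
pose r k x := f x * ((oc k x - ph k x ^+ 2 / 2) / enorm k ^+ 2).
have ocu k x : 0 <= ph k x ^+ 2 / 2 - oc k x <= ph k x ^+ 4 / 8.
  by have := onemcos_le (ph k x); have := onemcos_ge (ph k x); rewrite -/(oc k x) => *; apply/andP; split; lra.
have phb k x : ph k x ^+ 2 <= (d%:R * (enorm k * nx x)) ^+ 2.
  rewrite -[X in X <= _]real_normK ?num_real// ler_pXn2r ?nnegrE ?ph_bound//.
  by rewrite mulr_ge0// mulr_ge0 ?enorm_ge0.
have lim0 : (fun k => rsum (r k)) @ (0 : 'rV[R]_d)^' --> rsum (fun _ : V => 0 : R).
  apply: (rsum_cvg (g := fun x => d%:R ^+ 2 / 2 * `|nx x ^+ 2 * f x|)).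
  - by apply: summZ; rewrite summ_abs.
  - near=> k => x.
    have k0 : 0 < enorm k by near: k; exact: enorm_gt0.
    have k2 : 0 < enorm k ^+ 2 by exact: exprn_gt0.
    rewrite /r normrM [`|nx x ^+ 2 * _|]normrM mulrA [leRHS]mulrC; apply: ler_wpM2l => //.
    rewrite normrM normfV (gtr0_norm k2) ler_pdivrMr// (ger0_norm (sqr_ge0 _)).
    have /andP[h1 _] := ocu k x; have h2 := oc_ge0 k x; have h3 := phb k x.
    rewrite -normrN opprB ger0_norm//.
    apply: (le_trans (y := ph k x ^+ 2 / 2)); first by rewrite gerBl.
    rewrite (_ : _ * _ * enorm k ^+ 2 = (d%:R * (enorm k * nx x)) ^+ 2 / 2); last by ring.
    lra.
  - move=> x; apply/cvgrPdist_le => e e0.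
    pose K := `|f x| * ((d%:R * nx x) ^+ 4 / 8) + 1.
    have K1 : 0 <= (d%:R * nx x) ^+ 4 by rewrite exprn_ge0// mulr_ge0// enorm_ge0.
    have K0 : 0 < K by rewrite ltr_wpDl// mulr_ge0// divr_ge0.
    have eK : 0 < e / K by exact: divr_gt0.
    near=> k; rewrite sub0r normrN.
    have k0 : 0 < enorm k by near: k; exact: enorm_gt0.
    have k1 : enorm k < 1 by near: k; exact: enorm_lt.
    have k2 : 0 < enorm k ^+ 2 by exact: exprn_gt0.
    have ke : enorm k < e / K by near: k; exact: enorm_lt.
    apply: (le_trans (y := enorm k * K)); last by rewrite -ler_pdivlMr//; exact: ltW.
    rewrite /r normrM; apply: (le_trans (y := `|f x| * (enorm k * ((d%:R * nx x) ^+ 4 / 8)))).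
      apply: ler_wpM2l => //; rewrite normrM normfV (gtr0_norm k2) ler_pdivrMr//.
      have /andP[h1 h2] := ocu k x; rewrite -normrN opprB ger0_norm//; apply: le_trans h2 _.
      have h3 := phb k x; have h4 : 0 <= ph k x ^+ 2 := sqr_ge0 _.
      have h5 : ph k x ^+ 4 <= (d%:R * nx x) ^+ 4 * enorm k ^+ 4.
        rewrite (_ : ph k x ^+ 4 = ph k x ^+ 2 * ph k x ^+ 2); last by ring.
        rewrite (_ : _ * _ ^+ 4 = (d%:R * (enorm k * nx x)) ^+ 2 * (d%:R * (enorm k * nx x)) ^+ 2); last by ring.
        exact: ler_pM.
      apply: (le_trans (y := (d%:R * nx x) ^+ 4 * enorm k ^+ 4 / 8)); first lra.
      rewrite (_ : _ * _ * enorm k ^+ 2 = (d%:R * nx x) ^+ 4 * (enorm k * enorm k ^+ 2) / 8); last by ring.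
      apply: ler_wpM2r => //; apply: ler_wpM2l => //.
      rewrite (_ : enorm k ^+ 4 = enorm k * (enorm k * enorm k ^+ 2)); last by ring.
      by rewrite ler_piMl ?mulr_ge0 ?(ltW k0) ?(ltW k2)// ltW.
    rewrite mulrCA; apply: ler_wpM2l; first exact: ltW.
    by rewrite /K lerDl.
rewrite rsum0 in lim0.
rewrite -[M2 / _]add0r; apply: (cvg_trans _ (cvgD lim0 (cvg_cst (M2 / (2 * d%:R))))).
apply: near_eq_cvg; near=> k.
have k0 : 0 < enorm k by near: k; exact: enorm_gt0.
have k2 : 0 < enorm k ^+ 2 by exact: exprn_gt0.
have [s1 e1] := ph_sq_sum k.
have s2 := summ_oc k sf.
change (rsum (r k) + M2 / (2 * d%:R) = rsum (fun x => f x * oc k x) / enorm k ^+ 2).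
rewrite (eq_rsum (f := r k) (g := fun x => (enorm k ^+ 2)^-1 * (f x * oc k x - (1 / 2) * (ph k x ^+ 2 * f x)))); last first.
  by move=> x; rewrite /r; field; rewrite gt_eqF.
rewrite rsumZ rsumB//; last exact: summZ.
by rewrite (rsumZ (1 / 2)) e1; field; rewrite !gt_eqF.
Unshelve. all: by end_near. Qed.
End SecondMoment.

(** * Comparison of the step distribution with the mixture *)

Section StepAsymptotics.
Variables (R : realType) (d : nat) (alpha : R) (Dr : 'rV[int]_d -> R) (c : R).
Local Notation V := 'rV[int]_d.
Implicit Types (x : V) (k : 'rV[R]_d).
Hypotheses (d0 : (0 < d)%N) (al0 : 0 < alpha) (c0 : 0 < c).
Hypotheses (Dr0 : forall x, 0 <= Dr x) (sD : summ Dr) (D1 : rsum Dr = 1).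
Let nx x : R := enorm (ztor R x).
Hypothesis tail : forall e : R, 0 < e -> exists M : R, forall x, M < nx x ->
  `|nx x `^ (d%:R + alpha) * Dr x - c| <= e.
Let F := (0 : 'rV[R]_d)^'.

Lemma sk_rsum k : sk Dr k = rsum (fun x => Dr x * oc k x).
Proof. exact: skE. Qed.

(** With kap the quotient of the tail constants, |D - kap W| <= del W outside a ball, which costs a
    multiple of del on the scale considered; inside the ball the contribution is O(|k|^2) and
    negligible by [scale_small]. *)
Lemma sk_scale_le2 : alpha <= 2 -> exists2 v : R, 0 < v & sk Dr k / v_scale alpha k @[k --> F] --> v.
Proof.
move=> a2; pose th := alpha / 2; have th0 : 0 < th by rewrite /th; move: al0; lra.
have [C C0 hC] := Wr_tail d0 th0.
have [C' C'0 hF] := FS_scale d0 al0 a2.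
pose kap := c / C; have kap0 : 0 < kap by exact: divr_gt0.
pose W : V -> R := Wr th.
have W0 x : 0 <= W x by exact: Wr_ge0.
have sW : summ W by exact: summ_Wr.
have cmp del : 0 < del -> exists2 M : R, 0 <= M & forall x, M < nx x -> `|Dr x - kap * W x| <= del * W x.
  move=> del0; have [M1 h1] := tail (e := del * C / 4) ltac:(by rewrite divr_gt0// mulr_gt0).
  have [M2 h2] := hC (Num.min (C / 2) (del * C / (4 * kap))) ltac:(by rewrite lt_min !divr_gt0// mulr_gt0).
  exists (Num.max 0 (Num.max M1 M2)); first by rewrite le_max lexx.
  move=> x; rewrite !gt_max => /and3P[x0 x1 x2].
  have P0 : 0 < nx x `^ (d%:R + alpha) by exact: powR_gt0.
  have := h1 x x1; have := h2 x x2.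
  rewrite (_ : d%:R + 2 * th = d%:R + alpha); last by rewrite /th; field.
  rewrite -/(nx x) -/(W x); move: (nx x `^ _) (Dr x) (W x) (W0 x) P0 => P Dx w w0 P0.
  rewrite le_min => /andP[k1 k2] k3.
  rewrite -(ler_pM2l P0) -[X in X * `|_|](gtr0_norm P0) -normrM.
  have -> : P * (Dx - kap * w) = (P * Dx - c) - kap * (P * w - C).
    by rewrite /kap; field; rewrite gt_eqF.
  apply: le_trans (ler_normB _ _) _; rewrite normrM (gtr0_norm kap0).
  have k4 := ler_wpM2l (ltW kap0) k2.
  rewrite (_ : kap * (del * C / (4 * kap)) = del * C / 4) in k4; last by field; rewrite gt_eqF.
  apply: le_trans (lerD k3 k4) _; rewrite mulrCA.
  have k5 : C / 2 <= P * w by move: k1; rewrite ler_norml => /andP[]; lra.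
  by have := ler_wpM2l (ltW del0) k5; lra.
exists (kap * C'); first exact: mulr_gt0.
suff lim : (sk Dr k / v_scale alpha k - kap * (FS th (- ln (wh k)) / v_scale alpha k)) @[k --> F] --> (0 : R).
  rewrite -[kap * C']add0r; apply: (cvg_trans _ (cvgD lim (cvgM (cvg_cst kap) hF))).
  by apply: near_eq_cvg; near=> k; rewrite /= subrK.
apply/cvgrPdist_le => e e0.
pose del := e / (2 * (C' + 1)); have C'1 : 0 < C' + 1 by lra.
have del0 : 0 < del by rewrite divr_gt0// mulr_gt0.
have [M M0 hM] := cmp del del0.
pose g x := Dr x + kap * W x; have sg : summ g by apply: summD => //; exact: summZ.
have g0 x : 0 <= g x by rewrite addr_ge0// mulr_ge0// ltW.
pose K := (d%:R * M) ^+ 2 / 2 * rsum g + 1.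
have K0 : 0 < K by rewrite ltr_wpDl// mulr_ge0 ?divr_ge0 ?sqr_ge0// rsum_ge0.
have ek : 0 < e / (2 * K) by rewrite divr_gt0// mulr_gt0.
near=> k; rewrite sub0r normrN.
have k0 : 0 < enorm k by near: k; exact: enorm_gt0.
have k1 : enorm k < 1 by near: k; exact: enorm_lt.
have v0 : 0 < v_scale alpha k by near: k; exact: scale_gt0.
have [w0 _] := wh_quad (ltW k1).
have f1 : FS th (- ln (wh k)) / v_scale alpha k <= C' + 1.
  have : `|C' - FS th (- ln (wh k)) / v_scale alpha k| <= 1.
    by near: k; exact: (cvgr_dist_le _ _ hF).
  by rewrite ler_norml => /andP[h _]; lra.
have f2 : enorm k ^+ 2 / v_scale alpha k <= e / (2 * K).
  have : `|0 - enorm k ^+ 2 / v_scale alpha k| <= e / (2 * K).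
    by near: k; exact: (cvgr_dist_le _ _ (scale_small d0 al0 a2)).
  by rewrite sub0r normrN; apply: le_trans (ler_norm _).
rewrite -(Wr_oc th0 w0) sk_rsum -/W.
have -> : rsum (fun x => Dr x * oc k x) / v_scale alpha k - kap * (rsum (fun x => W x * oc k x) / v_scale alpha k)
   = rsum (fun x => (Dr x - kap * W x) * oc k x) / v_scale alpha k.
  rewrite mulrA -mulrBl -rsumZ -rsumB; [|exact: summ_oc|apply: summZ; exact: summ_oc].
  by congr (_ / _); apply: eq_rsum => x; ring.
rewrite normrM normfV (gtr0_norm v0) ler_pdivrMr//.
pose b x := del * (W x * oc k x) + (d%:R * M) ^+ 2 / 2 * enorm k ^+ 2 * g x.
have sb : summ b by apply: summD; apply: summZ => //; exact: summ_oc.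
apply: le_trans (ler_rsum_sup (g := b) _ sb) _.
  move=> x; rewrite normrM (ger0_norm (oc_ge0 _ _)) /b.
  have o0 := oc_ge0 k x.
  have t1 : 0 <= del * (W x * oc k x) by rewrite mulr_ge0 ?(ltW del0)// mulr_ge0.
  have t2 : 0 <= (d%:R * M) ^+ 2 / 2 * enorm k ^+ 2 * g x.
    by apply: mulr_ge0 => //; apply: mulr_ge0; [apply: divr_ge0 => //; exact: sqr_ge0|exact: sqr_ge0].
  have [xM|Mx] := leP (nx x) M; last first.
    by apply: ler_wpDr => //; rewrite mulrA; apply: ler_wpM2r => //; exact: hM.
  apply: ler_wpDl => //; rewrite mulrC; apply: ler_pM => //.
    apply: le_trans (oc_quad k x) _.
    rewrite (_ : _ * enorm k ^+ 2 = (d%:R * (enorm k * M)) ^+ 2 / 2); last by ring.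
    apply: ler_wpM2r => //; rewrite ler_pXn2r// ?nnegrE ?mulr_ge0 ?(ltW k0)// ?enorm_ge0//.
    by apply: ler_wpM2l => //; apply: ler_wpM2l => //; exact: ltW.
  apply: le_trans (ler_normB _ _) _; rewrite ger0_norm// ger0_norm// mulr_ge0// ltW//.
rewrite rsumD; [|apply: summZ; exact: summ_oc|exact: summZ].
rewrite (rsumZ del) (rsumZ _ g) -(Wr_oc th0 w0) -/W in f1 *.
have f3 : del * rsum (fun x => W x * oc k x) <= e / 2 * v_scale alpha k.
  rewrite ler_pdivrMr// in f1.
  apply: le_trans (ler_wpM2l (ltW del0) f1) _.
  by apply/eq_ler; rewrite /del; field; rewrite gt_eqF.
have f4 : (d%:R * M) ^+ 2 / 2 * enorm k ^+ 2 * rsum g <= e / 2 * v_scale alpha k.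
  apply: (le_trans (y := K * enorm k ^+ 2)).
    rewrite [leLHS]mulrAC; apply: ler_wpM2r; first exact: sqr_ge0.
    by rewrite /K lerDl.
  rewrite ler_pdivrMr// in f2; apply: le_trans (ler_wpM2l (ltW K0) f2) _.
  by apply/eq_ler; field; rewrite gt_eqF.
lra.
Unshelve. all: by end_near. Qed.

(** Outside a ball |x|^2 D(x) is at most a multiple of the mixture with th = (alpha - 2) / 2, which
    is summable by construction. *)
Lemma summ_M2 : 2 < alpha -> summ (fun x => nx x ^+ 2 * Dr x).
Proof.
move=> a2; pose th := (alpha - 2) / 2; have th0 : 0 < th by rewrite /th; lra.
have [C C0 hC] := Wr_tail d0 th0.
have [M1 h1] := tail ltr01.
have [M2 h2] := hC (C / 2) ltac:(lra).
pose M := Num.max 0 (Num.max M1 M2); have M0 : 0 <= M by rewrite le_max lexx.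
apply: (summ_le (g := fun x => M ^+ 2 * Dr x + (c + 1) * (2 / C) * Wr th x)).
  move=> x; have -> : `|nx x ^+ 2 * Dr x| = nx x ^+ 2 * Dr x.
    by rewrite ger0_norm//; apply: mulr_ge0 => //; exact: sqr_ge0.
  have w0 : 0 <= Wr th x by exact: Wr_ge0.
  have t2 : 0 <= (c + 1) * (2 / C) * Wr th x by rewrite !mulr_ge0 ?invr_ge0 ?(ltW C0)//; move: c0; lra.
  have [xM|] := leP (nx x) M.
    apply: ler_wpDr => //; apply: ler_wpM2r => //.
    by apply: lerXn2r => //; rewrite nnegrE; exact: enorm_ge0.
  rewrite !gt_max => /and3P[x0 x1 x2].
  apply: ler_wpDl; first by rewrite mulr_ge0 ?sqr_ge0.
  have := h1 x x1; have := h2 x x2; rewrite -/(nx x).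
  have e1 : nx x `^ (d%:R + alpha) = nx x ^+ 2 * nx x `^ (d%:R + 2 * th).
    rewrite -(powR_mulrn 2 (ltW x0)) -powRD ?(gt_eqF x0) ?implybT//; congr (_ `^ _).
    by rewrite /th; field.
  have P0 : 0 < nx x `^ (d%:R + 2 * th) by exact: powR_gt0.
  rewrite e1; move: (nx x `^ _) P0 (Wr _ _) w0 {t2 h1 h2} => P P0 w w0.
  rewrite !ler_norml => /andP[k1 _] /andP[_ k2].
  have k3 : C / 2 <= P * w by lra.
  rewrite -(ler_pM2l P0) mulrA [P * nx x ^+ 2]mulrC; apply: (le_trans (y := c + 1)); first lra.
  rewrite (_ : P * _ = (c + 1) * (2 / C) * (P * w)); last by ring.
  have q0 : 0 <= (c + 1) * (2 / C) by rewrite mulr_ge0 ?divr_ge0 ?(ltW C0)//; move: c0; lra.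
  apply: le_trans _ (ler_wpM2l q0 k3); apply/eq_ler; field; rewrite gt_eqF//.
by apply: summD; apply: summZ => //; exact: summ_Wr.
Qed.

Hypotheses (D00 : Dr 0 = 0) (Drefl : forall i x, Dr (zrefl i x) = Dr x).
Hypothesis Drot : forall i j x, i != j -> Dr (zrot i j x) = Dr x.

Lemma sk_scale_gt2 : 2 < alpha -> 0 < M2 Dr /\ sk Dr k / v_scale alpha k @[k --> F] --> M2 Dr / (2 * d%:R).
Proof.
move=> a2; have s2 := summ_M2 a2; split.
  apply: lt_le_trans ltr01 _; rewrite -D1; apply: le_rsum => // x.
  have [->|x0] := eqVneq x 0; first by rewrite D00 mulr0.
  rewrite -[leLHS]mul1r; apply: ler_wpM2r => //; rewrite enorm_zsq.
  have [i hi] : exists i, x ord0 i != 0.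
    by apply/existsP; apply: contraR x0; rewrite negb_exists => /forallP h; apply/eqP/rowP => i; rewrite mxE; apply/eqP; have := h i; rewrite negbK.
  rewrite (bigD1 i)//= ler_wpDr//; first by apply: sumr_ge0 => j _; exact: sqr_ge0.
  have : 1 <= `|(x ord0 i)%:~R : R| by rewrite -intr_norm ler1z -gtz0_ge1 normr_gt0.
  by move=> h; rewrite -real_normK ?num_real// -[leLHS](expr1n _ 2) ler_pXn2r// nnegrE.
have := oc_moment sD s2 Drefl Drot d0; apply: cvg_trans; apply: near_eq_cvg; near=> k.
have k0 : 0 < enorm k by near: k; exact: enorm_gt0.
rewrite /= sk_rsum /v_scale (gt_eqF a2) min_r ?(ltW a2)// powR_mulrn// ltW//.
Unshelve. all: by end_near. Qed.

Lemma sk_scale : exists2 v : R, 0 < v & sk Dr k / v_scale alpha k @[k --> F] --> v.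
Proof.
have [h|h] := leP alpha 2; first exact: sk_scale_le2.
have [m0 hm] := sk_scale_gt2 h; exists (M2 Dr / (2 * d%:R)) => //.
by rewrite divr_gt0// mulr_gt0// ltr0n.
Qed.
End StepAsymptotics.

(** * Self-avoiding walk at the critical point *)

Section WalkSums.
Variables (R : realType) (V : zmodType) (D : V -> enn R).
Local Notation E := (enn R).
Implicit Types (s T : seq V) (u x y : V).

Fixpoint wl T u s : E :=
  if s is y :: s' then D (y - u) * (y \notin u :: T)%:R * wl (u :: T) y s' else 1.

Lemma wlE T u s : wl T u s =
  (\prod_(i < size s) D (nth 0 (u :: s) i.+1 - nth 0 (u :: s) i)) * (all (fun v => v \notin T) s && uniq (u :: s))%:R.
Proof.
elim: s T u => [|y s IH] T u; first by rewrite /= big_ord0 mulr1.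
rewrite [LHS]/= IH [size _]/= big_ord_recl /= -!mulrA; congr (_ * _).
rewrite mulrCA; congr (_ * _); rewrite -natrM mulnb; congr (nat_of_bool _)%:R.
have -> : all (fun v => v \notin u :: T) s = (u \notin s) && all (fun v => v \notin T) s.
  elim: s {IH} => //= v s IH; rewrite {}IH !inE !negb_or [v == u]eq_sym.
  by case: (u != v); case: (v \notin T); case: (u \notin s).
rewrite /= !inE !negb_or [y == u]eq_sym.
by case: (u == y); case: (y \in T); case: (u \in s); case: (all _ s); case: (y \in s); case: (uniq s).
Qed.

Lemma tsum_tupleS n (f : seq V -> E) :
  tsum (fun t : n.+1.-tuple V => f t) = tsum (fun y => tsum (fun t : n.-tuple V => f (y :: t))).
Proof.
rewrite (tsum_bij (e := fun p : V * n.-tuple V => [tuple of p.1 :: p.2])); last first.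
  exists (fun t : n.+1.-tuple V => (thead t, [tuple of behead t])).
    by move=> [y t]; rewrite theadE; congr pair; apply: val_inj.
  by move=> t; apply: val_inj; rewrite [in RHS](tuple_eta t).
by rewrite -(tsum_pair (fun y (t : n.-tuple V) => f (y :: t))).
Qed.

Lemma Fw_walks n T u x : Fw D n T u x = tsum (fun t : n.-tuple V => wl T u t * (last u t == x)%:R).
Proof.
elim: n T u => [|n IH] T u.
  rewrite /= (tsum_bij (e := fun _ : unit => [tuple] : 0.-tuple V)); last first.
    by exists (fun=> tt) => [[]|t] //; apply: val_inj; case: t => -[].
  by rewrite tsum_finType big_const cardE /= enumT unlock /= addr0 mul1r.
rewrite /= (tsum_tupleS n (fun s => wl T u s * (last u s == x)%:R)); apply: eq_tsum => y.
by rewrite IH -tsumZl; apply: eq_tsum => t; rewrite /= mulrA.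
Qed.

Lemma tsum_ffun n (f : {ffun 'I_n -> V} -> E) :
  tsum f = tsum (fun t : n.-tuple V => f [ffun i => tnth t i]).
Proof.
apply: tsum_bij; exists (fun w : {ffun 'I_n -> V} => [tuple w i | i < n]).
  by move=> t; apply: eq_from_tnth => i; rewrite tnth_mktuple ffunE.
by move=> w; apply/ffunP => i; rewrite ffunE tnth_mktuple.
Qed.

(** Passage from the recursive walk sums to sums over functions on {0, ..., n}, the form in which
    [saw] is defined. *)
Lemma cw_ffun n x : cw D n x = tsum (fun w : {ffun 'I_n.+1 -> V} =>
  ((w ord0 == 0) && (w ord_max == x))%:R *
  ((\prod_(1 <= i < n.+1) D (w (inord i) - w (inord i.-1))) * (injectiveb w)%:R)).
Proof.
rewrite tsum_ffun.
pose f (s : seq V) : E := ((nth 0 s 0 == 0) && (nth 0 s n == x))%:R *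
  ((\prod_(i < n) D (nth 0 s i.+1 - nth 0 s i)) * (uniq s)%:R).
rewrite (eq_tsum (g := fun t : n.+1.-tuple V => f t)); last first.
  move=> t; rewrite !ffunE !(tnth_nth 0) /= /f.
  congr (_ * (_ * _)).
    have h j : (j < n.+1)%N -> [ffun i0 => tnth t i0] (inord j) = nth 0 t j.
      by move=> jn; rewrite ffunE (tnth_nth 0) inordK.
    rewrite big_add1 /= big_mkord; apply: eq_bigr => i _.
    have hi : (i < n)%N := ltn_ord i.
    by rewrite (h i.+1 hi) (h i (ltnW hi)).
  congr (nat_of_bool _)%:R; rewrite /injectiveb /dinjectiveb.
  by rewrite -[in RHS](map_tnth_enum t); congr uniq; apply: eq_map => i; rewrite ffunE.
rewrite tsum_tupleS /cw Fw_walks.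
rewrite (eq_tsum (g := fun y => (y == 0)%:R * tsum (fun t : n.-tuple V => wl [::] y t * (last y t == x)%:R))); last first.
  move=> y; rewrite -tsumZl; apply: eq_tsum => t; rewrite /f wlE /= size_tuple.
  rewrite (_ : all _ t = true); last by apply/allP.
  rewrite -[n in nth 0 (y :: t) n](size_tuple t) nth_last.
  by case: (y == 0); rewrite ?mul0r//= !mul1r mulrC.
by rewrite tsum_delta.
Qed.
End WalkSums.

(** * Identification with the walk and the coefficients of the statement *)

Section FrozenWalks.
Variables (R : realType) (d : nat).
Local Notation V := 'rV[int]_d.
Variable Dr : V -> R.
Hypotheses (Dr0 : forall x, 0 <= Dr x) (sD : summ Dr) (D1 : rsum Dr = 1) (D00 : Dr 0 = 0).

Lemma ofR_prod (I : Type) (s : seq I) (P : pred I) (f : I -> R) : (forall i, 0 <= f i) ->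
  ofR (\prod_(i <- s | P i) f i) = \prod_(i <- s | P i) ofR (f i).
Proof.
move=> f0; suff [] : ofR (\prod_(i <- s | P i) f i) = \prod_(i <- s | P i) ofR (f i) /\ 0 <= \prod_(i <- s | P i) f i by [].
split; last exact: prodr_ge0.
elim: s => [|a s IH]; first by rewrite !big_nil ofR1.
by rewrite !big_cons; case: ifP => // _; rewrite ofRM ?IH// prodr_ge0.
Qed.

Lemma saw_cr n x : saw Dr n x = cr Dr n x.
Proof.
case: n => [|n]; first by rewrite /saw /cr /cw /= eq_sym -(ofR_nat R) ofRK.
rewrite /saw usum_cond /cr cw_ffun rsum_ge0E; last first.
  by move=> w; case: ifP => // _; rewrite mulr_ge0// prodr_ge0.
congr toR; apply: eq_tsum => w.
have -> : (w \in @walks d n.+1 x) = (w ord0 == 0) && (w ord_max == x).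
  apply/idP/idP; rewrite inE /walks /=; first by case=> -> ->; rewrite !eqxx.
  by case/andP => /eqP -> /eqP ->.
case: ifP => _; last by rewrite ofR0 mul0r.
rewrite mul1r ofRM ?prodr_ge0// ofR_prod// ofR_nat//.
Qed.

Lemma saw_total_Cn n : saw_total Dr n = toR (Cn Dr n).
Proof.
rewrite /saw_total (_ : saw Dr n = cr Dr n); last by apply/funext => x; exact: saw_cr.
change (rsum (cr Dr n) = toR (Cn Dr n)).
by rewrite rsum_toR//; exact: Cn_fin.
Qed.

(* The recursion can be solved for pi_(n+1) because c_0 is a unit mass. *)
Lemma lace_unique (pi_ : nat -> V -> R) : lace_recursion Dr pi_ ->
  forall m, (2 <= m)%N -> pi_ m =1 pir Dr m.
Proof.
move=> hl; elim/ltn_ind => m IH m2 x.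
case: m m2 IH => [//|n] n1 IH.
have z0 (f : V -> R) : zconv f (cr Dr 0) x = f x.
  rewrite /zconv -[RHS](rsum_delta x f); apply: eq_rsum => y.
  by rewrite /cr /cw /= eq_sym subr_eq0 eq_sym -(ofR_nat R) ofRK// mulrC.
have := hl n x; rewrite saw_cr (lace_real Dr0 sD D1 D00).
have -> : saw Dr n = cr Dr n by apply/funext => y; exact: saw_cr.
move/addrI; rewrite !(@big_nat_recr _ _ _ n.+1 2)//= subnn.
have -> : saw Dr 0 = cr Dr 0 by apply/funext => y; exact: saw_cr.
rewrite !z0 => h.
have e : \sum_(2 <= i < n.+1) zconv (pi_ i) (saw Dr (n.+1 - i)) x = \sum_(2 <= i < n.+1) zconv (pir Dr i) (cr Dr (n.+1 - i)) x.
  apply: eq_big_nat => i /andP[i2 iN].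
  have -> : saw Dr (n.+1 - i) = cr Dr (n.+1 - i) by apply/funext => y; exact: saw_cr.
  by have -> : pi_ i = pir Dr i by apply/funext => y; exact: IH.
by move: h; rewrite e => /addrI.
Qed.
End FrozenWalks.

(** * The radius of convergence *)

Section CriticalPoint.
Variables (R : realType) (d : nat).
Local Notation V := 'rV[int]_d.
Variable Dr : V -> R.
Hypotheses (Dr0 : forall x, 0 <= Dr x) (sD : summ Dr) (D1 : rsum Dr = 1) (D00 : Dr 0 = 0).
Hypothesis Dsym : forall x, Dr (- x) = Dr x.
Variables (b beta W : R).
Hypotheses (b0 : 0 < b) (bs : 100 * b <= 1) (bb : b ^+ 2 = 2048 * beta).
Hypotheses (WE : W = 16 * 285) (bW : 16 * b * W <= 1 / 100).
Hypothesis Hrw : forall e : R, 0 < e -> exists M : V -> R,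
  [/\ summ M, (forall l, Dh Dr l ^+ 2 / (e + sk Dr l) ^+ 2 <= ct M l) & M 0 <= beta].

Lemma pseries_chi (r : R) : 0 <= r -> cvgn (pseries (saw_total Dr) r) <-> efin (chi Dr r).
Proof.
move=> r0; have t0 n : 0 <= saw_total Dr n * r ^+ n.
  by rewrite saw_total_Cn// mulr_ge0 ?toR_ge0 ?exprn_ge0.
have pE n : pseries (saw_total Dr) r n = \sum_(i < n) saw_total Dr i * r ^+ i.
  by rewrite /pseries /series /= big_mkord.
have cE n : ofR (saw_total Dr n * r ^+ n) = ofR r ^+ n * Cn Dr n.
  by rewrite saw_total_Cn// mulrC ofRM ?exprn_ge0 ?toR_ge0// ofRX// toRK// Cn_fin.
have mono : {homo pseries (saw_total Dr) r : n m / (n <= m)%N >-> n <= m}.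
  move=> n m nm; rewrite !pE -(subnKC nm) big_split_ord /= lerDl.
  by apply: sumr_ge0 => i _; exact: t0.
have pS n : ofR (pseries (saw_total Dr) r n) = \sum_(i < n) ofR r ^+ i * Cn Dr i.
  by rewrite pE ofR_sum//; apply: eq_bigr => i _; exact: cE.
split => [cv|fc].
  apply: (@efin_ofR_le _ _ (limn (pseries (saw_total Dr) r))).
  apply: tsum_nat_ub => n; rewrite -pS; apply: ele_ofR; exact: nondecreasing_cvgn_le.
apply: nondecreasing_is_cvgn mono _; exists (toR (chi Dr r)) => _ [n _ <-].
apply: ofR_le; first exact: toR_ge0.
rewrite pS toRK//; exact: tsum_nat_ge.
Qed.

(** If chi were finite beyond 2, the bootstrap would reach z = 2 and [z_lt2] would give 2 < 2. *)
Lemma chi_radius_le2 (s : R) : 0 <= s -> efin (chi Dr s) -> s <= 2.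
Proof.
move=> s0 fs; rewrite leNgt; apply/negP => s2.
pose z1 : R := 2; pose r := (2 + s) / 2.
have zr : z1 < r by rewrite /z1 /r; lra.
have rs : r < s by rewrite /r; lra.
have z10 : 0 <= z1 by [].
have st := bootstrap Dr0 sD D1 D00 Dsym b0 bs bb WE bW Hrw z10 zr rs fs.
have [hb _] := strong_weak WE st.
have fz : efin (chi Dr z1) by apply: efin_le fs; apply: chi_mono => //; exact: ltW (lt_trans zr rs).
by have := z_lt2 Dr0 sD D1 D00 Dsym z10 (ltW b0) bs hb fz; rewrite ltxx.
Qed.

Let cv0 : cvgn (pseries (saw_total Dr) 0).
Proof.
have h0 : (0 : R) <= 0 by [].
apply/(pseries_chi h0); exact: (chi_sub1 Dr0 sD D1 h0 ltr01).
Qed.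

Let S := [set r%:E | r in [set r : R | 0 <= r /\ cvgn (pseries (saw_total Dr) r)]].

(** [z_crit] is defined through [fine], which sends an infinite radius to 0; finiteness has to be
    known before it can be compared with other radii. *)
Lemma conv_radius_fin : conv_radius (saw_total Dr) = (z_crit Dr)%:E.
Proof.
rewrite /z_crit fineK// /conv_radius -/S; apply/fin_numP; split.
  rewrite -ltNye; apply: (@lt_le_trans _ _ 0%:E); first exact: ltNyr.
  by apply: ereal_sup_ubound; exists 0; [split; [exact: lexx|exact: cv0]|].
rewrite -ltey; apply: (@le_lt_trans _ _ 2%:E); last exact: ltry.
apply: ge_ereal_sup => _ [r [r0 cr] <-]; rewrite lee_fin; apply: chi_radius_le2 => //.
exact/pseries_chi.
Qed.

Lemma crit_below (z : R) : 0 <= z -> z < z_crit Dr -> efin (chi Dr z).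
Proof.
rewrite -lte_fin -conv_radius_fin /conv_radius => z0 /ereal_sup_gt[_ [r [r0 cr] <-]].
rewrite lte_fin => zr; have fr : efin (chi Dr r) by exact/pseries_chi.
by apply: efin_le fr; apply: chi_mono => //; exact: ltW.
Qed.

Lemma crit_above (z : R) : z_crit Dr < z -> efin (chi Dr z) = false.
Proof.
move=> hz; apply/negP => fz.
have zc0 : 0 <= z_crit Dr.
  rewrite -lee_fin -conv_radius_fin; apply: ereal_sup_ubound.
  by exists 0; [split; [exact: lexx|exact: cv0]|].
have z0 : 0 <= z by apply: ltW; exact: le_lt_trans hz.
have : (z%:E <= (z_crit Dr)%:E)%E.
  rewrite -conv_radius_fin; apply: ereal_sup_ubound; exists z => //=; split => //.
  exact/pseries_chi.
by rewrite lee_fin leNgt hz.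
Qed.
End CriticalPoint.

(** * Moments and small frequencies at the critical point *)

Section CriticalAsymptotics.
Variables (R : realType) (d : nat).
Local Notation V := 'rV[int]_d.
Local Notation E := (enn R).
Variable Dr : V -> R.
Hypotheses (Dr0 : forall x, 0 <= Dr x) (sD : summ Dr) (D1 : rsum Dr = 1) (D00 : Dr 0 = 0).
Hypothesis Dsym : forall x, Dr (- x) = Dr x.
Local Notation De := (De Dr).
Local Notation Dh := (Dh Dr).
Local Notation sk := (sk Dr).
Local Notation Pir := (Pir Dr).
Local Notation FF := (FF Dr).
Local Notation pir := (pir Dr).
Local Notation ph_ := (ph_ Dr).
Implicit Types (x y : V) (k : 'rV[R]_d) (m n N : nat).

(** The transformed coefficients satisfy the same recursion, whose solution is unique; the diagrams
    need not be inspected. *)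
Lemma pir_map (g : V -> V) m x : bijective g -> g 0 = 0 ->
  (forall x y, g (x - y) = g x - g y) -> (forall x, Dr (g x) = Dr x) -> (2 <= m)%N -> pir m (g x) = pir m x.
Proof.
move=> bg g0 gB Dg m2.
have cg n y : cr Dr n (g y) = cr Dr n y.
  by rewrite /cr cw_map// => z; exact: (f_equal (@ofR R) (Dg z)).
have zg (p q : V -> R) y : (forall z, q (g z) = q z) -> zconv (fun z => p (g z)) q y = zconv p q (g y).
  move=> hq; rewrite /zconv; change (rsum (fun z => p (g z) * q (y - z)) = rsum (fun z => p z * q (g y - z))).
  rewrite [in RHS](rsum_bij _ bg); apply: eq_rsum => z; by rewrite -gB hq.
have sg n : saw Dr n = cr Dr n by apply/funext => y; exact: saw_cr.
apply: (lace_unique Dr0 sD D1 D00 (pi_ := fun m y => pir m (g y))) => // n y.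
have Dge : (fun z => Dr (g z)) = Dr by apply/funext => z; exact: Dg.
rewrite !sg -(cg n.+1) (lace_real Dr0 sD D1 D00) -(zg Dr (cr Dr n) y (cg n)) Dge; apply: f_equal.
by apply: eq_bigr => i _; rewrite sg (zg (pir i) _ y (cg _)).
Qed.

Lemma Pir_map (g : V -> V) z x : bijective g -> g 0 = 0 ->
  (forall x y, g (x - y) = g x - g y) -> (forall x, Dr (g x) = Dr x) -> Pir z (g x) = Pir z x.
Proof. by move=> bg g0 gB Dg; apply: eq_rsum => m; rewrite (pir_map _ bg). Qed.

Hypotheses (Drefl : forall i x, Dr (zrefl i x) = Dr x).
Hypothesis Drot : forall i j x, i != j -> Dr (zrot i j x) = Dr x.

Lemma Pir_refl z i x : Pir z (zrefl i x) = Pir z x.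
Proof.
apply: Pir_map => //; first exact: zrefl_bij.
  by apply/rowP => l; rewrite !mxE; case: ifP; rewrite ?oppr0.
by move=> y w; apply/rowP => l; rewrite !mxE; case: ifP; rewrite // opprD.
Qed.

Lemma Pir_rot z i j x : i != j -> Pir z (zrot i j x) = Pir z x.
Proof.
move=> ij; apply: Pir_map; first exact: zrot_bij.
- by apply/rowP => l; rewrite !mxE; case: ifP; rewrite ?oppr0//; case: ifP.
- by move=> y w; apply/rowP => l; rewrite !mxE; case: ifP; rewrite ?opprD//; case: ifP.
- by move=> y; exact: Drot.
Qed.

Variables (z b W : R).
Hypotheses (z1 : 1 <= z) (z2 : z <= 2) (b0 : 0 <= b) (bs : 100 * b <= 1) (W0 : 0 <= W).
Hypotheses (bW : 16 * b * W <= 1 / 100) (HB : bub Dr z b) (HW : wbd Dr z W).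
Hypothesis F0 : FF z 0 = 0.

Let z0 : 0 <= z. Proof. by move: z1; lra. Qed.
Let fP := Pi_efin Dr0 sD D1 Dsym z0 b0 bs HB.
Let sP : summ (Pir z). Proof. exact: summ_Pir. Qed.

Definition Fm (m : nat) : R := z ^+ m.+2 * rsum (fun x => `|pir m.+2 x|).

Lemma Fm_ge0 m : 0 <= Fm m.
Proof. by rewrite mulr_ge0 ?exprn_ge0// rsum_ge0. Qed.

Lemma weighted_Pt : tsum (fun x : V => tsum (fun m : nat => m%:R * ofR z ^+ m * Pt De m x)) <<= ofR (20 * b).
Proof.
have b16 : 16 * b <= 1 by move: b0 bs; lra.
apply: ele_trans (Pt_sum1 (De_sym Dsym) b0 b16 HB (De1 Dr0 sD D1)) _.
rewrite -ofRM ?mulr_ge0//; apply: ele_ofR.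
by have := ler_wpM2r b0 z2; lra.
Qed.

Lemma Fm_sum : summ (fun m => m.+1%:R * Fm m) /\ rsum (fun m => m.+1%:R * Fm m) <= 4^-1.
Proof.
have t0 m : 0 <= m.+1%:R * Fm m by rewrite mulr_ge0 ?Fm_ge0.
have ub : tsum (fun m => ofR (m.+1%:R * Fm m)) <<= ofR (20 * b).
  apply: ele_trans weighted_Pt; rewrite tsum_swap.
  pose h (m : nat) : E := tsum (fun x => m%:R * ofR z ^+ m * Pt De m x).
  apply: (ele_trans (tsum (fun m => h m.+2))); last first.
    by apply: (tsum_inj_le (e := fun m => m.+2) h) => m n [].
  apply: le_tsum => m; rewrite /h tsumZl ofRM ?Fm_ge0// -mulrA; apply: eleM.
    by rewrite -(ofR_nat R) ; apply: ele_ofR; rewrite ler_nat.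
  rewrite /Fm ofRM ?exprn_ge0 ?rsum_ge0// ofRX//; apply: eleMl.
  rewrite rsum_abs toRK; last exact: summ_pir.
  by apply: le_tsum => x; exact: pir_le.
split; first by rewrite summ_ge0E//; exact: efin_ofR_le ub.
rewrite rsum_ge0E//; apply: (@le_trans _ _ (20 * b)); last by move: b0 bs; lra.
by apply: toR_le => //; rewrite mulr_ge0.
Qed.

Definition gm (m : nat) : R := z ^+ m.+2 * ph_ m.+2 0.

Lemma fN_le m k : `|z ^+ m.+2 * ph_ m.+2 k| <= Fm m.
Proof.
rewrite normrM ger0_norm ?exprn_ge0//; apply: ler_wpM2l; first exact: exprn_ge0.
by apply: ct_norm; exact: summ_pir.
Qed.

Lemma summ_wgm : summ (fun m => m.+1%:R * gm m).
Proof.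
apply: summ_le (proj1 Fm_sum) => m; rewrite normrM normr_nat; apply: ler_wpM2l => //.
exact: fN_le.
Qed.

Lemma gm_half : `|rsum (fun m => m.+1%:R * gm m)| <= 4^-1.
Proof.
apply: le_trans (proj2 Fm_sum); apply: ler_rsum_sup (proj1 Fm_sum) => m.
by rewrite normrM normr_nat; apply: ler_wpM2l => //; exact: fN_le.
Qed.

Lemma gm_sum : summ gm /\ rsum gm = 1 - z.
Proof.
have [h1 h2] := ct_Pir Dr0 sD D1 z0 fP 0.
split; first exact: h1.
have : 1 - z * ct Dr 0 - ct (Pir z) 0 = 0 := F0.
by rewrite h2 ct0 D1 mulr1 => /eqP; rewrite subr_eq0 => /eqP <-.
Qed.

Lemma FF_zcE k : FF z k = z * sk k + rsum (fun x => Pir z x * oc k x).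
Proof.
rewrite (FF_split Dr0 sD D1 z0 fP) F0 add0r skE// -rsumZ -rsumD; [|apply: summZ; exact: summ_oc|exact: summ_oc].
by apply: eq_rsum => x; rewrite mulrDl mulrA.
Qed.

(** Functions of x alone: [oc_Par] compares them at all frequencies simultaneously. *)
Definition gwr x : R := toR (gW De (ofR z) (ofR W) x).
Definition Par x : R := toR (tsum (fun m => ofR z ^+ m * Pt De m x)).

Lemma gw_fin : efin (tsum (gW De (ofR z) (ofR W))).
Proof. exact: efin_ofR_le (gW_tsum Dr0 sD D1 z0 b0 bs W0 bW HB). Qed.

Lemma summ_gwr : summ gwr. Proof. exact: summ_toR gw_fin. Qed.

Lemma oc_Par k x : oc k x * Par x <= sk k * gwr x.
Proof.
have /andP[s0 _] := sk_bnd Dr0 sD D1 k.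
have fa : efin (tsum (fun m => ofR z ^+ m * Pt De m x)) by exact: efin_tsum fP.
have fg : efin (gW De (ofR z) (ofR W) x) by exact: efin_tsum gw_fin.
apply: ofR_le; first by rewrite mulr_ge0 ?toR_ge0.
rewrite !ofRM ?oc_ge0 ?toR_ge0// !toRK//; exact: gW_Pir.
Qed.

Lemma Pir_Par x : `|Pir z x| <= Par x.
Proof.
apply: ofR_le; first exact: toR_ge0.
rewrite toRK; last by exact: efin_tsum fP.
exact: Pir_le.
Qed.

Variables (alpha v : R).
Hypotheses (d0 : (0 < d)%N) (al0 : 0 < alpha) (v0 : 0 < v).
Let F := (0 : 'rV[R]_d)^'.
Hypothesis skv : sk k / v_scale alpha k @[k --> F] --> v.

Lemma sk_gt0 : \forall k \near F, 0 < sk k.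
Proof.
near=> k.
have v1 : 0 < v_scale alpha k by near: k; exact: scale_gt0.
have : 0 < sk k / v_scale alpha k by near: k; apply: (cvgr_gt _ skv).
by rewrite pmulr_lgt0 ?invr_gt0.
Unshelve. all: by end_near. Qed.

Lemma scale2 k : 2 < alpha -> v_scale alpha k = enorm k ^+ 2.
Proof.
by move=> a2; rewrite /v_scale (gt_eqF a2) min_r ?(ltW a2)// powR_mulrn// enorm_ge0.
Qed.

(** The frequency-free bound [oc_Par] is taken at k = t e_i with t small: there 1 - cos(t x_i) >=
    t^2 x_i^2 / 4 and 1 - D(k) <= 2 v t^2. Dividing by t^2 gives 8 v for each coordinate. *)
Lemma Par_moment x : 2 < alpha -> enorm (ztor R x) ^+ 2 * Par x <= d%:R * (8 * v * gwr x).
Proof.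
move=> a2; rewrite enorm_zsq mulr_suml.
suff h i : ((x ord0 i)%:~R : R) ^+ 2 * Par x <= 8 * v * gwr x.
  apply: le_trans (ler_sum _ (fun i _ => h i)) _.
  by rewrite sumr_const card_ord -[leLHS]mulr_natl.
set X : R := (x ord0 i)%:~R.
have P0 : 0 <= Par x by exact: toR_ge0.
have g0 : 0 <= gwr x by exact: toR_ge0.
have PF := dnbhs_proper R d0.
have [r r0 hr] : exists2 r : R, 0 < r & forall k, k != 0 -> `|k| < r -> sk k <= 2 * v * enorm k ^+ 2.
  have : \forall k \near F, sk k <= 2 * v * enorm k ^+ 2.
    near=> k.
    have k0 : 0 < enorm k by near: k; exact: enorm_gt0.
    have h : sk k / v_scale alpha k <= 2 * v.
      by near: k; apply: (cvgr_le _ skv); move: v0; lra.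
    by move: h; rewrite scale2// ler_pdivrMr// exprn_gt0.
  move=> /nbhs_normP[r /= r0 hr]; exists r => // k k0 kr; apply: hr => //.
  by rewrite /= sub0r normrN.
pose e : 'rV[R]_d := delta_mx 0 i.
have e0 : e != 0 by apply/eqP => /rowP /(_ i); rewrite !mxE !eqxx => /eqP; rewrite oner_eq0.
have ne0 : 0 < `|e| by rewrite normr_gt0.
(* The first term keeps t e_i within the ball of radius r, the second gives t |x_i| <= 1. *)
pose t := Num.min (r / (2 * `|e|)) (1 + `|X|)^-1.
have X1 : 0 < 1 + `|X| by rewrite ltr_wpDr.
have t0 : 0 < t by rewrite lt_min invr_gt0 X1 divr_gt0// mulr_gt0.
have tX : t * `|X| <= 1.
  apply: (le_trans (y := (1 + `|X|)^-1 * (1 + `|X|))); last by rewrite mulVf// gt_eqF.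
  by apply: ler_pM => //; [exact: ltW|rewrite ge_min lexx orbT|rewrite lerDr].
have kr : `|t *: e| < r.
  rewrite normrZ (gtr0_norm t0); apply: (@le_lt_trans _ _ (r / 2)); last by move: r0; lra.
  apply: (le_trans (y := r / (2 * `|e|) * `|e|)).
    by apply: ler_wpM2r => //; rewrite ge_min lexx.
  by apply/eq_ler; field; rewrite gt_eqF.
have kn0 : t *: e != 0 by rewrite scaler_eq0 negb_or e0 gt_eqF.
have ke : enorm (t *: e) ^+ 2 = t ^+ 2.
  rewrite enorm_sq (bigD1 i)//= big1 ?addr0; first by rewrite !mxE !eqxx mulr1.
  by move=> j ji; rewrite !mxE eqxx (negbTE ji) mulr0 expr0n.
have pe : ph (t *: e) x = t * X.
  rewrite /ph /dotr (bigD1 i)//= big1 ?addr0; first by rewrite !mxE !eqxx mulr1.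
  by move=> j ji; rewrite !mxE eqxx (negbTE ji) mulr0 mul0r.
have h1 := oc_Par (t *: e) x; have h2 := hr _ kn0 kr; rewrite ke in h2.
have h3 := onemcos_ge (t * X); rewrite -pe -/(oc _ _) in h3.
have t2 : 0 < t ^+ 2 by exact: exprn_gt0.
have tX2 : (t * X) ^+ 2 <= 1.
  by rewrite -[X in X <= _]real_normK ?num_real// normrM (gtr0_norm t0) expr_le1// mulr_ge0// ltW.
have h4 : t ^+ 2 * (X ^+ 2 / 4) <= oc (t *: e) x.
  apply: le_trans h3; rewrite pe (_ : (t * X) ^+ 4 = (t * X) ^+ 2 * (t * X) ^+ 2); last by ring.
  rewrite (_ : t ^+ 2 * (X ^+ 2 / 4) = (t * X) ^+ 2 / 4); last by ring.
  have q0 : 0 <= (t * X) ^+ 2 := sqr_ge0 _; move: ((t * X) ^+ 2) q0 tX2 => q q0 q1.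
  by have := ler_wpM2l q0 q1; lra.
have h5 : t ^+ 2 * (X ^+ 2 / 4) * Par x <= 2 * v * t ^+ 2 * gwr x.
  apply: le_trans (ler_wpM2r P0 h4) _; apply: le_trans h1 _; exact: ler_wpM2r.
rewrite -(ler_pM2l t2); move: h5; move: (t ^+ 2) (X ^+ 2) => T X2; lra.
Unshelve. all: by end_near. Qed.

Lemma summ_Pir2 : 2 < alpha -> summ (fun x => enorm (ztor R x) ^+ 2 * Pir z x).
Proof.
move=> a2; apply: (summ_le (g := fun x => d%:R * (8 * v * gwr x))).
  move=> x; rewrite normrM ger0_norm ?sqr_ge0//; apply: le_trans (Par_moment x a2).
  by apply: ler_wpM2l; [exact: sqr_ge0|exact: Pir_Par].
by do 2! apply: summZ; exact: summ_gwr.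
Qed.

Definition J2 : R := if alpha <= 2 then 0 else M2 (Pir z) / (2 * d%:R * v).

(** For alpha > 2 both numerator and denominator are of order |k|^2, with known second moments. For
    alpha <= 2 the quotients are dominated by [gwr], and each tends to 0 because |k|^2 is negligible
    against 1 - D(k). *)
Lemma Pir_ratio : rsum (fun x => Pir z x * oc k x) / sk k @[k --> F] --> J2.
Proof.
have PF := dnbhs_proper R d0.
rewrite /J2; case: ifP => a2; last first.
  have {}a2 : 2 < alpha by rewrite ltNge a2.
  have c1 := oc_moment sP (summ_Pir2 a2) (Pir_refl z) (Pir_rot z) d0.
  have c2 : (sk k / v_scale alpha k)^-1 @[k --> F] --> v^-1.
    by apply: cvgV => //; rewrite gt_eqF.
  have -> : M2 (Pir z) / (2 * d%:R * v) = M2 (Pir z) / (2 * d%:R) * v^-1 by rewrite invfM mulrA.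
  apply: (cvg_trans _ (cvgM c1 c2)); apply: near_eq_cvg; near=> k.
  have k0 : 0 < enorm k by near: k; exact: enorm_gt0.
  have k2 : 0 < enorm k ^+ 2 by exact: exprn_gt0.
  have s0 : 0 < sk k by near: k; exact: sk_gt0.
  change (rsum (fun x => Pir z x * oc k x) / enorm k ^+ 2 * (sk k / v_scale alpha k)^-1 = rsum (fun x => Pir z x * oc k x) / sk k).
  by rewrite scale2//; field; rewrite !gt_eqF.
have lim : (fun k => rsum (fun x => Pir z x * (oc k x / sk k))) @ F --> rsum (fun _ : V => 0 : R).
  apply: (rsum_cvg (g := gwr)).
  - exact: summ_gwr.
  - near=> k => x.
    have s0 : 0 < sk k by near: k; exact: sk_gt0.
    rewrite normrM normrM normfV (gtr0_norm s0) (ger0_norm (oc_ge0 _ _)) mulrA ler_pdivrMr// mulrC.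
    rewrite [leRHS]mulrC; apply: le_trans (oc_Par k x).
    by apply: ler_wpM2l; [exact: oc_ge0|exact: Pir_Par].
  - move=> x; have c1 := scale_small d0 al0 a2.
    have c2 : (sk k / v_scale alpha k)^-1 @[k --> F] --> v^-1.
      by apply: cvgV => //; rewrite gt_eqF.
    pose K : R := `|Pir z x| * ((d%:R * enorm (ztor R x)) ^+ 2 / 2).
    have c3 : K * (enorm k ^+ 2 / v_scale alpha k * (sk k / v_scale alpha k)^-1) @[k --> F] --> (0 : R).
      rewrite [X in _ --> X](_ : 0 = K * (0 * v^-1)); last by rewrite mul0r mulr0.
      exact: cvgM (cvg_cst K) (cvgM c1 c2).
    apply/cvgrPdist_le => e e0; near=> k.
    have k0 : 0 < enorm k by near: k; exact: enorm_gt0.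
    have s0 : 0 < sk k by near: k; exact: sk_gt0.
    have w0 : 0 < v_scale alpha k by near: k; exact: scale_gt0.
    have : `|0 - K * (enorm k ^+ 2 / v_scale alpha k * (sk k / v_scale alpha k)^-1)| <= e.
      by near: k; exact: (cvgr_dist_le _ _ c3).
    rewrite !sub0r !normrN => h; apply: le_trans _ (le_trans (ler_norm _) h).
    rewrite normrM normrM normfV (gtr0_norm s0) (ger0_norm (oc_ge0 _ _)) /K -[leRHS]mulrA.
    apply: ler_wpM2l => //; rewrite ler_pdivrMr//.
    rewrite (_ : _ * sk k = (d%:R * (enorm k * enorm (ztor R x))) ^+ 2 / 2); last first.
      by field; rewrite !gt_eqF.
    exact: oc_quad.
rewrite rsum0 in lim; apply: (cvg_trans _ lim); apply: near_eq_cvg; near=> k.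
by rewrite [RHS]mulrC -rsumZ; apply: eq_rsum => x; rewrite mulrA mulrC.
Unshelve. all: by end_near. Qed.

Lemma FF_ratio : FF z k / sk k @[k --> F] --> z + J2.
Proof.
apply: (cvg_trans _ (cvgD (cvg_cst z) Pir_ratio)); apply: near_eq_cvg; near=> k.
have s0 : 0 < sk k by near: k; exact: sk_gt0.
change (z + rsum (fun x => Pir z x * oc k x) / sk k = FF z k / sk k).
rewrite FF_zcE; move: (rsum _) (sk k) s0 => r s s0.
by field; rewrite gt_eqF.
Unshelve. all: by end_near. Qed.

(** The bound [Pir_W] passes to the limit k -> 0; it makes z + J, and with it K, positive. *)
Lemma J2_small : `|J2| <= z / 100.
Proof.
have PF := dnbhs_proper R d0.
apply/ler_addgt0Pr => e e0.
suff hF : \forall k \near F, `|J2| <= z / 100 + e by have [k hk] := filter_ex hF.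
near=> k.
have : `|J2 - rsum (fun x => Pir z x * oc k x) / sk k| <= e.
  by near: k; exact: (cvgr_dist_le _ _ Pir_ratio).
set r := _ / _ => hr.
rewrite -[J2](subrK r); apply: le_trans (ler_normD _ _) _.
rewrite addrC; apply: lerD => //.
have s0 : 0 < sk k by near: k; exact: sk_gt0.
rewrite /r normrM normfV (gtr0_norm s0) ler_pdivrMr//.
apply: le_trans (Pir_W Dr0 sD D1 Dsym z0 b0 bs W0 bW HB HW k).
apply: le_trans (ler_norm_rsum (summ_oc k sP)) _; apply/eq_ler/eq_rsum => x.
by rewrite normrM (ger0_norm (oc_ge0 _ _)).
Unshelve. all: by end_near. Qed.
End CriticalAsymptotics.

(** * The scaling of the frequencies *)

Section Scaling.
Variable R : realType.

Definition to_infty (x : nat -> R) := forall A : R, \forall n \near \oo, A <= x n.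

Lemma powN_cvg0 (x : nat -> R) (q : R) : 0 < q -> to_infty x -> (fun n => x n `^ (- q)) @ \oo --> (0 : R).
Proof.
move=> q0 hx; apply/cvgrPdist_le => e e0.
have p0 : 0 < e `^ (- q^-1) by exact: powR_gt0.
near=> n; rewrite sub0r normrN ger0_norm ?powR_ge0//.
have h : e `^ (- q^-1) <= x n by near: n; exact: hx.
apply: le_trans (powR_decr (ltW q0) p0 h) _.
by rewrite -powRrM mulrNN mulVf ?gt_eqF// powRr1// ltW.
Unshelve. all: by end_near. Qed.

Lemma to_infty_nat (v : R) : 0 < v -> to_infty (fun n => v * n%:R).
Proof.
move=> v0 A; near=> n.
rewrite -ler_pdivrMl//; apply: le_trans (ler_norm _) _.
near: n; exists (Num.truncn `|v^-1 * A|).+1 => // n /= hn.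
by apply: ltW; apply: lt_le_trans (truncnS_gt _) _; rewrite ler_nat.
Unshelve. all: by end_near. Qed.

Definition lnsq (n : nat) : R := ln (Num.sqrt n%:R).

Lemma to_infty_ln : to_infty lnsq.
Proof.
move=> A; near=> n.
have h : expR A ^+ 2 <= 1 * n%:R by near: n; exact: to_infty_nat.
have n0 : 0 < n%:R :> R by apply: lt_le_trans (exprn_gt0 2 (expR_gt0 A)) _; rewrite mul1r in h.
rewrite -[A]expRK /lnsq ler_ln ?posrE ?expR_gt0 ?sqrtr_gt0//.
rewrite -(ger0_norm (ltW (expR_gt0 A))) -sqrtr_sqr ler_wsqrtr//; by rewrite mul1r in h.
Unshelve. all: by end_near. Qed.

Variables (alpha v : R).
Hypotheses (al0 : 0 < alpha) (v0 : 0 < v).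
Let a := Num.min alpha 2.
Let a0 : 0 < a. Proof. by rewrite /a lt_min al0 ltr0n. Qed.

Lemma f_alpha_cvg0 : (fun n => f_alpha alpha v n) @ \oo --> (0 : R).
Proof.
rewrite /f_alpha; case: eqVneq => _; apply: powN_cvg0; rewrite ?invr_gt0//; last exact: to_infty_nat.
move=> A; near=> n.
have h1 : `|A| <= v * n%:R by near: n; exact: to_infty_nat.
have h2 : 1 <= lnsq n by near: n; exact: to_infty_ln.
have vn : 0 <= v * n%:R by apply: le_trans h1.
by apply: le_trans (ler_norm A) _; apply: le_trans h1 _; rewrite ler_peMr.
Unshelve. all: by end_near. Qed.

Lemma f_alpha_gt0 : \forall n \near \oo, 0 < f_alpha alpha v n.
Proof.
near=> n.
have h2 : 1 <= lnsq n by near: n; exact: to_infty_ln.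
have n0 : 0 < n%:R :> R by rewrite ltr0n; near: n; exists 1%N.
by rewrite /f_alpha; case: ifP => _; apply: powR_gt0; rewrite !mulr_gt0//; exact: lt_le_trans h2.
Unshelve. all: by end_near. Qed.

Variable d : nat.
Implicit Types k : 'rV[R]_d.

Lemma enormZ (c : R) k : enorm (c *: k) = `|c| * enorm k.
Proof.
rewrite /enorm (_ : dotr (c *: k) (c *: k) = c ^+ 2 * dotr k k).
  by rewrite sqrtrM ?sqr_ge0// sqrtr_sqr.
by rewrite /dotr mulr_sumr; apply: eq_bigr => i _; rewrite !mxE; ring.
Qed.

(** Only alpha = 2 needs a limit. With l = ln(sqrt n), |k_n|^2 is |k|^2 / (v n l) and ln(1 / |k_n|)
    is l + C + (ln l) / 2, so that the quotient by l tends to 1. *)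
Lemma scale_cvg k : enorm k != 0 ->
  (fun n => n%:R * v_scale alpha (f_alpha alpha v n *: k)) @ \oo --> enorm k `^ a / v.
Proof.
move=> ek; have k0 : 0 < enorm k by rewrite lt_neqAle eq_sym ek enorm_ge0.
have [ae|ane] := eqVneq alpha 2; last first.
  have cc : (fun _ : nat => enorm k `^ a / v) @ \oo --> enorm k `^ a / v by exact: cvg_cst.
  apply: (cvg_trans _ cc); apply: near_eq_cvg; near=> n.
  have n0 : 0 < n%:R :> R by rewrite ltr0n; near: n; exists 1%N.
  have ne2 : (alpha == 2) = false by apply/negbTE.
  rewrite /v_scale /f_alpha ne2 enormZ ger0_norm ?powR_ge0// [(_ * enorm k) `^ _]powRM ?powR_ge0 ?enorm_ge0//.
  have vn : 0 <= v * n%:R by rewrite mulr_ge0// ltW.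
  rewrite -powRrM mulNr mulVf ?gt_eqF// powR_inv1//.
  by move: (_ `^ _) => p; field; rewrite !gt_eqF.
have c1 := powN_cvg0 ltr01 to_infty_ln.
have c2 : (fun n => ln (lnsq n) * (lnsq n)^-1) @ \oo --> (0 : R).
  have h : 0 < (2^-1 : R) by [].
  have c3 : 2 * lnsq n `^ (- 2^-1) @[n --> \oo] --> (0 : R).
    rewrite [X in _ --> X](_ : 0 = 2 * 0); last by rewrite mulr0.
    by apply: cvgM; [exact: cvg_cst|exact: (powN_cvg0 h to_infty_ln)].
  apply/cvgrPdist_le => e e0; near=> n.
  have l1 : 1 <= lnsq n by near: n; exact: to_infty_ln.
  have l0 : 0 < lnsq n by exact: lt_le_trans l1.
  have : `|0 - 2 * lnsq n `^ (- 2^-1)| <= e by near: n; exact: (cvgr_dist_le _ _ c3).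
  rewrite !sub0r !normrN => he; apply: le_trans _ (le_trans (ler_norm _) he).
  rewrite ger0_norm; last by rewrite mulr_ge0 ?ln_ge0// invr_ge0 ltW.
  rewrite powRN powR12_sqrt ?(ltW l0)//.
  have s0 : 0 < Num.sqrt (lnsq n) by rewrite sqrtr_gt0.
  have e1 : lnsq n = Num.sqrt (lnsq n) ^+ 2 by rewrite sqr_sqrtr// ltW.
  rewrite [X in ln X / X <= _]e1 lnXn// ; have := ln_sublinear s0.
  move: (Num.sqrt _) s0 => s s0 hs; rewrite ler_pdivrMr ?exprn_gt0//.
  have -> : 2 * s^-1 * s ^+ 2 = 2 * s by field; rewrite gt_eqF.
  by rewrite mulr2n; move: hs; lra.
pose C := ln v / 2 - ln (enorm k).
have c4 : enorm k ^+ 2 / v * (1 + (C * lnsq n `^ (- 1) + 2^-1 * (ln (lnsq n) * (lnsq n)^-1))) @[n --> \oo] -->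
    (enorm k ^+ 2 / v * (1 + (C * 0 + 2^-1 * 0)) : R).
  apply: cvgM; first exact: cvg_cst.
  apply: cvgD; first exact: cvg_cst.
  by apply: cvgD; (apply: cvgM; [exact: cvg_cst|]).
rewrite [X in _ --> X](_ : _ = enorm k ^+ 2 / v * (1 + (C * 0 + 2^-1 * 0))); last first.
  by rewrite !mulr0 !addr0 mulr1 /a ae minxx powR_mulrn// enorm_ge0.
apply: (cvg_trans _ c4); apply: near_eq_cvg; near=> n.
have n0 : 0 < n%:R :> R by rewrite ltr0n; near: n; exists 1%N.
have l1 : 1 <= lnsq n by near: n; exact: to_infty_ln.
have l0 : 0 < lnsq n by exact: lt_le_trans l1.
rewrite powR_inv1 ?(ltW l0)// /v_scale /f_alpha ae eqxx -/(lnsq n) enormZ ger0_norm ?powR_ge0//.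
set X := v * n%:R * lnsq n; have X0 : 0 < X by rewrite !mulr_gt0.
have s2 : (X `^ (- 2^-1)) ^+ 2 = X^-1.
  by rewrite powRN powR12_sqrt ?(ltW X0)// exprVn sqr_sqrtr// ltW.
have sp : 0 < X `^ (- 2^-1) by exact: powR_gt0.
have lnn : ln (n%:R : R) = 2 * lnsq n.
  rewrite /lnsq -[in LHS](sqr_sqrtr (ltW n0)) lnXn ?sqrtr_gt0// mulr_natl//.
have lnE : ln (1 / (X `^ (- 2^-1) * enorm k)) = lnsq n + (C + 2^-1 * ln (lnsq n)).
  rewrite div1r lnV ?posrE ?mulr_gt0// lnM ?posrE// ln_powR /X lnM ?posrE ?mulr_gt0// lnM ?posrE//.
  by rewrite lnn /C; field.
rewrite lnE exprMn s2 /X; move: (ln (lnsq n)) (lnsq n) l0 => ll l l0.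
by field; rewrite !gt_eqF.
Unshelve. all: by end_near. Qed.

Lemma f_alpha_dnbhs k : enorm k != 0 -> (fun n => f_alpha alpha v n *: k) @ \oo --> (0 : 'rV[R]_d)^'.
Proof.
move=> ek P /nbhs_normP[e /= e0 he].
have k0 : 0 < `|k|.
  by rewrite normr_gt0; apply: contraNneq ek => ->; rewrite -(scale0r 0) enormZ normr0 mul0r.
have c : 0 < e / `|k| by exact: divr_gt0.
change (\forall n \near \oo, P (f_alpha alpha v n *: k)).
near=> n; have s0 : 0 < f_alpha alpha v n by near: n; exact: f_alpha_gt0.
have s1 : `|0 - f_alpha alpha v n| < e / `|k| by near: n; exact: (cvgr_dist_lt _ _ f_alpha_cvg0).
rewrite /=; apply: he.
  rewrite /= sub0r normrN normrZ -ltr_pdivlMr//.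
  by rewrite sub0r normrN in s1.
by rewrite scaler_eq0 negb_or gt_eqF// -normr_gt0.
Unshelve. all: by end_near. Qed.
End Scaling.

(** * The limit at the critical point and the constant K *)

Section ScalingLimit.
Variables (R : realType) (d : nat).
Local Notation V := 'rV[int]_d.
Local Notation E := (enn R).
Variable Dr : V -> R.
Hypotheses (Dr0 : forall x, 0 <= Dr x) (sD : summ Dr) (D1 : rsum Dr = 1) (D00 : Dr 0 = 0).
Hypothesis Dsym : forall x, Dr (- x) = Dr x.
Hypotheses (Drefl : forall i x, Dr (zrefl i x) = Dr x).
Hypothesis Drot : forall i j x, i != j -> Dr (zrot i j x) = Dr x.
Local Notation De := (De Dr).
Local Notation sk := (sk Dr).
Local Notation Pir := (Pir Dr).
Local Notation FF := (FF Dr).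
Local Notation pir := (pir Dr).
Local Notation ph_ := (ph_ Dr).
Implicit Types (x y : V) (k : 'rV[R]_d) (m n N : nat).
Variables (z b W : R).
Hypotheses (z1 : 1 <= z) (z2 : z <= 2) (b0 : 0 <= b) (bs : 100 * b <= 1) (W0 : 0 <= W).
Hypotheses (bW : 16 * b * W <= 1 / 100) (HB : bub Dr z b) (HW : wbd Dr z W).
Hypothesis F0 : FF z 0 = 0.
Variables (alpha v : R).
Hypotheses (d0 : (0 < d)%N) (al0 : 0 < alpha) (v0 : 0 < v).
Hypothesis skv : sk k / v_scale alpha k @[k --> (0 : 'rV[R]_d)^'] --> v.

Let z0 : 0 <= z. Proof. by move: z1; lra. Qed.
Let fP := Pi_efin Dr0 sD D1 Dsym z0 b0 bs HB.
Let sP : summ (Pir z). Proof. exact: summ_Pir. Qed.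
Let a := Num.min alpha 2.
Let a0 : 0 < a. Proof. by rewrite /a lt_min al0 ltr0n. Qed.
Let kN k N : 'rV[R]_d := f_alpha alpha v N *: k.
Local Notation J := (J2 Dr z alpha v).
Local Notation gz := (gm Dr z).

(** The mean of the critical renewal weights: their mass is 1, and [gm m] sits at time m + 2. *)
Definition HH : R := 1 + rsum (fun m => m.+1%:R * gz m).

Lemma HH_gt0 : 0 < HH.
Proof.
have := gm_half Dr0 sD D1 Dsym z1 z2 b0 bs HB.
by rewrite ler_norml /HH => /andP[h _]; lra.
Qed.

Lemma zJ_gt0 : 0 < z + J.
Proof.
have := J2_small Dr0 sD D1 D00 Dsym Drefl Drot z1 b0 bs W0 bW HB HW d0 al0 v0 skv.
by rewrite ler_norml => /andP[h _]; move: z1; lra.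
Qed.

Lemma ct_cvg0 (f : V -> R) k : summ f -> ct f (kN k N) @[N --> \oo] --> ct f 0.
Proof.
move=> sf; apply: (rsum_cvg (g := fun x => `|f x|)).
- by rewrite summ_abs.
- near=> N => x; rewrite normrM ler_piMr//; exact: normr_cos.
- move=> x; apply: cvgM; first exact: cvg_cst.
  apply: (cvg_comp (fun N => ph (kN k N) x) (@cos R)); last exact: continuous_cos.
  rewrite (_ : (fun N => ph (kN k N) x) = (fun N => f_alpha alpha v N * ph k x)); last first.
    by apply/funext => N; rewrite /kN phZl.
  rewrite ph0l -(mul0r (ph k x)); apply: cvgM; last exact: cvg_cst.
  exact: f_alpha_cvg0.
Unshelve. all: by end_near. Qed.

Lemma NFF_cvg k : N%:R * FF z (kN k N) @[N --> \oo] --> enorm k `^ a * (z + J).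
Proof.
(* The limits at frequency 0 are along punctured neighbourhoods, so k = 0 is treated apart. *)
have [ek|ek] := eqVneq (enorm k) 0.
  rewrite (enorm_eq0 ek) (_ : (fun N => _) = fun=> 0); last first.
    by apply/funext => N; rewrite /kN scaler0 F0 mulr0.
  rewrite (_ : enorm 0 = 0 :> R) ?powR0 ?mul0r ?gt_eqF//; first exact: cvg_cst.
  by rewrite -ek (enorm_eq0 ek).
have c1 := scale_cvg al0 v0 ek.
have c0 := f_alpha_dnbhs al0 v0 ek.
have c2 : sk (kN k N) / v_scale alpha (kN k N) @[N --> \oo] --> v := cvg_comp _ _ c0 skv.
have c3 : FF z (kN k N) / sk (kN k N) @[N --> \oo] --> z + J :=
  cvg_comp _ _ c0 (FF_ratio Dr0 sD D1 D00 Dsym Drefl Drot z1 b0 bs W0 bW HB HW F0 d0 al0 v0 skv).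
rewrite (_ : enorm k `^ a * (z + J) = enorm k `^ a / v * v * (z + J)); last by field; rewrite gt_eqF.
apply: (cvg_trans _ (cvgM (cvgM c1 c2) c3)); apply: near_eq_cvg; near=> N.
have v1 : 0 < v_scale alpha (kN k N) by near: N; exact: (c0 _ (scale_gt0 d0 al0)).
have s0 : 0 < sk (kN k N) by near: N; exact: (c0 _ (sk_gt0 d0 al0 v0 skv)).
change (N%:R * v_scale alpha (kN k N) * (sk (kN k N) / v_scale alpha (kN k N)) * (FF z (kN k N) / sk (kN k N)) = N%:R * FF z (kN k N)).
by field; rewrite !gt_eqF.
Unshelve. all: by end_near. Qed.

Lemma saw_limit k : z ^+ N * ch Dr N (kN k N) @[N --> \oo] -->
  HH^-1 * expR (- (enorm k `^ a * (z + J) / HH)).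
Proof.
have [sF F4] := Fm_sum Dr0 sD D1 Dsym z1 z2 b0 bs HB.
apply: (renewal_limit (F := Fm Dr z) (g := gz) (f := fun N m => z ^+ m.+2 * ph_ m.+2 (kN k N))
  (f1 := fun N => z * Dh Dr (kN k N)) (u := fun N n => z ^+ n * ch Dr n (kN k N))) => //.
- exact: Fm_ge0.
- by move=> N m; exact: fN_le.
- move=> m; apply: cvgM; first exact: cvg_cst.
  by apply: ct_cvg0; exact: summ_pir.
- by move=> N; rewrite expr0 mul1r ch0.
- by move=> N n; exact: lace_renewal.
- rewrite (_ : (fun N => _) = (fun N => N%:R * FF z (kN k N))); first exact: NFF_cvg.
  by apply/funext => N; rewrite /eps -(proj2 (ct_Pir Dr0 sD D1 z0 fP (kN k N))).
Qed.

Lemma ratio_limit k : ch Dr N (kN k N) / ch Dr N 0 @[N --> \oo] -->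
  expR (- ((z + J) / HH * enorm k `^ a)).
Proof.
have H0 := HH_gt0; have e0 : enorm (0 : 'rV[R]_d) = 0.
  by rewrite -(scale0r 0) enormZ normr0 mul0r.
have c1 := @saw_limit k; have c2 := @saw_limit 0.
rewrite e0 powR0 ?gt_eqF// !mul0r oppr0 expR0 mulr1 in c2.
have Hi : HH^-1 != 0 by rewrite invr_eq0 gt_eqF.

rewrite (_ : expR _ = HH^-1 * expR (- (enorm k `^ a * (z + J) / HH)) * HH^-1^-1); last first.
  by rewrite [RHS]mulrAC mulfV// mul1r; congr (expR (- _)); field; rewrite gt_eqF.
apply: (cvg_trans _ (cvgM c1 (cvgV Hi c2))); apply: near_eq_cvg; near=> N.
have zN : z ^+ N != 0 by rewrite expf_neq0// gt_eqF//; move: z1; lra.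
change (z ^+ N * ch Dr N (kN k N) * (z ^+ N * ch Dr N (kN 0 N))^-1 = ch Dr N (kN k N) / ch Dr N 0).
by rewrite /kN scaler0 invfM mulrACA mulfV// mul1r.
Unshelve. all: by end_near. Qed.

Variable pi_ : nat -> V -> R.
Hypothesis hpi : forall m, (2 <= m)%N -> pi_ m =1 pir m.

Definition cut (f : nat -> R) (n : nat) : R := if (2 <= n)%N then f n else 0.

Lemma in_ge2 n : (n \in [set n : nat | (2 <= n)%N]) = (2 <= n)%N.
Proof. by apply/idP/idP; rewrite inE. Qed.

Lemma lace_sum_cut (f : V -> nat -> R) : lace_sum f = rsum (fun x => rsum (cut (f x))).
Proof.
rewrite /lace_sum; change (rsum (fun x => usum [set n : nat | (2 <= n)%N] (f x)) = rsum (fun x => rsum (cut (f x)))).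
by apply: eq_rsum => x; rewrite usum_cond; apply: eq_rsum => n; rewrite in_ge2.
Qed.

Lemma lace_summable_cut (f : V -> nat -> R) : efin (tsum (fun x => asum (cut (f x)))) -> lace_summable f.
Proof.
move=> h; rewrite /lace_summable /summable esum_mkcond.
have h2 : efin (tsum (fun p : V * nat => ofR `|cut (f p.1) p.2|)).
  by rewrite -(tsum_pair (fun x n => ofR `|cut (f x) n|)).
rewrite [X in (X < _)%E](_ : _ = val (tsum (fun p : V * nat => ofR `|cut (f p.1) p.2|)))//.
rewrite /tsum /=; apply: eq_esum => -[x n] _ /=.
have -> : ((x, n) \in [set p : V * nat | (2 <= p.2)%N]) = (2 <= n)%N by apply/idP/idP; rewrite inE.
by rewrite /cut; case: ifP => _; rewrite max_l// normr0.
Qed.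

Lemma term1_fin : efin (tsum (fun x => asum (cut (lace_term1 pi_ z x)))).
Proof.
apply: efin_le (efin_ofR_le (weighted_Pt Dr0 sD D1 Dsym z1 z2 b0 bs HB)).
apply: le_tsum => x; apply: le_tsum => n; rewrite /cut /lace_term1; case: ifP => n2; last first.
  by rewrite normr0 ofR0 ele0.
rewrite (hpi n2) !normrM (normr_nat R) (ger0_norm (exprn_ge0 _ z0)).
apply: (ele_trans (ofR (n%:R * z ^+ n * `|pir n x|))).
  apply: ele_ofR; rewrite mulrAC; apply: ler_wpM2r => //; apply: ler_wpM2l => //.
  by rewrite ler_weXn2l// leq_pred.
rewrite ofRM ?mulr_ge0 ?exprn_ge0// ofRM ?exprn_ge0// ofR_nat ofRX//.
by apply: eleMl; exact: pir_le.
Qed.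

Lemma term1_summable : lace_summable (lace_term1 pi_ z).
Proof. exact: lace_summable_cut term1_fin. Qed.

Lemma rsum_cut (f : nat -> R) : summ (cut f) -> rsum (cut f) = rsum (fun m => f m.+2).
Proof.
move=> sf; have s1 : summ (fun m => cut f m.+1) by exact: (summ_shift 1).
by rewrite (rsum_natS sf) (rsum_natS s1) /cut /= !add0r.
Qed.

(** The summand n pi_n z^n, with n = m + 2, is (m + 1) gm + gm, and the sum of gm is 1 - z because
    the critical weights have mass 1. *)
Lemma term1_sum : z * (1 + lace_sum (lace_term1 pi_ z)) = HH.
Proof.
pose h (m : nat) : R := m%:R * z ^+ m.-1 * ph_ m 0.
have inner n : rsum (fun x => cut (lace_term1 pi_ z x) n) = cut h n.
  rewrite /cut; case: ifP => n2; last exact: rsum0.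
  rewrite /h /ph_ ct0 -rsumZ; apply: eq_rsum => x.
  by rewrite /lace_term1 (hpi n2) mulrAC.
have sh : summ (cut h).
  rewrite -(eq_summ inner); apply: (summ_outer (f := fun n x => cut (lace_term1 pi_ z x) n)).
  by rewrite /asum tsum_swap; exact: term1_fin.
rewrite lace_sum_cut rsum_swap; last exact: term1_fin.
rewrite (eq_rsum inner) (rsum_cut sh).
have [sg rg] := gm_sum Dr0 sD D1 Dsym z1 b0 bs HB F0.
have sw : summ (fun m => m.+1%:R * gz m) by apply: (summ_wgm Dr0 sD D1 Dsym (b := b)).
rewrite mulrDr mulr1 -rsumZ (eq_rsum (g := fun m => m.+1%:R * gz m + gz m)); last first.
  by move=> m; rewrite /h /gm -[m.+2%:R]natr1 /= !exprS; ring.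
by rewrite rsumD// rg /HH; ring.
Qed.

Lemma term2_fin : 2 < alpha -> efin (tsum (fun x => asum (cut (lace_term2 pi_ z x)))).
Proof.
move=> a2; have sg := summ_gwr Dr0 sD D1 z1 b0 bs W0 bW HB.
have sg2 : summ (fun x => d%:R * (8 * v * gwr Dr z W x)) by do 2! apply: summZ.
rewrite summ_ge0E in sg2; last first.
  by move=> x; rewrite !mulr_ge0 ?toR_ge0// ltW.
apply: efin_le sg2; apply: le_tsum => x.
have hP := Par_moment Dr0 sD D1 Dsym z1 b0 bs W0 bW HB HW d0 v0 skv x a2.
apply: ele_trans (ele_ofR hP); rewrite ofRM ?sqr_ge0 ?toR_ge0// /Par toRK; last by exact: efin_tsum fP.
rewrite -tsumZl; apply: le_tsum => n; rewrite /cut /lace_term2; case: ifP => n2; last first.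
  by rewrite normr0 ofR0 ele0.
have q0 : 0 <= enorm (ztor R x) ^+ 2 := sqr_ge0 _; move: (enorm _ ^+ 2) q0 {hP} => q q0.
rewrite (hpi n2) -mulrA normrM normrM (ger0_norm q0) (ger0_norm (exprn_ge0 _ z0)).
rewrite ofRM ?mulr_ge0 ?exprn_ge0//; apply: eleMl.
rewrite mulrC ofRM ?exprn_ge0// ofRX//; apply: eleMl; exact: pir_le.
Qed.

Lemma term2_summable : 2 < alpha -> lace_summable (lace_term2 pi_ z).
Proof. by move=> a2; apply: lace_summable_cut; exact: term2_fin. Qed.

Lemma term2_sum : 2 < alpha -> lace_sum (lace_term2 pi_ z) = M2 (Pir z).
Proof.
move=> a2; rewrite lace_sum_cut /M2; apply: eq_rsum => x.
have s : summ (cut (lace_term2 pi_ z x)) by exact: efin_tsum (term2_fin a2).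
rewrite (rsum_cut s); change (rsum (fun m => lace_term2 pi_ z x m.+2) =
  enorm (ztor R x) ^+ 2 * rsum (fun m => z ^+ m.+2 * pir m.+2 x)).
rewrite -rsumZ; apply: eq_rsum => m.
by rewrite /lace_term2 hpi//; ring.
Qed.

Lemma K_alphaE : K_alpha alpha v z pi_ = (z + J) / HH.
Proof.
have zn : z != 0 by rewrite gt_eqF//; move: z1; lra.
have hH := term1_sum; have H0 := HH_gt0.
have hS : 1 + lace_sum (lace_term1 pi_ z) = HH / z by rewrite -hH mulrC mulKf.
rewrite /K_alpha hS /J2; case: ifP => a2.
  by rewrite addr0 mulr1 invf_div.
rewrite term2_sum; last by rewrite ltNge a2.
have dn : d%:R != 0 :> R by rewrite pnatr_eq0 -lt0n.
by move: HH (M2 _) H0 => H M H0; field; rewrite zn dn !gt_eqF.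
Qed.

Lemma K_alpha_gt0 : 0 < K_alpha alpha v z pi_.
Proof. by rewrite K_alphaE divr_gt0 ?zJ_gt0 ?HH_gt0. Qed.

Lemma K_limit k : ch Dr N (kN k N) / ch Dr N 0 @[N --> \oo] -->
  expR (- (K_alpha alpha v z pi_ * enorm k `^ a)).
Proof. by rewrite K_alphaE; exact: ratio_limit. Qed.
End ScalingLimit.

(** * Complex-valued limits of real quantities *)

Section ComplexLimits.
Variable R : realType.

Lemma norm_realc (x : R) : `|x%:C%C| = `|x|%:C%C.
Proof. by rewrite normc_def /= expr0n addr0 sqrtr_sqr. Qed.

Lemma cvg_realc (T : Type) (F : set_system T) (FF : Filter F) (f : T -> R) (l : R) :
  f @ F --> l <-> ((f k)%:C%C : R[i]^o) @[k --> F] --> (l%:C%C : R[i]^o).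
Proof.
split => /cvgrPdist_le h; apply/cvgrPdist_le => e e0.
- have : 0 < complex.Re e /\ complex.Im e = 0.
    by move: e0; rewrite ltcE /= => /andP[/eqP -> ->].
  case: e e0 => r i _ /= [r0 ->]; have := h r r0; apply: filterS => k hk.
  by rewrite -rmorphB /= norm_realc complexr0 lecR.
- have e1 : 0 < e%:C%C by rewrite ltcR.
  have := h _ e1; apply: filterS => k.
  by rewrite -rmorphB /= norm_realc lecR.
Qed.

Variable d : nat.

Lemma rfourier_ct (f : 'rV[int]_d -> R) (k : 'rV[R]_d) : (forall x, f (- x) = f x) ->
  rfourier f k = (ct f k)%:C%C.
Proof.
move=> fe; rewrite /rfourier /fourier /csum -complexr0; congr Complex.
  change (rsum (fun x => complex.Re ((f x)%:C%C * expi (dotr k (ztor R x)))) = rsum (fun x => f x * cos (ph k x))).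
  by apply: eq_rsum => x /=; rewrite mul0r subr0.
rewrite -(even_sin k fe).
change (rsum (fun x => complex.Im ((f x)%:C%C * expi (dotr k (ztor R x)))) = rsum (fun x => f x * sin (ph k x))).
by apply: eq_rsum => x /=; rewrite mul0r addr0.
Qed.
End ComplexLimits.

(** * Properties of the normalised step distribution *)

Section StepDistribution.
Variables (R : realType) (d : nat) (alpha : R) (h : 'rV[R]_d -> R).
Hypotheses (al0 : 0 < alpha) (d1 : (1 <= d)%N) (hh : step_profile alpha h).
Variable L : R.
Hypothesis L1 : 1 <= L.
Local Notation V := 'rV[int]_d.
Local Notation D := (stepD h L).

Let L0 : 0 < L. Proof. by move: L1; lra. Qed.

Lemma stepD_basic : [/\ (forall x, 0 <= D x), summ D, rsum D = 1 & 0 < SL h L].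
Proof.
have [C C0 hC] := profile_upper al0 hh.
have [c [s0 [c0 hc]]] := profile_lower hh.
split.
- exact: (stepD_ge0 al0 d1 hh L1 C0 c0 hC hc).
- exact: (stepD_summ al0 hh L1 C0 hC).
- exact: (stepD_sum1 al0 d1 hh L1 C0 c0 hC hc).
- exact: (SL_gt0 al0 d1 hh L1 C0 c0 hC hc).
Qed.

Lemma stepD_refl i (x : V) : D (zrefl i x) = D x.
Proof.
rewrite !stepDE /hL; congr (_ / _); rewrite -(profile_reflect hh i (L^-1 *: ztor R x)); congr h.
by apply/rowP => l; rewrite !mxE; case: ifP => // _; rewrite rmorphN /= mulrN.
Qed.

Lemma stepD_rot i j (x : V) : i != j -> D (zrot i j x) = D x.
Proof.
move=> ij; rewrite !stepDE /hL; congr (_ / _); rewrite -(profile_rot90 hh (L^-1 *: ztor R x) ij); congr h.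
apply/rowP => l; rewrite !mxE; case: ifP => _; first by rewrite rmorphN /= mulrN.
by case: ifP.
Qed.

Lemma stepD_tail : exists2 c : R, 0 < c & forall e : R, 0 < e -> exists M : R, forall x : V, M < enorm (ztor R x) ->
  `|enorm (ztor R x) `^ (d%:R + alpha) * D x - c| <= e.
Proof.
have [_ _ _ S0] := stepD_basic.
have [ch ch0 ht] := profile_tail hh.
set p := d%:R + alpha; pose c := L `^ p * ch / SL h L.
have Lp : 0 < L `^ p by exact: powR_gt0.
have c0 : 0 < c by rewrite divr_gt0// mulr_gt0.
exists c => // e e0.
have [M hM] := ht (e / c) ltac:(by rewrite divr_gt0).
exists (L * `|M|) => x hx.
have ye : enorm (L^-1 *: ztor R x) = L^-1 * enorm (ztor R x).
  by rewrite enormZ gtr0_norm// invr_gt0.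
have y1 : `|M| < enorm (L^-1 *: ztor R x) by rewrite ye ltr_pdivlMl.
have y0 : 0 < enorm (L^-1 *: ztor R x) by exact: le_lt_trans y1.
have xe : enorm (ztor R x) = L * enorm (L^-1 *: ztor R x) by rewrite ye mulrA mulfV ?mul1r// gt_eqF.
have := hM _ (le_lt_trans (ler_norm M) y1).
rewrite stepDE /hL xe powRM ?(ltW L0) ?(ltW y0)//.
have -> : - d%:R - alpha = - p by rewrite /p opprD.
rewrite powRN; move: (h _) (enorm _ `^ p) (powR_gt0 p y0) => hy P P0 h1.
have -> : L `^ p * P * (hy / SL h L) - c = c * (hy / (ch * P^-1) - 1).
  by rewrite /c; field; rewrite !gt_eqF.
by rewrite normrM (gtr0_norm c0) mulrC -ler_pdivlMr//; exact: ltW.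
Qed.
End StepDistribution.

(** * Choice of the constants and the scaling limit *)

Theorem theorem1p2 (R : realType) (d : nat) (alpha : R) (h : 'rV[R]_d -> R)
    (halpha : 0 < alpha) (hd1 : (1 <= d)%N)
    (hd : 2 * Num.min alpha 2 < d%:R) (hh : step_profile alpha h) :
  exists L0 : R, forall L : R, 1 <= L -> L0 <= L ->
    let D := stepD h L in
    let v := v_alpha alpha D in
    let zc := z_crit D in
    forall pi_ : nat -> 'rV[int]_d -> R, lace_recursion D pi_ ->
    let K := K_alpha alpha v zc pi_ in
    [/\ lace_summable (lace_term1 pi_ zc),
        2 < alpha -> lace_summable (lace_term2 pi_ zc),
        0 < K
      & forall k : 'rV[R]_d,
          (rfourier (saw D n) (f_alpha alpha v n *: k) /
             rfourier (saw D n) 0 : R[i]^o) @[n --> \oo] -->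
          ((expR (- (K * enorm k `^ Num.min alpha 2)))%:C%C : R[i]^o)].
Proof.
have [B B0 hB] := step_resolvent halpha hd1 hh hd.
have [W WE] : exists W : R, W = 16 * 285 by exists (16 * 285).
have W0 : 1 <= W by rewrite WE; lra.
(* This makes 16 b W equal to 1/100. *)
pose b : R := (1600 * W)^-1; have b0 : 0 < b by rewrite invr_gt0; lra.
have bW : 16 * b * W <= 1 / 100 by apply/eq_ler; rewrite /b; field; rewrite gt_eqF//; lra.
have bs : 100 * b <= 1 by have := ler_wpM2l (ltW b0) W0; lra.
have c2048 : 0 < 2048 :> R by rewrite ltr0n.
(* 2048 = 2 * 1024: the improved bubble bound 1024 beta is b^2 / 2. *)
pose beta := b ^+ 2 / 2048; have bt0 : 0 < beta by exact: divr_gt0 (exprn_gt0 2 b0) c2048.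
have bb : b ^+ 2 = 2048 * beta by rewrite /beta mulrC divfK; [|exact: lt0r_neq0].
(* As L >= 1 and d >= 1, B / L^d <= B / L <= beta. *)
exists (B / beta) => L L1 L0 D v zc pi_ hpi K.
have [D0 sD D1 _] := stepD_basic halpha hd1 hh L1.
have Dsym := stepD_sym hh L; have D00 : D 0 = 0 := profile_step0 hh L1.
have Drefl := stepD_refl hh L; have Drot := stepD_rot hh L.
have Lp : 0 < L by lra.
have Hrw e : 0 < e -> exists M : 'rV[int]_d -> R,
  [/\ summ M, (forall l, Dh D l ^+ 2 / (e + sk D l) ^+ 2 <= ct M l) & M 0 <= beta].
  move=> e0; have [M [sM hM M0]] := hB L L1 e e0; exists M; split => //.
  apply: le_trans M0 _; rewrite ler_pdivrMr ?exprn_gt0//.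
  rewrite ler_pdivrMr// mulrC in L0; apply: le_trans L0 _; rewrite ler_pM2l//.
  by case: (d) hd1 => // n _; rewrite exprS ler_peMr ?exprn_ege1// ltW.
have [c c0 tl] := stepD_tail halpha hd1 hh L1.
have ctE (a w : R) : (1 - a%:C%C) / w%:C%C = ((1 - a) / w)%:C%C by rewrite rmorphM fmorphV rmorphB rmorph1.
have [v0 skv] : 0 < v /\ sk D k / v_scale alpha k @[k --> (0 : 'rV[R]_d)^'] --> v.
  have : is_v_alpha alpha D v.
    (* [v_alpha] is a chosen value: once some constant with the defining limit exists, the chosen
       one has that limit as well. *)
    rewrite /v /v_alpha; apply: xgetPex.
    have [w w0 hw] := sk_scale hd1 halpha c0 D0 sD D1 tl D00 Drefl Drot.
    exists w; split => //.
    rewrite (_ : (fun k => _) = fun k => ((sk D k / (w * v_scale alpha k))%:C%C : R[i]^o)); last first.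
      by apply/funext => k; rewrite rfourier_ct// ctE.
    apply/cvg_realc; rewrite -(mulVf (lt0r_neq0 w0)).
    rewrite (_ : (fun k => sk D k / (w * v_scale alpha k)) = (fun k => w^-1 * (sk D k / v_scale alpha k))); last first.
      by apply/funext => k; rewrite invfM mulrCA.
    by apply: cvgM => //; exact: cvg_cst.
  case=> w0; rewrite (_ : (fun k => _) = fun k => ((sk D k / (v * v_scale alpha k))%:C%C : R[i]^o)); last first.
    by apply/funext => k; rewrite rfourier_ct// ctE.
  move=> /cvg_realc hv; split => //.
  rewrite (_ : (fun k => _) = (fun k => v * (sk D k / (v * v_scale alpha k)))); last first.
    by apply/funext => k; rewrite [RHS]mulrCA invfM mulVKf// gt_eqF.
  by rewrite -[X in _ --> X]mulr1; apply: cvgM => //; exact: cvg_cst.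
have zca y : 0 <= y -> y < z_crit D -> efin (chi D y).
  move=> y0 yz; exact: (@crit_below _ _ _ D0 sD D1 D00 Dsym _ _ _ b0 bs bb WE bW Hrw _ y0 yz).
have zcb y : z_crit D < y -> efin (chi D y) = false.
  move=> yz; exact: (@crit_above _ _ _ D0 sD D1 D00 Dsym _ _ _ b0 bs bb WE bW Hrw _ yz).
have z1 : 1 <= zc by exact: zc_ge1.
have z2 : zc <= 2 by exact: (zc_le2 D0 sD D1 D00 Dsym b0 bs bb WE bW Hrw zca).
have HB := zc_bub D0 sD D1 D00 Dsym b0 bs bb WE bW Hrw zca zcb.
have HW := zc_wbd D0 sD D1 D00 Dsym b0 bs bb WE bW Hrw zca zcb.
have F0 := FF_zc D0 sD D1 D00 Dsym b0 bs bb WE bW Hrw zca zcb.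
have Wn : 0 <= W by lra.
have hp := lace_unique D0 sD D1 D00 hpi.
split.
- exact: (term1_summable D0 sD D1 Dsym z1 z2 (ltW b0) bs HB).
- exact: (term2_summable D0 sD D1 Dsym z1 (ltW b0) bs Wn bW HB HW hd1 v0 skv).
- exact: (K_alpha_gt0 D0 sD D1 D00 Dsym Drefl Drot z1 z2 (ltW b0) bs Wn bW HB HW F0 hd1 halpha v0 skv).
move=> k; rewrite (_ : (fun n => _) = fun n => ((ch D n (f_alpha alpha v n *: k) / ch D n 0)%:C%C : R[i]^o)); last first.
  apply/funext => n; have -> : saw D n = cr D n by apply/funext => x; exact: saw_cr.
  have cs x : cr D n (- x) = cr D n x by exact: cr_sym.
  by rewrite !rfourier_ct// rmorphM fmorphV.
apply/cvg_realc.
exact: (K_limit D0 sD D1 D00 Dsym Drefl Drot z1 z2 (ltW b0) bs Wn bW HB HW F0 hd1 halpha v0 skv).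
Qed.
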